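(* Let $q>0$ and let $c_n$, $n\ge 0$, be defined by $$\sum_{n=0}^\infty c_nz^n=\prod_{k=1}^\infty\left(1+k^{-q}z^k\right),\qquad|z|<1.$$ (a) If $0<q<1$, put $r=\max\{j\ge1:1-qj>0\}$, $\rho_0=0$ and $\rho_l=1-q(r-l+1)$ for $l=1,\dots,r$ (so that $0<\rho_1<\dots<\rho_r$ are the numbers $1-qj$, $j=1,\dots,r$). Then there are constants $H$, $P_l$, $\hat h_l$ and $K_{s,l}$ (not depending on $n$) such that, as $n\to\infty$, $$c_n\sim H\,n^{-\frac{2+\rho_r-2A_0}{2(\rho_r+1)}}\exp\left(\sum_{l=0}^{r}P_l\,n^{\frac{\rho_l}{\rho_r+1}}+\sum_{l=0}^r\hat h_l\sum_{s:\lambda_s\le\rho_l}K_{s,l}\,n^{\frac{\rho_l-\lambda_s}{\rho_r+1}}\right),$$ where $A_0$ and the numbers $\lambda_s$ are as defined in the context. (b) If $q>1$, then, for a constant $W(q)>0$ depending only on $q$, $$c_n\sim W(q)\,n^{-q},\qquad n\to\infty.$$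
   Context: Notation: $x_n\sim y_n$ means $x_n/y_n\to1$. Definition of $A_0$ (for $0<q<1$): let $D(s)=\sum_{k\ge1}\Lambda_kk^{-s}$, where $\log\prod_{k\ge1}(1+k^{-q}z^k)=\sum_{k\ge1}\Lambda_kz^k$; for $\Re(s)$ large, $D(s)=\sum_{k\ge1}\sum_{j\ge1}\frac{(-1)^{j-1}}{j^{s+1}k^{s+qj}}$. $A_0$ is the residue at $s=0$ of the meromorphic continuation of $D$ if it has a simple pole there, and $A_0=0$ if it is analytic at $0$. Definition of $\lambda_s$: with $\rho_0=0$ and $\mathbb Z_+$ the set of nonnegative integers, let $$\tilde\Upsilon_r=\left\{\sum_{k=0}^{r-1}\tilde d_k(\rho_r-\rho_k):\ \tilde d_k\in\mathbb Z_+,\ \sum_{k=0}^{r-1}\tilde d_k\ge2\right\}\cap(0,\rho_r+1],\qquad \Upsilon_r=\tilde\Upsilon_r\cup\{\rho_r-\rho_k:\ k=0,1,\dots,r-1\},$$ and let $0<\lambda_1<\lambda_2<\dots<\lambda_{|\Upsilon_r|}$ be the elements of $\Upsilon_r$ in increasing order. *)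

(* Defs.v *)
From Stdlib Require Export Reals List Sorted.
From Coquelicot Require Export Coquelicot.
Open Scope R_scope.

(** * The generating function *)

(** [P] is the value at [z] of the product over k >= 1 of (1 + k^(-q) z^k). *)
Definition is_product (q : R) (z P : C) : Prop :=
  filterlim
    (fun N : nat =>
       fold_right Cmult (RtoC 1)
         (map (fun k : nat =>
                 (RtoC 1 + RtoC (Rpower (INR k) (- q)) * Cpow z k)%C)
              (seq 1 N)))
    eventually (locally P).

Definition product_coefficients (q : R) (c : nat -> R) : Prop :=
  forall z : C, Cmod z < 1 ->
    exists P : C,
      is_product q z P /\
      @is_pseries C_AbsRing C_NormedModule (fun n => RtoC (c n)) z P.

(** Only the limit [x n / y n -> 1] is required; since division by zero yields
    zero, it forces [y n <> 0] for all large [n]. *)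
Definition asymp (x y : nat -> R) : Prop :=
  is_lim_seq (fun n => x n / y n) 1.

(** * The Dirichlet series D and the number A_0 *)

Definition Cexp (z : C) : C :=
  (RtoC (exp (Re z)) * (cos (Im z), sin (Im z)))%C.

(** [Lam] is the sequence of Taylor coefficients of the logarithm of the
    product: the logarithm is the analytic branch on the unit disc that vanishes
    at 0, i.e. the power series without constant term whose exponential is the
    product. *)
Definition log_coefficients (q : R) (Lam : nat -> R) : Prop :=
  Lam 0%nat = 0 /\
  forall z : C, Cmod z < 1 ->
    exists L : C,
      @is_pseries C_AbsRing C_NormedModule (fun k => RtoC (Lam k)) z L /\
      is_product q z (Cexp L).

(** The sum over k >= 1 of Lam_k k^(-s) converges to [v]. *)
Definition is_dirichlet (Lam : nat -> R) (s v : C) : Prop :=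
  @is_series C_AbsRing C_NormedModule
    (fun k : nat =>
       (RtoC (Lam (S k)) * Cexp (- s * RtoC (ln (INR (S k)))))%C) v.

Definition holomorphic_at (g : C -> C) (s0 : C) : Prop :=
  locally s0 (fun s => @ex_derive C_AbsRing C_NormedModule g s).

(** On a punctured neighbourhood of [s0], [f] is [g s / (s - s0)^N] with [g]
    holomorphic at [s0]. The value of [f] at [s0] itself is irrelevant. *)
Definition has_laurent_form (f : C -> C) (s0 : C) (N : nat) (g : C -> C) : Prop :=
  holomorphic_at g s0 /\
  locally s0 (fun s => s <> s0 -> f s = (g s / Cpow (s - s0) N)%C).

Definition meromorphic_at (f : C -> C) (s0 : C) : Prop :=
  exists (N : nat) (g : C -> C), has_laurent_form f s0 N g.

Definition simple_pole_with_residue (f : C -> C) (s0 a : C) : Prop :=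
  a <> RtoC 0 /\
  exists g : C -> C, has_laurent_form f s0 1 g /\ g s0 = a.

Definition analytic_at (f : C -> C) (s0 : C) : Prop :=
  exists g : C -> C, has_laurent_form f s0 0 g.

(** [f] is a meromorphic continuation of D to some half-plane containing 0.
    The half-plane being connected, such an [f] is determined near 0 up to its
    values at isolated points. *)
Definition continues_D (q : R) (f : C -> C) : Prop :=
  exists Lam : nat -> R, log_coefficients q Lam /\
  (exists sigma : R, forall s : C, sigma < Re s -> is_dirichlet Lam s (f s)) /\
  (exists delta : R, 0 < delta /\
     forall s : C, - delta < Re s -> meromorphic_at f s).

Definition is_A0 (q A0 : R) : Prop :=
  exists f : C -> C, continues_D q f /\
    (simple_pole_with_residue f (RtoC 0) (RtoC A0) \/
     (analytic_at f (RtoC 0) /\ A0 = 0)).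

(** * The exponents rho_l and lambda_s *)

(** [r] is the largest integer j >= 1 with 1 - q j > 0. *)
Definition is_r (q : R) (r : nat) : Prop :=
  ((1 <= r)%nat /\ 0 < 1 - q * INR r) /\
  forall j : nat, (1 <= j)%nat -> 0 < 1 - q * INR j -> (j <= r)%nat.

(** Used for l <= r only. *)
Definition rho (q : R) (r l : nat) : R :=
  match l with
  | O => 0
  | S _ => 1 - q * (INR r - INR l + 1)
  end.

Definition Upsilon_tilde (q : R) (r : nat) (x : R) : Prop :=
  (exists d : nat -> nat,
      (2 <= list_sum (map d (seq 0 r)))%nat /\
      x = sum_n_m (fun k => INR (d k) * (rho q r r - rho q r k)) 0 (r - 1)) /\
  0 < x <= rho q r r + 1.

Definition Upsilon (q : R) (r : nat) (x : R) : Prop :=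
  Upsilon_tilde q r x \/
  exists k : nat, (k < r)%nat /\ x = rho q r r - rho q r k.

(** [lam] lists lambda_1 < lambda_2 < ..., so lambda_s is its entry of (0-based)
    index s - 1. *)
Definition is_lambdas (q : R) (r : nat) (lam : list R) : Prop :=
  StronglySorted Rlt lam /\ forall x : R, In x lam <-> Upsilon q r x.

Definition lambda (lam : list R) (s : nat) : R := nth (s - 1) lam 0.

(** The sum over all s with lambda_s <= rho_l of
    K_{s,l} n^((rho_l - lambda_s) / (rho_r + 1)). *)
Definition lambda_sum (q : R) (r : nat) (lam : list R)
    (K : nat -> nat -> R) (l n : nat) : R :=
  sum_n_m
    (fun s : nat =>
       if Rle_dec (lambda lam s) (rho q r l)
       then K s l *
            Rpower (INR n) ((rho q r l - lambda lam s) / (rho q r r + 1))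
       else 0)
    1 (length lam).

(* Main.v *)
From Stdlib Require Import ZArith Lia Lra Psatz Classical ClassicalEpsilon.
Require Import Defs.

(** For [0 < q < 1] the saddle-point method applies. With [d > 0], the number
    [c_n exp (- n d)] divided by the product at [exp (- d)] is the probability
    that a sum of independent variables [k Ber(p_k)] takes the value [n], where
    [p_k = w / (1 + w)] and [w = k^(-q) exp (- k d)]. Fourier inversion gives a
    local limit theorem when [n] is close enough to the mean. The logarithm of
    the product, its mean and its variance reduce to sums
    [sum_k k^(b - 1) exp (- k d)], which are compared with the binomial series of
    [(1 - z)^(- b)] at [z = exp (- d)]. The saddle-point equation is solved only
    approximately, by iteration, as [d = n^(- 1 / (2 - q)) u (n^(- q / (2 - q)))]
    with [u] having a finite expansion at 0+.

    The numbers [rho_l - lambda_s >= 0] are again among [rho_0, ..., rho_r], so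
    the second sum in the exponent adds no new powers of [n] and [h = K = 0]
    suffices.

    The function D is [sum_j (-1)^(j-1) j^(-s-1) zeta (s + q j)]; finitely many
    zeta terms are continued individually, the terms with [k = 1] sum up to a tail
    of the alternating zeta function, and the remaining double series converges
    absolutely to the left of 0. Hence D has a pole at 0 exactly when [q j = 1] for
    some [j], and this pole contributes the power of [d] coming from
    [sum_k k^(-1) exp (- k d) ~ - log d].

    For [q > 1], split the representations of [n] according to their largest part
    [n - m]: the factor [(n - m)^(-q)] behaves like [n^(-q)] and, by dominated
    convergence, the constant is [W(q) = sum_m c_m]. *)

(** * Real series *)

(** The local limit theorem is valid for every sequence [d] whose mean differs from n by o(standard
    deviation), that is by o(d^(- (3 - q) / 2)). Hence an inexact saddle point costs nothing: c_n is
    compared with exp (n d) times the product at that very [d], and only the explicit function n d +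
    [log_gf q d] has to be expanded. With x = n^(-1/(2-q)), y = x^q and d = x u(y), this function
    is, up to a logarithm and a convergent term, x^(-(1-q)) times a function expandable in y. Its
    powers x^(-(1-q(i+1))) are the powers of n attached to the rho_l; whatever converges goes into
    the constant H.

    The Dirichlet series is treated independently of these asymptotics; the two strands meet only in
    the number [A0val]. Holomorphy is obtained without integration theory: a quadratic remainder
    with one constant uniform on a disc is inherited by sums, products and dominated series, so that
    series may be differentiated termwise. *)

Lemma ex_series_le_R (a b : nat -> R) :
  (forall n, Rabs (a n) <= b n) -> ex_series b -> ex_series a.
Proof. intros Hab Hb. exact (ex_series_le a b Hab Hb). Qed.

Lemma series_tail_bound (a M : nat -> R) (K : nat) :
  (forall k, Rabs (a k) <= M k) -> ex_series M ->
  Rabs (Series a - sum_n a K) <= Series M - sum_n M K.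
Proof.
  intros Hle HM.
  assert (Ha : ex_series a) by (now apply ex_series_le_R with M).
  assert (HaR : ex_series (fun k => Rabs (a k))).
  { apply ex_series_le_R with M; [|exact HM].
    intros n; rewrite Rabs_Rabsolu; apply Hle. }
  rewrite (Series_incr_n a (S K)), (Series_incr_n M (S K)) by (auto with arith).
  simpl pred. rewrite !sum_n_Reals.
  replace (sum_f_R0 a K + Series (fun k => a (S K + k)%nat) - sum_f_R0 a K)
    with (Series (fun k => a (S K + k)%nat)) by ring.
  replace (sum_f_R0 M K + Series (fun k => M (S K + k)%nat) - sum_f_R0 M K)
    with (Series (fun k => M (S K + k)%nat)) by ring.
  eapply Rle_trans.
  - apply Series_Rabs. now apply (ex_series_incr_n (fun k => Rabs (a k)) (S K)).
  - apply Series_le; [|now apply (ex_series_incr_n M (S K))].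
    intros n; split; [apply Rabs_pos|apply Hle].
Qed.

Lemma sum_Sn_R (a : nat -> R) (n : nat) : sum_n a (S n) = sum_n a n + a (S n).
Proof. exact (sum_Sn a n). Qed.

Lemma is_lim_seq_sum_n (a : nat -> nat -> R) (l : nat -> R) (K : nat) :
  (forall k, (k <= K)%nat -> is_lim_seq (fun n => a n k) (l k)) ->
  is_lim_seq (fun n => sum_n (a n) K) (sum_n l K).
Proof.
  intros H. induction K as [|K IH].
  - rewrite sum_O. apply is_lim_seq_ext with (fun n => a n 0%nat).
    + intros n; now rewrite sum_O.
    + now apply H.
  - rewrite sum_Sn. apply is_lim_seq_ext with (fun n => sum_n (a n) K + a n (S K)).
    + intros n; now rewrite sum_Sn.
    + apply is_lim_seq_plus'; [apply IH; auto with arith|now apply H].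
Qed.

Lemma is_lim_seq_eps (u : nat -> R) (l : R) :
  is_lim_seq u l <->
  forall eps, 0 < eps -> exists N, forall n, (N <= n)%nat -> Rabs (u n - l) < eps.
Proof.
  split.
  - intros H eps He. apply is_lim_seq_spec in H.
    destruct (H (mkposreal eps He)) as [N HN]. now exists N.
  - intros H. apply is_lim_seq_spec. intros eps.
    destruct (H eps (cond_pos eps)) as [N HN]. now exists N.
Qed.

(** Dominated convergence for series. The bound passes to the limit [l], so both tails beyond [K]
    are at most the tail of [M], and only a finite sum is left to converge. *)
Lemma tannery (a : nat -> nat -> R) (l M : nat -> R) :
  ex_series M ->
  (exists N0, forall n k, (N0 <= n)%nat -> Rabs (a n k) <= M k) ->
  (forall k, is_lim_seq (fun n => a n k) (l k)) ->
  is_lim_seq (fun n => Series (a n)) (Series l).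
Proof.
  intros HM [N0 Hle] Hlim.
  assert (Hl : forall k, Rabs (l k) <= M k).
  { intros k. apply (is_lim_seq_le_loc (fun n => Rabs (a n k)) (fun _ => M k)
      (Rabs (l k)) (M k)).
    - exists N0. intros n Hn. now apply Hle.
    - apply (is_lim_seq_abs _ (Finite (l k))), Hlim.
    - apply is_lim_seq_const. }
  apply is_lim_seq_eps. intros eps He.
  assert (H3 : 0 < eps / 4) by lra.
  assert (HMs := Series_correct M HM).
  assert (HMl : is_lim_seq (sum_n M) (Series M)) by exact HMs.
  destruct (proj1 (is_lim_seq_eps _ _) HMl (eps / 4) H3) as [K HK].
  specialize (HK K (le_n K)).
  assert (Hs : is_lim_seq (fun n => sum_n (a n) K) (sum_n l K))
    by (apply is_lim_seq_sum_n; auto).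
  destruct (proj1 (is_lim_seq_eps _ _) Hs (eps / 4) H3) as [N HN].
  exists (max N0 N). intros n Hn.
  specialize (HN n ltac:(lia)).
  assert (H1 := series_tail_bound (a n) M K (fun k => Hle n k ltac:(lia)) HM).
  assert (H2 := series_tail_bound l M K Hl HM).
  revert HN HK H1 H2. unfold Rabs. repeat destruct Rcase_abs; lra.
Qed.

Lemma sum_n_nonneg (a : nat -> R) (n : nat) :
  (forall k, (k <= n)%nat -> 0 <= a k) -> 0 <= sum_n a n.
Proof.
  intros H. induction n as [|n IH].
  - rewrite sum_O; auto.
  - rewrite sum_Sn. apply Rplus_le_le_0_compat; auto.
Qed.

Lemma sum_n_le_loc (a b : nat -> R) (n : nat) :
  (forall k, (k <= n)%nat -> a k <= b k) -> sum_n a n <= sum_n b n.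
Proof.
  intros H. induction n as [|n IH].
  - rewrite !sum_O; auto.
  - rewrite !sum_Sn. apply Rplus_le_compat; auto.
Qed.

Lemma sum_n_mono (a : nat -> R) (m n : nat) :
  (forall k, 0 <= a k) -> (m <= n)%nat -> sum_n a m <= sum_n a n.
Proof.
  intros H Hmn. induction Hmn as [|n _ IH]; [apply Rle_refl|].
  rewrite sum_Sn. unfold plus; simpl. specialize (H (S n)). lra.
Qed.

Lemma sum_n_le_Series (a : nat -> R) (n : nat) :
  (forall k, 0 <= a k) -> ex_series a -> sum_n a n <= Series a.
Proof.
  intros H Ha.
  apply (is_lim_seq_incr_compare (sum_n a)).
  - exact (Series_correct a Ha).
  - intros m. rewrite sum_Sn. unfold plus; simpl. specialize (H (S m)). lra.
Qed.

Lemma ex_series_bounded (a : nat -> R) (B : R) :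
  (forall k, 0 <= a k) -> (forall n, sum_n a n <= B) -> ex_series a.
Proof.
  intros H HB.
  destruct (ex_finite_lim_seq_incr (sum_n a) B) as [l Hl].
  - intros m. rewrite sum_Sn. unfold plus; simpl. specialize (H (S m)). lra.
  - exact HB.
  - exists l. exact Hl.
Qed.

Lemma Rpower_pos (x a : R) : 0 < Rpower x a.
Proof. apply exp_pos. Qed.

Lemma INR_S_pos (k : nat) : 0 < INR (S k).
Proof. apply lt_0_INR; lia. Qed.

Lemma INR_S_ge_1 (k : nat) : 1 <= INR (S k).
Proof. rewrite S_INR. assert (H := pos_INR k). lra. Qed.

Lemma Rpower_neg_antitone (x y a : R) :
  0 < x -> x <= y -> 0 <= a -> Rpower y (- a) <= Rpower x (- a).
Proof.
  intros Hx Hxy Ha. rewrite !Rpower_Ropp.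
  apply Rinv_le_contravar; [apply Rpower_pos|].
  now apply Rle_Rpower_l.
Qed.

Lemma Rpower_base_1 (a : R) : Rpower 1 a = 1.
Proof. unfold Rpower. now rewrite ln_1, Rmult_0_r, exp_0. Qed.

Lemma Rpower_neg_le_1 (x a : R) : 1 <= x -> 0 <= a -> Rpower x (- a) <= 1.
Proof.
  intros Hx Ha. rewrite <- (Rpower_base_1 (- a)).
  apply Rpower_neg_antitone; lra.
Qed.

Lemma exp_ge_1_plus (x : R) : 1 + x <= exp x.
Proof.
  destruct (Req_dec x 0) as [->|H].
  - rewrite exp_0; lra.
  - left. now apply exp_ineq1.
Qed.

Lemma exp_mono (x y : R) : x <= y -> exp x <= exp y.
Proof. intros [H| ->]; [left; now apply exp_increasing|apply Rle_refl]. Qed.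

(** Both g - f and g + f are nondecreasing. Having a function [g] instead of a constant as majorant
    allows Taylor estimates to be obtained by repeated integration of the bounds. *)
Lemma increment_bound (f f' g g' : R -> R) (a b : R) :
  a <= b ->
  (forall x, a <= x <= b -> is_derive f x (f' x)) ->
  (forall x, a <= x <= b -> is_derive g x (g' x)) ->
  (forall x, a <= x <= b -> Rabs (f' x) <= g' x) ->
  Rabs (f b - f a) <= g b - g a.
Proof.
  intros Hab Hf Hg Hle.
  assert (mono : forall h h' : R -> R,
    (forall x, a <= x <= b -> is_derive h x (h' x)) ->
    (forall x, a <= x <= b -> 0 <= h' x) -> h a <= h b).
  { intros h h' Hh Hpos.
    destruct (MVT_gen h a b h') as [c [Hc Heq]].
    - rewrite Rmin_left, Rmax_right by exact Hab. intros x Hx. apply Hh; lra.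
    - rewrite Rmin_left, Rmax_right by exact Hab. intros x Hx.
      apply continuity_pt_filterlim. apply (ex_derive_continuous h).
      exists (h' x). apply Hh; lra.
    - rewrite Rmin_left, Rmax_right in Hc by exact Hab.
      assert (0 <= h' c * (b - a)) by (apply Rmult_le_pos; [now apply Hpos|lra]).
      lra. }
  assert (H1 : g a - f a <= g b - f b).
  { apply (mono (fun x => g x - f x) (fun x => g' x - f' x)).
    - intros x Hx. apply (is_derive_minus (V := R_NormedModule) g f x (g' x) (f' x)); auto.
    - intros x Hx. generalize (Hle x Hx) (Rle_abs (f' x)). lra. }
  assert (H2 : g a + f a <= g b + f b).
  { apply (mono (fun x => g x + f x) (fun x => g' x + f' x)).
    - intros x Hx. apply (is_derive_plus (V := R_NormedModule) g f x (g' x) (f' x)); auto.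
    - intros x Hx. generalize (Hle x Hx) (Rle_abs (- f' x)).
      rewrite Rabs_Ropp. lra. }
  apply Rabs_le. lra.
Qed.

Ltac ring_R :=
  unfold plus, mult, scal, opp, minus, zero, one; simpl;
  unfold mult; simpl;
  match goal with |- @eq _ ?x ?y => change (@eq R x y) end;
  repeat match goal with
    |- context [@sum_n ?G ?a ?n] => set (@sum_n G a n : R)
  end; ring.

Ltac eq_R := match goal with |- @eq _ ?x ?y => change (@eq R x y) end.

(** * The coefficients of the product *)

Definition wt (q : R) (k : nat) : R := Rpower (INR k) (- q).

Lemma wt_pos (q : R) (k : nat) : 0 < wt q k.
Proof. apply Rpower_pos. Qed.

Lemma wt_le_1 (q : R) (k : nat) : 0 <= q -> wt q (S k) <= 1.
Proof. intros Hq. apply Rpower_neg_le_1; [apply INR_S_ge_1|exact Hq]. Qed.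

(** The coefficient of index [z] of the product over k <= N; with integer indices
    no subtraction is truncated. *)
Fixpoint coef (q : R) (N : nat) (z : Z) : R :=
  match N with
  | O => if Z.eq_dec z 0 then 1 else 0
  | S N' => coef q N' z + wt q N * coef q N' (z - Z.of_nat N)
  end.

(** Factors of index above [n] do not change the coefficient of index [n], so this is the
    coefficient of the infinite product. *)
Definition coefs (q : R) (n : nat) : R := coef q n (Z.of_nat n).

Lemma coef_nonneg (q : R) (N : nat) (z : Z) : 0 <= coef q N z.
Proof.
  revert z; induction N as [|N IH]; intros z; simpl.
  - destruct Z.eq_dec; lra.
  - apply Rplus_le_le_0_compat; [apply IH|].
    apply Rmult_le_pos; [left; apply wt_pos|apply IH].
Qed.

Lemma coef_neg (q : R) (N : nat) (z : Z) : (z < 0)%Z -> coef q N z = 0.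
Proof.
  revert z; induction N as [|N IH]; intros z Hz; simpl.
  - destruct Z.eq_dec; [lia|reflexivity].
  - rewrite !IH by lia. ring.
Qed.

(** The product is a polynomial of degree 1 + 2 + ... + N = N (N + 1) / 2. *)
Lemma coef_above (q : R) (N : nat) (z : Z) :
  (Z.of_nat N * (Z.of_nat N + 1) < 2 * z)%Z -> coef q N z = 0.
Proof.
  revert z; induction N as [|N IH]; intros z Hz.
  - simpl. destruct Z.eq_dec; [lia|reflexivity].
  - cbn [coef]. rewrite !IH; [ring| |]; nia.
Qed.

Lemma coef_mono (q : R) (N M : nat) (z : Z) :
  (N <= M)%nat -> coef q N z <= coef q M z.
Proof.
  intros H; induction H as [|M _ IH]; [apply Rle_refl|].
  cbn [coef].
  assert (0 <= wt q (S M) * coef q M (z - Z.of_nat (S M))).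
  { apply Rmult_le_pos; [left; apply wt_pos|apply coef_nonneg]. }
  lra.
Qed.

Lemma coef_stable (q : R) (N M : nat) (z : Z) :
  (z <= Z.of_nat N)%Z -> (N <= M)%nat -> coef q M z = coef q N z.
Proof.
  intros Hz H; induction H as [|M H IH]; [reflexivity|].
  cbn [coef]. rewrite (coef_neg q M (z - _)) by lia. rewrite IH. ring.
Qed.

Lemma coef_coefs (q : R) (N n : nat) :
  (n <= N)%nat -> coef q N (Z.of_nat n) = coefs q n.
Proof. intros H. apply coef_stable; lia. Qed.

Lemma coef_le_coefs (q : R) (N n : nat) : coef q N (Z.of_nat n) <= coefs q n.
Proof.
  rewrite <- (coef_coefs q (max N n) n) by lia.
  apply coef_mono; lia.
Qed.

Lemma coefs_nonneg (q : R) (n : nat) : 0 <= coefs q n.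
Proof. apply coef_nonneg. Qed.

(** * Real partial products and summability of the coefficients *)

Fixpoint pprod (q : R) (N : nat) (x : R) : R :=
  match N with
  | O => 1
  | S N' => pprod q N' x * (1 + wt q N * x ^ N)
  end.

Lemma is_pseries_coef (q : R) (N : nat) (x : R) :
  is_pseries (fun n => coef q N (Z.of_nat n)) x (pprod q N x).
Proof.
  induction N as [|N IH].
  - apply is_pseries_R.
    apply filterlim_ext with (fun _ => 1); [|apply filterlim_const].
    intros n. induction n as [|n IH].
    + rewrite sum_O; simpl; ring.
    + rewrite sum_Sn, <- IH. unfold plus; simpl. ring.
  - cbn [pprod coef].
    assert (H := is_pseries_plus _ _ x _ _ IH
      (is_pseries_scal (wt q (S N)) _ x _ (Rmult_comm _ _)
        (is_pseries_incr_n _ (S N) x _ IH))).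
    replace (pprod q N x * (1 + wt q (S N) * x ^ S N)) with
      (plus (pprod q N x) (scal (wt q (S N)) (scal (pow_n x (S N)) (pprod q N x)))).
    + eapply is_pseries_ext; [|exact H].
      intros n. unfold PS_plus, PS_scal, plus, scal; simpl; unfold mult; simpl.
      f_equal. f_equal.
      change (PS_incr_n (fun n0 : nat => coef q N (Z.of_nat n0)) (S N) n =
        coef q N (Z.of_nat n - Z.of_nat (S N))).
      rewrite PS_incr_n_simplify.
      destruct le_lt_dec as [Hle|Hlt].
      * f_equal. lia.
      * rewrite coef_neg by lia. reflexivity.
    + rewrite pow_n_pow. unfold plus, scal; simpl; unfold mult; simpl. ring.
Qed.

Lemma is_series_coef (q : R) (N : nat) (x : R) :
  is_series (fun n => coef q N (Z.of_nat n) * x ^ n) (pprod q N x).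
Proof.
  exact (proj1 (is_pseries_R _ x _) (is_pseries_coef q N x)).
Qed.

Lemma pprod_pos (q : R) (N : nat) (x : R) : 0 <= x -> 0 < pprod q N x.
Proof.
  intros Hx. induction N as [|N IH]; cbn [pprod]; [lra|].
  apply Rmult_lt_0_compat; [exact IH|].
  assert (0 <= wt q (S N) * x ^ S N).
  { apply Rmult_le_pos; [left; apply wt_pos|now apply pow_le]. }
  lra.
Qed.

Lemma pprod_le_exp (q : R) (N : nat) (x : R) : 0 <= x ->
  pprod q N x <= exp (sum_n (fun k => wt q k * x ^ k) N).
Proof.
  intros Hx. induction N as [|N IH]; cbn [pprod].
  - rewrite sum_O, <- exp_0. apply exp_mono.
    apply Rmult_le_pos; [left; apply wt_pos|now apply pow_le].
  - rewrite sum_Sn. unfold plus; cbn [AbelianMonoid.plus]. simpl AbelianMonoid.plus.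
    change (pprod q N x * (1 + wt q (S N) * x ^ S N) <=
      exp (sum_n (fun k => wt q k * x ^ k) N + wt q (S N) * x ^ S N)).
    rewrite exp_plus. apply Rmult_le_compat.
    + left; now apply pprod_pos.
    + assert (0 <= wt q (S N) * x ^ S N).
      { apply Rmult_le_pos; [left; apply wt_pos|now apply pow_le]. }
      lra.
    + exact IH.
    + apply exp_ge_1_plus.
Qed.

(** Up to index [n] the coefficients are those of the polynomial [pprod q n], and the remaining ones
    are nonnegative. *)
Lemma sum_coefs_le_pprod (q : R) (n : nat) (x : R) : 0 <= x ->
  sum_n (fun m => coefs q m * x ^ m) n <= pprod q n x.
Proof.
  intros Hx.
  assert (Hnn : forall k, 0 <= coef q n (Z.of_nat k) * x ^ k).
  { intros k. apply Rmult_le_pos; [apply coef_nonneg|now apply pow_le]. }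
  rewrite <- (is_series_unique _ _ (is_series_coef q n x)).
  eapply Rle_trans; [|apply (sum_n_le_Series _ n Hnn)].
  - apply sum_n_le_loc. intros k Hk. rewrite coef_coefs by exact Hk. apply Rle_refl.
  - eexists; apply is_series_coef.
Qed.

(** The partial sums are bounded by the exponential of the sum of the weights. This serves both x <
    1 and, for q > 1, the boundary point x = 1. *)
Lemma ex_series_coefs_of_weights (q x : R) : 0 <= x ->
  ex_series (fun k => wt q k * x ^ k) -> ex_series (fun m => coefs q m * x ^ m).
Proof.
  intros Hx H.
  apply ex_series_bounded with (exp (Series (fun k => wt q k * x ^ k))).
  - intros k. apply Rmult_le_pos; [apply coefs_nonneg|now apply pow_le].
  - intros n. eapply Rle_trans; [now apply sum_coefs_le_pprod|].
    eapply Rle_trans; [now apply pprod_le_exp|].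
    apply exp_mono, sum_n_le_Series; [|exact H].
    intros k. apply Rmult_le_pos; [left; apply wt_pos|now apply pow_le].
Qed.

Lemma ex_series_coefs (q x : R) : 0 <= q -> Rabs x < 1 ->
  ex_series (fun m => coefs q m * Rabs x ^ m).
Proof.
  intros Hq Hx. apply ex_series_coefs_of_weights; [apply Rabs_pos|].
  apply ex_series_incr_1.
  apply ex_series_le_R with (fun k => Rabs x ^ S k).
  - intros k. rewrite Rabs_mult, (Rabs_pos_eq (wt _ _)) by (left; apply wt_pos).
    rewrite Rabs_pos_eq by (apply pow_le, Rabs_pos).
    rewrite <- (Rmult_1_l (Rabs x ^ S k)) at 2.
    apply Rmult_le_compat_r; [apply pow_le, Rabs_pos|now apply wt_le_1].
  - apply (ex_series_incr_1 (fun k => Rabs x ^ k)). apply ex_series_geom.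
    now rewrite Rabs_Rabsolu.
Qed.

(** Dominated convergence in the coefficients: each of them is eventually constant in [N] and never
    exceeds its final value. *)
Lemma pprod_lim (q x : R) : 0 <= q -> Rabs x < 1 ->
  is_lim_seq (fun N => pprod q N x) (Series (fun m => coefs q m * x ^ m)).
Proof.
  intros Hq Hx.
  apply is_lim_seq_ext with
    (fun N => Series (fun m => coef q N (Z.of_nat m) * x ^ m)).
  - intros N. apply is_series_unique, is_series_coef.
  - apply (tannery _ _ (fun m => coefs q m * Rabs x ^ m)).
    + now apply ex_series_coefs.
    + exists O. intros n k _. rewrite Rabs_mult, <- RPow_abs.
      apply Rmult_le_compat_r; [apply pow_le, Rabs_pos|].
      rewrite Rabs_pos_eq by apply coef_nonneg. apply coef_le_coefs.
    + intros k. apply is_lim_seq_ext_loc with (fun _ => coefs q k * x ^ k).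
      * exists k. intros n Hn. now rewrite coef_coefs.
      * apply is_lim_seq_const.
Qed.

(** * Complex limits and identification of the coefficients *)

Lemma filterlim_C_components (u : nat -> C) (l : C) :
  filterlim u eventually (locally l) <->
  is_lim_seq (fun n => Re (u n)) (Re l) /\ is_lim_seq (fun n => Im (u n)) (Im l).
Proof.
  split.
  - intros H. split.
    + apply is_lim_seq_spec. intros eps.
      destruct (proj1 (filterlim_locally u l) H eps) as [N HN].
      exists N. intros n Hn. destruct (HN n Hn) as [H1 _]. exact H1.
    + apply is_lim_seq_spec. intros eps.
      destruct (proj1 (filterlim_locally u l) H eps) as [N HN].
      exists N. intros n Hn. destruct (HN n Hn) as [_ H1]. exact H1.
  - intros [H1 H2]. apply filterlim_locally. intros eps.
    apply is_lim_seq_spec in H1, H2.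
    destruct (H1 eps) as [N1 HN1]. destruct (H2 eps) as [N2 HN2].
    exists (max N1 N2). intros n Hn. split.
    + apply HN1. lia.
    + apply HN2. lia.
Qed.

Lemma Cmod_le_components (z : C) : Cmod z <= Rabs (Re z) + Rabs (Im z).
Proof.
  destruct z as [x y]; simpl.
  replace ((x, y) : C) with (RtoC x + Ci * RtoC y)%C.
  - eapply Rle_trans; [apply Cmod_triangle|].
    rewrite Cmod_mult, !Cmod_R.
    replace (Cmod Ci) with 1; [lra|].
    transitivity (sqrt 1); [now rewrite sqrt_1|].
    unfold Cmod, Ci; simpl. f_equal. ring.
  - unfold RtoC, Ci, Cplus, Cmult; simpl. f_equal; ring.
Qed.

Lemma Re_le_Cmod (z : C) : Rabs (Re z) <= Cmod z.
Proof. eapply Rle_trans; [apply Rmax_l|apply Rmax_Cmod]. Qed.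

Lemma Im_le_Cmod (z : C) : Rabs (Im z) <= Cmod z.
Proof. eapply Rle_trans; [apply Rmax_r|apply Rmax_Cmod]. Qed.

Lemma filterlim_C_Cmod (u : nat -> C) (l : C) :
  filterlim u eventually (locally l) <->
  is_lim_seq (fun n => Cmod (u n - l)) 0.
Proof.
  rewrite filterlim_C_components. split.
  - intros [H1 H2].
    apply is_lim_seq_le_le with (fun _ => 0)
      (fun n => Rabs (Re (u n) - Re l) + Rabs (Im (u n) - Im l)).
    + intros n. split; [apply Cmod_ge_0|apply (Cmod_le_components (u n - l))].
    + apply is_lim_seq_const.
    + rewrite <- (Rplus_0_l 0).
      apply is_lim_seq_plus'.
      * rewrite <- Rabs_R0. apply (is_lim_seq_abs _ (Finite 0)).
        replace 0 with (Re l - Re l) by ring.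
        apply is_lim_seq_minus'; [exact H1|apply is_lim_seq_const].
      * rewrite <- Rabs_R0. apply (is_lim_seq_abs _ (Finite 0)).
        replace 0 with (Im l - Im l) by ring.
        apply is_lim_seq_minus'; [exact H2|apply is_lim_seq_const].
  - intros H.
    assert (aux : forall p : C -> R, (forall n, Rabs (p (u n) - p l) <= Cmod (u n - l)) ->
      is_lim_seq (fun n => p (u n)) (p l)).
    { intros p Hp. apply is_lim_seq_eps. intros eps He.
      destruct (proj1 (is_lim_seq_eps _ _) H eps He) as [N HN].
      exists N. intros n Hn. specialize (HN n Hn).
      rewrite Rminus_0_r, Rabs_pos_eq in HN by apply Cmod_ge_0.
      eapply Rle_lt_trans; [apply Hp|exact HN]. }
    split.
    + apply (aux Re). intros n. exact (Re_le_Cmod (u n - l)).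
    + apply (aux Im). intros n. exact (Im_le_Cmod (u n - l)).
Qed.

Fixpoint cprod (q : R) (N : nat) (z : C) : C :=
  match N with
  | O => RtoC 1
  | S N' => (cprod q N' z * (RtoC 1 + RtoC (wt q N) * Cpow z N))%C
  end.

Lemma fold_right_Cmult_init (l : list C) (a : C) :
  fold_right Cmult a l = (fold_right Cmult (RtoC 1) l * a)%C.
Proof.
  induction l as [|b l IH]; simpl.
  - now rewrite Cmult_1_l.
  - rewrite IH. now rewrite Cmult_assoc.
Qed.

Lemma cprod_fold (q : R) (z : C) (N : nat) :
  fold_right Cmult (RtoC 1)
    (map (fun k : nat => (RtoC 1 + RtoC (Rpower (INR k) (- q)) * Cpow z k)%C)
       (seq 1 N)) = cprod q N z.
Proof.
  induction N as [|N IH]; [reflexivity|].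
  rewrite seq_S, map_app, fold_right_app, fold_right_Cmult_init, IH.
  cbn [cprod map fold_right Nat.add]. unfold wt. now rewrite Cmult_1_r.
Qed.

Lemma is_product_cprod (q : R) (z P : C) :
  is_product q z P <->
  filterlim (fun N => cprod q N z) eventually (locally P).
Proof.
  unfold is_product; split; apply filterlim_ext; intros N;
    [|symmetry]; apply cprod_fold.
Qed.

Lemma Cpow_R (x : R) (n : nat) : Cpow (RtoC x) n = RtoC (x ^ n).
Proof.
  induction n as [|n IH]; [reflexivity|]. simpl. rewrite IH.
  now rewrite <- RtoC_mult.
Qed.

Lemma cprod_R (q x : R) (N : nat) : cprod q N (RtoC x) = RtoC (pprod q N x).
Proof.
  induction N as [|N IH]; [reflexivity|].
  cbn [cprod pprod]. rewrite IH, Cpow_R.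
  now rewrite <- RtoC_mult, <- RtoC_plus, <- RtoC_mult.
Qed.

Lemma sum_n_Re (u : nat -> C) (n : nat) :
  Re (sum_n (G := C_AbelianMonoid) u n) = sum_n (fun k => Re (u k)) n.
Proof.
  induction n as [|n IH]; [now rewrite !sum_O|].
  rewrite !sum_Sn, <- IH. reflexivity.
Qed.

Lemma sum_n_Im (u : nat -> C) (n : nat) :
  Im (sum_n (G := C_AbelianMonoid) u n) = sum_n (fun k => Im (u k)) n.
Proof.
  induction n as [|n IH]; [now rewrite !sum_O|].
  rewrite !sum_Sn, <- IH. reflexivity.
Qed.

Lemma is_series_C_components (u : nat -> C) (l : C) :
  @is_series C_AbsRing C_NormedModule u l <->
  is_series (fun n => Re (u n)) (Re l) /\ is_series (fun n => Im (u n)) (Im l).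
Proof.
  unfold is_series. rewrite (filterlim_C_components (sum_n u) l).
  change (is_lim_seq (fun n => Re (sum_n (G := C_AbelianMonoid) u n)) (Re l) /\
    is_lim_seq (fun n => Im (sum_n (G := C_AbelianMonoid) u n)) (Im l) <->
    is_lim_seq (sum_n (fun n => Re (u n))) (Re l) /\
    is_lim_seq (sum_n (fun n => Im (u n))) (Im l)).
  split; intros [H1 H2]; split.
  - eapply is_lim_seq_ext; [|exact H1]. intros n. apply sum_n_Re.
  - eapply is_lim_seq_ext; [|exact H2]. intros n. apply sum_n_Im.
  - eapply is_lim_seq_ext; [|exact H1]. intros n. symmetry. apply sum_n_Re.
  - eapply is_lim_seq_ext; [|exact H2]. intros n. symmetry. apply sum_n_Im.
Qed.

Lemma pow_n_Cpow (z : C) (n : nat) : @pow_n C_Ring z n = Cpow z n.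
Proof. induction n as [|n IH]; [reflexivity|]. simpl. now rewrite IH. Qed.

Lemma is_pseries_C_series (a : nat -> R) (z P : C) :
  @is_pseries C_AbsRing C_NormedModule (fun n => RtoC (a n)) z P <->
  @is_series C_AbsRing C_NormedModule (fun n => (RtoC (a n) * Cpow z n)%C) P.
Proof.
  assert (H : forall n, @scal C_AbsRing C_NormedModule (@pow_n C_AbsRing z n)
      (RtoC (a n)) = (RtoC (a n) * Cpow z n)%C).
  { intros n. etransitivity; [|apply Cmult_comm].
    exact (f_equal (fun w => (w * RtoC (a n))%C) (pow_n_Cpow z n)). }
  unfold is_pseries. split; apply is_series_ext; intros n; rewrite H; reflexivity.
Qed.

(** At real points of the unit disc both power series sum to the limit of the partial products, so
    their coefficients agree. From here on only the explicit sequence [coefs] is studied. *)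
Lemma product_coefficients_unique (q : R) (c : nat -> R) (n : nat) :
  0 <= q -> product_coefficients q c -> c n = coefs q n.
Proof.
  intros Hq Hc.
  assert (H : forall x, Rabs x < 1 -> is_pseries c x (PSeries (coefs q) x)).
  { intros x Hx. destruct (Hc (RtoC x)) as [P [HP Hs]].
    { now rewrite Cmod_R. }
    apply is_product_cprod, filterlim_C_components in HP. destruct HP as [HP _].
    apply (proj1 (is_pseries_C_series c (RtoC x) P)) in Hs. apply is_series_C_components in Hs. destruct Hs as [Hs _].
    apply is_pseries_R. replace (PSeries (coefs q) x) with (Re P).
    - eapply is_series_ext; [|exact Hs]. intros k. simpl.
      rewrite Cpow_R. simpl. ring.
    - assert (H1 := pprod_lim q x Hq Hx). apply is_lim_seq_unique in H1.
      apply is_lim_seq_unique in HP.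
      rewrite (Lim_seq_ext _ (fun N => pprod q N x)) in HP.
      + rewrite H1 in HP. now injection HP.
      + intros N. now rewrite cprod_R. }
  assert (H' : forall x, Rabs x < 1 -> ex_pseries (coefs q) x).
  { intros x Hx. apply ex_series_le_R with (fun m => coefs q m * Rabs x ^ m).
    - intros k. unfold scal; simpl; unfold mult; simpl.
      rewrite pow_n_pow, Rabs_mult, <- RPow_abs, Rmult_comm.
      rewrite (Rabs_pos_eq _ (coefs_nonneg q k)). apply Rle_refl.
    - now apply ex_series_coefs. }
  assert (rad : forall a : nat -> R, (forall x, Rabs x < 1 -> ex_pseries a x) ->
    Rbar_lt 0 (CV_radius a)).
  { intros a Ha. apply Rbar_lt_le_trans with (Finite (Rabs (/ 2))).
    - simpl. rewrite Rabs_pos_eq; lra.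
    - apply Rbar_not_lt_le. intros Hlt.
      apply CV_disk_outside in Hlt. apply Hlt.
      apply (ex_series_lim_0 (fun k => a k * (/ 2) ^ k)).
      apply (ex_pseries_R a (/ 2)). apply Ha. rewrite Rabs_pos_eq; lra. }
  apply PSeries_ext_recip.
  - apply rad. intros x Hx. eexists; now apply H.
  - now apply rad.
  - exists (mkposreal 1 Rlt_0_1). intros x Hx.
    apply is_pseries_unique, H.
    replace x with (x - 0) by ring. exact Hx.
Qed.

(** * The case q > 1 *)

Lemma is_derive_Rpower (a x : R) : 0 < x ->
  is_derive (fun t => Rpower t a) x (a * Rpower x (a - 1)).
Proof. intros Hx. apply is_derive_Reals. now apply derivable_pt_lim_power. Qed.

(** The integral test as a telescoping bound: a term of exponent p + 1 is at most 1/p times a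
    difference of powers of exponent p. *)
Lemma Rpower_increment (p x : R) : 0 < p -> 0 < x ->
  p * Rpower (x + 1) (- p - 1) <= Rpower x (- p) - Rpower (x + 1) (- p).
Proof.
  intros Hp Hx.
  destruct (MVT_gen (fun t => Rpower t (- p)) x (x + 1)
    (fun t => - p * Rpower t (- p - 1))) as [c [Hc Heq]].
  - rewrite Rmin_left, Rmax_right by lra. intros t Ht.
    apply is_derive_Rpower; lra.
  - rewrite Rmin_left, Rmax_right by lra. intros t Ht.
    apply continuity_pt_filterlim, (ex_derive_continuous (fun t => Rpower t (- p))).
    eexists. apply is_derive_Rpower; lra.
  - rewrite Rmin_left, Rmax_right in Hc by lra.
    assert (H : Rpower (x + 1) (- p - 1) <= Rpower c (- p - 1)).
    { replace (- p - 1) with (- (p + 1)) by ring.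
      apply Rpower_neg_antitone; lra. }
    assert (p * Rpower (x + 1) (- p - 1) <= p * Rpower c (- p - 1))
      by (apply Rmult_le_compat_l; lra).
    lra.
Qed.

Lemma ex_series_Riemann (p : R) : 1 < p ->
  ex_series (fun k => Rpower (INR (S k)) (- p)).
Proof.
  intros Hp. set (s := p - 1).
  apply ex_series_bounded with (1 + / s).
  - intros k. left; apply Rpower_pos.
  - intros n.
    enough (H : sum_n (fun k => Rpower (INR (S k)) (- p)) n
      <= 1 + / s * (1 - Rpower (INR (S n)) (- s))).
    { assert (0 < / s * Rpower (INR (S n)) (- s)).
      { apply Rmult_lt_0_compat; [apply Rinv_0_lt_compat; unfold s; lra|
          apply Rpower_pos]. }
      lra. }
    induction n as [|n IH].
    + rewrite sum_O. simpl INR. rewrite !Rpower_base_1. lra.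
    + rewrite sum_Sn.
      assert (H := Rpower_increment s (INR (S n)) ltac:(unfold s; lra)
        (INR_S_pos n)).
      rewrite <- S_INR in H.
      replace (- s - 1) with (- p) in H by (unfold s; ring).
      assert (Hs : 0 < / s) by (apply Rinv_0_lt_compat; unfold s; lra).
      apply (Rmult_le_compat_l (/ s)) in H; [|lra].
      rewrite <- Rmult_assoc, Rinv_l, Rmult_1_l in H by (unfold s; lra).
      unfold plus; simpl AbelianMonoid.plus in *.
      change (sum_n (fun k => Rpower (INR (S k)) (- p)) n +
        Rpower (INR (S (S n))) (- p) <= 1 + / s * (1 - Rpower (INR (S (S n))) (- s))).
      lra.
Qed.

Lemma Series_finite (a : nat -> R) (N : nat) :
  (forall k, (N < k)%nat -> a k = 0) -> is_series a (sum_n a N).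
Proof.
  intros H. apply filterlim_ext_loc with (fun _ => sum_n a N);
    [|apply filterlim_const].
  exists N. intros n Hn. induction Hn as [|n Hn IH]; [reflexivity|].
  rewrite sum_Sn, <- IH, H by lia. ring_R.
Qed.

Lemma sum_n_rev (a : nat -> R) (N : nat) :
  sum_n a N = sum_n (fun m => a (N - m)%nat) N.
Proof.
  revert a; induction N as [|N IH]; intros a.
  - rewrite !sum_O. reflexivity.
  - rewrite sum_Sn, (IH a). unfold sum_n at 2.
    rewrite sum_Sn_m by lia.
    rewrite <- (sum_n_m_S (fun m => a (S N - m)%nat) 0 N).
    replace (S N - 0)%nat with (S N) by lia.
    rewrite plus_comm. f_equal.
Qed.

(** * Decomposition by the largest part *)

Lemma coef_largest_part (q : R) (N : nat) (z : Z) : z <> 0%Z ->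
  coef q (S N) z =
  sum_n (fun j => wt q (S j) * coef q j (z - Z.of_nat (S j))) N.
Proof.
  intros Hz. induction N as [|N IH].
  - rewrite sum_O. cbn [coef]. destruct (Z.eq_dec z 0); [contradiction|]. ring.
  - rewrite sum_Sn, <- IH. reflexivity.
Qed.

Definition last_part (q : R) (n j : nat) : R :=
  wt q (S j) * coef q j (Z.of_nat n - Z.of_nat (S j)).

Lemma coefs_last_part (q : R) (N : nat) :
  coefs q (S N) = sum_n (last_part q (S N)) N.
Proof. unfold coefs. now rewrite coef_largest_part by lia. Qed.

Lemma last_part_nonneg (q : R) (n j : nat) : 0 <= last_part q n j.
Proof. apply Rmult_le_pos; [left; apply wt_pos|apply coef_nonneg]. Qed.

Lemma last_part_le (q : R) (n j : nat) : (S j <= n)%nat ->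
  last_part q n j <= wt q (S j) * coefs q (n - S j).
Proof.
  intros H. unfold last_part. apply Rmult_le_compat_l; [left; apply wt_pos|].
  replace (Z.of_nat n - Z.of_nat (S j))%Z with (Z.of_nat (n - S j)) by lia.
  apply coef_le_coefs.
Qed.

Lemma last_part_small (q : R) (n j : nat) : (S j * S j < n)%nat -> last_part q n j = 0.
Proof.
  intros H. unfold last_part. rewrite coef_above; [ring|]. nia.
Qed.

(** The representations of n + 1 whose largest part is less than, respectively
    at least, half of n + 1. *)
Definition low (q : R) (N j : nat) : R :=
  if (2 * S j <? S N)%nat
  then Rpower (INR (S N)) q * last_part q (S N) j else 0.

Definition high (q : R) (N m : nat) : R :=
  if andb (m <=? N)%nat (negb (2 * S (N - m) <? S N)%nat)
  then Rpower (INR (S N)) q * last_part q (S N) (N - m) else 0.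

(** [low] is indexed by the largest part j + 1, [high] by the sum m of all other parts, the largest
    being N + 1 - m. With these indices every single term has a limit as [N] grows. *)
Lemma coefs_low_high (q : R) (N : nat) :
  coefs q (S N) * Rpower (INR (S N)) q = Series (low q N) + Series (high q N).
Proof.
  assert (Hlow : forall k, (N < k)%nat -> low q N k = 0).
  { intros k Hk. unfold low.
    replace (2 * S k <? S N)%nat with false by (symmetry; apply Nat.ltb_ge; lia).
    reflexivity. }
  assert (Hhigh : forall k, (N < k)%nat -> high q N k = 0).
  { intros k Hk. unfold high.
    replace (k <=? N)%nat with false by (symmetry; apply Nat.leb_gt; lia).
    reflexivity. }
  rewrite (is_series_unique _ _ (Series_finite _ N Hlow)).
  rewrite (is_series_unique _ _ (Series_finite _ N Hhigh)).
  rewrite (sum_n_rev (high q N)), coefs_last_part, Rmult_comm.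
  rewrite <- (sum_n_mult_l (K := R_Ring)).
  change (sum_n (fun k => Rpower (INR (S N)) q * last_part q (S N) k) N =
    plus (sum_n (low q N) N) (sum_n (fun m => high q N (N - m)) N)).
  rewrite <- sum_n_plus. apply sum_n_ext_loc. intros j Hj.
  unfold low, high.
  replace (N - (N - j))%nat with j by lia.
  replace (N - j <=? N)%nat with true by (symmetry; apply Nat.leb_le; lia).
  destruct (2 * S j <? S N)%nat; cbn [andb negb]; ring_R.
Qed.

Lemma Rpower_opp_mult (x y q : R) : 0 < x -> 0 < y ->
  Rpower x q * Rpower y (- q) = Rpower (x / y) q.
Proof.
  intros Hx Hy. unfold Rpower, Rdiv. rewrite <- exp_plus, ln_mult, ln_Rinv;
    [f_equal; ring|exact Hy|exact Hx|now apply Rinv_0_lt_compat].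
Qed.

Lemma Rdiv_le_2 (x y : R) : 0 < y -> x <= 2 * y -> x / y <= 2.
Proof. intros Hy H. apply Rle_div_l; lra. Qed.

(** The largest part is at least half of N + 1, so its weight is at most 2^q (N + 1)^(-q). *)
Lemma high_bound (q : R) (N m : nat) : 0 <= q ->
  Rabs (high q N m) <= Rpower 2 q * coefs q m.
Proof.
  intros Hq. unfold high.
  destruct (m <=? N)%nat eqn:Hm; cbn [andb negb].
  2:{ rewrite Rabs_R0. apply Rmult_le_pos; [left; apply Rpower_pos|apply coefs_nonneg]. }
  destruct (2 * S (N - m) <? S N)%nat eqn:H; cbn [andb negb].
  { rewrite Rabs_R0. apply Rmult_le_pos; [left; apply Rpower_pos|apply coefs_nonneg]. }
  apply Nat.leb_le in Hm. apply Nat.ltb_ge in H.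
  rewrite Rabs_pos_eq.
  2:{ apply Rmult_le_pos; [left; apply Rpower_pos|apply last_part_nonneg]. }
  eapply Rle_trans.
  { apply Rmult_le_compat_l; [left; apply Rpower_pos|]. apply last_part_le; lia. }
  replace (S N - S (N - m))%nat with m by lia.
  rewrite <- Rmult_assoc. apply Rmult_le_compat_r; [apply coefs_nonneg|].
  unfold wt. rewrite Rpower_opp_mult by apply INR_S_pos.
  apply Rle_Rpower_l; [exact Hq|]. split.
  - apply Rdiv_lt_0_compat; apply INR_S_pos.
  - apply Rdiv_le_2; [apply INR_S_pos|].
    change 2 with (INR 2). rewrite <- mult_INR. now apply le_INR.
Qed.

(** Now the remainder N - j exceeds half of N + 1, so the decay assumed for smaller indices applies
    to it at the price of 2^q, while the weight of the largest part stays available for summation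
    over [j]. *)
Lemma low_bound (q C : R) (N j : nat) : 0 <= q -> 0 <= C ->
  (forall n, (n < N)%nat -> coefs q (S n) * Rpower (INR (S n)) q <= C) ->
  Rabs (low q N j) <= Rpower 2 q * C * Rpower (INR (S j)) (- q).
Proof.
  intros Hq HC0 HC. unfold low.
  destruct (2 * S j <? S N)%nat eqn:H.
  - apply Nat.ltb_lt in H.
    assert (HCm := HC (N - S j)%nat ltac:(lia)).
    replace (S (N - S j)) with (S N - S j)%nat in HCm by lia.
    set (m := (S N - S j)%nat) in *.
    assert (Hm : 0 < INR m) by (apply lt_0_INR; lia).
    rewrite Rabs_pos_eq.
    2:{ apply Rmult_le_pos; [left; apply Rpower_pos|apply last_part_nonneg]. }
    eapply Rle_trans.
    { apply Rmult_le_compat_l; [left; apply Rpower_pos|]. apply last_part_le; lia. }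
    fold m. unfold wt.
    replace (Rpower (INR (S N)) q * (Rpower (INR (S j)) (- q) * coefs q m)) with
      (Rpower (INR (S N)) q * Rpower (INR m) (- q) *
       (coefs q m * Rpower (INR m) q) * Rpower (INR (S j)) (- q)).
    2:{ rewrite (Rpower_Ropp (INR m)). field. apply Rgt_not_eq, Rpower_pos. }
    apply Rmult_le_compat_r; [left; apply Rpower_pos|].
    apply Rmult_le_compat; [| |clear HCm|exact HCm].
    + apply Rmult_le_pos; left; apply Rpower_pos.
    + apply Rmult_le_pos; [apply coefs_nonneg|left; apply Rpower_pos].
    + rewrite Rpower_opp_mult by (apply INR_S_pos || exact Hm).
      apply Rle_Rpower_l; [exact Hq|]. split.
      * apply Rdiv_lt_0_compat; [apply INR_S_pos|exact Hm].
      * apply Rdiv_le_2; [exact Hm|].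
        change 2 with (INR 2). rewrite <- mult_INR. apply le_INR. lia.
  - rewrite Rabs_R0. apply Rmult_le_pos; [|left; apply Rpower_pos].
    apply Rmult_le_pos; [left; apply Rpower_pos|exact HC0].
Qed.

Lemma is_lim_seq_Rpower_1 (u : nat -> R) (a : R) :
  is_lim_seq u 1 -> is_lim_seq (fun n => Rpower (u n) a) 1.
Proof.
  intros H. rewrite <- (Rpower_base_1 a).
  apply (is_lim_seq_continuous (fun t => Rpower t a)); [|exact H].
  apply continuity_pt_filterlim, (ex_derive_continuous (fun t => Rpower t a)).
  eexists. apply is_derive_Rpower; lra.
Qed.

Lemma is_lim_seq_const_div_INR (a : R) (f : nat -> nat) :
  (forall n, (n <= f n)%nat) -> is_lim_seq (fun n => a / INR (f n)) 0.
Proof.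
  intros Hf. replace 0 with (a * 0) by ring.
  apply (is_lim_seq_scal_l _ a 0).
  apply (is_lim_seq_inv _ p_infty); [|discriminate].
  apply is_lim_seq_le_p_loc with INR; [|apply is_lim_seq_INR].
  exists O. intros n _. now apply le_INR.
Qed.

Lemma high_lim (q : R) (m : nat) : 0 <= q ->
  is_lim_seq (fun N => high q N m) (coefs q m).
Proof.
  intros Hq.
  apply is_lim_seq_ext_loc with
    (fun N => Rpower (1 + INR m / INR (S (N - m))) q * coefs q m).
  - exists (2 * m + 1)%nat. intros N HN. unfold high.
    replace (m <=? N)%nat with true by (symmetry; apply Nat.leb_le; lia).
    replace (2 * S (N - m) <? S N)%nat with false
      by (symmetry; apply Nat.ltb_ge; lia).
    cbn [andb negb]. unfold last_part, wt.
    replace (Z.of_nat (S N) - Z.of_nat (S (N - m)))%Z with (Z.of_nat m) by lia.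
    rewrite coef_coefs by lia.
    rewrite <- Rmult_assoc, Rpower_opp_mult by apply INR_S_pos.
    f_equal. f_equal.
    replace (INR (S N)) with (INR (S (N - m)) + INR m)
      by (rewrite <- plus_INR; f_equal; lia).
    field. apply Rgt_not_eq, INR_S_pos.
  - replace (Finite (coefs q m)) with (Finite (1 * coefs q m)) by (f_equal; ring).
    apply is_lim_seq_mult'; [|apply is_lim_seq_const].
    apply is_lim_seq_Rpower_1.
    replace (Finite 1) with (Finite (1 + 0)) by (f_equal; ring).
    apply is_lim_seq_plus'; [apply is_lim_seq_const|].
    apply is_lim_seq_incr_n with m.
    apply (is_lim_seq_const_div_INR (INR m) (fun N => S (N + m - m))). lia.
Qed.

Lemma ex_series_coefs_1 (q : R) : 1 < q -> ex_series (coefs q).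
Proof.
  intros Hq. apply ex_series_ext with (fun m => coefs q m * 1 ^ m).
  { intros m. rewrite pow1. ring_R. }
  apply ex_series_coefs_of_weights; [lra|].
  apply ex_series_incr_1.
  apply ex_series_ext with (fun k => Rpower (INR (S k)) (- q)).
  { intros m. rewrite pow1. unfold wt. ring_R. }
  now apply ex_series_Riemann.
Qed.

Lemma Series_high_le (q : R) (N : nat) : 1 < q ->
  Series (high q N) <= Rpower 2 q * Series (coefs q).
Proof.
  intros Hq. rewrite <- Series_scal_l. apply Series_le.
  - intros m. assert (H := high_bound q N m ltac:(lra)).
    split; [|eapply Rle_trans; [apply Rle_abs|exact H]].
    unfold high. destruct andb; [|lra].
    apply Rmult_le_pos; [left; apply Rpower_pos|apply last_part_nonneg].
  - apply (ex_series_scal (V := R_NormedModule)). now apply ex_series_coefs_1.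
Qed.

(** Distinct parts not exceeding K + 1 have sum at most (K + 1)^2, which is less than N + 1. *)
Lemma low_small (q : R) (N K j : nat) :
  (S K * S K <= N)%nat -> (j <= K)%nat -> low q N j = 0.
Proof.
  intros H Hj. unfold low. destruct (2 * S j <? S N)%nat; [|reflexivity].
  rewrite last_part_small; [ring|]. nia.
Qed.

(** Strong induction with a contraction. For large [N] only terms with j > K survive in [low]; [K]
    is chosen such that the tail of the Riemann series beyond it, times 2^q, is at most 1/2. The
    induction hypothesis with constant C then returns C/2 + 2^q W. *)
Lemma coefs_polynomial_decay (q : R) : 1 < q ->
  exists C, 0 <= C /\ forall n, coefs q (S n) * Rpower (INR (S n)) q <= C.
Proof.
  intros Hq.
  set (z := fun k => Rpower (INR (S k)) (- q)).
  assert (Hz : ex_series z) by (now apply ex_series_Riemann).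
  assert (He : 0 < / 2 * Rpower 2 (- q))
    by (apply Rmult_lt_0_compat; [lra|apply Rpower_pos]).
  destruct (proj1 (is_lim_seq_eps _ _) (Series_correct z Hz) _ He) as [K HK].
  specialize (HK K (le_n K)).
  set (n0 := (S K * S K)%nat).
  set (W := Series (coefs q)).
  assert (HW : 0 <= W).
  { apply Rle_trans with (sum_n (coefs q) 0).
    - rewrite sum_O. apply coefs_nonneg.
    - apply sum_n_le_Series; [apply coefs_nonneg|now apply ex_series_coefs_1]. }
  set (C0 := sum_n (fun n => coefs q (S n) * Rpower (INR (S n)) q) n0).
  assert (Hnn : forall n, 0 <= coefs q (S n) * Rpower (INR (S n)) q).
  { intros n. apply Rmult_le_pos; [apply coefs_nonneg|left; apply Rpower_pos]. }
  assert (HC0 : 0 <= C0) by (apply sum_n_nonneg; auto).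
  assert (H2q := Rpower_pos 2 q).
  (* Chosen so that C/2 + 2^q W <= C; [C0] covers the finitely many indices up to [n0]. *)
  set (C := C0 + 2 * (Rpower 2 q * W)).
  assert (HC : 0 <= C) by (unfold C; nra).
  exists C. split; [exact HC|].
  apply (well_founded_induction lt_wf). intros N IH.
  destruct (le_lt_dec N n0) as [Hle|Hgt].
  - apply Rle_trans with C0; [|unfold C; nra].
    unfold C0. apply Rle_trans with
      (sum_n (fun n => coefs q (S n) * Rpower (INR (S n)) q) N).
    + destruct N as [|N]; [rewrite sum_O; apply Rle_refl|].
      rewrite sum_Sn. unfold plus; simpl AbelianMonoid.plus.
      assert (H : 0 <= sum_n (fun n => coefs q (S n) * Rpower (INR (S n)) q) N)
        by (apply sum_n_nonneg; auto).
      change (coefs q (S (S N)) * Rpower (INR (S (S N))) q <=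
        sum_n (fun n => coefs q (S n) * Rpower (INR (S n)) q) N +
        coefs q (S (S N)) * Rpower (INR (S (S N))) q). lra.
    + now apply sum_n_mono.
  - rewrite coefs_low_high.
    assert (H1 := Series_high_le q N Hq). fold W in H1.
    assert (Hb : forall j, Rabs (low q N j) <= Rpower 2 q * C * z j)
      by (intros j; apply low_bound; [lra|exact HC|exact IH]).
    assert (Hex : ex_series (fun j => Rpower 2 q * C * z j))
      by (now apply (ex_series_scal (V := R_NormedModule))).
    assert (H2 := series_tail_bound _ _ K Hb Hex).
    replace (sum_n (low q N) K) with 0 in H2.
    2:{ symmetry. rewrite (sum_n_ext_loc _ (fun _ => 0)).
        - rewrite sum_n_const. ring.
        - intros j Hj. apply low_small with K; [fold n0; lia|exact Hj]. }
    rewrite Series_scal_l in H2.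
    replace (sum_n (fun j => Rpower 2 q * C * z j) K) with
      (Rpower 2 q * C * sum_n z K) in H2
      by (symmetry; exact (sum_n_mult_l (K := R_Ring) _ z K)).
    rewrite Rminus_0_r in H2. apply Rle_trans with (1 := Rplus_le_compat _ _ _ _
      (Rle_trans _ _ _ (Rle_abs _) H2) H1).
    replace (Rpower 2 q * C * Series z - Rpower 2 q * C * sum_n z K) with
      (C * (Rpower 2 q * (Series z - sum_n z K))) by ring.
    assert (H3 : Rpower 2 q * (Series z - sum_n z K) <= / 2).
    { apply Rle_trans with (Rpower 2 q * (/ 2 * Rpower 2 (- q))).
      - apply Rmult_le_compat_l; [lra|]. rewrite Rabs_minus_sym in HK.
        left. exact (Rle_lt_trans _ _ _ (Rle_abs _) HK).
      - rewrite Rpower_Ropp. right. field. lra. }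
    apply (Rmult_le_compat_l C) in H3; [|exact HC]. unfold C in *. lra.
Qed.

(** Every term of [low] is eventually zero, and the decay estimate provides its dominating series;
    the terms of [high] converge to [coefs q m]. *)
Lemma coefs_asymp_gt_1 (q : R) : 1 < q ->
  is_lim_seq (fun n => coefs q n * Rpower (INR n) q) (Series (coefs q)).
Proof.
  intros Hq. apply is_lim_seq_incr_1.
  apply is_lim_seq_ext with (fun N => Series (low q N) + Series (high q N)).
  { intros N. symmetry. apply coefs_low_high. }
  replace (Finite (Series (coefs q))) with
    (Finite (Series (fun _ => 0) + Series (coefs q))).
  2:{ assert (H0 : is_series (fun _ : nat => 0) (sum_n (fun _ => 0) 0))
        by (apply Series_finite; reflexivity).
      rewrite (is_series_unique _ _ H0), sum_O. f_equal; ring. }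
  destruct (coefs_polynomial_decay q Hq) as [C [HC0 HC]].
  apply is_lim_seq_plus'.
  - apply tannery with (fun j => Rpower 2 q * C * Rpower (INR (S j)) (- q)).
    + apply (ex_series_scal (V := R_NormedModule)). now apply ex_series_Riemann.
    + exists O. intros N j _. apply low_bound; [lra|exact HC0|auto].
    + intros j. apply is_lim_seq_ext_loc with (fun _ => 0);
        [|apply is_lim_seq_const].
      exists (S j * S j)%nat. intros N HN. symmetry. now apply low_small with j.
  - apply tannery with (fun m => Rpower 2 q * coefs q m).
    + apply (ex_series_scal (V := R_NormedModule)). now apply ex_series_coefs_1.
    + exists O. intros N m _. apply high_bound; lra.
    + intros m. apply high_lim; lra.
Qed.

Lemma theorem3_gt_1 (q : R) : 1 < q ->
  exists W : R, 0 < W /\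
    forall c : nat -> R, product_coefficients q c ->
      asymp c (fun n : nat => W * Rpower (INR n) (- q)).
Proof.
  intros Hq. exists (Series (coefs q)).
  assert (HW : 0 < Series (coefs q)).
  { apply Rlt_le_trans with (sum_n (coefs q) 0).
    - rewrite sum_O. unfold coefs; simpl. lra.
    - apply sum_n_le_Series; [apply coefs_nonneg|now apply ex_series_coefs_1]. }
  split; [exact HW|]. intros c Hc. unfold asymp.
  apply is_lim_seq_ext with
    (fun n => coefs q n * Rpower (INR n) q * / Series (coefs q)).
  - intros n. rewrite (product_coefficients_unique q c n) by (lra || exact Hc).
    rewrite Rpower_Ropp. field. split; [apply Rgt_not_eq, Rpower_pos|lra].
  - replace (Finite 1) with (Finite (Series (coefs q) * / Series (coefs q)))
      by (f_equal; field; lra).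
    apply is_lim_seq_mult'; [now apply coefs_asymp_gt_1|apply is_lim_seq_const].
Qed.

(** * Binomial series and the sums of k^(b - 1) exp (- k d) *)

(** Taylor coefficients of [(1 - z)^(-b)]. *)
Fixpoint binc (b : R) (k : nat) : R :=
  match k with
  | O => 1
  | S k' => binc b k' * ((b + INR k') / INR (S k'))
  end.

Lemma binc_pos (b : R) (k : nat) : 0 < b -> 0 < binc b k.
Proof.
  intros Hb. induction k as [|k IH]; cbn [binc]; [lra|].
  apply Rmult_lt_0_compat; [exact IH|].
  apply Rdiv_lt_0_compat; [|apply INR_S_pos]. assert (H := pos_INR k). lra.
Qed.

Lemma binc_CV_radius (b : R) : 0 < b -> CV_radius (binc b) = 1.
Proof.
  intros Hb. rewrite <- Rinv_1.
  apply (CV_radius_finite_DAlembert (binc b) 1).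
  - intros n. apply Rgt_not_eq. now apply binc_pos.
  - lra.
  - apply is_lim_seq_ext with (fun n => 1 + (b - 1) / INR (S n)).
    + intros n. cbn [binc]. assert (Hn := INR_S_pos n). assert (Hp := binc_pos b n Hb).
      replace (binc b n * ((b + INR n) / INR (S n)) / binc b n) with
        ((b + INR n) / INR (S n)) by (field; lra).
      rewrite Rabs_pos_eq.
      * rewrite S_INR in *. field. lra.
      * assert (H := pos_INR n). apply Rlt_le, Rdiv_lt_0_compat; lra.
    + replace (Finite 1) with (Finite (1 + 0)) by (f_equal; ring).
      apply is_lim_seq_plus'; [apply is_lim_seq_const|].
      apply (is_lim_seq_const_div_INR (b - 1) S). lia.
Qed.

Lemma constant_of_derive_0 (f : R -> R) (x : R) : 0 <= x ->
  (forall t, 0 <= t <= x -> is_derive f t 0) -> f x = f 0.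
Proof.
  intros Hx H.
  assert (Hb : Rabs (f x - f 0) <= 0 - 0).
  { apply (increment_bound f (fun _ => 0) (fun _ => 0) (fun _ => 0) 0 x Hx H).
    - intros t _. apply (is_derive_const (V := R_NormedModule)).
    - intros t _. rewrite Rabs_R0. lra. }
  assert (H0 : Rabs (f x - f 0) = 0) by (generalize (Rabs_pos (f x - f 0)); lra).
  destruct (Req_dec (f x - f 0) 0) as [E|E]; [lra|].
  now apply Rabs_no_R0 in E.
Qed.

(** The recursion of the coefficients says that the sum f satisfies (1 - x) f' = b f, so f (1 - x)^b
    is constant. *)
Lemma binc_PSeries (b x : R) : 0 < b -> 0 <= x < 1 ->
  PSeries (binc b) x = Rpower (1 - x) (- b).
Proof.
  intros Hb Hx.
  assert (Hcv : forall t, 0 <= t <= x -> Rbar_lt (Rabs t) (CV_radius (binc b))).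
  { intros t Ht. rewrite binc_CV_radius by exact Hb. simpl. rewrite Rabs_pos_eq; lra. }
  assert (Hode : forall t, 0 <= t <= x ->
    PSeries (PS_derive (binc b)) t * (1 - t) = b * PSeries (binc b) t).
  { intros t Ht.
    assert (Hd : ex_pseries (PS_derive (binc b)) t).
    { apply CV_radius_inside. rewrite CV_radius_derive. now apply Hcv. }
    assert (H0 : ex_pseries (binc b) t) by (apply CV_radius_inside; now apply Hcv).
    assert (E : PSeries (PS_derive (binc b)) t =
      b * PSeries (binc b) t + t * PSeries (PS_derive (binc b)) t).
    { rewrite <- PSeries_scal, <- PSeries_incr_1, <- PSeries_plus.
      - apply PSeries_ext. intros n. unfold PS_derive, PS_plus, PS_scal, PS_incr_1.
        destruct n as [|n].
        + cbn [binc]. simpl INR. unfold plus, scal, zero; simpl; unfold mult; simpl.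
          field.
        + unfold plus, scal; simpl AbelianMonoid.plus.
          change (INR (S (S n)) * binc b (S (S n)) =
            b * binc b (S n) + INR (S n) * binc b (S n)).
          change (binc b (S (S n))) with
            (binc b (S n) * ((b + INR (S n)) / INR (S (S n)))).
          field. apply Rgt_not_eq, INR_S_pos.
      - apply ex_pseries_scal; [apply Rmult_comm|exact H0].
      - now apply ex_pseries_incr_1. }
    lra. }
  assert (H : PSeries (binc b) x * Rpower (1 - x) b =
    PSeries (binc b) 0 * Rpower (1 - 0) b).
  { apply (constant_of_derive_0 (fun t => PSeries (binc b) t * Rpower (1 - t) b));
      [lra|].
    intros t Ht.
    assert (H1 := is_derive_PSeries (binc b) t (Hcv t Ht)).
    assert (H2 : is_derive (fun u => Rpower (1 - u) b) t (- (b * Rpower (1 - t) (b - 1)))).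
    { assert (H3 := is_derive_comp (fun v => Rpower v b) (fun u => 1 - u) t _ (-1)
        (is_derive_Rpower b (1 - t) ltac:(lra))).
      replace (- (b * Rpower (1 - t) (b - 1))) with
        (scal (-1) (b * Rpower (1 - t) (b - 1)))
        by (unfold scal; simpl; unfold mult; simpl; ring).
      apply H3. auto_derive; [exact I|ring]. }
    assert (H4 := is_derive_mult (K := R_AbsRing) _ _ t _ _ H1 H2 Rmult_comm).
    replace 0 with (plus (mult (PSeries (PS_derive (binc b)) t) (Rpower (1 - t) b))
      (mult (PSeries (binc b) t) (- (b * Rpower (1 - t) (b - 1))))); [exact H4|].
    unfold plus, mult; simpl.
    replace (Rpower (1 - t) b) with (Rpower (1 - t) (b - 1) * (1 - t)).
    - replace (PSeries (PS_derive (binc b)) t * (Rpower (1 - t) (b - 1) * (1 - t)))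
        with (PSeries (PS_derive (binc b)) t * (1 - t) * Rpower (1 - t) (b - 1)) by ring.
      rewrite (Hode t Ht). ring.
    - rewrite <- (Rpower_1 (1 - t)) at 2 by lra.
      rewrite <- Rpower_plus. f_equal. ring. }
  rewrite PSeries_0 in H. simpl binc in H.
  rewrite Rminus_0_r, Rpower_base_1 in H. rewrite Rpower_Ropp.
  apply Rmult_eq_reg_r with (Rpower (1 - x) b); [|apply Rgt_not_eq, Rpower_pos].
  rewrite H. field. apply Rgt_not_eq, Rpower_pos.
Qed.

(** Tends to [1 / Gamma b] by Gauss's formula. *)
Definition gauss (b : R) (k : nat) : R := binc b (S k) * Rpower (INR (S k)) (1 - b).

Definition gam (b : R) : R := / real (Lim_seq (gauss b)).

Lemma gauss_pos (b : R) (k : nat) : 0 < b -> 0 < gauss b k.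
Proof. intros Hb. apply Rmult_lt_0_compat; [now apply binc_pos|apply Rpower_pos]. Qed.

Lemma ln_1_plus_bounds (t : R) : 0 <= t -> t - t * t / 2 <= ln (1 + t) <= t.
Proof.
  intros Ht. split.
  - assert (H : Rabs ((ln (1 + t) - t) - (ln (1 + 0) - 0)) <=
      t * t / 2 - 0 * 0 / 2).
    { apply (increment_bound (fun u => ln (1 + u) - u) (fun u => / (1 + u) - 1)
        (fun u => u * u / 2) (fun u => u)); [exact Ht| | |].
      - intros u Hu. auto_derive; [lra|field; lra].
      - intros u Hu. auto_derive; [exact I|field].
      - intros u Hu. replace (/ (1 + u) - 1) with (- (u / (1 + u))) by (field; lra).
        rewrite Rabs_Ropp, Rabs_pos_eq by (apply Rdiv_le_0_compat; lra).
        apply Rle_div_l; nra. }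
    rewrite Rplus_0_r, ln_1 in H. apply Rabs_le_between in H.
    lra.
  - rewrite <- (ln_exp t) at 2. apply ln_le; [lra|].
    apply exp_ge_1_plus.
Qed.

Definition gauss_incr (b : R) (k : nat) : R :=
  ln (1 + b * / INR (S k)) - b * ln (1 + / INR (S k)).

Lemma ln_gauss_incr (b : R) (k : nat) : 0 < b ->
  ln (gauss b (S k)) - ln (gauss b k) = gauss_incr b k.
Proof.
  intros Hb. unfold gauss, gauss_incr.
  assert (Hk := INR_S_pos k). assert (Hk' := INR_S_pos (S k)).
  assert (Hp := binc_pos b (S k) Hb).
  change (binc b (S (S k))) with (binc b (S k) * ((b + INR (S k)) / INR (S (S k)))).
  assert (0 < b + INR (S k)) by lra.
  replace (1 + b * / INR (S k)) with ((b + INR (S k)) / INR (S k)) by (field; lra).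
  replace (1 + / INR (S k)) with (INR (S (S k)) / INR (S k))
    by (rewrite (S_INR (S k)); field; lra).
  rewrite !ln_mult; try apply Rpower_pos; try assumption;
    try (apply Rdiv_lt_0_compat; assumption);
    try (apply Rmult_lt_0_compat; [assumption|apply Rdiv_lt_0_compat; assumption]).
  unfold Rpower, Rdiv. rewrite !ln_exp, !ln_mult, !ln_Rinv;
    try assumption; try (now apply Rinv_0_lt_compat).
  ring.
Qed.

Lemma gauss_incr_bound (b : R) (k : nat) : 0 < b ->
  Rabs (gauss_incr b k) <= (b + b * b) / 2 * / INR (S k) * / INR (S k).
Proof.
  intros Hb. unfold gauss_incr. set (x := / INR (S k)).
  assert (Hx : 0 < x) by (apply Rinv_0_lt_compat, INR_S_pos).
  assert (H1 := ln_1_plus_bounds x ltac:(lra)).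
  assert (H2 := ln_1_plus_bounds (b * x) ltac:(nra)).
  apply Rabs_le. split; nra.
Qed.

(** The increments are O(k^(-2)), since the first-order terms of the two logarithms cancel. By 1/x^2
    <= 2 (1/x - 1/(x+1)) for x >= 1 their sums telescope, which yields convergence and its rate
    together. *)
Lemma gauss_near (b : R) : 0 < b ->
  exists L : R, is_lim_seq (fun k => ln (gauss b k)) L /\
    forall k, Rabs (ln (gauss b k) - L) <= (b + b * b) * / INR (S k).
Proof.
  intros Hb. set (D := b + b * b). assert (HD : 0 < D) by (unfold D; nra).
  assert (step : forall k m, Rabs (ln (gauss b (k + m)) - ln (gauss b k)) <=
    D * (/ INR (S k) - / INR (S (k + m)))).
  { intros k m. induction m as [|m IH].
    - rewrite Nat.add_0_r, !Rminus_diag, Rabs_R0. lra.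
    - replace (k + S m)%nat with (S (k + m)) by lia. set (i := (k + m)%nat) in *.
      assert (H1 := ln_gauss_incr b i Hb).
      assert (H2 := gauss_incr_bound b i Hb). rewrite <- H1 in H2.
      replace (ln (gauss b (S i)) - ln (gauss b k)) with
        ((ln (gauss b (S i)) - ln (gauss b i)) +
         (ln (gauss b i) - ln (gauss b k))) by ring.
      eapply Rle_trans; [apply Rabs_triang|]. fold D in H2.
      assert (H3 : / INR (S i) * / INR (S i) <= 2 * (/ INR (S i) - / INR (S (S i)))).
      { assert (Hi := INR_S_ge_1 i). rewrite (S_INR (S i)). set (x := INR (S i)) in *.
        replace (2 * (/ x - / (x + 1))) with (2 / (x * (x + 1))) by (field; lra).
        replace (/ x * / x) with (1 / (x * x)) by (field; lra).
        apply Rle_div_l; [nra|].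
        replace (2 / (x * (x + 1)) * (x * x)) with (2 * x / (x + 1)) by (field; lra).
        apply Rle_div_r; lra. }
      apply (Rmult_le_compat_l (D / 2)) in H3; lra. }
  assert (HL : ex_finite_lim_seq (fun k => ln (gauss b k))).
  { apply ex_lim_seq_cauchy_corr. intros eps.
    destruct (proj1 (is_lim_seq_eps _ _) (is_lim_seq_const_div_INR D S ltac:(lia)) eps
      (cond_pos eps)) as [N HN].
    exists N.
    assert (main : forall n m, (N <= n)%nat -> (n <= m)%nat ->
      Rabs (ln (gauss b m) - ln (gauss b n)) < eps).
    { intros n m Hn Hm. replace m with (n + (m - n))%nat by lia.
      eapply Rle_lt_trans; [apply step|].
      specialize (HN n Hn). rewrite Rminus_0_r in HN.
      apply Rle_lt_trans with (2 := HN).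
      eapply Rle_trans; [|apply Rle_abs]. unfold Rdiv.
      apply Rmult_le_compat_l; [lra|].
      assert (0 < / INR (S (n + (m - n)))) by (apply Rinv_0_lt_compat, INR_S_pos).
      lra. }
    intros n m Hn Hm. destruct (le_lt_dec n m).
    - rewrite Rabs_minus_sym. now apply main.
    - apply main; [exact Hm|lia]. }
  destruct HL as [L HL]. exists L. split; [exact HL|].
  intros k. rewrite Rabs_minus_sym.
  apply (is_lim_seq_le (fun m => Rabs (ln (gauss b (k + m)) - ln (gauss b k)))
    (fun _ => D * / INR (S k)) (Rabs (L - ln (gauss b k))) (D * / INR (S k))).
  - intros m. eapply Rle_trans; [apply step|].
    apply Rmult_le_compat_l; [lra|].
    assert (0 < / INR (S (k + m))) by (apply Rinv_0_lt_compat, INR_S_pos). lra.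
  - apply (is_lim_seq_abs _ (Finite (L - ln (gauss b k)))).
    apply is_lim_seq_minus'; [|apply is_lim_seq_const].
    apply is_lim_seq_ext with (fun m => ln (gauss b (m + k))).
    + intros m. now rewrite Nat.add_comm.
    + now apply (is_lim_seq_incr_n (fun k => ln (gauss b k)) k).
  - apply is_lim_seq_const.
Qed.

Lemma is_lim_seq_exp (u : nat -> R) (l : R) :
  is_lim_seq u l -> is_lim_seq (fun n => exp (u n)) (exp l).
Proof.
  intros H. apply (is_lim_seq_continuous exp); [|exact H].
  apply derivable_continuous_pt, derivable_pt_exp.
Qed.

Lemma gam_spec (b : R) : 0 < b ->
  0 < gam b /\ is_lim_seq (gauss b) (/ gam b) /\
  forall k, Rabs (ln (gauss b k) + ln (gam b)) <= (b + b * b) * / INR (S k).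
Proof.
  intros Hb. destruct (gauss_near b Hb) as [L [HL HD]].
  assert (HU : is_lim_seq (gauss b) (exp L)).
  { apply is_lim_seq_ext with (fun k => exp (ln (gauss b k))).
    - intros k. apply exp_ln. now apply gauss_pos.
    - exact (is_lim_seq_exp _ _ HL). }
  assert (Hg : gam b = / exp L)
    by (unfold gam; now rewrite (is_lim_seq_unique _ _ HU)).
  rewrite Hg, Rinv_inv.
  split; [apply Rinv_0_lt_compat, exp_pos|]. split; [exact HU|].
  intros k. rewrite <- exp_Ropp, ln_exp. exact (HD k).
Qed.

(** The Gauss sequences of b + 1 and b differ by the factor (1 + b/(k+1))/b. The equation is what
    makes the constants in the expansion of the mean match those of the logarithm. *)
Lemma gam_succ (b : R) : 0 < b -> gam (b + 1) = b * gam b.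
Proof.
  intros Hb.
  destruct (gam_spec b Hb) as [Hp [Hl _]].
  destruct (gam_spec (b + 1) ltac:(lra)) as [Hp' [Hl' _]].
  assert (Hbin : forall k, binc (b + 1) k = binc b k * ((b + INR k) / b)).
  { induction k as [|k IH]; cbn [binc]; [simpl INR; field; lra|].
    rewrite IH, S_INR. assert (H := pos_INR k). field. lra. }
  assert (H : is_lim_seq (gauss (b + 1)) (/ gam b * (/ b * (1 + 0)))).
  { apply is_lim_seq_ext with (fun k => gauss b k * (/ b * (1 + b / INR (S k)))).
    - intros k. unfold gauss. rewrite Hbin.
      replace (1 - b) with ((1 - (b + 1)) + 1) by ring.
      rewrite Rpower_plus, Rpower_1 by apply INR_S_pos.
      assert (Hk := INR_S_pos k). field. lra.
    - apply is_lim_seq_mult'; [exact Hl|].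
      apply is_lim_seq_mult'; [apply is_lim_seq_const|].
      apply is_lim_seq_plus'; [apply is_lim_seq_const|].
      apply (is_lim_seq_const_div_INR b S). lia. }
  apply is_lim_seq_unique in H, Hl'. rewrite H in Hl'. injection Hl' as E.
  apply Rinv_eq_reg. rewrite <- E. field. lra.
Qed.

Lemma exp_minus_1_bound (t : R) : Rabs (exp t - 1) <= Rabs t * exp (Rabs t).
Proof.
  assert (H1 := exp_ge_1_plus t). assert (H2 := exp_ge_1_plus (- t)).
  assert (Hm : exp t * exp (- t) = 1) by (rewrite <- exp_plus, Rplus_opp_r; apply exp_0).
  destruct (Rle_dec 0 t) as [H|H].
  - rewrite !(Rabs_pos_eq t) by exact H. rewrite Rabs_pos_eq by lra. nra.
  - rewrite !(Rabs_left t) by lra. rewrite Rabs_left1 by nra. nra.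
Qed.

(** The rate in [gam_spec] is a relative error O(1/k) between k^(b-1) and its binomial counterpart,
    so replacing one by the other leaves a sum whose parameter is lower by one. *)
Lemma binc_near (b : R) : 0 < b ->
  exists C, 0 < C /\ forall k,
    Rabs (Rpower (INR (S k)) (b - 1) - gam b * binc b (S k)) <=
    C * Rpower (INR (S k)) (b - 2).
Proof.
  intros Hb. destruct (gam_spec b Hb) as [Hg [_ Hn]].
  set (D := b + b * b) in *. assert (HD : 0 < D) by (unfold D; nra).
  exists (D * exp D). split; [apply Rmult_lt_0_compat; [exact HD|apply exp_pos]|].
  intros k. assert (Hk := INR_S_pos k). assert (Hk1 := INR_S_ge_1 k).
  set (t := ln (gauss b k) + ln (gam b)).
  assert (Et : gam b * binc b (S k) = Rpower (INR (S k)) (b - 1) * exp t).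
  { unfold t. rewrite exp_plus, !exp_ln by (apply gauss_pos || exact Hg; exact Hb).
    unfold gauss. replace (1 - b) with (- (b - 1)) by ring.
    rewrite Rpower_Ropp. field. apply Rgt_not_eq, Rpower_pos. }
  rewrite Et.
  replace (Rpower (INR (S k)) (b - 1) - Rpower (INR (S k)) (b - 1) * exp t) with
    (- (Rpower (INR (S k)) (b - 1) * (exp t - 1))) by ring.
  rewrite Rabs_Ropp, Rabs_mult, Rabs_pos_eq by (left; apply Rpower_pos).
  replace (b - 1) with ((b - 2) + 1) by ring.
  rewrite Rpower_plus, Rpower_1 by exact Hk.
  rewrite Rmult_assoc, (Rmult_comm (D * exp D)).
  apply Rmult_le_compat_l; [left; apply Rpower_pos|].
  assert (Hi : 0 < / INR (S k) <= 1).
  { split; [now apply Rinv_0_lt_compat|]. rewrite <- Rinv_1.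
    apply Rinv_le_contravar; lra. }
  specialize (Hn k). fold t in Hn.
  assert (Ht : Rabs (exp t - 1) <= D * / INR (S k) * exp D).
  { eapply Rle_trans; [apply exp_minus_1_bound|].
    apply Rmult_le_compat; [apply Rabs_pos|left; apply exp_pos|exact Hn|].
    apply exp_mono. eapply Rle_trans; [exact Hn|]. nra. }
  apply (Rmult_le_compat_l (INR (S k))) in Ht; [|lra].
  replace (D * exp D) with (INR (S k) * (D * / INR (S k) * exp D)) by (field; lra).
  exact Ht.
Qed.

Lemma power_le_binc (b : R) : 0 < b ->
  exists C, 0 < C /\ forall k, Rpower (INR (S k)) (b - 1) <= C * binc b (S k).
Proof.
  intros Hb. destruct (gam_spec b Hb) as [Hg [_ Hn]].
  set (D := b + b * b) in *.
  exists (gam b * exp D). split; [apply Rmult_lt_0_compat; [exact Hg|apply exp_pos]|].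
  intros k. assert (Hk := INR_S_pos k). assert (Hk1 := INR_S_ge_1 k).
  assert (Hi : 0 < / INR (S k) <= 1).
  { split; [now apply Rinv_0_lt_compat|]. rewrite <- Rinv_1.
    apply Rinv_le_contravar; lra. }
  assert (H1 : 1 <= gam b * exp D * gauss b k).
  { replace (gam b * exp D * gauss b k) with
      (exp (D + (ln (gauss b k) + ln (gam b)))).
    - rewrite <- exp_0. apply exp_mono. specialize (Hn k).
      apply Rabs_le_between in Hn. nra.
    - rewrite !exp_plus, !exp_ln by (apply gauss_pos || exact Hg; exact Hb). ring. }
  apply (Rmult_le_compat_l (Rpower (INR (S k)) (b - 1))) in H1;
    [|left; apply Rpower_pos].
  rewrite Rmult_1_r in H1. eapply Rle_trans; [exact H1|]. right.
  unfold gauss. replace (1 - b) with (- (b - 1)) by ring.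
  rewrite Rpower_Ropp. field. apply Rgt_not_eq, Rpower_pos.
Qed.

(** * Polylogarithm sums as d tends to 0 *)

Definition powexp (b d : R) (k : nat) : R :=
  Rpower (INR (S k)) (b - 1) * exp (- (INR (S k) * d)).

(** The polylogarithm of order 1 - b at exp (- d). *)
Definition theta (b d : R) : R := Series (powexp b d).

Lemma powexp_pos (b d : R) (k : nat) : 0 < powexp b d k.
Proof. apply Rmult_lt_0_compat; [apply Rpower_pos|apply exp_pos]. Qed.

Lemma exp_pow (d : R) (k : nat) : exp (- (INR k * d)) = exp (- d) ^ k.
Proof.
  rewrite <- Rpower_pow by apply exp_pos. unfold Rpower. rewrite ln_exp.
  f_equal. ring.
Qed.

Lemma exp_neg_lt_1 (d : R) : 0 < d -> 0 < exp (- d) < 1.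
Proof.
  intros Hd. split; [apply exp_pos|]. rewrite <- exp_0. apply exp_increasing. lra.
Qed.

Lemma is_series_binc (b d : R) : 0 < b -> 0 < d ->
  is_series (fun k => binc b (S k) * exp (- (INR (S k) * d)))
    (Rpower (1 - exp (- d)) (- b) - 1).
Proof.
  intros Hb Hd. assert (Hx := exp_neg_lt_1 d Hd). set (x := exp (- d)) in *.
  assert (H : is_series (fun k => binc b k * x ^ k) (Rpower (1 - x) (- b))).
  { rewrite <- binc_PSeries by (exact Hb || lra).
    refine (proj1 (is_pseries_R (binc b) x _) _). apply PSeries_correct, CV_radius_inside.
    rewrite binc_CV_radius by exact Hb. simpl. rewrite Rabs_pos_eq; lra. }
  apply is_series_ext with (fun k => binc b (S k) * x ^ S k).
  - intros k. now rewrite exp_pow.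
  - apply (is_series_incr_1 (fun k => binc b k * x ^ k)).
    match goal with |- is_series _ ?l =>
      replace l with (Rpower (1 - x) (- b)) by ring_R end.
    exact H.
Qed.

Lemma ex_series_powexp_pos (b d : R) : 0 < b -> 0 < d -> ex_series (powexp b d).
Proof.
  intros Hb Hd. destruct (power_le_binc b Hb) as [C [HC H]].
  apply ex_series_le_R with
    (fun k => scal C (binc b (S k) * exp (- (INR (S k) * d)))).
  - intros k. rewrite Rabs_pos_eq by (left; apply powexp_pos).
    unfold powexp, scal; simpl; unfold mult; simpl.
    rewrite <- Rmult_assoc. apply Rmult_le_compat_r; [left; apply exp_pos|apply H].
  - apply (ex_series_scal (V := R_NormedModule)). eexists. now apply is_series_binc.
Qed.

Lemma ex_series_powexp (b d : R) : 0 < d -> ex_series (powexp b d).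
Proof.
  intros Hd. destruct (Rlt_dec 0 b) as [Hb|Hb]; [now apply ex_series_powexp_pos|].
  apply ex_series_le_R with (powexp 1 d); [|apply ex_series_powexp_pos; lra].
  intros k. rewrite Rabs_pos_eq by (left; apply powexp_pos).
  apply Rmult_le_compat_r; [left; apply exp_pos|].
  apply Rle_Rpower; [apply INR_S_ge_1|lra].
Qed.

Lemma theta_expand (b d : R) : 0 < b -> 0 < d ->
  theta b d = gam b * (Rpower (1 - exp (- d)) (- b) - 1) +
    Series (fun k => (Rpower (INR (S k)) (b - 1) - gam b * binc b (S k)) *
      exp (- (INR (S k) * d))).
Proof.
  intros Hb Hd. assert (H := is_series_binc b d Hb Hd).
  rewrite <- (is_series_unique _ _ H), <- Series_scal_l.
  assert (Hx : ex_series (fun k => gam b * (binc b (S k) * exp (- (INR (S k) * d))))).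
  { apply (ex_series_scal (V := R_NormedModule)). eexists; exact H. }
  rewrite (Series_ext (fun k => (Rpower (INR (S k)) (b - 1) - gam b * binc b (S k)) *
      exp (- (INR (S k) * d))) (fun k => powexp b d k -
        gam b * (binc b (S k) * exp (- (INR (S k) * d))))).
  - rewrite Series_minus by (exact Hx || now apply ex_series_powexp). unfold theta. ring.
  - intros k. unfold powexp. ring.
Qed.

Lemma one_minus_exp_bounds (d : R) : 0 <= d <= 1 ->
  d - d * d / 2 <= 1 - exp (- d) <= d.
Proof.
  intros Hd. split; [|generalize (exp_ge_1_plus (- d)); lra].
  assert (H : Rabs ((exp (- d) + d) - (exp (- 0) + 0)) <= d * d / 2 - 0 * 0 / 2).
  { apply (increment_bound (fun u => exp (- u) + u) (fun u => 1 - exp (- u))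
      (fun u => u * u / 2) (fun u => u)); [lra| | |].
    - intros u Hu. auto_derive; [exact I|ring].
    - intros u Hu. auto_derive; [exact I|field].
    - intros u Hu. assert (H1 := exp_ge_1_plus (- u)).
      assert (H2 : exp (- u) <= 1).
      { rewrite <- exp_0. apply exp_mono; lra. }
      rewrite Rabs_pos_eq; lra. }
  rewrite Ropp_0, exp_0 in H. apply Rabs_le_between in H. lra.
Qed.

Lemma one_minus_exp_power (b : R) : 0 < b ->
  exists C, 0 < C /\ forall d, 0 < d <= 1 ->
    Rabs (Rpower (1 - exp (- d)) (- b) - Rpower d (- b)) <= C * Rpower d (1 - b).
Proof.
  (* The mean value theorem between 1 - exp (- d) and [d]: the gap is at most d^2/2, and the smaller
     endpoint is at least d/2, whence 2^(b+1). *)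
  intros Hb. exists (b * Rpower 2 (b + 1) / 2).
  split; [apply Rdiv_lt_0_compat; [apply Rmult_lt_0_compat;
    [exact Hb|apply Rpower_pos]|lra]|].
  intros d Hd. assert (Hm := one_minus_exp_bounds d ltac:(lra)).
  set (m := 1 - exp (- d)) in *.
  assert (Hm2 : d / 2 <= m) by nra.
  set (B := b * Rpower (d / 2) (- (b + 1))).
  assert (H : Rabs (Rpower d (- b) - Rpower m (- b)) <= B * d - B * m).
  { apply (increment_bound (fun t => Rpower t (- b))
      (fun t => - b * Rpower t (- b - 1)) (fun t => B * t) (fun _ => B)); [lra| | |].
    - intros x Hx. apply is_derive_Rpower. lra.
    - intros x Hx. auto_derive; [exact I|ring].
    - intros x Hx. rewrite Rabs_mult, Rabs_Ropp, (Rabs_pos_eq b) by lra.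
      rewrite Rabs_pos_eq by (left; apply Rpower_pos). unfold B.
      apply Rmult_le_compat_l; [lra|].
      replace (- b - 1) with (- (b + 1)) by ring.
      apply Rpower_neg_antitone; lra. }
  rewrite Rabs_minus_sym. eapply Rle_trans; [exact H|].
  assert (HB : 0 < B) by (apply Rmult_lt_0_compat; [exact Hb|apply Rpower_pos]).
  apply Rle_trans with (B * (d * d / 2)); [nra|].
  right. unfold B.
  replace (Rpower (d / 2) (- (b + 1))) with (Rpower d (- (b + 1)) * Rpower 2 (b + 1)).
  - replace (1 - b) with (- (b + 1) + 1 + 1) by ring.
    rewrite !Rpower_plus, !Rpower_1 by lra. field.
  - unfold Rdiv. unfold Rpower. rewrite ln_mult, ln_Rinv, <- exp_plus by lra.
    f_equal. ring.
Qed.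

Lemma theta_upper (b : R) : 0 < b ->
  exists C, 0 < C /\ forall d, 0 < d <= 1 -> theta b d <= C * Rpower d (- b).
Proof.
  intros Hb. destruct (power_le_binc b Hb) as [C [HC H]].
  destruct (one_minus_exp_power b Hb) as [C1 [HC1 H1]].
  exists (C * (C1 + 1)). split; [apply Rmult_lt_0_compat; lra|].
  intros d Hd. assert (Hs := is_series_binc b d Hb ltac:(lra)).
  apply Rle_trans with (C * (Rpower (1 - exp (- d)) (- b) - 1)).
  - rewrite <- (is_series_unique _ _ Hs), <- Series_scal_l.
    apply Series_le.
    + intros k. split; [left; apply powexp_pos|]. unfold powexp.
      rewrite <- Rmult_assoc. apply Rmult_le_compat_r; [left; apply exp_pos|apply H].
    + apply (ex_series_scal (V := R_NormedModule)). eexists; exact Hs.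
  - rewrite Rmult_assoc. apply Rmult_le_compat_l; [lra|].
    specialize (H1 d Hd). apply Rabs_le_between in H1.
    assert (H2 : Rpower d (1 - b) <= Rpower d (- b)).
    { replace (1 - b) with (- b + 1) by ring.
      rewrite Rpower_plus, Rpower_1 by lra. assert (H2 := Rpower_pos d (- b)). nra. }
    nra.
Qed.

(** The remainder of [theta_expand] is dominated by a multiple of [theta (b - 1) d], which is
    O(d^(1-b)). *)
Lemma theta_asymp_gt_1 (b : R) : 1 < b ->
  exists C, 0 < C /\ forall d, 0 < d <= 1 ->
    Rabs (theta b d - gam b * Rpower d (- b)) <= C * Rpower d (1 - b).
Proof.
  intros Hb. destruct (binc_near b ltac:(lra)) as [C0 [HC0 H0]].
  destruct (one_minus_exp_power b ltac:(lra)) as [C1 [HC1 H1]].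
  destruct (theta_upper (b - 1) ltac:(lra)) as [C2 [HC2 H2]].
  destruct (gam_spec b ltac:(lra)) as [Hg _].
  exists (gam b * C1 + gam b + C0 * C2).
  split; [assert (0 < gam b * C1) by (apply Rmult_lt_0_compat; lra); nra|].
  intros d Hd. rewrite theta_expand by lra.
  match goal with |- context [Series ?f] => set (rem := f) end.
  assert (Hrem : Rabs (Series rem) <= C0 * C2 * Rpower d (1 - b)).
  { assert (Hle : forall k, Rabs (rem k) <= C0 * powexp (b - 1) d k).
    { intros k. unfold rem, powexp. rewrite Rabs_mult, (Rabs_pos_eq (exp _))
        by (left; apply exp_pos).
      rewrite <- Rmult_assoc. apply Rmult_le_compat_r; [left; apply exp_pos|].
      replace (b - 1 - 1) with (b - 2) by ring. apply H0. }
    assert (Hex : ex_series (fun k => C0 * powexp (b - 1) d k)).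
    { apply (ex_series_scal (V := R_NormedModule)), ex_series_powexp; lra. }
    eapply Rle_trans; [apply Series_Rabs|].
    { apply ex_series_le_R with (2 := Hex). intros k. rewrite Rabs_Rabsolu. apply Hle. }
    eapply Rle_trans; [apply Series_le with (2 := Hex)|].
    - intros k. split; [apply Rabs_pos|apply Hle].
    - rewrite Series_scal_l, Rmult_assoc. apply Rmult_le_compat_l; [lra|].
      specialize (H2 d Hd). replace (- (b - 1)) with (1 - b) in H2 by ring. exact H2. }
  specialize (H1 d Hd).
  assert (H3 : 1 <= Rpower d (1 - b)).
  { replace (1 - b) with (- (b - 1)) by ring.
    apply Rle_trans with (Rpower 1 (- (b - 1))); [rewrite Rpower_base_1; lra|].
    apply Rpower_neg_antitone; lra. }
  set (m := Rpower (1 - exp (- d)) (- b)) in *.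
  replace (gam b * (m - 1) + Series rem - gam b * Rpower d (- b)) with
    (gam b * (m - Rpower d (- b)) + - gam b + Series rem) by ring.
  eapply Rle_trans; [apply Rabs_triang|].
  eapply Rle_trans; [apply Rplus_le_compat_r, Rabs_triang|].
  rewrite Rabs_mult, Rabs_Ropp, !(Rabs_pos_eq (gam b)) by lra.
  apply (Rmult_le_compat_l (gam b)) in H1; [|lra].
  apply (Rmult_le_compat_l (gam b)) in H3; [|lra]. lra.
Qed.

Lemma is_lim_seq_exp_decay (d : nat -> R) (k : nat) : is_lim_seq d 0 ->
  is_lim_seq (fun n => exp (- (INR k * d n))) 1.
Proof.
  intros Hd. rewrite <- exp_0. apply is_lim_seq_exp.
  replace 0 with (- (INR k * 0)) by ring.
  apply (is_lim_seq_opp _ (Finite (INR k * 0))).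
  apply (is_lim_seq_scal_l _ (INR k) 0 Hd).
Qed.

Lemma tannery_decay (a : nat -> R) (d : nat -> R) :
  ex_series (fun k => Rabs (a k)) -> (forall n, 0 < d n) -> is_lim_seq d 0 ->
  is_lim_seq (fun n => Series (fun k => a k * exp (- (INR (S k) * d n)))) (Series a).
Proof.
  intros Ha Hp Hd. apply tannery with (fun k => Rabs (a k)); [exact Ha| |].
  - exists O. intros n k _. rewrite Rabs_mult, (Rabs_pos_eq (exp _))
      by (left; apply exp_pos).
    rewrite <- (Rmult_1_r (Rabs (a k))) at 2.
    apply Rmult_le_compat_l; [apply Rabs_pos|].
    rewrite <- exp_0. apply exp_mono.
    assert (0 < INR (S k) * d n) by (apply Rmult_lt_0_compat; [apply INR_S_pos|auto]).
    lra.
  - intros k. rewrite <- (Rmult_1_r (a k)) at 1.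
    apply (is_lim_seq_scal_l _ (a k) 1). now apply is_lim_seq_exp_decay.
Qed.

Lemma is_lim_seq_Rpower_0 (d : nat -> R) (a : R) : 0 < a ->
  (forall n, 0 < d n) -> is_lim_seq d 0 -> is_lim_seq (fun n => Rpower (d n) a) 0.
Proof.
  intros Ha Hp Hd. apply is_lim_seq_eps. intros eps He.
  assert (Hr := Rpower_pos eps (/ a)).
  destruct (proj1 (is_lim_seq_eps _ _) Hd _ Hr) as [N HN].
  exists N. intros n Hn. specialize (HN n Hn).
  rewrite Rminus_0_r in *. rewrite Rabs_pos_eq in HN by (left; apply Hp).
  rewrite Rabs_pos_eq by (left; apply Rpower_pos).
  replace eps with (Rpower (Rpower eps (/ a)) a).
  - apply Rlt_Rpower_l; [exact Ha|]. split; [apply Hp|exact HN].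
  - rewrite Rpower_mult, Rinv_l, Rpower_1 by lra. reflexivity.
Qed.

Lemma is_lim_seq_eventually_lt (d : nat -> R) (l M : R) :
  is_lim_seq d l -> l < M -> exists N, forall n, (N <= n)%nat -> d n < M.
Proof.
  intros Hd HM. destruct (proj1 (is_lim_seq_eps _ _) Hd (M - l) ltac:(lra)) as [N HN].
  exists N. intros n Hn. specialize (HN n Hn). apply Rabs_def2 in HN. lra.
Qed.

Lemma is_lim_seq_abs_le (u v : nat -> R) (l : R) :
  (exists N, forall n, (N <= n)%nat -> Rabs (u n - l) <= v n) ->
  is_lim_seq v 0 -> is_lim_seq u l.
Proof.
  intros [N HN] Hv. apply is_lim_seq_eps. intros eps He.
  destruct (proj1 (is_lim_seq_eps _ _) Hv eps He) as [M HM].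
  exists (max N M). intros n Hn. specialize (HN n ltac:(lia)). specialize (HM n ltac:(lia)).
  rewrite Rminus_0_r in HM. generalize (Rle_abs (v n)). lra.
Qed.

(** For b < 1 the differences k^(b-1) - gam b binc b k are O(k^(b-2)), hence summable already at d =
    0; the remainder therefore converges instead of merely being bounded. *)
Lemma theta_lim_lt_1 (b : R) (d : nat -> R) : 0 < b < 1 ->
  (forall n, 0 < d n) -> is_lim_seq d 0 ->
  exists k : R, is_lim_seq (fun n => theta b (d n) - gam b * Rpower (d n) (- b)) k.
Proof.
  intros Hb Hp Hd. destruct (binc_near b ltac:(lra)) as [C0 [HC0 H0]].
  destruct (one_minus_exp_power b ltac:(lra)) as [C1 [HC1 H1]].
  set (e := fun k => Rpower (INR (S k)) (b - 1) - gam b * binc b (S k)).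
  exists (gam b * (0 - 1) + Series e).
  apply is_lim_seq_ext with (fun n =>
    gam b * ((Rpower (1 - exp (- d n)) (- b) - Rpower (d n) (- b)) - 1) +
    Series (fun k => e k * exp (- (INR (S k) * d n)))).
  { intros n. rewrite theta_expand by (lra || apply Hp). fold e. unfold e. ring. }
  apply is_lim_seq_plus'.
  - apply (is_lim_seq_scal_l _ (gam b) (0 - 1)).
    apply is_lim_seq_minus'; [|apply is_lim_seq_const].
    apply is_lim_seq_abs_le with (fun n => C1 * Rpower (d n) (1 - b)).
    + destruct (is_lim_seq_eventually_lt d 0 1 Hd ltac:(lra)) as [N HN].
      exists N. intros n Hn. rewrite Rminus_0_r. apply H1.
      split; [apply Hp|left; now apply HN].
    + rewrite <- (Rmult_0_r C1). apply (is_lim_seq_scal_l _ C1 0).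
      apply is_lim_seq_Rpower_0; [lra|exact Hp|exact Hd].
  - apply tannery_decay; [|exact Hp|exact Hd].
    apply ex_series_le_R with (fun k => C0 * Rpower (INR (S k)) (- (2 - b))).
    + intros k. rewrite Rabs_Rabsolu. replace (- (2 - b)) with (b - 2) by ring. apply H0.
    + apply (ex_series_scal (V := R_NormedModule)), ex_series_Riemann. lra.
Qed.

Lemma theta_0 (d : R) : 0 < d -> theta 0 d = - ln (1 - exp (- d)).
Proof.
  intros Hd. assert (Hx := exp_neg_lt_1 d Hd). set (x := exp (- d)) in *.
  set (a := fun n : nat => match n with O => 0 | S k => / INR (S k) end).
  assert (Hgeom : forall t, Rabs t < 1 -> is_pseries (fun _ => 1) t (/ (1 - t))).
  { intros t Ht. apply is_pseries_R. eapply is_series_ext; [|now apply is_series_geom].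
    intros n. simpl. ring. }
  assert (Ea : forall n, a n = PS_Int (fun _ => 1) n).
  { intros [|n]; unfold PS_Int; [reflexivity|]. unfold a, Rdiv. now rewrite Rmult_1_l. }
  assert (Hr : forall t, Rabs t < 1 -> Rbar_lt (Rabs t) (CV_radius a)).
  { intros t Ht. rewrite (CV_radius_ext _ _ Ea), CV_radius_Int.
    apply Rbar_lt_le_trans with (Finite ((Rabs t + 1) / 2)); [simpl; lra|].
    apply Rbar_not_lt_le. intros Hlt.
    assert (Hpos : 0 <= (Rabs t + 1) / 2) by (generalize (Rabs_pos t); lra).
    rewrite <- (Rabs_pos_eq _ Hpos) in Hlt.
    apply CV_disk_outside in Hlt. apply Hlt.
    apply (ex_series_lim_0 (fun k => 1 * ((Rabs t + 1) / 2) ^ k)).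
    refine (proj1 (ex_pseries_R (fun _ => 1) _) _). eexists. apply Hgeom.
    rewrite Rabs_pos_eq; lra. }
  assert (H : PSeries a x + ln (1 - x) = PSeries a 0 + ln (1 - 0)).
  { apply (constant_of_derive_0 (fun t => PSeries a t + ln (1 - t))); [lra|].
    intros t Ht. assert (Hat : Rabs t < 1) by (rewrite Rabs_pos_eq; lra).
    assert (H1 := is_derive_PSeries a t (Hr t Hat)).
    assert (H2 : is_derive (fun u => ln (1 - u)) t (- / (1 - t))).
    { auto_derive; [lra|field; lra]. }
    replace 0 with (plus (PSeries (PS_derive a) t) (- / (1 - t))).
    - apply (is_derive_plus (V := R_NormedModule) _ _ t _ _ H1 H2).
    - rewrite (PSeries_ext (PS_derive a) (fun _ => 1)).
      + rewrite (is_pseries_unique _ _ _ (Hgeom t Hat)). unfold plus; simpl. ring.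
      + intros n. unfold PS_derive, a. field. apply Rgt_not_eq, INR_S_pos. }
  rewrite PSeries_0 in H. simpl a in H. rewrite Rminus_0_r, ln_1 in H.
  replace (- ln (1 - x)) with (PSeries a x) by lra.
  unfold theta, PSeries.
  rewrite (Series_incr_1 (fun k => a k * x ^ k)).
  - simpl (a 0%nat). rewrite Rmult_0_l, Rplus_0_l. apply Series_ext.
    intros k. unfold powexp. rewrite exp_pow. fold x. f_equal.
    unfold a. replace (0 - 1) with (Ropp 1) by ring.
    rewrite Rpower_Ropp, Rpower_1 by apply INR_S_pos. reflexivity.
  - refine (proj1 (ex_pseries_R a x) _). apply CV_radius_inside, Hr. rewrite Rabs_pos_eq; lra.
Qed.

Lemma theta_0_lim (d : nat -> R) : (forall n, 0 < d n) -> is_lim_seq d 0 ->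
  is_lim_seq (fun n => theta 0 (d n) + ln (d n)) 0.
Proof.
  intros Hp Hd. apply is_lim_seq_abs_le with d; [|exact Hd].
  destruct (is_lim_seq_eventually_lt d 0 1 Hd ltac:(lra)) as [N HN].
  exists N. intros n Hn. specialize (HN n Hn). specialize (Hp n).
  rewrite theta_0 by exact Hp. set (x := d n) in *.
  assert (Hm := one_minus_exp_bounds x ltac:(lra)). set (m := 1 - exp (- x)) in *.
  assert (Hm0 : 0 < m) by nra.
  assert (H1 : ln m <= ln x) by (apply ln_le; lra).
  assert (H2 : ln x - ln m <= x).
  { rewrite <- ln_div by lra. rewrite <- (ln_exp x) at 2.
    apply ln_le; [apply Rdiv_lt_0_compat; lra|].
    apply Rle_trans with (1 + x); [|apply exp_ge_1_plus].
    apply Rle_div_l; nra. }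
  rewrite Rminus_0_r, Rabs_pos_eq; lra.
Qed.

(** * Asymptotics of the logarithm and of its derivatives *)

Definition weight (q d : R) (k : nat) : R := powexp (1 - q) d k.

Lemma weight_eq (q d : R) (k : nat) : weight q d k = wt q (S k) * exp (- d) ^ S k.
Proof.
  unfold weight, powexp, wt. rewrite exp_pow. f_equal. f_equal. ring.
Qed.

Lemma weight_pos (q d : R) (k : nat) : 0 < weight q d k.
Proof. apply powexp_pos. Qed.

Lemma weight_le_1 (q d : R) (k : nat) : 0 <= q -> 0 <= d -> weight q d k <= 1.
Proof.
  intros Hq Hd. rewrite weight_eq, <- (Rmult_1_r 1).
  apply Rmult_le_compat; [left; apply wt_pos|apply pow_le; left; apply exp_pos|
    now apply wt_le_1|].
  rewrite <- exp_pow, <- exp_0. apply exp_mono.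
  assert (0 <= INR (S k) * d) by (apply Rmult_le_pos; [apply pos_INR|exact Hd]). lra.
Qed.

(** Because of this identity every moment of every power of the weights sums to some [theta], with
    exponent shifted by q j and [d] replaced by j d. *)
Lemma pow_mult_weight (q d : R) (m j k : nat) :
  INR (S k) ^ m * weight q d k ^ j = powexp (INR m + 1 - q * INR j) (INR j * d) k.
Proof.
  unfold weight, powexp. rewrite Rpow_mult_distr.
  rewrite <- !Rpower_pow by (apply Rpower_pos || apply exp_pos || apply INR_S_pos).
  rewrite Rpower_mult, <- Rmult_assoc, <- Rpower_plus.
  f_equal.
  - f_equal. ring.
  - unfold Rpower. rewrite ln_exp. f_equal. ring.
Qed.

Definition alt (i : nat) : R := (-1) ^ i.

Lemma Rabs_alt (i : nat) : Rabs (alt i) = 1.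
Proof. apply pow_1_abs. Qed.

Lemma geometric_alt (w : R) (n : nat) : 0 <= w ->
  Rabs (/ (1 + w) - sum_n (fun i => alt i * w ^ i) n) <= w ^ S n.
Proof.
  intros Hw.
  assert (E : / (1 + w) - sum_n (fun i => alt i * w ^ i) n =
    alt (S n) * w ^ S n / (1 + w)).
  { induction n as [|n IH].
    - rewrite sum_O. unfold alt. simpl. field. lra.
    - rewrite sum_Sn. unfold plus; simpl AbelianMonoid.plus.
      match goal with |- _ - Rplus ?a ?b = _ =>
        replace (/ (1 + w) - (a + b)) with ((/ (1 + w) - a) - b) by ring end.
      rewrite IH. unfold alt. simpl. field. lra. }
  rewrite E. unfold Rdiv. rewrite !Rabs_mult, Rabs_alt, Rabs_pos_eq by now apply pow_le.
  rewrite (Rabs_pos_eq (/ _)) by (left; apply Rinv_0_lt_compat; lra).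
  assert (H : / (1 + w) <= 1).
  { rewrite <- Rinv_1. apply Rinv_le_contravar; lra. }
  assert (Hp : 0 <= w ^ S n) by now apply pow_le. nra.
Qed.

Lemma is_derive_pow_S (c t : R) (i : nat) :
  is_derive (fun u => c * u ^ S i) t (c * (INR (S i) * t ^ i)).
Proof.
  apply is_derive_Reals. apply derivable_pt_lim_scal.
  exact (derivable_pt_lim_pow t (S i)).
Qed.

Lemma ln_taylor (w : R) (n : nat) : 0 <= w ->
  Rabs (ln (1 + w) - sum_n (fun i => alt i / INR (S i) * w ^ S i) n) <= w ^ S (S n).
Proof.
  intros Hw.
  assert (H : Rabs ((ln (1 + w) - sum_n (fun i => alt i / INR (S i) * w ^ S i) n) -
    (ln (1 + 0) - sum_n (fun i => alt i / INR (S i) * 0 ^ S i) n)) <=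
    1 * w ^ S (S n) - 1 * 0 ^ S (S n)).
  { apply (increment_bound
      (fun t => ln (1 + t) - sum_n (fun i => alt i / INR (S i) * t ^ S i) n)
      (fun t => / (1 + t) - sum_n (fun i => alt i * t ^ i) n)
      (fun t => 1 * t ^ S (S n)) (fun t => 1 * (INR (S (S n)) * t ^ S n))); [exact Hw| | |].
    - intros t Ht.
      apply (is_derive_minus (V := R_NormedModule) (fun t => ln (1 + t))).
      + auto_derive; [lra|field; lra].
      + rewrite (sum_n_ext _ (fun i => alt i / INR (S i) * (INR (S i) * t ^ i))).
        * apply (is_derive_sum_n (V := R_NormedModule)
            (fun i t => alt i / INR (S i) * t ^ S i)).
          intros i _. apply is_derive_pow_S.
        * intros i. eq_R.
          field. apply Rgt_not_eq, INR_S_pos.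
    - intros t Ht. apply is_derive_pow_S.
    - intros t Ht. eapply Rle_trans; [apply geometric_alt; lra|].
      assert (H1 := INR_S_ge_1 (S n)). assert (H2 : 0 <= t ^ S n) by (apply pow_le; lra).
      nra. }
  rewrite Rplus_0_r, ln_1 in H.
  rewrite (sum_n_ext (fun i => alt i / INR (S i) * 0 ^ S i) (fun _ => 0)) in H
    by (intros i; rewrite pow_i by lia; eq_R; ring).
  rewrite sum_n_const, pow_i in H by lia.
  replace (0 - INR (S n) * 0) with 0 in H by ring.
  replace (1 * w ^ S (S n) - 1 * 0) with (w ^ S (S n)) in H by ring.
  now rewrite Rminus_0_r in H.
Qed.

Definition log_gf (q d : R) : R := Series (fun k => ln (1 + weight q d k)).

Definition mean (q d : R) : R :=
  Series (fun k => INR (S k) * (weight q d k / (1 + weight q d k))).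

Definition variance (q d : R) : R :=
  Series (fun k => INR (S k) ^ 2 * (weight q d k / (1 + weight q d k) ^ 2)).

Lemma ex_series_pow_mult_weight (q d : R) (m : nat) : 0 < d ->
  ex_series (fun k => INR (S k) ^ m * weight q d k).
Proof.
  intros Hd.
  apply ex_series_ext with (powexp (INR m + 1 - q * INR 1) (INR 1 * d)).
  - intros k. rewrite <- pow_mult_weight. now rewrite pow_1.
  - apply ex_series_powexp. simpl; lra.
Qed.

Lemma weight_frac_bounds (q d : R) (k : nat) :
  0 <= weight q d k / (1 + weight q d k) <= weight q d k /\
  0 <= weight q d k / (1 + weight q d k) ^ 2 <= weight q d k.
Proof.
  assert (Hw := weight_pos q d k). set (w := weight q d k) in *.
  repeat split.
  - apply Rdiv_le_0_compat; lra.
  - apply Rle_div_l; nra.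
  - apply Rdiv_le_0_compat; nra.
  - apply Rle_div_l; nra.
Qed.

Lemma ex_series_log_gf (q d : R) : 0 < d ->
  ex_series (fun k => ln (1 + weight q d k)).
Proof.
  intros Hd. apply ex_series_le_R with (fun k => INR (S k) ^ 0 * weight q d k);
    [|now apply ex_series_pow_mult_weight].
  intros k. assert (Hw := weight_pos q d k).
  assert (H := ln_1_plus_bounds _ (Rlt_le _ _ Hw)).
  simpl pow. rewrite Rmult_1_l, Rabs_pos_eq; [lra|].
  rewrite <- ln_1. apply ln_le; lra.
Qed.

Lemma ex_series_mean (q d : R) : 0 < d ->
  ex_series (fun k => INR (S k) * (weight q d k / (1 + weight q d k))).
Proof.
  intros Hd. apply ex_series_le_R with (fun k => INR (S k) ^ 1 * weight q d k);
    [|now apply ex_series_pow_mult_weight].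
  intros k. destruct (weight_frac_bounds q d k) as [[H1 H2] _].
  assert (H := INR_S_pos k). rewrite pow_1, Rabs_pos_eq by (apply Rmult_le_pos; lra).
  apply Rmult_le_compat_l; lra.
Qed.

Lemma ex_series_variance (q d : R) : 0 < d ->
  ex_series (fun k => INR (S k) ^ 2 * (weight q d k / (1 + weight q d k) ^ 2)).
Proof.
  intros Hd. apply ex_series_le_R with (fun k => INR (S k) ^ 2 * weight q d k);
    [|now apply ex_series_pow_mult_weight].
  intros k. destruct (weight_frac_bounds q d k) as [_ [H1 H2]].
  assert (H : 0 <= INR (S k) ^ 2) by apply pow2_ge_0.
  rewrite Rabs_pos_eq by (apply Rmult_le_pos; lra).
  apply Rmult_le_compat_l; lra.
Qed.

Lemma pprod_exp (q d : R) (N : nat) :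
  pprod q (S N) (exp (- d)) = exp (sum_n (fun k => ln (1 + weight q d k)) N).
Proof.
  induction N as [|N IH].
  - rewrite sum_O. assert (H := weight_pos q d 0). rewrite exp_ln by lra.
    rewrite weight_eq. cbn [pprod]. ring.
  - change (pprod q (S (S N)) (exp (- d))) with
      (pprod q (S N) (exp (- d)) * (1 + wt q (S (S N)) * exp (- d) ^ S (S N))).
    rewrite IH, <- weight_eq, sum_Sn. unfold plus; simpl AbelianMonoid.plus.
    assert (H := weight_pos q d (S N)).
    rewrite <- (exp_ln (1 + weight q d (S N))) at 1 by lra.
    now rewrite <- exp_plus.
Qed.

Lemma Series_sum_n (a : nat -> nat -> R) (J : nat) :
  (forall i, (i <= J)%nat -> ex_series (a i)) ->
  ex_series (fun k => sum_n (fun i => a i k) J) /\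
  Series (fun k => sum_n (fun i => a i k) J) = sum_n (fun i => Series (a i)) J.
Proof.
  intros H. induction J as [|J IH].
  - assert (E : forall k, a 0%nat k = sum_n (fun i => a i k) 0)
      by (intros k; now rewrite sum_O).
    split.
    + apply ex_series_ext with (1 := E). auto.
    + rewrite sum_O. symmetry. now apply Series_ext.
  - destruct IH as [H1 H2]; [auto|].
    assert (E : forall k, sum_n (fun i => a i k) J + a (S J) k =
      sum_n (fun i => a i k) (S J)) by (intros k; now rewrite sum_Sn).
    split.
    + apply ex_series_ext with (1 := E).
      apply (ex_series_plus (V := R_NormedModule) _ _ H1). auto.
    + rewrite sum_Sn, <- H2. rewrite <- (Series_ext _ _ E).
      apply Series_plus; auto.
Qed.

(** Expanding [ln (1 + w)] up to order n + 1 leaves a remainder that is summable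
    even at [d = 0]. *)
Lemma log_gf_theta (q : R) (n : nat) (d : nat -> R) :
  0 < q -> 1 < q * INR (S (S n)) -> (forall m, 0 < d m) -> is_lim_seq d 0 ->
  exists l : R, is_lim_seq (fun m => log_gf q (d m) -
    sum_n (fun i => alt i / INR (S i) *
      theta (1 - q * INR (S i)) (INR (S i) * d m)) n) l.
Proof.
  intros Hq Hn Hp Hd.
  set (poly := fun w : R => sum_n (fun i => alt i / INR (S i) * w ^ S i) n : R).
  exists (Series (fun k => ln (1 + wt q (S k)) - poly (wt q (S k)))).
  apply is_lim_seq_ext with (fun m =>
    Series (fun k => ln (1 + weight q (d m) k) - poly (weight q (d m) k))).
  { intros m.
    destruct (Series_sum_n (fun i k => alt i / INR (S i) * weight q (d m) k ^ S i) n)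
      as [H1 H2].
    - intros i _. apply (ex_series_scal (V := R_NormedModule)).
      apply ex_series_ext with (powexp (INR 0 + 1 - q * INR (S i)) (INR (S i) * d m)).
      + intros k. rewrite <- pow_mult_weight. simpl. ring.
      + apply ex_series_powexp, Rmult_lt_0_compat; [apply INR_S_pos|apply Hp].
    - unfold poly. rewrite Series_minus by (exact H1 || now apply ex_series_log_gf).
      unfold log_gf. f_equal. rewrite H2. apply sum_n_ext. intros i.
      rewrite Series_scal_l. f_equal. apply Series_ext. intros k.
      transitivity (INR (S k) ^ 0 * weight q (d m) k ^ S i); [rewrite pow_O; ring|].
      rewrite pow_mult_weight. do 2 f_equal. simpl INR. ring. }
  apply tannery with (fun k => Rpower (INR (S k)) (- (q * INR (S (S n))))).
  - now apply ex_series_Riemann.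
  - exists O. intros m k _. assert (Hw := weight_pos q (d m) k).
    eapply Rle_trans; [apply ln_taylor; lra|].
    replace (- (q * INR (S (S n)))) with (- q * INR (S (S n))) by ring.
    rewrite <- Rpower_mult, Rpower_pow by apply Rpower_pos.
    apply pow_incr. split; [lra|]. rewrite weight_eq. unfold wt.
    rewrite <- (Rmult_1_r (Rpower _ _)) at 2.
    apply Rmult_le_compat_l; [left; apply Rpower_pos|].
    rewrite <- exp_pow, <- exp_0. apply exp_mono.
    assert (0 < INR (S k) * d m) by (apply Rmult_lt_0_compat; [apply INR_S_pos|apply Hp]).
    lra.
  - intros k.
    assert (Hlim : is_lim_seq (fun m => weight q (d m) k) (wt q (S k))).
    { apply is_lim_seq_ext with (fun m => wt q (S k) * exp (- (INR (S k) * d m))).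
      - intros m. now rewrite weight_eq, exp_pow.
      - replace (Finite (wt q (S k))) with (Finite (wt q (S k) * 1)) by (f_equal; ring).
        apply (is_lim_seq_scal_l _ (wt q (S k)) 1). now apply is_lim_seq_exp_decay. }
    apply is_lim_seq_minus'.
    + apply (is_lim_seq_continuous (fun w => ln (1 + w))); [|exact Hlim].
      apply continuity_pt_filterlim, (ex_derive_continuous (fun w => ln (1 + w))).
      auto_derive. assert (H := wt_pos q (S k)). lra.
    + apply is_lim_seq_sum_n. intros i _.
      apply (is_lim_seq_scal_l _ _ (wt q (S k) ^ S i)).
      apply (is_lim_seq_continuous (fun w => w ^ S i)); [|exact Hlim].
      apply derivable_continuous_pt, derivable_pt_pow.
Qed.

(** Coefficient of [d^(- (1 - q (i + 1)))] in the expansion of [log_gf q d] at 0+. *)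
Definition bcoef (q : R) (i : nat) : R :=
  alt i / INR (S i) * gam (1 - q * INR (S i)) *
  Rpower (INR (S i)) (- (1 - q * INR (S i))).

(** Here [r] is the largest integer with q r < 1, so q j = 1 is possible for j = r + 1 only; the
    value is then (-1)^(j-1)/j, because [alt r] is (-1)^r. *)
Definition A0val (q : R) (r : nat) : R :=
  if Req_EM_T (q * INR (S r)) 1 then alt r / INR (S r) else 0.

Lemma Rpower_mult_base (x y a : R) : 0 < x -> 0 < y ->
  Rpower (x * y) a = Rpower x a * Rpower y a.
Proof. intros Hx Hy. symmetry. now apply Rpower_mult_distr. Qed.

Lemma is_lim_seq_scale_0 (c : R) (d : nat -> R) :
  is_lim_seq d 0 -> is_lim_seq (fun n => c * d n) 0.
Proof. intros H. rewrite <- (Rmult_0_r c). apply (is_lim_seq_scal_l _ c 0 H). Qed.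

Lemma ex_lim_seq_sum_n (a : nat -> nat -> R) (n : nat) :
  (forall i, (i <= n)%nat -> exists l : R, is_lim_seq (fun m => a m i) l) ->
  exists l : R, is_lim_seq (fun m => sum_n (a m) n) l.
Proof.
  intros H. induction n as [|n IH].
  - destruct (H 0%nat (le_n _)) as [l Hl]. exists l.
    apply is_lim_seq_ext with (2 := Hl). intros m. now rewrite sum_O.
  - destruct IH as [l1 H1]; [auto|]. destruct (H (S n) (le_n _)) as [l2 H2].
    exists (l1 + l2). apply is_lim_seq_ext with (fun m => sum_n (a m) n + a m (S n)).
    + intros m. now rewrite sum_Sn.
    + now apply is_lim_seq_plus'.
Qed.

Lemma sum_n_minus_R (a b : nat -> R) (n : nat) :
  sum_n (fun i => a i - b i) n = sum_n a n - sum_n b n.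
Proof.
  induction n as [|n IH]; [now rewrite !sum_O|].
  rewrite !sum_Sn, IH. ring_R.
Qed.

(** The index [r] is one less than that of the theorem. If q (r + 2) > 1, the remainder after r + 1
    terms of the logarithmic series converges. If q (r + 2) = 1, one more term is split off; it is a
    multiple of [theta 0], and its logarithm appears with the factor [A0val]. *)
Lemma log_gf_asymp (q : R) (r : nat) (d : nat -> R) :
  0 < q -> q * INR (S r) < 1 -> 1 <= q * INR (S (S r)) ->
  (forall m, 0 < d m) -> is_lim_seq d 0 ->
  exists l : R, is_lim_seq (fun m => log_gf q (d m) -
    sum_n (fun i => bcoef q i * Rpower (d m) (- (1 - q * INR (S i)))) r +
    A0val q (S r) * ln (d m)) l.
Proof.
  intros Hq Hr Hr' Hp Hd.
  assert (Hterm : exists l : R, is_lim_seq (fun m =>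
    sum_n (fun i => alt i / INR (S i) * theta (1 - q * INR (S i)) (INR (S i) * d m)) r -
    sum_n (fun i => bcoef q i * Rpower (d m) (- (1 - q * INR (S i)))) r) l).
  { destruct (ex_lim_seq_sum_n (fun m i => alt i / INR (S i) *
      theta (1 - q * INR (S i)) (INR (S i) * d m) -
      bcoef q i * Rpower (d m) (- (1 - q * INR (S i)))) r) as [l Hl].
    - intros i Hi. assert (Hi0 := INR_S_pos i).
      assert (Hi' : INR (S i) <= INR (S r)) by (apply le_INR; lia).
      destruct (theta_lim_lt_1 (1 - q * INR (S i)) (fun m => INR (S i) * d m))
        as [l Hl].
      + split; nra.
      + intros m. apply Rmult_lt_0_compat; [exact Hi0|apply Hp].
      + now apply is_lim_seq_scale_0.
      + exists (alt i / INR (S i) * l).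
        apply is_lim_seq_ext with (2 := is_lim_seq_scal_l _ (alt i / INR (S i)) l Hl).
        intros m. rewrite Rpower_mult_base by (exact Hi0 || apply Hp).
        unfold bcoef. ring.
    - exists l. apply is_lim_seq_ext with (2 := Hl). intros m. apply sum_n_minus_R. }
  destruct Hterm as [l1 H1]. unfold A0val.
  destruct (Req_EM_T (q * INR (S (S r))) 1) as [E|NE].
  - destruct (log_gf_theta q (S r) d Hq) as [l2 H2]; [|exact Hp|exact Hd|].
    { rewrite S_INR. rewrite Rmult_plus_distr_l, E. lra. }
    set (c := alt (S r) / INR (S (S r))).
    exists (l2 + l1 + c * (0 - ln (INR (S (S r))))).
    apply is_lim_seq_ext with (2 := is_lim_seq_plus' _ _ _ _
      (is_lim_seq_plus' _ _ _ _ H2 H1)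
      (is_lim_seq_scal_l _ c _ (is_lim_seq_minus' _ _ _ _
        (theta_0_lim (fun m => INR (S (S r)) * d m)
          (fun m => Rmult_lt_0_compat _ _ (INR_S_pos (S r)) (Hp m))
          (is_lim_seq_scale_0 _ d Hd))
        (is_lim_seq_const (ln (INR (S (S r)))))))).
    intros m. rewrite sum_Sn_R, E, ln_mult by (apply INR_S_pos || apply Hp).
    replace (1 - 1) with 0 by ring. fold c. ring.
  - destruct (log_gf_theta q r d Hq) as [l2 H2]; [lra|exact Hp|exact Hd|].
    exists (l2 + l1).
    apply is_lim_seq_ext with (2 := is_lim_seq_plus' _ _ _ _ H2 H1).
    intros m. ring.
Qed.

Lemma Rpower_m1 (x : R) : 0 < x -> Rpower x (Ropp 1) = / x.
Proof. intros Hx. now rewrite Rpower_Ropp, Rpower_1. Qed.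

Lemma Rpower_le_base_le_1 (x a b : R) : 0 < x <= 1 -> a <= b ->
  Rpower x b <= Rpower x a.
Proof.
  intros Hx Hab. unfold Rpower. apply exp_mono.
  assert (ln x <= 0) by (rewrite <- ln_1; apply ln_le; lra). nra.
Qed.

(** The mean is minus the derivative of [log_gf], and the coefficient found is that of the formally
    differentiated expansion. It comes from [gam_succ], so no asymptotic expansion is
    differentiated. *)
Lemma mean_term (q : R) (i : nat) : 0 < q -> q * INR (S i) < 1 ->
  exists C, 0 <= C /\ forall d, 0 < d <= / INR (S i) ->
    Rabs (alt i * theta (2 - q * INR (S i)) (INR (S i) * d) -
      bcoef q i * (1 - q * INR (S i)) * Rpower d (- (2 - q * INR (S i)))) <= C * / d.
Proof.
  intros Hq Hi. set (j := INR (S i)) in *. assert (Hj : 0 < j) by apply INR_S_pos.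
  assert (Hqj : 0 < q * j) by (apply Rmult_lt_0_compat; lra).
  destruct (theta_asymp_gt_1 (2 - q * j)) as [C [HC H]]; [lra|].
  exists (C * Rpower j (1 - (2 - q * j))).
  split; [apply Rmult_le_pos; [lra|left; apply Rpower_pos]|].
  intros d Hd.
  assert (Hjd : 0 < j * d <= 1).
  { split; [apply Rmult_lt_0_compat; lra|].
    rewrite <- (Rinv_r j) by lra. apply Rmult_le_compat_l; lra. }
  specialize (H (j * d) Hjd).
  rewrite !Rpower_mult_base in H by lra.
  replace (alt i * theta (2 - q * j) (j * d) -
    bcoef q i * (1 - q * j) * Rpower d (- (2 - q * j))) with
    (alt i * (theta (2 - q * j) (j * d) - gam (2 - q * j) *
      (Rpower j (- (2 - q * j)) * Rpower d (- (2 - q * j))))).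
  - rewrite Rabs_mult, Rabs_alt, Rmult_1_l. eapply Rle_trans; [exact H|].
    rewrite <- Rmult_assoc. apply Rmult_le_compat_l.
    + apply Rmult_le_pos; [lra|left; apply Rpower_pos].
    + rewrite <- Rpower_m1 by lra. apply Rpower_le_base_le_1; [|lra].
      split; [lra|]. apply Rle_trans with (1 := proj2 Hd).
      rewrite <- Rinv_1. apply Rinv_le_contravar; [lra|apply INR_S_ge_1].
  - assert (E : gam (2 - q * j) * Rpower j (- (2 - q * j)) =
      gam (1 - q * j) * Rpower j (- (1 - q * j)) * (1 - q * j) / j).
    { replace (gam (2 - q * j)) with ((1 - q * j) * gam (1 - q * j))
        by (rewrite <- gam_succ by lra; f_equal; ring).
      replace (- (2 - q * j)) with (- (1 - q * j) + Ropp 1) by ring.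
      rewrite Rpower_plus, Rpower_m1 by exact Hj. field. lra. }
    rewrite <- Rmult_assoc, E. unfold bcoef. fold j. field. lra.
Qed.

Lemma sum_bound_uniform (a : R -> nat -> R) (n : nat) (D : nat -> R -> Prop) (f : R -> R) :
  (forall i, (i <= n)%nat -> exists C, 0 <= C /\
    forall d, D i d -> Rabs (a d i) <= C * f d) ->
  exists C, 0 <= C /\ forall d, (forall i, (i <= n)%nat -> D i d) ->
    Rabs (sum_n (a d) n) <= C * f d.
Proof.
  intros H. induction n as [|n IH].
  - destruct (H 0%nat (le_n _)) as [C [HC HH]]. exists C. split; [exact HC|].
    intros d Hd. rewrite sum_O. auto.
  - destruct IH as [C1 [HC1 H1]]; [auto|].
    destruct (H (S n) (le_n _)) as [C2 [HC2 H2]].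
    exists (C1 + C2). split; [lra|]. intros d Hd. rewrite sum_Sn_R.
    eapply Rle_trans; [apply Rabs_triang|]. rewrite Rmult_plus_distr_r.
    apply Rplus_le_compat; auto.
Qed.

(** After r + 1 terms of the geometric expansion the rest is dominated by k w^(r+2) <= exp (- k d),
    because q (r + 2) >= 1. The resulting error O(1/d) is small compared with the standard
    deviation, of order d^(-(3-q)/2). *)
Lemma mean_asymp (q : R) (r : nat) :
  0 < q -> q * INR (S r) < 1 -> 1 <= q * INR (S (S r)) ->
  exists C, 0 <= C /\ forall d, 0 < d <= / INR (S r) ->
    Rabs (mean q d - sum_n (fun i => bcoef q i * (1 - q * INR (S i)) *
      Rpower d (- (2 - q * INR (S i)))) r) <= C * / d.
Proof.
  intros Hq Hr Hr'.
  assert (Hmon : forall i, (i <= r)%nat -> INR (S i) <= INR (S r))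
    by (intros i Hi; apply le_INR; lia).
  destruct (sum_bound_uniform (fun d i =>
    alt i * theta (2 - q * INR (S i)) (INR (S i) * d) -
    bcoef q i * (1 - q * INR (S i)) * Rpower d (- (2 - q * INR (S i)))) r
    (fun i d => 0 < d <= / INR (S i)) (fun d => / d)) as [C1 [HC1 H1]].
  { intros i Hi. apply mean_term; [exact Hq|]. specialize (Hmon i Hi). nra. }
  destruct (theta_upper 1 Rlt_0_1) as [C2 [HC2 H2]].
  exists (C1 + C2). split; [lra|]. intros d Hd.
  assert (Hd1 : 0 < d <= 1).
  { split; [lra|]. apply Rle_trans with (1 := proj2 Hd).
    rewrite <- Rinv_1. apply Rinv_le_contravar; [lra|apply INR_S_ge_1]. }
  assert (Hdi : forall i, (i <= r)%nat -> 0 < d <= / INR (S i)).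
  { intros i Hi. split; [lra|]. apply Rle_trans with (1 := proj2 Hd).
    apply Rinv_le_contravar; [apply INR_S_pos|auto]. }
  specialize (H1 d Hdi). rewrite sum_n_minus_R in H1.
  set (M := sum_n (fun i => bcoef q i * (1 - q * INR (S i)) *
      Rpower d (- (2 - q * INR (S i)))) r : R) in *.
  assert (Ht : sum_n (fun i => alt i * theta (2 - q * INR (S i)) (INR (S i) * d)) r =
    Series (fun k => sum_n (fun i => alt i * (INR (S k) ^ 1 * weight q d k ^ S i)) r) /\
    ex_series (fun k => sum_n (fun i => alt i * (INR (S k) ^ 1 * weight q d k ^ S i)) r)).
  { destruct (Series_sum_n (fun i k => alt i * (INR (S k) ^ 1 * weight q d k ^ S i)) r)
      as [Hex Heq].
    - intros i _. apply (ex_series_scal (V := R_NormedModule)).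
      apply ex_series_ext with (powexp (INR 1 + 1 - q * INR (S i)) (INR (S i) * d)).
      + intros k. now rewrite <- pow_mult_weight.
      + apply ex_series_powexp, Rmult_lt_0_compat; [apply INR_S_pos|lra].
    - split; [|exact Hex]. rewrite Heq. apply sum_n_ext. intros i.
      rewrite Series_scal_l. f_equal. apply Series_ext. intros k.
      rewrite pow_mult_weight. do 2 f_equal. }
  destruct Ht as [Ht Hex]. rewrite Ht in H1. clear Ht.
  set (tr := fun k => sum_n (fun i => alt i * (INR (S k) ^ 1 * weight q d k ^ S i)) r : R)
    in *.
  assert (H3 : Rabs (mean q d - Series tr) <= C2 * / d).
  { unfold mean. rewrite <- Series_minus by (exact Hex || apply ex_series_mean; lra).
    assert (Hle : forall k, Rabs (INR (S k) * (weight q d k / (1 + weight q d k)) - tr k)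
      <= powexp 1 d k).
    { intros k. assert (Hw := weight_pos q d k). assert (Hk := INR_S_pos k).
      replace (INR (S k) * (weight q d k / (1 + weight q d k)) - tr k) with
        (INR (S k) * weight q d k *
         (/ (1 + weight q d k) - sum_n (fun i => alt i * weight q d k ^ i) r)).
      - rewrite Rabs_mult, Rabs_pos_eq by (apply Rmult_le_pos; lra).
        eapply Rle_trans.
        { apply Rmult_le_compat_l; [apply Rmult_le_pos; lra|].
          apply geometric_alt; lra. }
        replace (INR (S k) * weight q d k * weight q d k ^ S r) with
          (INR (S k) ^ 1 * weight q d k ^ S (S r)) by (simpl; ring).
        rewrite pow_mult_weight. unfold powexp.
        apply Rmult_le_compat; [left; apply Rpower_pos|left; apply exp_pos| |].
        + apply Rle_Rpower; [apply INR_S_ge_1|]. simpl (INR 1). lra.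
        + apply exp_mono. assert (H := INR_S_ge_1 (S r)).
          assert (0 < INR (S k) * d) by (apply Rmult_lt_0_compat; lra). nra.
      - unfold tr, Rdiv. rewrite Rmult_minus_distr_l, Rmult_assoc. f_equal. f_equal.
        rewrite <- (sum_n_mult_l (K := R_Ring)). apply sum_n_ext. intros i.
        simpl. unfold mult; simpl. eq_R. ring. }
    assert (Hx : ex_series (powexp 1 d)) by (apply ex_series_powexp; lra).
    eapply Rle_trans; [apply Series_Rabs|].
    { apply ex_series_le_R with (2 := Hx). intros k. rewrite Rabs_Rabsolu. apply Hle. }
    eapply Rle_trans; [apply Series_le with (2 := Hx)|].
    - intros k. split; [apply Rabs_pos|apply Hle].
    - specialize (H2 d Hd1). rewrite Rpower_m1 in H2 by lra. exact H2. }
  replace (mean q d - M) with ((mean q d - Series tr) + (Series tr - M)) by ring.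
  eapply Rle_trans; [apply Rabs_triang|]. lra.
Qed.

Lemma variance_asymp (q : R) : 0 < q < 1 ->
  exists C, 0 <= C /\ forall d, 0 < d <= / 2 ->
    Rabs (variance q d - gam (3 - q) * Rpower d (- (3 - q))) <=
    C * Rpower d (- (3 - 2 * q)).
Proof.
  intros Hq.
  destruct (theta_asymp_gt_1 (3 - q)) as [C1 [HC1 H1]]; [lra|].
  destruct (theta_upper (3 - 2 * q)) as [C2 [HC2 H2]]; [lra|].
  exists (C1 + 2 * C2). split; [lra|]. intros d Hd.
  specialize (H1 d ltac:(lra)). specialize (H2 (2 * d) ltac:(lra)).
  assert (H3 : Rabs (variance q d - theta (3 - q) d) <= 2 * theta (3 - 2 * q) (2 * d)).
  { unfold variance, theta at 1. rewrite <- Series_minus.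
    2: apply ex_series_variance; lra. 2: apply ex_series_powexp; lra.
    unfold theta. rewrite <- Series_scal_l.
    assert (Hx : ex_series (fun k => 2 * powexp (3 - 2 * q) (2 * d) k)).
    { apply (ex_series_scal (V := R_NormedModule)), ex_series_powexp; lra. }
    assert (Hle : forall k, Rabs (INR (S k) ^ 2 *
      (weight q d k / (1 + weight q d k) ^ 2) - powexp (3 - q) d k) <=
      2 * powexp (3 - 2 * q) (2 * d) k).
    { intros k. assert (Hw := weight_pos q d k).
      replace (powexp (3 - q) d k) with (INR (S k) ^ 2 * weight q d k ^ 1).
      2:{ rewrite pow_mult_weight. f_equal; simpl; ring. }
      replace (powexp (3 - 2 * q) (2 * d) k) with (INR (S k) ^ 2 * weight q d k ^ 2).
      2:{ rewrite pow_mult_weight. f_equal; simpl; ring. }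
      set (w := weight q d k) in *. rewrite pow_1, <- Rmult_minus_distr_l, Rabs_mult.
      rewrite (Rabs_pos_eq (INR (S k) ^ 2)) by apply pow2_ge_0.
      replace (2 * (INR (S k) ^ 2 * w ^ 2)) with (INR (S k) ^ 2 * (2 * w ^ 2)) by ring.
      apply Rmult_le_compat_l; [apply pow2_ge_0|].
      replace (w / (1 + w) ^ 2 - w) with (- (w * w * (2 + w) / (1 + w) ^ 2))
        by (field; lra).
      rewrite Rabs_Ropp, Rabs_pos_eq.
      - apply Rle_div_l; [nra|].
        apply Rle_trans with (w * w * (2 * (1 + w) ^ 2)); [|right; ring].
        apply Rmult_le_compat_l; nra.
      - apply Rdiv_le_0_compat; [|nra]. apply Rmult_le_pos; nra. }
    eapply Rle_trans; [apply Series_Rabs|].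
    { apply ex_series_le_R with (2 := Hx). intros k. rewrite Rabs_Rabsolu. apply Hle. }
    apply Series_le with (2 := Hx). intros k. split; [apply Rabs_pos|apply Hle]. }
  assert (H4 : Rpower (2 * d) (- (3 - 2 * q)) <= Rpower d (- (3 - 2 * q)))
    by (apply Rpower_neg_antitone; lra).
  assert (H5 : Rpower d (1 - (3 - q)) <= Rpower d (- (3 - 2 * q)))
    by (apply Rpower_le_base_le_1; lra).
  replace (variance q d - gam (3 - q) * Rpower d (- (3 - q))) with
    ((variance q d - theta (3 - q) d) +
     (theta (3 - q) d - gam (3 - q) * Rpower d (- (3 - q)))) by ring.
  eapply Rle_trans; [apply Rabs_triang|].
  apply (Rmult_le_compat_l C2) in H4; [|lra].
  apply (Rmult_le_compat_l C1) in H5; [|lra]. lra.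
Qed.

Lemma third_moment_upper (q : R) : 0 < q < 1 ->
  exists C, 0 < C /\ forall d, 0 < d <= 1 ->
    Series (fun k => INR (S k) ^ 3 * weight q d k) <= C * Rpower d (- (4 - q)).
Proof.
  intros Hq. destruct (theta_upper (4 - q)) as [C [HC H]]; [lra|].
  exists C. split; [exact HC|]. intros d Hd.
  eapply Rle_trans; [|apply (H d Hd)]. right. apply Series_ext. intros k.
  rewrite <- (pow_1 (weight q d k)), pow_mult_weight. f_equal; simpl; ring.
Qed.

(** * Fourier analysis of the coefficients *)

Definition cis (t : R) : C := (cos t, sin t).

Lemma cis_plus (a b : R) : cis (a + b) = (cis a * cis b)%C.
Proof.
  unfold cis, Cmult; simpl. rewrite cos_plus, sin_plus. f_equal; ring.
Qed.

Lemma cis_0 : cis 0 = RtoC 1.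
Proof. unfold cis. now rewrite cos_0, sin_0. Qed.

Lemma Cmod_cis (t : R) : Cmod (cis t) = 1.
Proof.
  unfold Cmod, cis; simpl fst; simpl snd.
  replace (cos t ^ 2 + sin t ^ 2) with 1; [apply sqrt_1|].
  generalize (sin2_cos2 t). unfold Rsqr. intros H. rewrite <- H. ring.
Qed.

Lemma cis_pow (t : R) (n : nat) : Cpow (cis t) n = cis (INR n * t).
Proof.
  induction n as [|n IH].
  - simpl. now rewrite Rmult_0_l, cis_0.
  - rewrite S_INR, Rmult_plus_distr_r, Rmult_1_l, Rplus_comm, cis_plus, <- IH.
    reflexivity.
Qed.

Lemma Cpow_mult_distr (a b : C) (n : nat) :
  Cpow (a * b)%C n = (Cpow a n * Cpow b n)%C.
Proof.
  induction n as [|n IH]; simpl; [now rewrite Cmult_1_l|].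
  rewrite IH. ring.
Qed.

Lemma polar_pow (x t : R) (n : nat) :
  Cpow (RtoC x * cis t)%C n = (RtoC (x ^ n) * cis (INR n * t))%C.
Proof. now rewrite Cpow_mult_distr, Cpow_R, cis_pow. Qed.

Lemma is_RInt_cos_integer (z : Z) :
  is_RInt (fun t => cos (- (IZR z * t))) 0 PI (if Z.eq_dec z 0 then PI else 0).
Proof.
  destruct (Z.eq_dec z 0) as [->|Hz].
  - apply is_RInt_ext with (fun _ => 1).
    + intros t _. rewrite Rmult_0_l, Ropp_0, cos_0. reflexivity.
    + replace PI with (scal (PI - 0) 1) at 2.
      * apply (is_RInt_const (V := R_NormedModule)).
      * unfold scal; simpl; unfold mult; simpl; ring.
  - assert (Hz' : IZR z <> 0) by now apply not_0_IZR.
    replace 0 with (minus (sin (IZR z * PI) / IZR z) (sin (IZR z * 0) / IZR z)) at 2.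
    + apply (is_RInt_derive (fun t => sin (IZR z * t) / IZR z)).
      * intros t _. auto_derive; [exact I|]. rewrite cos_neg. field. exact Hz'.
      * intros t _. apply (ex_derive_continuous (fun t => cos (- (IZR z * t)))).
        auto_derive. exact I.
    + rewrite sin_eq_0_1 by (exists z; reflexivity).
      rewrite Rmult_0_r, sin_0. unfold minus, plus, opp; simpl. field. exact Hz'.
Qed.

(** Cosines of nonzero integer frequency have integral 0 over half a period, so the real part over
    [0, PI] suffices. The index [z] is arbitrary because the recursion for the coefficients shifts
    it. *)
Lemma coef_fourier (q d : R) (N : nat) (z : Z) :
  is_RInt (fun t => Re (cprod q N (RtoC (exp (- d)) * cis t) * cis (- (IZR z * t))))
    0 PI (PI * coef q N z * exp (- (IZR z * d))).
Proof.
  revert z. induction N as [|N IH]; intros z.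
  - replace (PI * coef q 0 z * exp (- (IZR z * d))) with
      (if Z.eq_dec z 0 then PI else 0).
    + eapply is_RInt_ext; [|apply is_RInt_cos_integer].
      intros t _. cbn [cprod]. rewrite Cmult_1_l. reflexivity.
    + cbn [coef]. destruct (Z.eq_dec z 0) as [->|Hz]; [|ring].
      rewrite Rmult_0_l, Ropp_0, exp_0. ring.
  - set (a := wt q (S N) * exp (- d) ^ S N).
    assert (H := is_RInt_plus (V := R_NormedModule) _ _ 0 PI _ _ (IH z)
      (is_RInt_scal (V := R_NormedModule) _ 0 PI a _ (IH (z - Z.of_nat (S N))%Z))).
    replace (PI * coef q (S N) z * exp (- (IZR z * d))) with
      (plus (PI * coef q N z * exp (- (IZR z * d)))
        (scal a (PI * coef q N (z - Z.of_nat (S N)) *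
          exp (- (IZR (z - Z.of_nat (S N)) * d))))).
    + eapply is_RInt_ext; [|exact H]. intros t _. cbv beta.
      cbn [cprod]. rewrite polar_pow.
      replace (cis (- (IZR (z - Z.of_nat (S N)) * t))) with
        (cis (INR (S N) * t) * cis (- (IZR z * t)))%C.
      2:{ rewrite <- cis_plus, minus_IZR, <- INR_IZR_INZ. f_equal. ring. }
      set (g := cprod q N _). set (u := cis (- (IZR z * t))).
      set (v := cis (INR (S N) * t)).
      transitivity (Re (g * u + RtoC a * (g * (v * u)))%C).
      * unfold plus, scal; simpl; unfold mult; simpl. ring.
      * f_equal. unfold a. rewrite RtoC_mult. ring.
    + change (PI * coef q N z * exp (- (IZR z * d)) +
        a * (PI * coef q N (z - Z.of_nat (S N)) * exp (- (IZR (z - Z.of_nat (S N)) * d))) =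
        PI * (coef q N z + wt q (S N) * coef q N (z - Z.of_nat (S N))) *
        exp (- (IZR z * d))).
      unfold a.
      rewrite <- exp_pow, minus_IZR, <- INR_IZR_INZ.
      replace (exp (- ((IZR z - INR (S N)) * d))) with
        (exp (- (IZR z * d)) * / exp (- (INR (S N) * d))).
      * field. apply Rgt_not_eq, exp_pos.
      * rewrite <- exp_Ropp, <- exp_plus. f_equal. ring.
Qed.

(** Characteristic function of a Bernoulli variable of parameter [p]. *)
Definition phi (p t : R) : C := (RtoC (1 - p) + RtoC p * cis t)%C.

Definition prob (q d : R) (k : nat) : R := weight q d k / (1 + weight q d k).
Definition bvar (q d : R) (k : nat) : R := weight q d k / (1 + weight q d k) ^ 2.

Fixpoint charf (q d : R) (N : nat) (t : R) : C :=
  match N with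
  | O => RtoC 1
  | S k => (charf q d k t * phi (prob q d k) (INR (S k) * t))%C
  end.

Lemma prob_bounds (q d : R) (k : nat) : 0 < prob q d k < 1.
Proof.
  unfold prob. assert (H := weight_pos q d k). split.
  - apply Rdiv_lt_0_compat; lra.
  - apply Rlt_div_l; lra.
Qed.

Lemma bvar_prob (q d : R) (k : nat) : bvar q d k = prob q d k * (1 - prob q d k).
Proof. unfold bvar, prob. assert (H := weight_pos q d k). field. lra. Qed.

Lemma cprod_charf (q d t : R) (N : nat) :
  cprod q N (RtoC (exp (- d)) * cis t) =
  (RtoC (pprod q N (exp (- d))) * charf q d N t)%C.
Proof.
  induction N as [|N IH]; cbn [cprod pprod charf]; [now rewrite Cmult_1_l|].
  rewrite IH, polar_pow, <- weight_eq.
  assert (H := weight_pos q d N).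
  replace (RtoC 1 + RtoC (wt q (S N)) *
    (RtoC (exp (- d) ^ S N) * cis (INR (S N) * t)))%C with
    (RtoC (1 + weight q d N) * phi (prob q d N) (INR (S N) * t))%C.
  - rewrite RtoC_mult. ring.
  - rewrite Cmult_assoc, <- RtoC_mult, <- weight_eq. unfold phi.
    rewrite Cmult_plus_distr_l, Cmult_assoc, <- !RtoC_mult. unfold prob.
    f_equal; [f_equal; field; lra|]. f_equal. f_equal. field. lra.
Qed.

(** * Characteristic functions near t = 0 *)

Lemma Cmod_phi (p t : R) : 0 <= p <= 1 ->
  Cmod (phi p t) <= exp (- (p * (1 - p) * (1 - cos t))).
Proof.
  intros Hp. apply Rsqr_incr_0_var; [|left; apply exp_pos].
  assert (E : Rsqr (Cmod (phi p t)) = 1 - 2 * (p * (1 - p) * (1 - cos t))).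
  { unfold Cmod, phi, cis, Cplus, Cmult, RtoC; simpl fst; simpl snd.
    rewrite Rsqr_sqrt by (apply Rplus_le_le_0_compat; apply pow2_ge_0).
    assert (H := sin2_cos2 t). unfold Rsqr in H.
    match goal with |- ?l = _ =>
      replace l with ((1 - p + p * cos t) ^ 2 + p * p * (sin t * sin t)) by ring end.
    replace (sin t * sin t) with (1 - cos t * cos t) by lra. ring. }
  rewrite E. unfold Rsqr. rewrite <- exp_plus.
  set (s := p * (1 - p) * (1 - cos t)).
  generalize (exp_ge_1_plus (- s + - s)). lra.
Qed.

Lemma cos_taylor (u : R) : 0 <= u -> Rabs (cos u - 1 + u * u / 2) <= u ^ 3 / 6.
Proof.
  intros Hu.
  assert (Hsin : forall t, 0 <= t -> Rabs (sin t - t) <= t * t / 2).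
  { intros t Ht.
    assert (H : Rabs ((sin t - t) - (sin 0 - 0)) <= t * t / 2 - 0 * 0 / 2).
    { apply (increment_bound (fun s => sin s - s) (fun s => cos s - 1)
        (fun s => s * s / 2) (fun s => s)); [exact Ht| | |].
      - intros s _. auto_derive; [exact I|ring].
      - intros s _. auto_derive; [exact I|field].
      - intros s Hs.
        assert (H : Rabs (cos s - cos 0) <= s - 0).
        { apply (increment_bound cos (fun v => - sin v) (fun v => v) (fun _ => 1));
            [lra| | |].
          - intros v _. auto_derive; [exact I|ring].
          - intros v _. auto_derive; [exact I|ring].
          - intros v _. rewrite Rabs_Ropp. apply Rabs_le, SIN_bound. }
        rewrite cos_0 in H. lra. }
    rewrite sin_0 in H. replace (sin t - t - (0 - 0)) with (sin t - t) in H by ring. lra. }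
  assert (H : Rabs ((cos u - 1 + u * u / 2) - (cos 0 - 1 + 0 * 0 / 2)) <=
    u ^ 3 / 6 - 0 ^ 3 / 6).
  { apply (increment_bound (fun s => cos s - 1 + s * s / 2) (fun s => - (sin s - s))
      (fun s => s ^ 3 / 6) (fun s => s * s / 2)); [exact Hu| | |].
    - intros s _. auto_derive; [exact I|field].
    - intros s _. auto_derive; [exact I|field].
    - intros s Hs. rewrite Rabs_Ropp. apply Hsin. lra. }
  rewrite cos_0 in H.
  replace (cos u - 1 + u * u / 2 - (1 - 1 + 0 * 0 / 2)) with
    (cos u - 1 + u * u / 2) in H by field.
  simpl pow in *. lra.
Qed.

Lemma sin_taylor (u : R) : 0 <= u -> Rabs (sin u - u) <= u ^ 3 / 6.
Proof.
  intros Hu.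
  assert (Hcos : forall t, 0 <= t -> Rabs (cos t - 1) <= t * t / 2).
  { intros t Ht.
    assert (H : Rabs (cos t - cos 0) <= t * t / 2 - 0 * 0 / 2).
    { apply (increment_bound cos (fun s => - sin s)
        (fun s => s * s / 2) (fun s => s)); [exact Ht| | |].
      - intros s _. auto_derive; [exact I|ring].
      - intros s _. auto_derive; [exact I|field].
      - intros s Hs. rewrite Rabs_Ropp.
        assert (H : Rabs (sin s - sin 0) <= s - 0).
        { apply (increment_bound sin cos (fun v => v) (fun _ => 1)); [lra| | |].
          - intros v _. auto_derive; [exact I|ring].
          - intros v _. auto_derive; [exact I|ring].
          - intros v _. apply Rabs_le, COS_bound. }
        rewrite sin_0 in H. rewrite !Rminus_0_r in H. exact H. }
    rewrite cos_0 in H. lra. }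
  assert (H : Rabs ((sin u - u) - (sin 0 - 0)) <= u ^ 3 / 6 - 0 ^ 3 / 6).
  { apply (increment_bound (fun s => sin s - s) (fun s => cos s - 1)
      (fun s => s ^ 3 / 6) (fun s => s * s / 2)); [exact Hu| | |].
    - intros s _. auto_derive; [exact I|field].
    - intros s _. auto_derive; [exact I|field].
    - intros s Hs. apply Hcos. lra. }
  rewrite sin_0 in H. replace (sin u - u - (0 - 0)) with (sin u - u) in H by ring.
  simpl pow in *. lra.
Qed.

(** Centering cancels the linear terms of the two phases. The cubic remainder is weighted by p (1-p)
    (p^2 + (1-p)^2), at most the variance p (1-p); keeping the variance as a factor makes the bound
    summable over the factors of the product. *)
Lemma phi_centered (p t : R) : 0 <= p <= 1 -> 0 <= t ->
  Cmod (phi p t * cis (- (p * t)) - RtoC (exp (- (p * (1 - p) * (t * t) / 2)))) <=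
  p * (1 - p) * t ^ 3.
Proof.
  intros Hp Ht. set (v := p * (1 - p)).
  assert (Hv : 0 <= v <= 1) by (unfold v; nra).
  assert (E : (phi p t * cis (- (p * t)))%C =
    ((1 - p) * cos (p * t) + p * cos ((1 - p) * t),
     - ((1 - p) * sin (p * t)) + p * sin ((1 - p) * t))).
  { unfold phi. rewrite Cmult_plus_distr_r, <- Cmult_assoc, <- cis_plus.
    replace (t + - (p * t)) with ((1 - p) * t) by ring.
    unfold cis. rewrite cos_neg, sin_neg.
    unfold Cplus, Cmult, RtoC; simpl. f_equal; ring. }
  rewrite E.
  eapply Rle_trans; [apply Cmod_le_components|].
  unfold Cminus, Cplus, Copp, RtoC; simpl Re; simpl Im.
  assert (C1 := cos_taylor (p * t) ltac:(nra)).
  assert (C2 := cos_taylor ((1 - p) * t) ltac:(nra)).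
  assert (S1 := sin_taylor (p * t) ltac:(nra)).
  assert (S2 := sin_taylor ((1 - p) * t) ltac:(nra)).
  assert (Ht3 : 0 <= t ^ 3) by now apply pow_le.
  assert (Hcube : (1 - p) * ((p * t) ^ 3 / 6) + p * (((1 - p) * t) ^ 3 / 6) <=
    v * t ^ 3 / 6).
  { replace ((1 - p) * ((p * t) ^ 3 / 6) + p * (((1 - p) * t) ^ 3 / 6)) with
      (v * t ^ 3 / 6 * (p * p + (1 - p) * (1 - p))) by (unfold v; field).
    rewrite <- (Rmult_1_r (v * t ^ 3 / 6)) at 2.
    apply Rmult_le_compat_l; [|nra].
    apply Rdiv_le_0_compat; [apply Rmult_le_pos; lra|lra]. }
  set (s := v * (t * t) / 2).
  assert (Hs : 0 <= s) by (unfold s; nra).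
  assert (Hexp : Rabs (exp (- s) - 1 + s) <= v * t ^ 3 / 2).
  { assert (H1 := exp_ge_1_plus (- s)).
    rewrite Rabs_pos_eq by lra.
    (* For t <= 1 the second-order bound s^2/2 is small enough; for t > 1 the bound [s] itself is
       already below v t^3/2. *)
    destruct (Rle_dec t 1) as [H|H].
    - assert (H2 : exp (- s) - 1 + s <= s * s / 2).
      { destruct (Rle_dec s 1) as [Hs1|Hs1].
        - generalize (one_minus_exp_bounds s ltac:(lra)). lra.
        - assert (s <= 1) by (unfold s; nra). lra. }
      eapply Rle_trans; [exact H2|].
      replace (s * s / 2) with (v * t ^ 3 / 2 * (v * t / 4)) by (unfold s; field).
      rewrite <- (Rmult_1_r (v * t ^ 3 / 2)) at 2.
      apply Rmult_le_compat_l; [|nra].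
      apply Rdiv_le_0_compat; [apply Rmult_le_pos; lra|lra].
    - assert (exp (- s) <= 1) by (rewrite <- exp_0; apply exp_mono; lra).
      apply Rle_trans with s; [lra|]. unfold s, Rdiv.
      apply Rmult_le_compat_r; [lra|]. apply Rmult_le_compat_l; [lra|].
      simpl. nra. }
  assert (HR : Rabs ((1 - p) * cos (p * t) + p * cos ((1 - p) * t) + - exp (- s)) <=
    v * t ^ 3 / 6 + v * t ^ 3 / 2).
  { replace ((1 - p) * cos (p * t) + p * cos ((1 - p) * t) + - exp (- s)) with
      ((1 - p) * (cos (p * t) - 1 + p * t * (p * t) / 2) +
       p * (cos ((1 - p) * t) - 1 + (1 - p) * t * ((1 - p) * t) / 2) -
       (exp (- s) - 1 + s)) by (unfold s, v; field).
    eapply Rle_trans; [apply Rabs_triang|]. rewrite Rabs_Ropp.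
    apply Rplus_le_compat; [|exact Hexp].
    eapply Rle_trans; [apply Rabs_triang|]. rewrite !Rabs_mult.
    rewrite (Rabs_pos_eq (1 - p)), (Rabs_pos_eq p) by lra.
    eapply Rle_trans; [|exact Hcube].
    apply Rplus_le_compat; apply Rmult_le_compat_l; assumption || lra. }
  assert (HI : Rabs (- ((1 - p) * sin (p * t)) + p * sin ((1 - p) * t) + - 0) <=
    v * t ^ 3 / 6).
  { replace (- ((1 - p) * sin (p * t)) + p * sin ((1 - p) * t) + - 0) with
      (- ((1 - p) * (sin (p * t) - p * t)) +
       p * (sin ((1 - p) * t) - (1 - p) * t)) by ring.
    eapply Rle_trans; [apply Rabs_triang|]. rewrite Rabs_Ropp, !Rabs_mult.
    rewrite (Rabs_pos_eq (1 - p)), (Rabs_pos_eq p) by lra.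
    eapply Rle_trans; [|exact Hcube].
    apply Rplus_le_compat; apply Rmult_le_compat_l; assumption || lra. }
  fold s. assert (0 <= v * t ^ 3) by (apply Rmult_le_pos; lra). lra.
Qed.

Lemma Cmod_mult_diff (a b c d : C) : Cmod a <= 1 -> Cmod d <= 1 ->
  Cmod (a * b - c * d) <= Cmod (a - c) + Cmod (b - d).
Proof.
  intros Ha Hd. replace (a * b - c * d)%C with ((a - c) * d + a * (b - d))%C by ring.
  eapply Rle_trans; [apply Cmod_triangle|]. rewrite !Cmod_mult.
  assert (H1 := Cmod_ge_0 (a - c)). assert (H2 := Cmod_ge_0 (b - d)). nra.
Qed.

Fixpoint psum (a : nat -> R) (N : nat) : R :=
  match N with O => 0 | S k => psum a k + a k end.

Lemma psum_sum_n (a : nat -> R) (N : nat) : psum a (S N) = sum_n a N.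
Proof.
  induction N as [|N IH]; [rewrite sum_O; simpl; ring|].
  rewrite sum_Sn_R, <- IH. reflexivity.
Qed.

Lemma Cmod_charf (q d t : R) (N : nat) :
  Cmod (charf q d N t) <= exp (- psum (fun k => bvar q d k * (1 - cos (INR (S k) * t))) N).
Proof.
  induction N as [|N IH]; cbn [charf psum].
  - rewrite Cmod_1, Ropp_0, exp_0. lra.
  - rewrite Cmod_mult, Ropp_plus_distr, exp_plus.
    apply Rmult_le_compat; [apply Cmod_ge_0|apply Cmod_ge_0|exact IH|].
    rewrite bvar_prob. apply Cmod_phi. generalize (prob_bounds q d N). lra.
Qed.

Lemma bvar_pos (q d : R) (k : nat) : 0 < bvar q d k.
Proof. rewrite bvar_prob. generalize (prob_bounds q d k). nra. Qed.

Lemma psum_nonneg (a : nat -> R) (N : nat) : (forall k, 0 <= a k) -> 0 <= psum a N.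
Proof.
  intros H. induction N as [|N IH]; simpl; [lra|]. generalize (H N). lra.
Qed.

Lemma Cmod_charf_le_1 (q d t : R) (N : nat) : Cmod (charf q d N t) <= 1.
Proof.
  eapply Rle_trans; [apply Cmod_charf|].
  apply Rle_trans with (exp 0); [|rewrite exp_0; lra]. apply exp_mono.
  assert (H : 0 <= psum (fun k => bvar q d k * (1 - cos (INR (S k) * t))) N).
  { apply psum_nonneg. intros k. apply Rmult_le_pos; [left; apply bvar_pos|].
    generalize (COS_bound (INR (S k) * t)). lra. }
  lra.
Qed.

(** Factors are exchanged for Gaussian ones one at a time, as in Lindeberg's method; all of them
    have modulus at most 1, so the errors simply add up. *)
Lemma charf_centered (q d t : R) (N : nat) : 0 <= t ->
  Cmod (charf q d N t * cis (- (psum (fun k => INR (S k) * prob q d k) N * t)) -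
    RtoC (exp (- (psum (fun k => INR (S k) ^ 2 * bvar q d k) N * (t * t) / 2)))) <=
  psum (fun k => INR (S k) ^ 3 * bvar q d k) N * t ^ 3.
Proof.
  intros Ht. induction N as [|N IH]; cbn [charf psum].
  - rewrite !Rmult_0_l. unfold Rdiv. rewrite Rmult_0_l, Ropp_0, exp_0, cis_0.
    rewrite Cmult_1_l. unfold Cminus. rewrite Cplus_opp_r, Cmod_0. lra.
  - set (mu := psum (fun k => INR (S k) * prob q d k) N) in *.
    set (V := psum (fun k => INR (S k) ^ 2 * bvar q d k) N) in *.
    set (j := INR (S N)). set (p := prob q d N).
    replace (charf q d N t * phi p (j * t) * cis (- ((mu + j * p) * t)))%C with
      ((charf q d N t * cis (- (mu * t))) * (phi p (j * t) * cis (- (p * (j * t)))))%C.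
    2:{ replace (- ((mu + j * p) * t)) with (- (mu * t) + - (p * (j * t))) by ring.
        rewrite cis_plus. ring. }
    replace (RtoC (exp (- ((V + j ^ 2 * bvar q d N) * (t * t) / 2)))) with
      (RtoC (exp (- (V * (t * t) / 2))) *
       RtoC (exp (- (p * (1 - p) * ((j * t) * (j * t)) / 2))))%C.
    2:{ rewrite <- RtoC_mult, <- exp_plus, bvar_prob. f_equal. f_equal.
        unfold p. field. }
    eapply Rle_trans; [apply Cmod_mult_diff|].
    + rewrite Cmod_mult, Cmod_cis, Rmult_1_r. apply Cmod_charf_le_1.
    + rewrite Cmod_R, Rabs_pos_eq by (left; apply exp_pos).
      apply Rle_trans with (exp 0); [|rewrite exp_0; lra]. apply exp_mono.
      assert (0 < p * (1 - p)) by (unfold p; rewrite <- bvar_prob; apply bvar_pos).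
      assert (0 <= (j * t) * (j * t)) by nra. nra.
    + rewrite Rmult_plus_distr_r. apply Rplus_le_compat; [exact IH|].
      replace (j ^ 3 * bvar q d N * t ^ 3) with (p * (1 - p) * (j * t) ^ 3)
        by (rewrite bvar_prob; unfold p; ring).
      apply phi_centered.
      * unfold p. generalize (prob_bounds q d N). lra.
      * apply Rmult_le_pos; [apply pos_INR|exact Ht].
Qed.

Lemma Cmod_cis_minus_1 (s : R) : Cmod (cis s - RtoC 1) <= 2 * Rabs s.
Proof.
  eapply Rle_trans; [apply Cmod_le_components|].
  assert (H : forall u, 0 <= u -> Rabs (cos u - 1) <= u /\ Rabs (sin u) <= u).
  { intros u Hu. split.
    - rewrite <- cos_0. replace u with (u - 0) at 2 by ring.
      apply (increment_bound cos (fun s => - sin s) (fun s => s) (fun _ => 1) 0 u Hu).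
      + intros x _. auto_derive; [exact I|ring].
      + intros x _. auto_derive; [exact I|ring].
      + intros x _. rewrite Rabs_Ropp. apply Rabs_le, SIN_bound.
    - replace (sin u) with (sin u - sin 0) by (rewrite sin_0; ring).
      replace u with (u - 0) at 2 by ring.
      apply (increment_bound sin cos (fun s => s) (fun _ => 1) 0 u Hu).
      + intros x _. auto_derive; [exact I|ring].
      + intros x _. auto_derive; [exact I|ring].
      + intros x _. apply Rabs_le, COS_bound. }
  unfold cis, Cminus, Cplus, Copp, RtoC; simpl Re; simpl Im.
  rewrite Ropp_0, Rplus_0_r. fold (cos s - 1).
  destruct (Rle_dec 0 s) as [Hs|Hs].
  - destruct (H s Hs). rewrite (Rabs_pos_eq s) by exact Hs. lra.
  - destruct (H (- s) ltac:(lra)) as [H1 H2].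
    rewrite cos_neg in H1. rewrite sin_neg, Rabs_Ropp in H2.
    rewrite (Rabs_left s) by lra. lra.
Qed.

Lemma exp_lipschitz_neg (a b : R) : 0 <= a -> 0 <= b ->
  Rabs (exp (- a) - exp (- b)) <= Rabs (a - b).
Proof.
  assert (H : forall a b, 0 <= a -> a <= b -> Rabs (exp (- a) - exp (- b)) <= b - a).
  { clear. intros a b Ha Hab.
    assert (E : exp (- b) = exp (- a) * exp (- (b - a)))
      by (rewrite <- exp_plus; f_equal; ring).
    assert (H1 := exp_ge_1_plus (- (b - a))).
    assert (H2 : exp (- (b - a)) <= 1) by (rewrite <- exp_0; apply exp_mono; lra).
    assert (H3 : exp (- a) <= 1) by (rewrite <- exp_0; apply exp_mono; lra).
    assert (H4 := exp_pos (- a)). rewrite E, Rabs_pos_eq; nra. }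
  intros Ha Hb. destruct (Rle_dec a b) as [Hab|Hab].
  - rewrite (Rabs_minus_sym a b), (Rabs_pos_eq (b - a)) by lra. auto.
  - rewrite Rabs_minus_sym, (Rabs_pos_eq (a - b)) by lra. apply H; lra.
Qed.

(** The centre [s] and the variance [B2] are free, since [n] is only close to the mean and the
    variance is replaced by its leading term; the discrepancies appear as separate errors. *)
Lemma charf_gauss (q d t s B2 : R) (N : nat) : 0 <= t -> 0 <= B2 ->
  Rabs (Re (charf q d N t * cis (- (s * t))) - exp (- (B2 * (t * t) / 2))) <=
  psum (fun k => INR (S k) ^ 3 * bvar q d k) N * t ^ 3 +
  2 * Rabs (psum (fun k => INR (S k) * prob q d k) N - s) * t +
  Rabs (psum (fun k => INR (S k) ^ 2 * bvar q d k) N - B2) * t ^ 2.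
Proof.
  intros Ht HB.
  assert (H1 := charf_centered q d t N Ht).
  set (mu := psum (fun k => INR (S k) * prob q d k) N) in *.
  set (V := psum (fun k => INR (S k) ^ 2 * bvar q d k) N) in *.
  set (M3 := psum (fun k => INR (S k) ^ 3 * bvar q d k) N) in *.
  assert (HV : 0 <= V).
  { apply psum_nonneg. intros k.
    apply Rmult_le_pos; [apply pow2_ge_0|left; apply bvar_pos]. }
  assert (H2 : Cmod (charf q d N t * cis (- (s * t)) -
    charf q d N t * cis (- (mu * t))) <= 2 * Rabs (mu - s) * t).
  { replace (charf q d N t * cis (- (s * t)) - charf q d N t * cis (- (mu * t)))%C
      with (charf q d N t * (cis (- (mu * t)) * (cis ((mu - s) * t) - RtoC 1)))%C.
    - rewrite !Cmod_mult, Cmod_cis, Rmult_1_l.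
      assert (H := Cmod_cis_minus_1 ((mu - s) * t)).
      rewrite Rabs_mult, (Rabs_pos_eq t) in H by exact Ht.
      assert (Hc := Cmod_charf_le_1 q d t N).
      assert (H0 := Cmod_ge_0 (cis ((mu - s) * t) - RtoC 1)).
      nra.
    - replace (- (s * t)) with (- (mu * t) + (mu - s) * t) by ring.
      rewrite cis_plus. ring. }
  assert (Htt : 0 <= t * t) by nra.
  assert (H3 : Rabs (exp (- (V * (t * t) / 2)) - exp (- (B2 * (t * t) / 2))) <=
    Rabs (V - B2) * t ^ 2).
  { eapply Rle_trans; [apply exp_lipschitz_neg|]; try nra.
    replace (V * (t * t) / 2 - B2 * (t * t) / 2) with ((V - B2) * (t * t / 2)) by field.
    rewrite Rabs_mult, (Rabs_pos_eq (t * t / 2)) by lra.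
    apply Rmult_le_compat_l; [apply Rabs_pos|]. simpl. lra. }
  set (z := (charf q d N t * cis (- (s * t)))%C) in *.
  set (z' := (charf q d N t * cis (- (mu * t)))%C) in *.
  set (e := exp (- (V * (t * t) / 2))) in *.
  replace (Re z - exp (- (B2 * (t * t) / 2))) with
    (Re (z' - RtoC e)%C + Re (z - z')%C + (e - exp (- (B2 * (t * t) / 2))))
    by (unfold Cminus, Cplus, Copp, RtoC; simpl; ring).
  eapply Rle_trans; [apply Rabs_triang|]. apply Rplus_le_compat; [|exact H3].
  eapply Rle_trans; [apply Rabs_triang|].
  apply Rplus_le_compat; (eapply Rle_trans; [apply Re_le_Cmod|assumption]).
Qed.

(** * Decay of the characteristic function away from t = 0 *)

Lemma sin_ge_third (x : R) : 0 <= x <= PI / 2 -> x / 3 <= sin x.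
Proof.
  intros Hx.
  assert (H : forall y, 0 <= y <= 1 -> 5 / 6 * y <= sin y).
  { intros y Hy. assert (H := sin_taylor y ltac:(lra)). apply Rabs_le_between in H.
    assert (y ^ 3 <= y) by (simpl; nra). lra. }
  destruct (Rle_dec x 1) as [H1|H1].
  - generalize (H x ltac:(lra)). lra.
  - assert (Hpi : PI <= 4) by apply PI_4.
    assert (H2 : sin 1 <= sin x) by (apply sin_incr_1; lra).
    generalize (H 1 ltac:(lra)). lra.
Qed.

(** The Dirichlet kernel. *)
Lemma psum_cos (t : R) (M : nat) :
  psum (fun k => cos (INR (S k) * t)) M * (2 * sin (t / 2)) =
  sin ((INR M + / 2) * t) - sin (t / 2).
Proof.
  induction M as [|M IH].
  - simpl. replace ((0 + / 2) * t) with (t / 2) by field. ring.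
  - cbn [psum]. rewrite Rmult_plus_distr_r, IH.
    replace ((INR (S M) + / 2) * t) with (INR (S M) * t + t / 2) by field.
    replace ((INR M + / 2) * t) with (INR (S M) * t - t / 2) by (rewrite S_INR; field).
    rewrite sin_plus, sin_minus. ring.
Qed.

Lemma psum_le (a b : nat -> R) (N : nat) :
  (forall k, (k < N)%nat -> a k <= b k) -> psum a N <= psum b N.
Proof.
  intros H. induction N as [|N IH]; simpl; [lra|].
  apply Rplus_le_compat; auto.
Qed.

Lemma psum_scal (c : R) (a : nat -> R) (N : nat) :
  psum (fun k => c * a k) N = c * psum a N.
Proof. induction N as [|N IH]; simpl; [ring|]. rewrite IH. ring. Qed.

Lemma psum_mono (a : nat -> R) (M N : nat) :
  (forall k, 0 <= a k) -> (M <= N)%nat -> psum a M <= psum a N.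
Proof.
  intros H HMN. induction HMN as [|N _ IH]; [lra|]. simpl. generalize (H N). lra.
Qed.

(** For K t <= 2 the first [K] terms suffice, by 1 - cos x >= x^2/8 on [0, 2]. For K t > 2 the
    Dirichlet kernel bounds the sum of the 4 K cosines by 3 K, leaving at least [K]. *)
Lemma psum_one_minus_cos (K : nat) (t : R) : 0 <= t <= PI ->
  Rmin (INR K ^ 3 * t ^ 2 / 24) (INR K) <=
  psum (fun k => 1 - cos (INR (S k) * t)) (4 * K).
Proof.
  intros Ht.
  assert (Hnn : forall k, 0 <= 1 - cos (INR (S k) * t)).
  { intros k. generalize (COS_bound (INR (S k) * t)). lra. }
  destruct (Rle_dec (INR K * t) 2) as [H|H].
  - apply Rle_trans with (1 := Rmin_l _ _).
    apply Rle_trans with (psum (fun k => 1 - cos (INR (S k) * t)) K);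
      [|apply psum_mono; [exact Hnn|lia]].
    apply Rle_trans with (psum (fun k => t ^ 2 / 8 * INR (S k) ^ 2) K).
    + rewrite psum_scal.
      assert (Hsq : forall n, INR n ^ 3 / 3 <= psum (fun k => INR (S k) ^ 2) n).
      { induction n as [|n IH]; cbn [psum]; [simpl; lra|].
        assert (Hn := pos_INR n). rewrite S_INR. simpl pow in *. nra. }
      specialize (Hsq K).
      replace (INR K ^ 3 * t ^ 2 / 24) with (t ^ 2 / 8 * (INR K ^ 3 / 3)) by field.
      apply Rmult_le_compat_l; [|exact Hsq].
      generalize (pow2_ge_0 t). lra.
    + apply psum_le. intros k Hk.
      assert (Hk' : INR (S k) <= INR K) by (apply le_INR; lia).
      assert (Hk0 := INR_S_pos k).
      assert (Hx : 0 <= INR (S k) * t <= 2) by nra.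
      set (x := INR (S k) * t) in *.
      replace (t ^ 2 / 8 * INR (S k) ^ 2) with (x * x / 8) by (unfold x; field).
      assert (Hc := cos_taylor x ltac:(lra)). apply Rabs_le_between in Hc.
      nra.
  - apply Rle_trans with (1 := Rmin_r _ _).
    assert (Hs : t / 6 <= sin (t / 2)).
    { generalize (sin_ge_third (t / 2) ltac:(lra)). lra. }
    assert (E : psum (fun k => 1 - cos (INR (S k) * t)) (4 * K) =
      4 * INR K - psum (fun k => cos (INR (S k) * t)) (4 * K)).
    { replace (4 * INR K) with (INR (4 * K)) by (rewrite mult_INR; simpl; ring).
      generalize (4 * K)%nat. induction n as [|n IH]; [simpl; ring|].
      cbn [psum]. rewrite IH, S_INR. ring. }
    rewrite E. assert (Hps := psum_cos t (4 * K)).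
    set (c := psum (fun k => cos (INR (S k) * t)) (4 * K)) in *.
    assert (Hb := SIN_bound ((INR (4 * K) + / 2) * t)).
    enough (c <= 3 * INR K) by lra.
    destruct (Rle_dec c 0) as [Hc0|Hc0]; [nra|].
    assert (c * (2 / 3) <= INR K).
    { nra. }
    lra.
Qed.

(** Only the factors with index up to 4 K, where K is the integer part of 1/(4 d), are used: there
    the exponential is bounded below and all variances are at least a constant times K^(-q). The two
    exponentials correspond to the two arguments of the minimum in [psum_one_minus_cos]. *)
Lemma charf_tail (q : R) : 0 < q < 1 ->
  exists c1 c2, 0 < c1 /\ 0 < c2 /\
  forall d N t, 0 < d <= / 8 -> / d <= INR N -> 0 <= t <= PI ->
    Cmod (charf q d N t) <= exp (- (c1 * Rpower d (- (3 - q)) * t ^ 2)) +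
      exp (- (c2 * Rpower d (- (1 - q)))).
Proof.
  (* The factor 1/4 comes from (1 + w)^2 <= 4 for w <= 1; the others bound the weight from below for
     k + 1 <= 4 K <= 1/d. *)
  intros Hq. set (c := / 4 * (Rpower 4 (- q) * exp (Ropp 1))).
  assert (Hc : 0 < c).
  { apply Rmult_lt_0_compat; [lra|].
    apply Rmult_lt_0_compat; [apply Rpower_pos|apply exp_pos]. }
  exists (c * Rpower 8 (- (3 - q)) / 24), (c * Rpower 8 (- (1 - q))).
  assert (H81 := Rpower_pos 8 (- (3 - q))). assert (H82 := Rpower_pos 8 (- (1 - q))).
  split; [apply Rdiv_lt_0_compat; [nra|lra]|]. split; [nra|].
  intros d N t Hd HN Ht.
  assert (Hd4 : 2 <= / (4 * d)).
  { replace 2 with (/ (4 * / 8)) by field. apply Rinv_le_contravar; lra. }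
  destruct (nfloor_ex (/ (4 * d))) as [K [HK1 HK2]]; [lra|].
  assert (HK8 : / (8 * d) <= INR K).
  { replace (/ (8 * d)) with (/ (4 * d) / 2) by (field; lra). lra. }
  assert (H8d : 0 < / (8 * d)) by (apply Rinv_0_lt_compat; lra).
  assert (HK0 : 0 < INR K) by lra.
  assert (HKN : (4 * K <= N)%nat).
  { apply INR_le. rewrite mult_INR. simpl (INR 4).
    apply Rle_trans with (2 := HN).
    replace (/ d) with (4 * / (4 * d)) by (field; lra). lra. }
  assert (Hv : forall k, (k < 4 * K)%nat -> c * Rpower (INR K) (- q) <= bvar q d k).
  { intros k Hk. assert (Hw := weight_pos q d k).
    assert (Hw1 := weight_le_1 q d k ltac:(lra) ltac:(lra)).
    apply Rle_trans with (/ 4 * weight q d k).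
    - unfold c. rewrite Rmult_assoc. apply Rmult_le_compat_l; [lra|].
      assert (Hk4 : INR (S k) <= 4 * INR K).
      { replace (4 * INR K) with (INR (4 * K)) by (rewrite mult_INR; simpl; ring).
        apply le_INR. lia. }
      unfold weight, powexp. replace (1 - q - 1) with (- q) by ring.
      replace (Rpower 4 (- q) * exp (Ropp 1) * Rpower (INR K) (- q)) with
        (Rpower 4 (- q) * Rpower (INR K) (- q) * exp (Ropp 1)) by ring.
      rewrite <- Rpower_mult_base by lra.
      apply Rmult_le_compat; [left; apply Rpower_pos|left; apply exp_pos| |].
      + apply Rpower_neg_antitone; [apply INR_S_pos|exact Hk4|lra].
      + apply exp_mono. apply Ropp_le_contravar.
        apply Rle_trans with (4 * INR K * d); [apply Rmult_le_compat_r; lra|].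
        apply Rle_trans with (4 * / (4 * d) * d); [nra|]. right. field. lra.
    - unfold bvar. set (w := weight q d k) in *. refine (proj1 (Rle_div_r (/ 4 * w) w ((1 + w) ^ 2) _) _); [apply pow_lt; lra|].
      apply Rle_trans with (/ 4 * w * 4); [|lra].
      apply Rmult_le_compat_l; [lra|]. simpl. nra. }
  eapply Rle_trans; [apply Cmod_charf|].
  assert (HQ : c * Rpower (INR K) (- q) * Rmin (INR K ^ 3 * t ^ 2 / 24) (INR K) <=
    psum (fun k => bvar q d k * (1 - cos (INR (S k) * t))) N).
  { eapply Rle_trans; [|apply psum_mono with (2 := HKN)].
    2:{ intros k. apply Rmult_le_pos; [left; apply bvar_pos|].
        generalize (COS_bound (INR (S k) * t)). lra. }
    eapply Rle_trans.
    { apply Rmult_le_compat_l; [|apply (psum_one_minus_cos K t Ht)].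
      apply Rmult_le_pos; [lra|left; apply Rpower_pos]. }
    rewrite <- psum_scal. apply psum_le. intros k Hk.
    apply Rmult_le_compat_r; [generalize (COS_bound (INR (S k) * t)); lra|auto]. }
  assert (Hscale : forall a, 0 < a -> Rpower 8 (- a) * Rpower d (- a) <= Rpower (INR K) a).
  { intros a Ha. rewrite <- Rpower_mult_base by lra.
    replace (Rpower (8 * d) (- a)) with (Rpower (/ (8 * d)) a).
    - apply Rle_Rpower_l; lra.
    - unfold Rpower. rewrite ln_Rinv by lra. f_equal. ring. }
  assert (Hcube : Rpower (INR K) (- q) * INR K ^ 3 = Rpower (INR K) (3 - q)).
  { rewrite <- Rpower_pow by exact HK0. rewrite <- Rpower_plus. f_equal. simpl. ring. }
  assert (Hone : Rpower (INR K) (- q) * INR K = Rpower (INR K) (1 - q)).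
  { rewrite <- (Rpower_1 (INR K)) at 2 by exact HK0.
    rewrite <- Rpower_plus. f_equal. ring. }
  assert (Hp1 := exp_pos (- (c * Rpower 8 (- (3 - q)) / 24 * Rpower d (- (3 - q)) * t ^ 2))).
  assert (Hp2 := exp_pos (- (c * Rpower 8 (- (1 - q)) * Rpower d (- (1 - q))))).
  revert HQ. apply Rmin_case; intros HQ.
  - apply Rle_trans with
      (exp (- (c * Rpower 8 (- (3 - q)) / 24 * Rpower d (- (3 - q)) * t ^ 2))); [|lra].
    apply exp_mono, Ropp_le_contravar. eapply Rle_trans; [|exact HQ].
    replace (c * Rpower (INR K) (- q) * (INR K ^ 3 * t ^ 2 / 24)) with
      (c * t ^ 2 / 24 * (Rpower (INR K) (- q) * INR K ^ 3)) by field.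
    rewrite Hcube. specialize (Hscale (3 - q) ltac:(lra)).
    replace (c * Rpower 8 (- (3 - q)) / 24 * Rpower d (- (3 - q)) * t ^ 2) with
      (c * t ^ 2 / 24 * (Rpower 8 (- (3 - q)) * Rpower d (- (3 - q)))) by field.
    apply Rmult_le_compat_l; [|exact Hscale].
    generalize (pow2_ge_0 t). intros. apply Rdiv_le_0_compat; nra.
  - apply Rle_trans with
      (exp (- (c * Rpower 8 (- (1 - q)) * Rpower d (- (1 - q))))); [|lra].
    apply exp_mono, Ropp_le_contravar. eapply Rle_trans; [|exact HQ].
    rewrite !Rmult_assoc, Hone. apply Rmult_le_compat_l; [lra|].
    apply Hscale. lra.
Qed.

(** * The Gaussian integral *)

Definition gauss_int (T : R) : R := RInt (fun t => exp (- (t * t / 2))) 0 T.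

Lemma ex_RInt_continuous_R (f : R -> R) (a b : R) :
  (forall x, ex_derive f x) -> ex_RInt f a b.
Proof.
  intros H. apply (ex_RInt_continuous (V := R_CompleteNormedModule)).
  intros x _. apply (ex_derive_continuous f), H.
Qed.

Lemma ex_RInt_gauss (B2 a b : R) : ex_RInt (fun t => exp (- (B2 * (t * t) / 2))) a b.
Proof. apply ex_RInt_continuous_R. intros x. auto_derive. exact I. Qed.

Lemma gauss_int_scale (B tau : R) : 0 < B ->
  RInt (fun t => exp (- (B ^ 2 * (t * t) / 2))) 0 tau = gauss_int (B * tau) / B.
Proof.
  intros HB. unfold gauss_int.
  assert (E := RInt_comp_lin (fun t => exp (- (t * t / 2))) B 0 0 tau).
  replace (B * 0 + 0) with 0 in E by ring. rewrite (Rplus_0_r (B * tau)) in E.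
  rewrite <- E.
  - assert (E2 : RInt (fun y => B * exp (- (B ^ 2 * (y * y) / 2))) 0 tau =
      B * RInt (fun y => exp (- (B ^ 2 * (y * y) / 2))) 0 tau)
      by exact (RInt_scal (V := R_CompleteNormedModule) _ 0 tau B
        (ex_RInt_gauss (B ^ 2) 0 tau)).
    assert (E3 : RInt (fun y => B * exp (- (B ^ 2 * (y * y) / 2))) 0 tau =
      RInt (fun y => scal B (exp (- ((B * y + 0) * (B * y + 0) / 2)))) 0 tau).
    { apply RInt_ext. intros y _. unfold scal; simpl; unfold mult; simpl.
      eq_R. f_equal. f_equal. field. }
    apply Rmult_eq_reg_l with B; [|lra]. rewrite <- E2. unfold Rdiv.
    rewrite <- Rmult_assoc, Rinv_r_simpl_m by lra. exact E3.
  - apply ex_RInt_continuous_R. intros x. auto_derive. exact I.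
Qed.

Lemma gauss_int_lim : exists I0 : R, 0 < I0 /\
  is_lim_seq (fun m => gauss_int (INR m)) I0.
Proof.
  assert (Hex : forall a b, ex_RInt (fun t => exp (- (t * t / 2))) a b).
  { intros a b. apply ex_RInt_continuous_R. intros x. auto_derive. exact I. }
  assert (Hmono : forall m, gauss_int (INR m) <= gauss_int (INR (S m))).
  { intros m. unfold gauss_int.
    rewrite <- (RInt_Chasles _ 0 (INR m) (INR (S m))) by apply Hex.
    assert (H : 0 <= RInt (fun t => exp (- (t * t / 2))) (INR m) (INR (S m))).
    { apply RInt_ge_0; [rewrite S_INR; lra|apply Hex|].
      intros; left; apply exp_pos. }
    unfold plus; simpl AbelianMonoid.plus.
    change (gauss_int (INR m) <= gauss_int (INR m) +
      RInt (fun t => exp (- (t * t / 2))) (INR m) (INR (S m))). lra. }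
  (* From (t - 1)^2 >= 0 the integrand is at most exp (1/2 - t). *)
  assert (Hbound : forall m, gauss_int (INR m) <= exp (/ 2)).
  { intros m.
    assert (Hi : is_RInt (fun t => exp (/ 2 - t)) 0 (INR m)
      (minus (- exp (/ 2 - INR m)) (- exp (/ 2 - 0)))).
    { apply (is_RInt_derive (fun t => - exp (/ 2 - t))).
      - intros x _. auto_derive; [exact I|unfold Rminus; ring].
      - intros x _. apply (ex_derive_continuous (fun t => exp (/ 2 - t))).
        auto_derive. exact I. }
    apply Rle_trans with (RInt (fun t => exp (/ 2 - t)) 0 (INR m)).
    - apply RInt_le; [apply pos_INR|apply Hex|eexists; exact Hi|].
      intros x _. apply exp_mono. generalize (pow2_ge_0 (x - 1)). simpl. nra.
    - rewrite (is_RInt_unique _ _ _ _ Hi). rewrite Rminus_0_r.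
      unfold minus, plus, opp; simpl. generalize (exp_pos (/ 2 - INR m)). lra. }
  destruct (ex_finite_lim_seq_incr _ _ Hmono Hbound) as [I0 HI].
  exists I0. split; [|exact HI].
  apply Rlt_le_trans with (gauss_int (INR 1)).
  - unfold gauss_int. apply RInt_gt_0; [simpl; lra| |].
    + intros; apply exp_pos.
    + intros x _. apply (ex_derive_continuous (fun t => exp (- (t * t / 2)))).
      auto_derive. exact I.
  - apply (is_lim_seq_incr_compare (fun m => gauss_int (INR m)) I0 HI Hmono).
Qed.

(** * The local limit theorem *)

Lemma is_RInt_charf (q d : R) (N n : nat) : (n <= N)%nat ->
  is_RInt (fun t => Re (charf q d N t * cis (- (INR n * t)))) 0 PI
    (PI * coefs q n * exp (- (INR n * d)) / pprod q N (exp (- d))).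
Proof.
  intros Hn. assert (Hp := pprod_pos q N (exp (- d)) (Rlt_le _ _ (exp_pos _))).
  set (P := pprod q N (exp (- d))) in *.
  assert (H := is_RInt_scal (V := R_NormedModule) _ 0 PI (/ P) _
    (coef_fourier q d N (Z.of_nat n))).
  rewrite coef_coefs, <- INR_IZR_INZ in H by exact Hn.
  replace (PI * coefs q n * exp (- (INR n * d)) / P) with
    (scal (/ P) (PI * coefs q n * exp (- (INR n * d))))
    by (unfold scal; simpl; unfold mult; simpl; unfold Rdiv; ring).
  eapply is_RInt_ext; [|exact H]. intros t _. cbv beta.
  rewrite cprod_charf. fold P. rewrite <- Cmult_assoc.
  set (z := (charf q d N t * cis (- (INR n * t)))%C).
  unfold scal; simpl; unfold mult; simpl. field. lra.
Qed.

Lemma is_lim_seq_psum (a : nat -> R) : ex_series a ->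
  is_lim_seq (fun N => psum a (S N)) (Series a).
Proof.
  intros H. apply is_lim_seq_ext with (sum_n a).
  - intros N. symmetry. apply psum_sum_n.
  - exact (Series_correct a H).
Qed.

(** For a finite product the Fourier integral is split at [tau]: [charf_gauss] serves on the left
    and the assumed tail bound on the right; then N tends to infinity. The assumed decay is linear
    in [t], which keeps the integral of the tail explicit; Gaussian decay implies it wherever B t >=
    1. *)
Lemma local_inequality (q d B tau a e : R) (n : nat) :
  0 < d -> 0 < B -> 0 <= tau <= PI -> 0 < a -> 0 <= e ->
  (exists N0, forall N t, (N0 <= N)%nat -> tau <= t <= PI ->
    Cmod (charf q d N t) <= exp (- (a * t)) + e) ->
  Rabs (PI * coefs q n * exp (- (INR n * d)) * exp (- log_gf q d) -
    gauss_int (B * tau) / B) <=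
  Series (fun k => INR (S k) ^ 3 * weight q d k) * tau ^ 4 +
  2 * Rabs (mean q d - INR n) * tau ^ 2 + Rabs (variance q d - B ^ 2) * tau ^ 3 +
  (exp (- (a * tau)) / a + PI * e).
Proof.
  intros Hd HB Htau Ha He [N0 Htail].
  set (M3 := Series (fun k => INR (S k) ^ 3 * weight q d k)).
  set (A := PI * coefs q n * exp (- (INR n * d))).
  assert (Hlim1 : is_lim_seq (fun N => A * / pprod q (S N) (exp (- d)))
    (A * exp (- log_gf q d))).
  { apply is_lim_seq_ext with
      (fun N => A * exp (- sum_n (fun k => ln (1 + weight q d k)) N)).
    - intros N. now rewrite pprod_exp, exp_Ropp.
    - apply (is_lim_seq_scal_l _ A (exp (- log_gf q d))).
      apply is_lim_seq_exp. apply (is_lim_seq_opp _ (Finite (log_gf q d))).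
      apply (Series_correct _ (ex_series_log_gf q d Hd)). }
  assert (Hlim2 : is_lim_seq (fun N => psum (fun k => INR (S k) * prob q d k) (S N))
    (mean q d)) by (apply is_lim_seq_psum, ex_series_mean; exact Hd).
  assert (Hlim3 : is_lim_seq (fun N => psum (fun k => INR (S k) ^ 2 * bvar q d k) (S N))
    (variance q d)) by (apply is_lim_seq_psum, ex_series_variance; exact Hd).
  apply (is_lim_seq_le_loc
    (fun N => Rabs (A * / pprod q (S N) (exp (- d)) - gauss_int (B * tau) / B))
    (fun N => M3 * tau ^ 4 +
      2 * Rabs (psum (fun k => INR (S k) * prob q d k) (S N) - INR n) * tau ^ 2 +
      Rabs (psum (fun k => INR (S k) ^ 2 * bvar q d k) (S N) - B ^ 2) * tau ^ 3 +
      (exp (- (a * tau)) / a + PI * e))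
    (Finite _) (Finite _)).
  - exists (max N0 n). intros N HN.
    assert (HF := is_RInt_charf q d (S N) n ltac:(lia)). fold A in HF.
    set (F := fun t => Re (charf q d (S N) t * cis (- (INR n * t)))) in *.
    assert (HexF : ex_RInt F 0 PI) by (eexists; exact HF).
    assert (Hex1 : ex_RInt F 0 tau) by (apply (ex_RInt_Chasles_1 F 0 tau PI); auto).
    assert (Hex2 : ex_RInt F tau PI) by (apply (ex_RInt_Chasles_2 F 0 tau PI); auto).
    set (g := fun t => exp (- (B ^ 2 * (t * t) / 2))).
    assert (Hg : is_RInt g 0 tau (gauss_int (B * tau) / B)).
    { rewrite <- gauss_int_scale by exact HB.
      apply (RInt_correct (V := R_CompleteNormedModule)), ex_RInt_gauss. }
    set (K := M3 * tau ^ 3 +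
      2 * Rabs (psum (fun k => INR (S k) * prob q d k) (S N) - INR n) * tau +
      Rabs (psum (fun k => INR (S k) ^ 2 * bvar q d k) (S N) - B ^ 2) * tau ^ 2).
    assert (Hnear : Rabs (RInt F 0 tau - gauss_int (B * tau) / B) <= tau * K).
    { assert (Hc : is_RInt (fun _ => K) 0 tau (tau * K)).
      { replace (tau * K) with (scal (tau - 0) K)
          by (unfold scal; simpl; unfold mult; simpl; ring).
        apply (is_RInt_const (V := R_NormedModule)). }
      apply (norm_RInt_le (V := R_NormedModule) (fun t => minus (F t) (g t))
        (fun _ => K) 0 tau _ _ (proj1 Htau)) with (3 := Hc).
      - intros t Ht.
        change (Rabs (F t - g t) <= K). unfold F, g.
        eapply Rle_trans.
        { apply charf_gauss; [lra|]. apply pow2_ge_0. }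
        assert (Htp : forall m, 0 <= t ^ m <= tau ^ m).
        { intros m. split; [apply pow_le; lra|apply pow_incr; lra]. }
        unfold K. repeat apply Rplus_le_compat.
        + apply Rmult_le_compat; [|apply Htp| |apply Htp].
          * apply psum_nonneg. intros k. apply Rmult_le_pos; [|left; apply bvar_pos].
            apply pow_le, pos_INR.
          * rewrite psum_sum_n. eapply Rle_trans.
            { apply (sum_n_le_loc _ (fun k => INR (S k) ^ 3 * weight q d k)).
              intros k _. apply Rmult_le_compat_l; [apply pow_le, pos_INR|].
              apply (weight_frac_bounds q d k). }
            apply sum_n_le_Series; [|now apply ex_series_pow_mult_weight].
            intros k. apply Rmult_le_pos; [apply pow_le, pos_INR|left; apply weight_pos].
        + apply Rmult_le_compat_l; [|lra].
          apply Rmult_le_pos; [lra|apply Rabs_pos].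
        + apply Rmult_le_compat_l; [apply Rabs_pos|apply Htp].
      - apply (is_RInt_minus (V := R_NormedModule)); [|exact Hg].
        apply (RInt_correct (V := R_CompleteNormedModule)), Hex1. }
    assert (Hfar : Rabs (RInt F tau PI) <= exp (- (a * tau)) / a + PI * e).
    { assert (Hi : is_RInt (fun t => exp (- (a * t)) + e) tau PI
        (minus (- exp (- (a * PI)) / a + e * PI) (- exp (- (a * tau)) / a + e * tau))).
      { apply (is_RInt_derive (fun t => - exp (- (a * t)) / a + e * t)).
        - intros x _. auto_derive; [exact I|field; lra].
        - intros x _. apply (ex_derive_continuous (fun t => exp (- (a * t)) + e)).
          auto_derive. exact I. }
      eapply Rle_trans.
      { apply (norm_RInt_le (V := R_NormedModule) F (fun t => exp (- (a * t)) + e)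
          tau PI _ _ (proj2 Htau)) with (3 := Hi).
        - intros t Ht. change (Rabs (F t) <= exp (- (a * t)) + e). unfold F.
          eapply Rle_trans; [apply Re_le_Cmod|].
          rewrite Cmod_mult, Cmod_cis, Rmult_1_r. apply Htail; [lia|exact Ht].
        - apply (RInt_correct (V := R_CompleteNormedModule)), Hex2. }
      unfold minus, plus, opp; simpl.
      assert (0 < exp (- (a * PI)) / a) by (apply Rdiv_lt_0_compat; [apply exp_pos|exact Ha]).
      assert (0 <= e * tau) by (apply Rmult_le_pos; lra).
      unfold Rdiv in *. lra. }
    assert (HCh : A * / pprod q (S N) (exp (- d)) = RInt F 0 tau + RInt F tau PI).
    { transitivity (RInt F 0 PI); symmetry.
      - exact (is_RInt_unique _ _ _ _ HF).
      - exact (RInt_Chasles F 0 tau PI Hex1 Hex2). }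
    rewrite HCh.
    replace (RInt F 0 tau + RInt F tau PI - gauss_int (B * tau) / B) with
      ((RInt F 0 tau - gauss_int (B * tau) / B) + RInt F tau PI) by ring.
    eapply Rle_trans; [apply Rabs_triang|]. apply Rplus_le_compat; [|exact Hfar].
    eapply Rle_trans; [exact Hnear|]. right. unfold K. ring.
  - apply (is_lim_seq_abs _ (Finite _)). apply is_lim_seq_minus'; [exact Hlim1|].
    apply is_lim_seq_const.
  - apply is_lim_seq_plus'; [|apply is_lim_seq_const].
    apply is_lim_seq_plus'; [apply is_lim_seq_plus'; [apply is_lim_seq_const|]|].
    + apply is_lim_seq_mult'; [|apply is_lim_seq_const].
      apply is_lim_seq_mult'; [apply is_lim_seq_const|].
      apply (is_lim_seq_abs _ (Finite _)).
      apply is_lim_seq_minus'; [exact Hlim2|apply is_lim_seq_const].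
    + apply is_lim_seq_mult'; [|apply is_lim_seq_const].
      apply (is_lim_seq_abs _ (Finite _)).
      apply is_lim_seq_minus'; [exact Hlim3|apply is_lim_seq_const].
Qed.

Lemma exp_neg_power_bound (c a m : R) : 0 < c -> 0 < a -> 0 < m ->
  exists C, 0 < C /\ forall d, 0 < d ->
    exp (- (c * Rpower d (- a))) <= C * Rpower d m.
Proof.
  intros Hc Ha Hm. set (s := m / a). assert (Hs : 0 < s) by (apply Rdiv_lt_0_compat; lra).
  exists (Rpower (c / s) (- s)). split; [apply Rpower_pos|]. intros d Hd.
  set (y := c * Rpower d (- a)).
  assert (Hy : 0 < y) by (apply Rmult_lt_0_compat; [exact Hc|apply Rpower_pos]).
  apply Rle_trans with (Rpower (y / s) (- s)).
  - assert (Hys : 0 < y / s) by (apply Rdiv_lt_0_compat; lra).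
    unfold Rpower at 1. apply exp_mono.
    assert (H : ln (y / s) <= y / s).
    { rewrite <- (ln_exp (y / s)) at 2. apply ln_le; [exact Hys|].
      generalize (exp_ge_1_plus (y / s)). lra. }
    apply (Rmult_le_compat_l s) in H; [|lra].
    replace (s * (y / s)) with y in H by (field; lra). lra.
  - right. unfold y. replace (c * Rpower d (- a) / s) with (c / s * Rpower d (- a))
      by (field; lra).
    rewrite Rpower_mult_base by (apply Rpower_pos || apply Rdiv_lt_0_compat; lra).
    rewrite Rpower_mult. do 2 f_equal. unfold s. field. lra.
Qed.

Lemma is_lim_seq_0_of_power_bound (u d : nat -> R) (C a d0 : R) :
  0 < a -> 0 < d0 -> (forall n, 0 < d n) -> is_lim_seq d 0 ->
  (forall n, d n <= d0 -> Rabs (u n) <= C * Rpower (d n) a) -> is_lim_seq u 0.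
Proof.
  intros Ha Hd0 Hp Hd H.
  apply is_lim_seq_abs_le with (fun n => C * Rpower (d n) a).
  - destruct (is_lim_seq_eventually_lt d 0 d0 Hd Hd0) as [N HN].
    exists N. intros n Hn. rewrite Rminus_0_r. apply H. left. now apply HN.
  - rewrite <- (Rmult_0_r C). apply (is_lim_seq_scal_l _ C 0).
    now apply is_lim_seq_Rpower_0.
Qed.

(** With [B n] the leading order of the standard deviation, the integral is cut at T / B. For fixed
    [T] all errors vanish as n grows; for instance the third moment contributes d^(-(4-q)) B^(-3),
    of order d^((1-q)/2). Only afterwards does [T] tend to infinity, through the integers. *)
Lemma local_limit (q : R) : 0 < q < 1 ->
  exists H0, 0 < H0 /\ forall d : nat -> R,
    (forall n, 0 < d n) -> is_lim_seq d 0 ->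
    is_lim_seq (fun n => (mean q (d n) - INR n) * Rpower (d n) ((3 - q) / 2)) 0 ->
    is_lim_seq (fun n => coefs q n * exp (- (INR n * d n)) * exp (- log_gf q (d n)) *
      Rpower (d n) (- ((3 - q) / 2))) H0.
Proof.
  intros Hq.
  destruct (gam_spec (3 - q) ltac:(lra)) as [Hsig _]. set (sig := gam (3 - q)) in *.
  set (sB := sqrt sig). assert (HsB : 0 < sB) by now apply sqrt_lt_R0.
  assert (HsB2 : sB * sB = sig) by (apply sqrt_sqrt; lra).
  destruct (charf_tail q Hq) as [c1 [c2 [Hc1 [Hc2 Htail]]]].
  destruct gauss_int_lim as [I0 [HI0 HI]].
  destruct (third_moment_upper q Hq) as [C3 [HC3 H3]].
  destruct (variance_asymp q Hq) as [Cv [HCv Hv]].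
  assert (HPI := PI_RGT_0).
  (* The exponent 3 only has to exceed (3 - q)/2, so that the bound still tends to 0 after
     multiplication by [B n]. *)
  destruct (exp_neg_power_bound c2 (1 - q) 3 Hc2 ltac:(lra) ltac:(lra)) as [Ce [HCe He]].
  exists (I0 * / (PI * sB)).
  split; [apply Rmult_lt_0_compat; [exact HI0|
    now apply Rinv_0_lt_compat, Rmult_lt_0_compat]|].
  intros d Hp Hd Hmean.
  set (B := fun n => sB * Rpower (d n) (- ((3 - q) / 2))).
  assert (HB : forall n, 0 < B n)
    by (intros n; apply Rmult_lt_0_compat; [exact HsB|apply Rpower_pos]).
  assert (HBinv : forall n, / B n = / sB * Rpower (d n) ((3 - q) / 2)).
  { intros n. unfold B. rewrite Rpower_Ropp. field. split; [lra|].
    apply Rgt_not_eq, Rpower_pos. }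
  assert (HB2 : forall n, B n ^ 2 = sig * Rpower (d n) (- (3 - q))).
  { intros n. unfold B. rewrite <- HsB2.
    replace (- (3 - q)) with (- ((3 - q) / 2) + - ((3 - q) / 2)) by field.
    rewrite Rpower_plus. ring. }
  set (X := fun n => PI * coefs q n * exp (- (INR n * d n)) * exp (- log_gf q (d n))).
  set (e1 := fun n => Series (fun k => INR (S k) ^ 3 * weight q (d n) k) * (/ B n) ^ 3).
  set (e2 := fun n => Rabs (mean q (d n) - INR n) * / B n).
  set (e3 := fun n => Rabs (variance q (d n) - B n ^ 2) * (/ B n) ^ 2).
  set (e4 := fun n => B n * exp (- (c2 * Rpower (d n) (- (1 - q))))).
  assert (L1 : is_lim_seq e1 0).
  { apply (is_lim_seq_0_of_power_bound e1 d (C3 * (/ sB) ^ 3) ((1 - q) / 2) 1);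
      [lra|lra|exact Hp|exact Hd|].
    intros n Hn. specialize (H3 (d n) (conj (Hp n) Hn)).
    assert (H0 : 0 <= Series (fun k => INR (S k) ^ 3 * weight q (d n) k)).
    { eapply Rle_trans; [|apply (sum_n_le_Series _ 0)].
      - rewrite sum_O. apply Rmult_le_pos; [apply pow_le, pos_INR|left; apply weight_pos].
      - intros k. apply Rmult_le_pos; [apply pow_le, pos_INR|left; apply weight_pos].
      - apply ex_series_pow_mult_weight, Hp. }
    unfold e1. assert (HBi : 0 <= (/ B n) ^ 3)
      by (apply pow_le; left; apply Rinv_0_lt_compat, HB).
    rewrite Rabs_pos_eq by (apply Rmult_le_pos; assumption).
    eapply Rle_trans; [apply Rmult_le_compat_r; [exact HBi|exact H3]|].
    right. rewrite HBinv, Rpow_mult_distr.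
    replace ((1 - q) / 2) with (- (4 - q) + ((3 - q) / 2 + ((3 - q) / 2 + (3 - q) / 2)))
      by field.
    rewrite !(Rpower_plus _ _ (d n)). ring. }
  assert (L2 : is_lim_seq e2 0).
  { apply is_lim_seq_ext with (fun n => / sB *
      Rabs ((mean q (d n) - INR n) * Rpower (d n) ((3 - q) / 2))).
    - intros n. unfold e2. rewrite HBinv, Rabs_mult.
      rewrite (Rabs_pos_eq (Rpower _ _)) by (left; apply Rpower_pos). ring.
    - rewrite <- (Rmult_0_r (/ sB)). apply (is_lim_seq_scal_l _ (/ sB) 0).
      rewrite <- Rabs_R0. exact (is_lim_seq_abs _ (Finite 0) Hmean). }
  assert (L3 : is_lim_seq e3 0).
  { apply (is_lim_seq_0_of_power_bound e3 d (Cv * (/ sB) ^ 2) q (/ 2));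
      [lra|lra|exact Hp|exact Hd|].
    intros n Hn. specialize (Hv (d n) (conj (Hp n) Hn)). fold sig in Hv.
    unfold e3. rewrite HB2, Rabs_mult, Rabs_Rabsolu.
    rewrite (Rabs_pos_eq ((/ B n) ^ 2)) by apply pow2_ge_0.
    eapply Rle_trans; [apply Rmult_le_compat_r; [apply pow2_ge_0|exact Hv]|].
    right. rewrite HBinv, Rpow_mult_distr.
    replace (Rpower (d n) q) with
      (Rpower (d n) (- (3 - 2 * q) + ((3 - q) / 2 + (3 - q) / 2))) by (f_equal; field).
    rewrite !(Rpower_plus _ _ (d n)). ring. }
  assert (L4 : is_lim_seq e4 0).
  { apply (is_lim_seq_0_of_power_bound e4 d (sB * Ce) ((3 + q) / 2) 1);
      [lra|lra|exact Hp|exact Hd|].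
    intros n _. specialize (He (d n) (Hp n)). unfold e4.
    rewrite Rabs_pos_eq by (apply Rmult_le_pos; [left; apply HB|left; apply exp_pos]).
    eapply Rle_trans; [apply Rmult_le_compat_l; [left; apply HB|exact He]|].
    right. unfold B.
    replace ((3 + q) / 2) with (- ((3 - q) / 2) + 3) by field.
    rewrite Rpower_plus. ring. }
  (* Rewrites the decay of [charf_tail] as c3 (B t)^2, which is at least c3 B t once B t >= 1. *)
  set (c3 := c1 / sig). assert (Hc3 : 0 < c3) by now apply Rdiv_lt_0_compat.
  assert (main : forall T, 1 <= T -> exists N, forall n, (N <= n)%nat ->
    Rabs (B n * X n - gauss_int T) <=
    T ^ 4 * e1 n + 2 * T ^ 2 * e2 n + T ^ 3 * e3 n + PI * e4 n + exp (- (c3 * T)) / c3).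
  { intros T HT.
    destruct (is_lim_seq_eventually_lt d 0 (/ 8) Hd ltac:(lra)) as [N1 HN1].
    assert (Ltau : is_lim_seq (fun n => T * / B n) 0).
    { apply is_lim_seq_ext with (fun n => T * / sB * Rpower (d n) ((3 - q) / 2)).
      - intros n. rewrite HBinv. ring.
      - rewrite <- (Rmult_0_r (T * / sB)). apply (is_lim_seq_scal_l _ (T * / sB) 0).
        apply is_lim_seq_Rpower_0; [lra|exact Hp|exact Hd]. }
    destruct (is_lim_seq_eventually_lt _ 0 PI Ltau HPI) as [N2 HN2].
    exists (max N1 N2). intros n Hn.
    specialize (HN1 n ltac:(lia)). specialize (HN2 n ltac:(lia)). cbv beta in HN2.
    assert (HBn := HB n). assert (Hpn := Hp n).
    assert (HBi : 0 < / B n) by now apply Rinv_0_lt_compat.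
    set (tau := T * / B n) in *.
    assert (Htau : B n * tau = T) by (unfold tau; field; lra).
    set (e := exp (- (c2 * Rpower (d n) (- (1 - q))))).
    assert (H := local_inequality q (d n) (B n) tau (c3 * B n) e n Hpn HBn).
    rewrite Htau in H.
    assert (Htau0 : 0 <= tau) by (unfold tau; nra).
    specialize (H (conj Htau0 (Rlt_le _ _ HN2)) ltac:(nra) (Rlt_le _ _ (exp_pos _))).
    assert (Ht : exists N0, forall N t, (N0 <= N)%nat -> tau <= t <= PI ->
      Cmod (charf q (d n) N t) <= exp (- (c3 * B n * t)) + e).
    { destruct (nfloor_ex (/ d n)) as [N0 [_ HN0]].
      { left. now apply Rinv_0_lt_compat. }
      exists (S N0). intros N t HN Ht.
      eapply Rle_trans; [apply Htail|].
      - lra.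
      - rewrite <- S_INR in HN0. left. apply Rlt_le_trans with (1 := HN0). now apply le_INR.
      - lra.
      - fold e. apply Rplus_le_compat_r, exp_mono, Ropp_le_contravar.
        replace (c1 * Rpower (d n) (- (3 - q)) * t ^ 2) with
          (c3 * ((B n * t) * (B n * t))).
        + assert (1 <= B n * t) by (rewrite <- Htau in HT; nra).
          rewrite Rmult_assoc. apply Rmult_le_compat_l; nra.
        + replace ((B n * t) * (B n * t)) with (B n ^ 2 * t ^ 2) by ring.
          rewrite HB2. unfold c3. field. lra. }
    specialize (H Ht).
    apply (Rmult_le_compat_l (B n)) in H; [|lra].
    fold (X n) in H.
    replace (B n * X n - gauss_int T) with (B n * (X n - gauss_int T / B n)) by (field; lra).
    rewrite Rabs_mult, (Rabs_pos_eq (B n)) by lra.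
    eapply Rle_trans; [exact H|]. right.
    unfold e1, e2, e3, e4. fold e.
    replace (c3 * B n * tau) with (c3 * T) by (rewrite <- Htau; ring).
    unfold tau. field. lra. }
  assert (Hlim : is_lim_seq (fun n => B n * X n) I0).
  { apply is_lim_seq_eps. intros eps Heps.
    destruct (proj1 (is_lim_seq_eps _ _) HI (eps / 3) ltac:(lra)) as [M1 HM1].
    assert (Hdec : is_lim_seq (fun m => exp (- (c3 * INR m)) / c3) 0).
    { apply is_lim_seq_abs_le with (fun m => / (c3 * c3) / INR (m + 0)).
      - exists 1%nat. intros m Hm. rewrite Nat.add_0_r.
        assert (Hm0 : 0 < INR m) by (apply lt_0_INR; lia).
        rewrite Rminus_0_r, Rabs_pos_eq
          by (left; apply Rdiv_lt_0_compat; [apply exp_pos|exact Hc3]).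
        rewrite exp_Ropp.
        apply Rle_trans with (/ (c3 * INR m) / c3).
        + apply Rmult_le_compat_r; [left; now apply Rinv_0_lt_compat|].
          apply Rinv_le_contravar; [nra|].
          generalize (exp_ge_1_plus (c3 * INR m)). lra.
        + right. field. lra.
      - apply (is_lim_seq_const_div_INR (/ (c3 * c3)) (fun m => (m + 0)%nat)). lia. }
    destruct (proj1 (is_lim_seq_eps _ _) Hdec (eps / 3) ltac:(lra)) as [M2 HM2].
    set (m := S (max M1 M2)).
    specialize (HM1 m ltac:(lia)). specialize (HM2 m ltac:(lia)).
    assert (HT : 1 <= INR m) by apply INR_S_ge_1.
    set (T := INR m) in *.
    destruct (main T HT) as [N1 HN1].
    assert (Lsum : is_lim_seq (fun n =>
      T ^ 4 * e1 n + 2 * T ^ 2 * e2 n + T ^ 3 * e3 n + PI * e4 n) 0).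
    { replace 0 with (T ^ 4 * 0 + 2 * T ^ 2 * 0 + T ^ 3 * 0 + PI * 0) by ring.
      repeat apply is_lim_seq_plus';
        apply (is_lim_seq_scal_l _ _ (Finite 0)); assumption. }
    destruct (is_lim_seq_eventually_lt _ 0 (eps / 3) Lsum ltac:(lra)) as [N2 HN2].
    exists (max N1 N2). intros n Hn.
    specialize (HN1 n ltac:(lia)). specialize (HN2 n ltac:(lia)). cbv beta in HN2.
    rewrite Rminus_0_r in HM2.
    assert (HM2' := Rle_lt_trans _ _ _ (Rle_abs _) HM2).
    replace (B n * X n - I0) with ((B n * X n - gauss_int T) + (gauss_int T - I0)) by ring.
    eapply Rle_lt_trans; [apply Rabs_triang|]. lra. }
  apply is_lim_seq_ext with (fun n => B n * X n * / (PI * sB)).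
  - intros n. unfold B, X. field. lra.
  - apply is_lim_seq_mult'; [exact Hlim|apply is_lim_seq_const].
Qed.

(** * Expansions at 0+ and the saddle point *)

Definition near0 (P : R -> Prop) : Prop := exists e, 0 < e /\ forall y, 0 < y < e -> P y.

Lemma near0_and (P Q : R -> Prop) : near0 P -> near0 Q -> near0 (fun y => P y /\ Q y).
Proof.
  intros [e [He H]] [e' [He' H']]. exists (Rmin e e').
  split; [now apply Rmin_glb_lt|]. intros y Hy.
  assert (H1 := Rmin_l e e'). assert (H2 := Rmin_r e e').
  split; [apply H|apply H']; lra.
Qed.

Lemma near0_impl (P Q : R -> Prop) :
  (forall y, 0 < y -> P y -> Q y) -> near0 P -> near0 Q.
Proof.
  intros HPQ [e [He H]]. exists e. split; [exact He|].
  intros y Hy. apply HPQ; [lra|auto].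
Qed.

Lemma near0_all (P : R -> Prop) : (forall y, 0 < y -> P y) -> near0 P.
Proof. intros H. exists 1. split; [lra|]. intros y Hy. apply H. lra. Qed.

Lemma near0_lt (e : R) : 0 < e -> near0 (fun y => y < e).
Proof. intros He. exists e. split; [exact He|]. intros y Hy. lra. Qed.

Definition order (m : nat) (g : R -> R) : Prop :=
  exists C, 0 <= C /\ near0 (fun y => Rabs (g y) <= C * y ^ m).

(** [g] has an asymptotic expansion at 0+ up to an error O(y^m). *)
Fixpoint expands (m : nat) (g : R -> R) : Prop :=
  match m with
  | O => order 0 g
  | S m' => exists (a : R) (h : R -> R),
      near0 (fun y => g y = a + y * h y) /\ expands m' h
  end.

Lemma order_ext (m : nat) (g g' : R -> R) :
  near0 (fun y => g y = g' y) -> order m g -> order m g'.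
Proof.
  intros He [C [HC H]]. exists C. split; [exact HC|].
  apply near0_impl with (2 := near0_and _ _ He H).
  intros y _ [E HE]. now rewrite <- E.
Qed.

Lemma expands_ext (m : nat) (g g' : R -> R) :
  near0 (fun y => g y = g' y) -> expands m g -> expands m g'.
Proof.
  destruct m as [|m]; [apply order_ext|]. intros He [a [h [H Hh]]].
  exists a, h. split; [|exact Hh].
  apply near0_impl with (2 := near0_and _ _ He H).
  intros y _ [E HE]. now rewrite <- E.
Qed.

Lemma expands_order_0 (m : nat) (g : R -> R) : expands m g -> order 0 g.
Proof.
  revert g. induction m as [|m IH]; intros g; [auto|].
  intros [a [h [H Hh]]]. destruct (IH h Hh) as [C [HC HCh]].
  exists (Rabs a + C). split; [generalize (Rabs_pos a); lra|].
  apply near0_impl with (2 := near0_and _ _ (near0_lt 1 Rlt_0_1) (near0_and _ _ H HCh)).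
  intros y Hy [Hy1 [E Hb]]. rewrite E. simpl in *.
  eapply Rle_trans; [apply Rabs_triang|]. rewrite Rabs_mult, (Rabs_pos_eq y) by lra.
  generalize (Rabs_pos (h y)). nra.
Qed.

Lemma expands_weaken (m : nat) (g : R -> R) : expands (S m) g -> expands m g.
Proof.
  revert g. induction m as [|m IH]; intros g Hg.
  - exact (expands_order_0 1 g Hg).
  - destruct Hg as [a [h [H Hh]]]. exists a, h. split; [exact H|now apply IH].
Qed.

Lemma expands_const (m : nat) (c : R) : expands m (fun _ => c).
Proof.
  revert c. induction m as [|m IH]; intros c.
  - exists (Rabs c). split; [apply Rabs_pos|]. apply near0_all. intros y _. simpl. lra.
  - exists c, (fun _ => 0). split; [|apply IH]. apply near0_all. intros y _. ring.
Qed.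

Lemma expands_shift (m : nat) (h : R -> R) :
  expands m h -> expands (S m) (fun y => y * h y).
Proof.
  intros H. exists 0, h. split; [|exact H]. apply near0_all. intros y _. ring.
Qed.

Lemma expands_shift_weak (m : nat) (h : R -> R) :
  expands m h -> expands m (fun y => y * h y).
Proof. intros H. now apply expands_weaken, expands_shift. Qed.

Lemma expands_plus (m : nat) (g g' : R -> R) :
  expands m g -> expands m g' -> expands m (fun y => g y + g' y).
Proof.
  revert g g'. induction m as [|m IH]; intros g g'.
  - intros [C [HC H]] [C' [HC' H']]. exists (C + C'). split; [lra|].
    apply near0_impl with (2 := near0_and _ _ H H').
    intros y _ [H1 H2]. eapply Rle_trans; [apply Rabs_triang|]. lra.
  - intros [a [h [H Hh]]] [a' [h' [H' Hh']]].
    exists (a + a'), (fun y => h y + h' y). split; [|now apply IH].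
    apply near0_impl with (2 := near0_and _ _ H H').
    intros y _ [-> ->]. ring.
Qed.

Lemma expands_mult (m : nat) (g g' : R -> R) :
  expands m g -> expands m g' -> expands m (fun y => g y * g' y).
Proof.
  revert g g'. induction m as [|m IH]; intros g g'.
  - intros [C [HC H]] [C' [HC' H']]. exists (C * C'). split; [nra|].
    apply near0_impl with (2 := near0_and _ _ H H').
    intros y _ [H1 H2]. simpl in *. rewrite Rabs_mult, Rmult_1_r in *.
    apply Rmult_le_compat; try apply Rabs_pos; assumption || lra.
  - intros [a [h [H Hh]]] [a' [h' [H' Hh']]].
    exists (a * a'), (fun y => (a * h' y + a' * h y) + y * (h y * h' y)). split.
    + apply near0_impl with (2 := near0_and _ _ H H').
      intros y _ [-> ->]. ring.
    + apply expands_plus.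
      * apply expands_plus; apply IH; assumption || apply expands_const.
      * apply expands_shift_weak. now apply IH.
Qed.

Lemma expands_id (m : nat) : expands m (fun y => y).
Proof.
  apply expands_ext with (fun y => y * 1).
  - apply near0_all. intros y _. ring.
  - apply expands_shift_weak, expands_const.
Qed.

Lemma expands_pow (m n : nat) (g : R -> R) :
  expands m g -> expands m (fun y => g y ^ n).
Proof.
  intros H. induction n as [|n IH]; simpl; [apply expands_const|].
  now apply expands_mult.
Qed.

Lemma expands_sum_n (m n : nat) (f : nat -> R -> R) :
  (forall i, (i <= n)%nat -> expands m (f i)) ->
  expands m (fun y => sum_n (fun i => f i y) n).
Proof.
  intros H. induction n as [|n IH].
  - apply expands_ext with (f 0%nat); [|auto].
    apply near0_all. intros y _. now rewrite sum_O.
  - apply expands_ext with (fun y => sum_n (fun i => f i y) n + f (S n) y).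
    + apply near0_all. intros y _. now rewrite sum_Sn_R.
    + apply expands_plus; auto.
Qed.

Lemma expands_of_order (m : nat) (g : R -> R) : order m g -> expands m g.
Proof.
  revert g. induction m as [|m IH]; intros g [C [HC H]].
  - exists C. auto.
  - exists 0, (fun y => g y / y). split.
    + apply near0_all. intros y Hy. field. lra.
    + apply IH. exists C. split; [exact HC|].
      apply near0_impl with (2 := H). intros y Hy Hb.
      unfold Rdiv. rewrite Rabs_mult, (Rabs_pos_eq (/ y))
        by (left; now apply Rinv_0_lt_compat).
      apply (Rmult_le_compat_r (/ y)) in Hb; [|left; now apply Rinv_0_lt_compat].
      eapply Rle_trans; [exact Hb|]. right. simpl. field. lra.
Qed.

Lemma expands_coefficients (m : nat) (g : R -> R) : expands (S m) g ->
  exists a : nat -> R, order (S m) (fun y => g y - sum_n (fun i => a i * y ^ i) m).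
Proof.
  revert g. induction m as [|m IH]; intros g [a [h [H Hh]]].
  - destruct Hh as [C [HC Hb]]. exists (fun _ => a), C. split; [exact HC|].
    apply near0_impl with (2 := near0_and _ _ H Hb). intros y Hy [E Hc].
    rewrite sum_O, E. simpl in *.
    replace (a + y * h y - a * 1) with (y * h y) by ring.
    rewrite Rabs_mult, (Rabs_pos_eq y) by lra. nra.
  - destruct (IH h Hh) as [b [C [HC Hb]]].
    exists (fun i => match i with O => a | S i' => b i' end), C. split; [exact HC|].
    apply near0_impl with (2 := near0_and _ _ H Hb). intros y Hy [E Hc].
    assert (Es : sum_n (fun i => match i with O => a | S i' => b i' end * y ^ i) (S m) =
      a + y * sum_n (fun i => b i * y ^ i) m).
    { clear. induction m as [|m IHm].
      - rewrite sum_Sn_R, !sum_O. simpl. ring.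
      - rewrite sum_Sn_R, IHm, (sum_Sn_R _ m). simpl. ring. }
    rewrite Es, E.
    replace (a + y * h y - (a + y * sum_n (fun i => b i * y ^ i) m)) with
      (y * (h y - sum_n (fun i => b i * y ^ i) m)) by ring.
    rewrite Rabs_mult, (Rabs_pos_eq y) by lra.
    apply (Rmult_le_compat_l y) in Hc; [|lra].
    eapply Rle_trans; [exact Hc|]. right. simpl. ring.
Qed.

(** * Powers of expandable functions *)

Lemma mean_value_bound (f f' : R -> R) (a b K : R) :
  (forall x, Rmin a b <= x <= Rmax a b -> is_derive f x (f' x)) ->
  (forall x, Rmin a b <= x <= Rmax a b -> Rabs (f' x) <= K) ->
  Rabs (f b - f a) <= K * Rabs (b - a).
Proof.
  intros Hd HK. destruct (MVT_gen f a b f') as [c [Hc E]].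
  - intros x Hx. apply Hd. lra.
  - intros x Hx. apply continuity_pt_filterlim, (ex_derive_continuous f).
    exists (f' x). now apply Hd.
  - rewrite E, Rabs_mult. apply Rmult_le_compat_r; [apply Rabs_pos|]. now apply HK.
Qed.

Lemma Rpower_bounded (a b s : R) : 0 < a -> forall x, a <= x <= b ->
  Rpower x s <= Rpower a s + Rpower b s.
Proof.
  intros Ha x Hx. assert (H1 := Rpower_pos a s). assert (H2 := Rpower_pos b s).
  destruct (Rle_dec 0 s) as [Hs|Hs].
  - assert (Rpower x s <= Rpower b s) by (apply Rle_Rpower_l; lra). lra.
  - replace s with (- (- s)) by ring.
    assert (Rpower x (- (- s)) <= Rpower a (- (- s)))
      by (apply Rpower_neg_antitone; lra).
    replace (- (- s)) with s in * by ring. lra.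
Qed.

Lemma Rpower_lipschitz (a b s : R) : 0 < a ->
  exists L, 0 <= L /\ forall x y, a <= x <= b -> a <= y <= b ->
    Rabs (Rpower x s - Rpower y s) <= L * Rabs (x - y).
Proof.
  intros Ha. exists (Rabs s * (Rpower a (s - 1) + Rpower b (s - 1))).
  split.
  - apply Rmult_le_pos; [apply Rabs_pos|].
    generalize (Rpower_pos a (s - 1)) (Rpower_pos b (s - 1)). lra.
  - intros x y Hx Hy.
    assert (Hm : forall z, Rmin y x <= z <= Rmax y x -> a <= z <= b).
    { intros z. unfold Rmin, Rmax. destruct Rle_dec; lra. }
    apply (mean_value_bound (fun t => Rpower t s) (fun t => s * Rpower t (s - 1))).
    + intros z Hz. apply is_derive_Rpower. specialize (Hm z Hz). lra.
    + intros z Hz. rewrite Rabs_mult, (Rabs_pos_eq (Rpower _ _))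
        by (left; apply Rpower_pos).
      apply Rmult_le_compat_l; [apply Rabs_pos|]. apply Rpower_bounded; auto.
Qed.

(** Induction on the order for all exponents simultaneously: the derivative has exponent s - 1, and
    its expansion is integrated term by term. The restriction |t| <= a/2 keeps the base away from
    0. *)
Lemma Rpower_taylor (a : R) (m : nat) (s : R) : 0 < a ->
  exists (c : nat -> R) (C : R), 0 <= C /\ forall t, Rabs t <= a / 2 ->
    Rabs (Rpower (a + t) s - sum_n (fun i => c i * t ^ i) m) <= C * Rabs t ^ S m.
Proof.
  intros Ha. revert s. induction m as [|m IH]; intros s.
  - destruct (Rpower_lipschitz (a / 2) (2 * a) s ltac:(lra)) as [L [HL H]].
    exists (fun _ => Rpower a s), L. split; [exact HL|]. intros t Ht.
    apply Rabs_le_between in Ht. rewrite sum_O. simpl. rewrite !Rmult_1_r.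
    replace t with (a + t - a) at 2 by ring. apply H; lra.
  - destruct (IH (s - 1)) as [c [C [HC H]]].
    exists (fun i => match i with O => Rpower a s | S j => s * c j / INR (S j) end),
      (Rabs s * C).
    split; [apply Rmult_le_pos; [apply Rabs_pos|exact HC]|]. intros t Ht.
    set (c' := fun i => match i with O => Rpower a s | S j => s * c j / INR (S j) end).
    assert (E : forall u, sum_n (fun i => c' i * u ^ i) (S m) =
      Rpower a s + sum_n (fun i => s * c i / INR (S i) * u ^ S i) m).
    { intros u. clear. induction m as [|m IHm].
      - rewrite sum_Sn_R, !sum_O. unfold c'. simpl. ring.
      - rewrite sum_Sn_R, IHm, (sum_Sn_R _ m). unfold c'. eq_R; ring. }
    set (f := fun u => Rpower (a + u) s -
      sum_n (fun i => s * c i / INR (S i) * u ^ S i) m).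
    assert (Hf0 : f 0 = Rpower a s).
    { unfold f. rewrite Rplus_0_r, (sum_n_ext _ (fun _ => 0)).
      - rewrite sum_n_const. ring.
      - intros i. rewrite pow_i by lia. eq_R. ring. }
    rewrite E.
    replace (Rpower (a + t) s -
      (Rpower a s + sum_n (fun i => s * c i / INR (S i) * t ^ S i) m)) with (f t - f 0)
      by (rewrite Hf0; unfold f; ring).
    replace (Rabs s * C * Rabs t ^ S (S m)) with
      (Rabs s * (C * Rabs t ^ S m) * Rabs (t - 0))
      by (rewrite Rminus_0_r; simpl; ring).
    assert (Hu : forall u, Rmin 0 t <= u <= Rmax 0 t -> Rabs u <= Rabs t).
    { intros u. unfold Rmin, Rmax, Rabs.
      destruct Rle_dec; destruct (Rcase_abs u); destruct (Rcase_abs t); lra. }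
    apply (mean_value_bound f (fun u => s * (Rpower (a + u) (s - 1) -
      sum_n (fun i => c i * u ^ i) m))).
    + intros u Hu0. specialize (Hu u Hu0).
      assert (Hu1 : Rabs u <= a / 2) by lra. apply Rabs_le_between in Hu1.
      assert (D1 : is_derive (fun v => Rpower (a + v) s) u (s * Rpower (a + u) (s - 1))).
      { replace (s * Rpower (a + u) (s - 1)) with (scal 1 (s * Rpower (a + u) (s - 1)))
          by (unfold scal; simpl; unfold mult; simpl; ring).
        apply (is_derive_comp (fun v => Rpower v s) (fun v => a + v)).
        - apply is_derive_Rpower. lra.
        - auto_derive; [exact I|ring]. }
      assert (D2 : is_derive (fun v => sum_n (fun i => s * c i / INR (S i) * v ^ S i) m) u
        (sum_n (fun i => s * (c i * u ^ i)) m)).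
      { apply (is_derive_sum_n (V := R_NormedModule)
          (fun i v => s * c i / INR (S i) * v ^ S i)).
        intros i _. replace (s * (c i * u ^ i)) with
          (s * c i / INR (S i) * (INR (S i) * u ^ i)).
        - apply is_derive_pow_S.
        - field. apply Rgt_not_eq, INR_S_pos. }
      assert (E2 : sum_n (fun i => s * (c i * u ^ i)) m =
        s * sum_n (fun i => c i * u ^ i) m)
        by exact (sum_n_mult_l (K := R_Ring) s (fun i => c i * u ^ i) m).
      rewrite Rmult_minus_distr_l, <- E2.
      exact (is_derive_minus (V := R_NormedModule) _ _ u _ _ D1 D2).
    + intros u Hu0. specialize (Hu u Hu0). rewrite Rabs_mult.
      apply Rmult_le_compat_l; [apply Rabs_pos|].
      eapply Rle_trans; [apply H; lra|].
      apply Rmult_le_compat_l; [exact HC|].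
      apply pow_incr. split; [apply Rabs_pos|exact Hu].
Qed.

Lemma order_mult_bounded (m n : nat) (g h : R -> R) :
  order m g -> order n h -> order (m + n) (fun y => g y * h y).
Proof.
  intros [C [HC H]] [C' [HC' H']]. exists (C * C'). split; [nra|].
  apply near0_impl with (2 := near0_and _ _ H H').
  intros y Hy [H1 H2]. rewrite Rabs_mult, pow_add.
  replace (C * C' * (y ^ m * y ^ n)) with ((C * y ^ m) * (C' * y ^ n)) by ring.
  apply Rmult_le_compat; try apply Rabs_pos; assumption.
Qed.

Lemma order_weaken (m n : nat) (g : R -> R) : (n <= m)%nat -> order m g -> order n g.
Proof.
  intros Hmn [C [HC H]]. exists C. split; [exact HC|].
  apply near0_impl with (2 := near0_and _ _ (near0_lt 1 Rlt_0_1) H).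
  intros y Hy [Hy1 Hb]. eapply Rle_trans; [exact Hb|].
  apply Rmult_le_compat_l; [exact HC|].
  replace m with (n + (m - n))%nat by lia. rewrite pow_add.
  rewrite <- (Rmult_1_r (y ^ n)) at 2. apply Rmult_le_compat_l; [apply pow_le; lra|].
  rewrite <- (pow1 (m - n)). apply pow_incr. lra.
Qed.

Lemma order_1_small (g : R -> R) (e : R) : 0 < e -> order 1 g ->
  near0 (fun y => Rabs (g y) <= e).
Proof.
  intros He [C [HC H]].
  assert (He' : 0 < e / (C + 1)) by (apply Rdiv_lt_0_compat; lra).
  apply near0_impl with (2 := near0_and _ _ (near0_lt _ He') H).
  intros y Hy [H1 H2]. eapply Rle_trans; [exact H2|]. rewrite pow_1.
  apply Rlt_div_r in H1; [|lra]. nra.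
Qed.

(** A Taylor polynomial in g - a is expandable, and its error is O(y^(m+1)) because g - a is
    O(y). *)
Lemma expands_Rpower (m : nat) (g : R -> R) (a s : R) : 0 < a ->
  expands m g -> order 1 (fun y => g y - a) -> expands m (fun y => Rpower (g y) s).
Proof.
  intros Ha Hg Ho. destruct (Rpower_taylor a m s Ha) as [c [C [HC H]]].
  set (t := fun y => g y - a).
  set (p := fun y => sum_n (fun i => c i * t y ^ i) m).
  assert (Ht : expands m t).
  { apply (expands_plus m g (fun _ => - a)); [exact Hg|apply expands_const]. }
  apply expands_ext with (fun y => p y + (Rpower (g y) s - p y)).
  - apply near0_all. intros y _. ring.
  - apply expands_plus.
    + unfold p. apply expands_sum_n. intros i _.
      apply expands_mult; [apply expands_const|now apply expands_pow].
    + apply expands_of_order.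
      assert (Hpow : forall n, order n (fun y => t y ^ n)).
      { induction n as [|n IH].
        - exists 1. split; [lra|]. apply near0_all. intros y _. simpl.
          rewrite Rabs_R1. lra.
        - exact (order_mult_bounded 1 n _ _ Ho IH). }
      apply order_weaken with (S m); [lia|].
      destruct (Hpow (S m)) as [C' [HC' H']].
      exists (C * C'). split; [nra|].
      apply near0_impl with
        (2 := near0_and _ _ (order_1_small _ (a / 2) ltac:(lra) Ho) H').
      intros y Hy [H1 H2]. fold (t y) in H1.
      specialize (H (t y) H1). replace (a + t y) with (g y) in H by (unfold t; ring).
      eapply Rle_trans; [exact H|]. rewrite Rmult_assoc.
      apply Rmult_le_compat_l; [exact HC|]. rewrite RPow_abs. exact H2.
Qed.

(** * The approximate saddle point *)

Lemma poly_lipschitz (b : nat -> R) (n : nat) :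
  exists L, 0 <= L /\ forall v w, Rabs v <= 1 -> Rabs w <= 1 ->
    Rabs (sum_n (fun i => b i * v ^ i) n - sum_n (fun i => b i * w ^ i) n) <=
    L * Rabs (v - w).
Proof.
  assert (Hpow : forall i v w, Rabs v <= 1 -> Rabs w <= 1 ->
    Rabs (v ^ i - w ^ i) <= INR i * Rabs (v - w)).
  { intros i v w Hv Hw. induction i as [|i IH].
    - simpl. rewrite Rminus_diag, Rabs_R0. lra.
    - replace (v ^ S i - w ^ S i) with (v * (v ^ i - w ^ i) + w ^ i * (v - w))
        by (simpl; ring).
      eapply Rle_trans; [apply Rabs_triang|]. rewrite !Rabs_mult, S_INR.
      assert (H1 : Rabs (w ^ i) <= 1).
      { rewrite <- RPow_abs, <- (pow1 i). apply pow_incr. split; [apply Rabs_pos|exact Hw]. }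
      assert (H2 := Rabs_pos (v - w)). assert (H3 := Rabs_pos (v ^ i - w ^ i)).
      nra. }
  induction n as [|n [L [HL IH]]].
  - exists 0. split; [lra|]. intros v w _ _. rewrite !sum_O. simpl.
    rewrite Rminus_diag, Rabs_R0. lra.
  - exists (L + Rabs (b (S n)) * INR (S n)).
    split; [apply Rplus_le_le_0_compat; [exact HL|
      apply Rmult_le_pos; [apply Rabs_pos|apply pos_INR]]|].
    intros v w Hv Hw. rewrite !sum_Sn_R.
    replace (sum_n (fun i => b i * v ^ i) n + b (S n) * v ^ S n -
      (sum_n (fun i => b i * w ^ i) n + b (S n) * w ^ S n)) with
      ((sum_n (fun i => b i * v ^ i) n - sum_n (fun i => b i * w ^ i) n) +
       b (S n) * (v ^ S n - w ^ S n)) by ring.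
    eapply Rle_trans; [apply Rabs_triang|]. rewrite Rmult_plus_distr_r, Rabs_mult.
    apply Rplus_le_compat; [now apply IH|]. rewrite Rmult_assoc.
    apply Rmult_le_compat_l; [apply Rabs_pos|now apply Hpow].
Qed.

(** Fixed-point iteration for [a = sum_i b_i (y a^s)^i]: each step gains a factor
    y in the error. *)
Fixpoint iterate (b : nat -> R) (n : nat) (s : R) (k : nat) (y : R) : R :=
  match k with
  | O => b 0%nat
  | S k' => sum_n (fun i => b i * (y * Rpower (iterate b n s k' y) s) ^ i) n
  end.

(** Near 0 all iterates lie between b_0/2 and 2 b_0, where the power x^s is Lipschitz, and the
    arguments y x^s lie in [0, 1], where the polynomial is Lipschitz. The gained factor y is the one
    in these arguments. *)
Lemma iterate_spec (b : nat -> R) (n : nat) (s : R) (k : nat) : 0 < b 0%nat ->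
  (forall m, expands m (iterate b n s k)) /\
  order 1 (fun y => iterate b n s k y - b 0%nat) /\
  order (S k) (fun y => iterate b n s (S k) y - iterate b n s k y).
Proof.
  intros Hb.
  destruct (poly_lipschitz b n) as [L [HL Hlip]].
  destruct (Rpower_lipschitz (b 0%nat / 2) (2 * b 0%nat) s ltac:(lra)) as [L' [HL' Hlip']].
  assert (Hs0 : sum_n (fun i => b i * 0 ^ i) n = b 0%nat).
  { clear. induction n as [|n IH]; [rewrite sum_O; simpl; eq_R; ring|].
    rewrite sum_Sn_R, IH, pow_i by lia. eq_R; ring. }
  set (P := Rpower (b 0%nat / 2) s + Rpower (2 * b 0%nat) s).
  assert (HP : 0 < P).
  { unfold P. generalize (Rpower_pos (b 0%nat / 2) s) (Rpower_pos (2 * b 0%nat) s). lra. }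
  assert (range : forall g, order 1 (fun y => g y - b 0%nat) ->
    near0 (fun y => b 0%nat / 2 <= g y <= 2 * b 0%nat)).
  { intros g Hg. apply near0_impl with (2 := order_1_small _ (b 0%nat / 2) ltac:(lra) Hg).
    intros y _ H. apply Rabs_le_between in H. lra. }
  assert (small : near0 (fun y => y * P <= 1)).
  { apply near0_impl with (2 := near0_lt (/ P) (Rinv_0_lt_compat _ HP)).
    intros y Hy H. apply (Rmult_lt_compat_r P) in H; [|exact HP].
    rewrite Rinv_l in H by lra. lra. }
  assert (arg : forall y x, 0 < y -> y * P <= 1 -> b 0%nat / 2 <= x <= 2 * b 0%nat ->
    Rabs (y * Rpower x s) <= 1).
  { intros y x Hy Hs Hx. rewrite Rabs_pos_eq
      by (apply Rmult_le_pos; [lra|left; apply Rpower_pos]).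
    assert (H := Rpower_bounded (b 0%nat / 2) (2 * b 0%nat) s ltac:(lra) x Hx).
    fold P in H. nra. }
  assert (first : forall g, order 1 (fun y => g y - b 0%nat) ->
    order 1 (fun y => sum_n (fun i => b i * (y * Rpower (g y) s) ^ i) n - b 0%nat)).
  { intros g Hg. exists (L * P). split; [nra|].
    apply near0_impl with (2 := near0_and _ _ small (range g Hg)).
    intros y Hy [Hsm Hr]. rewrite <- Hs0.
    eapply Rle_trans; [apply Hlip; [now apply arg|rewrite Rabs_R0; lra]|].
    rewrite Rmult_assoc. apply Rmult_le_compat_l; [exact HL|].
    rewrite Rminus_0_r, pow_1, Rabs_pos_eq
      by (apply Rmult_le_pos; [lra|left; apply Rpower_pos]).
    rewrite Rmult_comm. apply Rmult_le_compat_r; [lra|].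
    now apply Rpower_bounded; [lra|]. }
  induction k as [|k [IH1 [IH2 IH3]]].
  - assert (H0 : order 1 (fun y => iterate b n s 0 y - b 0%nat)).
    { exists 0. split; [lra|]. apply near0_all. intros y _. simpl.
      rewrite Rminus_diag, Rabs_R0. lra. }
    split; [intros m; exact (expands_const m (b 0%nat))|]. split; [exact H0|].
    exact (first (iterate b n s 0) H0).
  - assert (H1 : order 1 (fun y => iterate b n s (S k) y - b 0%nat))
      by exact (first _ IH2).
    split; [|split; [exact H1|]].
    + intros m. cbn [iterate]. apply expands_sum_n. intros i _.
      apply expands_mult; [apply expands_const|]. apply expands_pow.
      apply expands_mult; [apply expands_id|].
      apply expands_Rpower with (b 0%nat); auto.
    + destruct IH3 as [C [HC H3]]. exists (L * (L' * C)).
      split; [apply Rmult_le_pos; [exact HL|nra]|].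
      apply near0_impl with (2 := near0_and _ _ (near0_and _ _ small H3)
        (near0_and _ _ (range _ IH2) (range _ H1))).
      intros y Hy [[Hsm Hd] [Hr Hr1]].
      set (x := iterate b n s k y) in *. set (x1 := iterate b n s (S k) y) in *.
      change (iterate b n s (S (S k)) y) with
        (sum_n (fun i => b i * (y * Rpower x1 s) ^ i) n).
      change x1 with (sum_n (fun i => b i * (y * Rpower x s) ^ i) n) at 2.
      eapply Rle_trans; [apply Hlip; now apply arg|].
      rewrite Rmult_assoc. apply Rmult_le_compat_l; [exact HL|].
      replace (y * Rpower x1 s - y * Rpower x s) with (y * (Rpower x1 s - Rpower x s))
        by ring.
      rewrite Rabs_mult, (Rabs_pos_eq y) by lra.
      apply Rle_trans with (y * (L' * (C * y ^ S k))); [|right; simpl; ring].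
      apply Rmult_le_compat_l; [lra|].
      eapply Rle_trans; [apply (Hlip' x1 x Hr1 Hr)|].
      apply Rmult_le_compat_l; assumption.
Qed.

(** Multiplied by u^(2-q), the equation becomes u^(2-q) = sum_i b_i (y u^q)^i. In the unknown a =
    u^(2-q) this is the fixed-point equation of [iterate] with s = q/(2-q), and [m] iterations give
    the required order. *)
Lemma saddle_point (q : R) (b : nat -> R) (n m : nat) : 0 < q < 1 -> 0 < b 0%nat ->
  exists (u : R -> R) (u0 : R), 0 < u0 /\ order 1 (fun y => u y - u0) /\
    (forall k, expands k u) /\ (forall y, 0 < u y) /\
    order m (fun y => sum_n (fun i =>
      b i * y ^ i * Rpower (u y) (- (2 - q * INR (S i)))) n - 1).
Proof.
  intros Hq Hb. set (s := q / (2 - q)).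
  destruct (iterate_spec b n s m Hb) as [H1 [H2 H3]].
  set (a := iterate b n s m) in *. set (p := / (2 - q)).
  exists (fun y => Rpower (a y) p), (Rpower (b 0%nat) p).
  split; [apply Rpower_pos|].
  assert (Ha : near0 (fun y => b 0%nat / 2 <= a y <= 2 * b 0%nat)).
  { apply near0_impl with (2 := order_1_small _ (b 0%nat / 2) ltac:(lra) H2).
    intros y _ H. apply Rabs_le_between in H. lra. }
  split; [|split; [|split; [intros y; apply Rpower_pos|]]].
  - destruct (Rpower_lipschitz (b 0%nat / 2) (2 * b 0%nat) p ltac:(lra)) as [L [HL Hl]].
    destruct H2 as [C [HC Hc]]. exists (L * C). split; [nra|].
    apply near0_impl with (2 := near0_and _ _ Ha Hc). intros y Hy [Hr Hd].
    eapply Rle_trans; [apply Hl; [exact Hr|lra]|]. rewrite Rmult_assoc.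
    apply Rmult_le_compat_l; assumption.
  - intros k. apply expands_Rpower with (b 0%nat); auto.
  - destruct H3 as [C [HC Hc]]. exists (C * / (b 0%nat / 2)).
    split; [apply Rmult_le_pos; [exact HC|left; apply Rinv_0_lt_compat; lra]|].
    apply near0_impl with
      (2 := near0_and _ _ (near0_and _ _ (near0_lt 1 Rlt_0_1) Ha) Hc).
    intros y Hy [[Hy1 Hr] Hd].
    assert (E : sum_n (fun i =>
      b i * y ^ i * Rpower (Rpower (a y) p) (- (2 - q * INR (S i)))) n =
      / a y * iterate b n s (S m) y).
    { cbn [iterate]. fold a.
      transitivity (sum_n (fun i => / a y * (b i * (y * Rpower (a y) s) ^ i)) n).
      - apply sum_n_ext. intros i. rewrite Rpow_mult_distr, <- (Rpower_pow i (Rpower (a y) s))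
          by apply Rpower_pos.
        rewrite !Rpower_mult, <- (Rpower_m1 (a y)) by lra.
        replace (p * - (2 - q * INR (S i))) with (Ropp 1 + s * INR i)
          by (unfold p, s; rewrite S_INR; field; lra).
        rewrite Rpower_plus. eq_R. ring.
      - exact (sum_n_mult_l (K := R_Ring) (/ a y) _ n). }
    rewrite E. fold (a y) in Hd.
    replace (/ a y * iterate b n s (S m) y - 1) with
      ((iterate b n s (S m) y - a y) * / a y) by (field; lra).
    rewrite Rabs_mult, (Rabs_pos_eq (/ a y)) by (left; apply Rinv_0_lt_compat; lra).
    replace (C * / (b 0%nat / 2) * y ^ m) with (C * y ^ m * / (b 0%nat / 2)) by ring.
    apply Rmult_le_compat; [apply Rabs_pos|left; apply Rinv_0_lt_compat; lra| |].
    + eapply Rle_trans; [exact Hd|]. apply Rmult_le_compat_l; [exact HC|].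
      simpl. assert (0 <= y ^ m) by (apply pow_le; lra). nra.
    + apply Rinv_le_contravar; lra.
Qed.

(** * The exponents lambda_s *)

Lemma sorted_insert (a : R) (l : list R) : StronglySorted Rlt l ->
  exists l', StronglySorted Rlt l' /\ forall x, In x l' <-> x = a \/ In x l.
Proof.
  induction l as [|b l IH]; intros Hl.
  - exists (a :: nil). split; [repeat constructor|]. intros x. simpl. intuition.
  - apply StronglySorted_inv in Hl. destruct Hl as [Hl Hb].
    destruct (Rtotal_order a b) as [Hab|[->|Hab]].
    + exists (a :: b :: l). split.
      * constructor; [now constructor|]. constructor; [exact Hab|].
        apply Forall_impl with (2 := Hb). intros x. lra.
      * intros x. simpl. intuition.
    + exists (b :: l). split; [now constructor|]. intros x. simpl. intuition.
    + destruct (IH Hl) as [l' [Hl' Hin]]. exists (b :: l'). split.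
      * constructor; [exact Hl'|]. apply Forall_forall. intros x Hx.
        apply Hin in Hx. destruct Hx as [->|Hx]; [exact Hab|].
        rewrite Forall_forall in Hb. now apply Hb.
      * intros x. simpl. rewrite Hin. intuition.
Qed.

(** [P] need not be decidable: membership of each entry of [l] is settled by excluded middle. *)
Lemma finite_sorted_list (l : list R) (P : R -> Prop) : (forall x, P x -> In x l) ->
  exists lam, StronglySorted Rlt lam /\ forall x, In x lam <-> P x.
Proof.
  revert P. induction l as [|a l IH]; intros P HP.
  - exists nil. split; [constructor|]. intros x. split; [intros []|apply HP].
  - destruct (IH (fun x => P x /\ x <> a)) as [lam [Hs Hin]].
    + intros x [Hx Hne]. destruct (HP x Hx) as [E|H]; [congruence|exact H].
    + destruct (classic (P a)) as [Ha|Ha].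
      * destruct (sorted_insert a lam Hs) as [l' [Hs' Hin']]. exists l'.
        split; [exact Hs'|]. intros x. rewrite Hin', Hin.
        destruct (Req_dec x a) as [->|Hne]; intuition.
      * exists lam. split; [exact Hs|]. intros x. rewrite Hin. split; [tauto|].
        intros Hx. split; [exact Hx|]. now intros ->.
Qed.

Lemma rho_top (q : R) (r : nat) : (1 <= r)%nat -> rho q r r = 1 - q.
Proof. intros Hr. destruct r as [|r]; [lia|]. unfold rho. ring. Qed.

Lemma rho_gap (q : R) (r k : nat) : (k < r)%nat ->
  exists I J : nat, rho q r r - rho q r k = INR I * q + INR J * (1 - q).
Proof.
  intros Hk. rewrite rho_top by lia. destruct k as [|k].
  - exists 0%nat, 1%nat. simpl. ring.
  - exists (r - S k)%nat, 0%nat. rewrite minus_INR by lia.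
    change (rho q r (S k)) with (1 - q * (INR r - INR (S k) + 1)).
    change (INR 0) with 0. ring.
Qed.

(** The gaps rho_r - rho_k are 1 - q for k = 0 and (r - k) q otherwise. Placing the exponents on a
    lattice reduces their finiteness to boundedness. *)
Lemma Upsilon_grid (q : R) (r : nat) (x : R) : (1 <= r)%nat -> Upsilon q r x ->
  exists I J : nat, x = INR I * q + INR J * (1 - q).
Proof.
  intros Hr [[[d [_ ->]] _]|[k [Hk ->]]]; [|now apply rho_gap].
  assert (H : forall n, (n < r)%nat -> exists I J : nat,
    sum_n_m (fun k => INR (d k) * (rho q r r - rho q r k)) 0 n =
    INR I * q + INR J * (1 - q)).
  { induction n as [|n IH]; intros Hn.
    - rewrite sum_n_n. destruct (rho_gap q r 0 Hn) as [I [J ->]].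
      exists (d 0 * I)%nat, (d 0 * J)%nat. rewrite !mult_INR. eq_R. ring.
    - destruct IH as [I [J E]]; [lia|].
      destruct (rho_gap q r (S n) Hn) as [I' [J' E']].
      exists (I + d (S n) * I')%nat, (J + d (S n) * J')%nat.
      rewrite sum_n_Sm by lia. rewrite E, E'.
      rewrite !plus_INR, !mult_INR. unfold plus; simpl AbelianMonoid.plus.
      change (INR I * q + INR J * (1 - q) +
        INR (d (S n)) * (INR I' * q + INR J' * (1 - q)) =
        (INR I + INR (d (S n)) * INR I') * q +
        (INR J + INR (d (S n)) * INR J') * (1 - q)). ring. }
  apply H. lia.
Qed.

(** All elements are at most 2, which bounds both lattice coordinates. *)
Lemma exists_lambdas (q : R) (r : nat) : 0 < q < 1 -> (1 <= r)%nat ->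
  q * INR r < 1 -> exists lam, is_lambdas q r lam.
Proof.
  intros Hq Hr Hqr.
  assert (Hbig : forall y, 0 < y -> exists M, forall n, INR n * y <= 2 -> (n <= M)%nat).
  { intros y Hy. destruct (nfloor_ex (2 / y)) as [M [_ HM]].
    { apply Rlt_le, Rdiv_lt_0_compat; lra. }
    exists M. intros n Hn. apply le_S_n. apply INR_lt. rewrite S_INR.
    apply Rle_lt_trans with (2 / y); [apply Rle_div_r; lra|lra]. }
  destruct (Hbig q) as [M1 H1]; [lra|]. destruct (Hbig (1 - q)) as [M2 H2]; [lra|].
  apply (finite_sorted_list (map (fun p => INR (fst p) * q + INR (snd p) * (1 - q))
    (list_prod (seq 0 (S M1)) (seq 0 (S M2))))).
  intros x Hx.
  assert (Hx2 : x <= 2).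
  { assert (Htop := rho_top q r Hr).
    destruct Hx as [[_ [_ Hle]]|[k [Hk ->]]]; [lra|].
    rewrite Htop. destruct k as [|k]; [simpl; lra|].
    change (rho q r (S k)) with (1 - q * (INR r - INR (S k) + 1)).
    assert (0 < INR (S k)) by apply INR_S_pos. nra. }
  destruct (Upsilon_grid q r x Hr Hx) as [I [J ->]].
  assert (HI := pos_INR I). assert (HJ := pos_INR J).
  assert (0 <= INR I * q) by nra. assert (0 <= INR J * (1 - q)) by nra.
  apply (in_map (fun p => INR (fst p) * q + INR (snd p) * (1 - q))
    _ (I, J)). apply in_prod; apply in_seq.
  - specialize (H1 I ltac:(lra)). lia.
  - specialize (H2 J ltac:(lra)). lia.
Qed.

(** * The case 0 < q < 1 *)

Lemma near0_seq (P : R -> Prop) (y : nat -> R) : near0 P ->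
  (forall n, 0 < y n) -> is_lim_seq y 0 -> exists N, forall n, (N <= n)%nat -> P (y n).
Proof.
  intros [e [He H]] Hp Hy. destruct (is_lim_seq_eventually_lt y 0 e Hy He) as [N HN].
  exists N. intros n Hn. apply H. split; [apply Hp|now apply HN].
Qed.

Lemma order_1_lim (g : R -> R) (a : R) (y : nat -> R) : order 1 (fun t => g t - a) ->
  (forall n, 0 < y n) -> is_lim_seq y 0 -> is_lim_seq (fun n => g (y n)) a.
Proof.
  intros [C [HC H]] Hp Hy. apply is_lim_seq_abs_le with (fun n => C * y n).
  - destruct (near0_seq _ y H Hp Hy) as [N HN]. exists N. intros n Hn.
    specialize (HN n Hn). now rewrite pow_1 in HN.
  - rewrite <- (Rmult_0_r C). exact (is_lim_seq_scal_l _ C 0 Hy).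
Qed.

Lemma is_lim_seq_Rpower (u : nat -> R) (l a : R) : 0 < l ->
  is_lim_seq u l -> is_lim_seq (fun n => Rpower (u n) a) (Rpower l a).
Proof.
  intros Hl H. apply (is_lim_seq_continuous (fun t => Rpower t a)); [|exact H].
  apply continuity_pt_filterlim, (ex_derive_continuous (fun t => Rpower t a)).
  eexists. now apply is_derive_Rpower.
Qed.

Lemma Rpower_INR_lim_0 (p : R) : 0 < p ->
  is_lim_seq (fun n => Rpower (INR n) (- p)) 0.
Proof.
  intros Hp. apply is_lim_seq_incr_1.
  apply is_lim_seq_ext with (fun n => Rpower (/ INR (S n)) p).
  - intros n. unfold Rpower. rewrite ln_Rinv by apply INR_S_pos. f_equal. ring.
  - apply is_lim_seq_Rpower_0; [exact Hp| |].
    + intros n. apply Rinv_0_lt_compat, INR_S_pos.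
    + apply is_lim_seq_ext with (fun n => 1 / INR (S n)).
      * intros n. unfold Rdiv. ring.
      * apply (is_lim_seq_const_div_INR 1 S). lia.
Qed.

Lemma bcoef_0_pos (q : R) : 0 < q < 1 -> 0 < bcoef q 0 * (1 - q * INR 1).
Proof.
  intros Hq. destruct (gam_spec (1 - q) ltac:(lra)) as [Hg _].
  unfold bcoef, alt. change (INR 1) with 1.
  rewrite Rpower_base_1, pow_O, (Rmult_1_r q).
  apply Rmult_lt_0_compat; [|lra]. lra.
Qed.

(** Again [r] is one less than in the theorem. The proof inserts d = x u(y) into [local_limit] and
    [log_gf_asymp]; the limits of all convergent terms are multiplied into [H]. *)
Lemma coefs_asymp_lt_1 (q : R) (r : nat) :
  0 < q -> q * INR (S r) < 1 -> 1 <= q * INR (S (S r)) ->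
  exists (H : R) (v : nat -> R), 0 < H /\
  is_lim_seq (fun n => coefs q n /
    (Rpower (INR n) (- (((3 - q) / 2 - A0val q (S r)) / (2 - q))) *
     exp (sum_n (fun i => v i * Rpower (INR n) ((1 - q * INR (S i)) / (2 - q))) r))) H.
Proof.
  intros Hq0 Hr Hr'.
  assert (Hq : 0 < q < 1).
  { split; [exact Hq0|]. assert (H := INR_S_ge_1 r). nra. }
  set (A0 := A0val q (S r)).
  (* The coefficients are those of the mean. Order r + 2 suffices: the defect n y^(r+2), divided by
     the order of the standard deviation, has exponent q (r + 2) - (1 - q)/2 > 0 in x. *)
  destruct (saddle_point q (fun i => bcoef q i * (1 - q * INR (S i))) r (S (S r)) Hq
    (bcoef_0_pos q Hq)) as [u [u0 [Hu0 [Hu1 [Hue [Hup Hur]]]]]].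
  set (x := fun n => Rpower (INR n) (- / (2 - q))).
  (* This includes n = 0, since [Rpower] is by definition an exponential. *)
  assert (Hx : forall n, 0 < x n) by (intros n; apply Rpower_pos).
  assert (Hx0 : is_lim_seq x 0)
    by (apply Rpower_INR_lim_0, Rinv_0_lt_compat; lra).
  set (y := fun n => Rpower (x n) q).
  assert (Hy : forall n, 0 < y n) by (intros n; apply Rpower_pos).
  assert (Hy0 : is_lim_seq y 0) by (apply is_lim_seq_Rpower_0; [lra|exact Hx|exact Hx0]).
  assert (Hu : is_lim_seq (fun n => u (y n)) u0) by (apply order_1_lim; assumption).
  set (d := fun n => x n * u (y n)).
  assert (Hd : forall n, 0 < d n)
    by (intros n; apply Rmult_lt_0_compat; [apply Hx|apply Hup]).
  assert (Hd0 : is_lim_seq d 0).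
  { replace 0 with (0 * u0) by ring. now apply is_lim_seq_mult'. }
  assert (Hyp : forall n i, y n ^ i = Rpower (x n) (q * INR i)).
  { intros n i. unfold y. rewrite <- Rpower_pow by apply Rpower_pos.
    apply Rpower_mult. }
  assert (Hdp : forall n a, Rpower (d n) a = Rpower (x n) a * Rpower (u (y n)) a)
    by (intros n a; apply Rpower_mult_base; [apply Hx|apply Hup]).
  assert (Hn : forall n, (1 <= n)%nat -> Rpower (x n) (- (2 - q)) = INR n).
  { intros n Hn. unfold x. rewrite Rpower_mult.
    replace (- / (2 - q) * - (2 - q)) with 1 by (field; lra).
    apply Rpower_1, lt_0_INR. lia. }
  assert (Hmean : is_lim_seq (fun n => (mean q (d n) - INR n) *
    Rpower (d n) ((3 - q) / 2)) 0).
  { destruct (mean_asymp q r Hq0 Hr Hr') as [C1 [HC1 H1]].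
    destruct Hur as [C2 [HC2 H2]].
    destruct (near0_seq _ y H2 Hy Hy0) as [N2 HN2].
    destruct (is_lim_seq_eventually_lt d 0 (/ INR (S r)) Hd0) as [N1 HN1].
    { apply Rinv_0_lt_compat, INR_S_pos. }
    apply is_lim_seq_abs_le with (fun n => C1 * Rpower (d n) ((1 - q) / 2) +
      C2 * (Rpower (x n) (- (2 - q) + q * INR (S (S r)) + (3 - q) / 2) *
        Rpower (u (y n)) ((3 - q) / 2))).
    - exists (max 1 (max N1 N2)). intros n Hn1. rewrite Rminus_0_r.
      specialize (H1 (d n) (conj (Hd n) (Rlt_le _ _ (HN1 n ltac:(lia))))).
      specialize (HN2 n ltac:(lia)). rewrite Hyp in HN2.
      set (M := sum_n (fun i => bcoef q i * (1 - q * INR (S i)) *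
        Rpower (d n) (- (2 - q * INR (S i)))) r : R) in *.
      set (Q := sum_n (fun i => bcoef q i * (1 - q * INR (S i)) * y n ^ i *
        Rpower (u (y n)) (- (2 - q * INR (S i)))) r : R) in *.
      assert (EM : M = INR n * Q).
      { rewrite <- (Hn n) by lia. unfold M, Q.
        rewrite <- (sum_n_mult_l (K := R_Ring)). apply sum_n_ext. intros i.
        rewrite Hdp, Hyp.
        replace (- (2 - q * INR (S i))) with (- (2 - q) + q * INR i) at 1
          by (rewrite S_INR; ring).
        rewrite Rpower_plus. unfold mult; simpl. eq_R. ring. }
      rewrite Rabs_mult, (Rabs_pos_eq (Rpower (d n) _)) by (left; apply Rpower_pos).
      assert (Hb : Rabs (mean q (d n) - INR n) <= C1 * / d n +
        Rpower (x n) (- (2 - q)) * (C2 * Rpower (x n) (q * INR (S (S r))))).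
      { replace (mean q (d n) - INR n) with ((mean q (d n) - M) + INR n * (Q - 1))
          by (rewrite EM; ring).
        eapply Rle_trans; [apply Rabs_triang|]. apply Rplus_le_compat; [exact H1|].
        rewrite Rabs_mult, Rabs_pos_eq by apply pos_INR. rewrite (Hn n) by lia.
        apply Rmult_le_compat_l; [apply pos_INR|exact HN2]. }
      eapply Rle_trans; [apply Rmult_le_compat_r; [left; apply Rpower_pos|exact Hb]|].
      right. rewrite Rmult_plus_distr_r. f_equal.
      + rewrite <- Rpower_m1 by apply Hd.
        replace ((1 - q) / 2) with (Ropp 1 + (3 - q) / 2) by field.
        rewrite Rpower_plus. ring.
      + rewrite Hdp, !Rpower_plus. ring.
    - replace 0 with (C1 * 0 + C2 * (0 * Rpower u0 ((3 - q) / 2))) by ring.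
      apply is_lim_seq_plus'.
      + apply (is_lim_seq_scal_l _ C1 0). apply is_lim_seq_Rpower_0; [lra|exact Hd|exact Hd0].
      + apply (is_lim_seq_scal_l _ C2 (0 * Rpower u0 ((3 - q) / 2))).
        apply is_lim_seq_mult'; [|now apply is_lim_seq_Rpower].
        apply is_lim_seq_Rpower_0; [lra|exact Hx|exact Hx0]. }
  destruct (local_limit q Hq) as [H0 [HH0 Hloc]].
  specialize (Hloc d Hd Hd0 Hmean).
  destruct (log_gf_asymp q r d Hq0 Hr Hr' Hd Hd0) as [l2 Hlog]. fold A0 in Hlog.
  (* The singular part of the exponent, n d plus the powers in the expansion of [log_gf], is
     x^(-(1-q)) V(y); see [EV] below. *)
  set (V := fun t => u t + sum_n (fun i =>
    bcoef q i * (t ^ i * Rpower (u t) (- (1 - q * INR (S i))))) r).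
  assert (HV : forall m, expands m V).
  { intros m. apply expands_plus; [apply Hue|]. apply expands_sum_n. intros i _.
    apply expands_mult; [apply expands_const|].
    apply expands_mult; [apply expands_pow, expands_id|].
    apply expands_Rpower with u0; auto. }
  destruct (expands_coefficients (S r) V (HV _)) as [v [C [HC HvC]]].
  destruct (near0_seq _ y HvC Hy Hy0) as [N HN].
  set (s3 := fun n => Rpower (x n) (- (1 - q)) * V (y n) -
    sum_n (fun i => v i * Rpower (x n) (- (1 - q * INR (S i)))) r).
  assert (Hs3 : exists l3 : R, is_lim_seq s3 l3).
  { assert (Hlast : exists l : R, is_lim_seq (fun n =>
      v (S r) * Rpower (x n) (q * INR (S (S r)) - 1)) l).
    { destruct (Req_dec (q * INR (S (S r))) 1) as [E|NE].
      - exists (v (S r)). apply is_lim_seq_ext with (fun _ => v (S r));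
          [|apply is_lim_seq_const].
        intros n. rewrite E, Rminus_diag, Rpower_O by apply Hx. ring.
      - exists (v (S r) * 0). apply (is_lim_seq_scal_l _ (v (S r)) 0).
        apply is_lim_seq_Rpower_0; [lra|exact Hx|exact Hx0]. }
    destruct Hlast as [l Hl]. exists (l + 0).
    apply is_lim_seq_ext with (fun n => v (S r) * Rpower (x n) (q * INR (S (S r)) - 1) +
      Rpower (x n) (- (1 - q)) * (V (y n) - sum_n (fun i => v i * y n ^ i) (S r))).
    - intros n. unfold s3. rewrite Rmult_minus_distr_l.
      assert (E : Rpower (x n) (- (1 - q)) * sum_n (fun i => v i * y n ^ i) (S r) =
        sum_n (fun i => v i * Rpower (x n) (- (1 - q * INR (S i)))) (S r)).
      { rewrite <- (sum_n_mult_l (K := R_Ring)). apply sum_n_ext. intros i.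
        rewrite Hyp. replace (- (1 - q * INR (S i))) with (- (1 - q) + q * INR i)
          by (rewrite S_INR; ring).
        rewrite Rpower_plus. unfold mult; simpl. eq_R. ring. }
      rewrite E, sum_Sn_R.
      replace (- (1 - q * INR (S (S r)))) with (q * INR (S (S r)) - 1) by ring. ring.
    - apply is_lim_seq_plus'; [exact Hl|].
      apply is_lim_seq_abs_le with (fun n =>
        C * Rpower (x n) (- (1 - q) + q * INR (S (S r)))).
      + exists N. intros n Hn1. specialize (HN n Hn1). rewrite Hyp in HN.
        rewrite Rminus_0_r, Rabs_mult, Rabs_pos_eq by (left; apply Rpower_pos).
        eapply Rle_trans; [apply Rmult_le_compat_l; [left; apply Rpower_pos|exact HN]|].
        right. rewrite Rpower_plus. ring.
      + rewrite <- (Rmult_0_r C). apply (is_lim_seq_scal_l _ C 0).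
        apply is_lim_seq_Rpower_0; [lra|exact Hx|exact Hx0]. }
  destruct Hs3 as [l3 Hs3].
  (* The total power of [d]: (3 - q)/2 from the standard deviation, - A0 from the logarithm in
     [log_gf_asymp]. *)
  set (kap := (3 - q) / 2 - A0).
  exists (H0 * (exp l3 * (exp l2 * Rpower u0 kap))), v.
  split.
  { repeat apply Rmult_lt_0_compat; try apply exp_pos; assumption. }
  apply is_lim_seq_ext_loc with (2 := is_lim_seq_mult' _ _ _ _ Hloc
    (is_lim_seq_mult' _ _ _ _ (is_lim_seq_exp _ _ Hs3)
      (is_lim_seq_mult' _ _ _ _ (is_lim_seq_exp _ _ Hlog)
        (is_lim_seq_Rpower _ _ kap Hu0 Hu)))).
  exists 1%nat. intros n Hn1.
  assert (EV : Rpower (x n) (- (1 - q)) * V (y n) = INR n * d n +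
    sum_n (fun i => bcoef q i * Rpower (d n) (- (1 - q * INR (S i)))) r).
  { unfold V. rewrite Rmult_plus_distr_l. f_equal.
    - rewrite <- (Hn n) by exact Hn1. unfold d.
      replace (- (1 - q)) with (- (2 - q) + 1) by ring.
      rewrite Rpower_plus, Rpower_1 by apply Hx. ring.
    - rewrite <- (sum_n_mult_l (K := R_Ring)). apply sum_n_ext. intros i.
      rewrite Hdp, Hyp.
      replace (- (1 - q * INR (S i))) with (- (1 - q) + q * INR i) at 2
        by (rewrite S_INR; ring).
      rewrite Rpower_plus. unfold mult; simpl. eq_R. ring. }
  assert (Ex : forall a, Rpower (INR n) (a / (2 - q)) = Rpower (x n) (- a)).
  { intros a. unfold x. rewrite Rpower_mult. f_equal. field. lra. }
  replace (- (kap / (2 - q))) with ((- kap) / (2 - q)) by (field; lra).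
  rewrite Ex, Ropp_involutive.
  rewrite (sum_n_ext (fun i => v i * Rpower (INR n) ((1 - q * INR (S i)) / (2 - q)))
    (fun i => v i * Rpower (x n) (- (1 - q * INR (S i)))))
    by (intros i; now rewrite Ex).
  unfold s3. rewrite EV.
  set (S1 := sum_n (fun i => bcoef q i * Rpower (d n) (- (1 - q * INR (S i)))) r : R).
  set (S2 := sum_n (fun i => v i * Rpower (x n) (- (1 - q * INR (S i)))) r : R).
  replace (INR n * d n + S1 - S2) with (INR n * d n + S1 + - S2) by ring.
  replace (log_gf q (d n) - S1 + A0 * ln (d n)) with
    (log_gf q (d n) + - S1 + A0 * ln (d n)) by ring.
  rewrite !exp_plus, !exp_Ropp.
  replace (exp (A0 * ln (d n))) with (Rpower (d n) A0) by reflexivity.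
  rewrite !Hdp. unfold kap.
  replace ((3 - q) / 2 - A0) with ((3 - q) / 2 + - A0) by ring.
  rewrite !Rpower_plus, !Rpower_Ropp.
  field.
  repeat split; apply Rgt_not_eq; apply exp_pos || apply Rpower_pos.
Qed.

(** * Holomorphic functions and series of them *)

Lemma Cexp_cis (z : C) : Cexp z = (RtoC (exp (Re z)) * cis (Im z))%C.
Proof. reflexivity. Qed.

Lemma Cexp_plus (z w : C) : Cexp (z + w) = (Cexp z * Cexp w)%C.
Proof.
  rewrite !Cexp_cis. destruct z as [a b], w as [c d].
  unfold Re, Im, Cplus. simpl fst. simpl snd.
  rewrite exp_plus, RtoC_mult, cis_plus. ring.
Qed.

Lemma Cexp_RtoC (x : R) : Cexp (RtoC x) = RtoC (exp x).
Proof. rewrite Cexp_cis. simpl. rewrite cis_0. ring. Qed.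

Lemma Cexp_0 : Cexp (RtoC 0) = RtoC 1.
Proof. now rewrite Cexp_RtoC, exp_0. Qed.

Lemma Cmod_Cexp (z : C) : Cmod (Cexp z) = exp (Re z).
Proof.
  rewrite Cexp_cis, Cmod_mult, Cmod_cis, Cmod_R, Rmult_1_r.
  apply Rabs_pos_eq. left; apply exp_pos.
Qed.

Lemma Cmod_Cexp_le (z : C) : Cmod (Cexp z) <= exp (Cmod z).
Proof.
  rewrite Cmod_Cexp. apply exp_mono.
  eapply Rle_trans; [apply Rle_abs|apply Re_le_Cmod].
Qed.

Lemma exp_remainder (x : R) : Rabs (exp x - 1 - x) <= x * x / 2 * exp (Rabs x).
Proof.
  assert (H0 := exp_ge_1_plus x).
  rewrite Rabs_pos_eq by lra.
  destruct (Rle_dec 0 x) as [Hx|Hx].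
  - rewrite Rabs_pos_eq by exact Hx.
    assert (H : Rabs ((exp x - x) - (exp 0 - 0)) <=
      x * x / 2 * exp x - 0 * 0 / 2 * exp x).
    { apply (increment_bound (fun t => exp t - t) (fun t => exp t - 1)
        (fun t => t * t / 2 * exp x) (fun t => t * exp x)); [exact Hx| | |].
      - intros t _. auto_derive; [exact I|ring].
      - intros t _. auto_derive; [exact I|field].
      - intros t Ht. eapply Rle_trans; [apply exp_minus_1_bound|].
        rewrite (Rabs_pos_eq t) by lra. apply Rmult_le_compat_l; [lra|].
        apply exp_mono; lra. }
    rewrite exp_0 in H. apply Rabs_le_between in H. lra.
  - assert (H : exp x - 1 - x <= x * x / 2).
    { assert (H : Rabs ((exp (- - x) + - x) - (exp (- 0) + 0)) <=
        (- x) * (- x) / 2 - 0 * 0 / 2).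
      { apply (increment_bound (fun u => exp (- u) + u) (fun u => 1 - exp (- u))
          (fun u => u * u / 2) (fun u => u)); [lra| | |].
        - intros u Hu. auto_derive; [exact I|ring].
        - intros u Hu. auto_derive; [exact I|field].
        - intros u Hu. assert (H1 := exp_ge_1_plus (- u)).
          assert (H2 : exp (- u) <= 1) by (rewrite <- exp_0; apply exp_mono; lra).
          rewrite Rabs_pos_eq; lra. }
      rewrite Ropp_involutive, Ropp_0, exp_0 in H. apply Rabs_le_between in H. lra. }
    assert (1 <= exp (Rabs x)) by (rewrite <- exp_0; apply exp_mono, Rabs_pos).
    nra.
Qed.

Lemma sin_cos_abs_bounds (y : R) :
  Rabs (cos y - 1) <= y * y / 2 /\ Rabs (sin y) <= Rabs y /\
  Rabs (sin y - y) <= y * y / 2.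
Proof.
  assert (pos : forall u, 0 <= u -> Rabs (cos u - 1) <= u * u / 2 /\
    Rabs (sin u) <= u /\ Rabs (sin u - u) <= u * u / 2).
  { assert (Hsin : forall u, 0 <= u -> Rabs (sin u) <= u).
    { intros u Hu. replace (sin u) with (sin u - sin 0) by (rewrite sin_0; ring).
      replace u with (u - 0) at 2 by ring.
      apply (increment_bound sin cos (fun s => s) (fun _ => 1) 0 u Hu).
      - intros x _. auto_derive; [exact I|ring].
      - intros x _. auto_derive; [exact I|ring].
      - intros x _. apply Rabs_le, COS_bound. }
    assert (Hcos1 : forall u, 0 <= u -> Rabs (cos u - 1) <= u).
    { intros u Hu. rewrite <- cos_0. replace u with (u - 0) at 2 by ring.
      apply (increment_bound cos (fun s => - sin s) (fun s => s) (fun _ => 1) 0 u Hu).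
      - intros x _. auto_derive; [exact I|ring].
      - intros x _. auto_derive; [exact I|ring].
      - intros x _. rewrite Rabs_Ropp. apply Rabs_le, SIN_bound. }
    intros u Hu. split; [|split; [now apply Hsin|]].
    - rewrite <- cos_0. replace (u * u / 2) with (u * u / 2 - 0 * 0 / 2) by field.
      apply (increment_bound cos (fun s => - sin s) (fun s => s * s / 2)
        (fun s => s) 0 u Hu).
      + intros x _. auto_derive; [exact I|ring].
      + intros x _. auto_derive; [exact I|field].
      + intros x Hx. rewrite Rabs_Ropp. apply Hsin. lra.
    - replace (sin u - u) with ((sin u - u) - (sin 0 - 0)) by (rewrite sin_0; ring).
      replace (u * u / 2) with (u * u / 2 - 0 * 0 / 2) by field.
      apply (increment_bound (fun s => sin s - s) (fun s => cos s - 1)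
        (fun s => s * s / 2) (fun s => s) 0 u Hu).
      + intros x _. auto_derive; [exact I|ring].
      + intros x _. auto_derive; [exact I|field].
      + intros x Hx. apply Hcos1. lra. }
  destruct (Rle_dec 0 y) as [Hy|Hy].
  - rewrite (Rabs_pos_eq y) by exact Hy. now apply pos.
  - destruct (pos (- y) ltac:(lra)) as [H1 [H2 H3]].
    rewrite cos_neg in H1. rewrite sin_neg, Rabs_Ropp in H2. rewrite sin_neg in H3.
    replace (- sin y - - y) with (- (sin y - y)) in H3 by ring.
    rewrite Rabs_Ropp in H3. rewrite (Rabs_left y) by lra.
    replace (- y * - y) with (y * y) in * by ring. auto.
Qed.

Lemma Cmod_sqr (z : C) : Cmod z * Cmod z = Re z * Re z + Im z * Im z.
Proof.
  unfold Cmod. rewrite sqrt_sqrt.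
  - destruct z; simpl. ring.
  - apply Rplus_le_le_0_compat; apply pow2_ge_0.
Qed.

Lemma Cexp_remainder (z : C) :
  Cmod (Cexp z - RtoC 1 - z) <= 2 * (Cmod z * Cmod z) * exp (Cmod z).
Proof.
  rewrite Cmod_sqr. assert (Hx := Re_le_Cmod z).
  eapply Rle_trans; [apply Cmod_le_components|].
  destruct z as [x y]. rewrite Cexp_cis.
  unfold Re, Im, cis, Cminus, Cplus, Copp, Cmult, RtoC in *. simpl fst in *. simpl snd in *.
  destruct (sin_cos_abs_bounds y) as [H1 [H2 H3]].
  set (E := exp (Cmod (x, y))).
  assert (HEx : exp (Rabs x) <= E) by (apply exp_mono, Hx).
  assert (HE1 : 1 <= exp (Rabs x)) by (rewrite <- exp_0; apply exp_mono, Rabs_pos).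
  assert (Hexp : exp x <= exp (Rabs x)) by (apply exp_mono, Rle_abs).
  assert (Hr := exp_remainder x). assert (Hm := exp_minus_1_bound x).
  assert (Hpx := exp_pos x).
  assert (Hxx : 0 <= x * x) by nra. assert (Hyy : 0 <= y * y) by nra.
  assert (R1 : Rabs (exp x * cos y - 0 * sin y + - (1) + - x) <=
    (x * x / 2 + y * y / 2) * E).
  { replace (exp x * cos y - 0 * sin y + - (1) + - x) with
      ((exp x - 1 - x) + exp x * (cos y - 1)) by ring.
    eapply Rle_trans; [apply Rabs_triang|].
    rewrite Rabs_mult, (Rabs_pos_eq (exp x)) by lra.
    rewrite Rmult_plus_distr_r. apply Rplus_le_compat.
    - eapply Rle_trans; [exact Hr|]. apply Rmult_le_compat_l; lra.
    - rewrite (Rmult_comm (y * y / 2)). apply Rmult_le_compat; try lra. apply Rabs_pos. }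
  assert (R2 : Rabs (exp x * sin y + 0 * cos y + - 0 + - y) <=
    (y * y / 2 + (x * x + y * y) / 2) * E).
  { replace (exp x * sin y + 0 * cos y + - 0 + - y) with
      ((sin y - y) + (exp x - 1) * sin y) by ring.
    eapply Rle_trans; [apply Rabs_triang|].
    rewrite Rabs_mult, Rmult_plus_distr_r. apply Rplus_le_compat.
    - eapply Rle_trans; [exact H3|]. rewrite <- (Rmult_1_r (y * y / 2)) at 1.
      apply Rmult_le_compat_l; lra.
    - apply Rle_trans with (Rabs x * exp (Rabs x) * Rabs y).
      + apply Rmult_le_compat; try apply Rabs_pos; assumption.
      + replace (Rabs x * exp (Rabs x) * Rabs y) with
          (Rabs x * Rabs y * exp (Rabs x)) by ring.
        assert (Hax := Rabs_pos x). assert (Hay := Rabs_pos y).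
        apply Rmult_le_compat; [nra|lra| |lra].
        assert (Sx : x * x = Rabs x * Rabs x)
          by (unfold Rabs; destruct Rcase_abs; ring).
        assert (Sy : y * y = Rabs y * Rabs y)
          by (unfold Rabs; destruct Rcase_abs; ring).
        rewrite Sx, Sy. assert (Hsq := Rle_0_sqr (Rabs x - Rabs y)).
        unfold Rsqr in Hsq. lra. }
  eapply Rle_trans; [apply Rplus_le_compat; [exact R1|exact R2]|]. nra.
Qed.

Lemma Cexp_minus_1 (z : C) :
  Cmod (Cexp z - RtoC 1) <= Cmod z * (1 + 2 * Cmod z * exp (Cmod z)).
Proof.
  replace (Cexp z - RtoC 1)%C with ((Cexp z - RtoC 1 - z) + z)%C by ring.
  eapply Rle_trans; [apply Cmod_triangle|].
  generalize (Cexp_remainder z). lra.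
Qed.

(** The remainder in the expansion of [f] at [s] is quadratic, uniformly on the
    disc of radius [e]; one constant bounds values, derivative and remainder. *)
Definition quad (f : C -> C) (l s : C) (e B : R) : Prop :=
  Cmod l <= B /\ forall h : C, Cmod h < e ->
    Cmod (f (s + h)%C) <= B /\
    Cmod (f (s + h) - f s - l * h)%C <= B * (Cmod h * Cmod h).

Lemma quad_center (f : C -> C) (l s : C) (e B : R) : 0 < e -> quad f l s e B ->
  Cmod (f s) <= B.
Proof.
  intros He [_ H]. destruct (H (RtoC 0)) as [H1 _]; [now rewrite Cmod_0|].
  now rewrite Cplus_0_r in H1.
Qed.

Lemma quad_B_nonneg (f : C -> C) (l s : C) (e B : R) : quad f l s e B -> 0 <= B.
Proof. intros [H _]. eapply Rle_trans; [apply Cmod_ge_0|exact H]. Qed.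

Lemma quad_weaken (f : C -> C) (l s : C) (e e' B B' : R) :
  e' <= e -> B <= B' -> quad f l s e B -> quad f l s e' B'.
Proof.
  intros He HB [Hl H]. split; [lra|]. intros h Hh. destruct (H h) as [H1 H2]; [lra|].
  split; [lra|].
  eapply Rle_trans; [exact H2|]. apply Rmult_le_compat_r; [nra|exact HB].
Qed.

Lemma quad_ext (f g : C -> C) (l s : C) (e B : R) : (forall z, f z = g z) ->
  quad f l s e B -> quad g l s e B.
Proof.
  intros E [Hl H]. split; [exact Hl|]. intros h Hh. rewrite <- !E. now apply H.
Qed.

Lemma quad_const (c s : C) (e : R) : quad (fun _ => c) (RtoC 0) s e (Cmod c).
Proof.
  split; [rewrite Cmod_0; apply Cmod_ge_0|]. intros h _. split; [lra|].
  replace (c - c - RtoC 0 * h)%C with (RtoC 0) by ring. rewrite Cmod_0.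
  assert (H' := Cmod_ge_0 c).
  apply Rmult_le_pos; [exact H'|nra].
Qed.

Lemma quad_id (s : C) (e : R) : e <= 1 -> quad (fun z => z) (RtoC 1) s e (Cmod s + 1).
Proof.
  intros He. split; [rewrite Cmod_1; generalize (Cmod_ge_0 s); lra|]. intros h Hh.
  split; [eapply Rle_trans; [apply Cmod_triangle|lra]|].
  replace (s + h - s - RtoC 1 * h)%C with (RtoC 0) by ring. rewrite Cmod_0.
  assert (H' := Cmod_ge_0 s).
  apply Rmult_le_pos; [lra|nra].
Qed.

Lemma quad_plus (f g : C -> C) (l m s : C) (e B B' : R) :
  quad f l s e B -> quad g m s e B' ->
  quad (fun z => f z + g z)%C (l + m)%C s e (B + B').
Proof.
  intros [Hl H] [Hm H']. split; [eapply Rle_trans; [apply Cmod_triangle|lra]|].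
  intros h Hh. destruct (H h Hh) as [H1 H2]. destruct (H' h Hh) as [H3 H4].
  split; [eapply Rle_trans; [apply Cmod_triangle|lra]|].
  replace (f (s + h) + g (s + h) - (f s + g s) - (l + m) * h)%C with
    ((f (s + h) - f s - l * h) + (g (s + h) - g s - m * h))%C by ring.
  eapply Rle_trans; [apply Cmod_triangle|]. lra.
Qed.

Lemma quad_mult (f g : C -> C) (l m s : C) (e B B' : R) :
  0 < e <= 1 -> quad f l s e B -> quad g m s e B' ->
  quad (fun z => f z * g z)%C (l * g s + f s * m)%C s e (4 * (B * B')).
Proof.
  intros He Hf Hg.
  assert (Hfs := quad_center _ _ _ _ _ (proj1 He) Hf).
  assert (Hgs := quad_center _ _ _ _ _ (proj1 He) Hg).
  assert (HB := quad_B_nonneg _ _ _ _ _ Hf). assert (HB' := quad_B_nonneg _ _ _ _ _ Hg).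
  destruct Hf as [Hl H]. destruct Hg as [Hm H'].
  assert (mult_le : forall a b x y, Cmod a <= x -> Cmod b <= y -> Cmod (a * b) <= x * y).
  { intros a b x y Ha Hb. rewrite Cmod_mult.
    apply Rmult_le_compat; try apply Cmod_ge_0; assumption. }
  assert (HBB : 0 <= B * B') by nra.
  split.
  - eapply Rle_trans; [apply Cmod_triangle|].
    generalize (mult_le l (g s) _ _ Hl Hgs) (mult_le (f s) m _ _ Hfs Hm). lra.
  - intros h Hh. destruct (H h Hh) as [H1 H2]. destruct (H' h Hh) as [H3 H4].
    split; [generalize (mult_le _ _ _ _ H1 H3); lra|].
    set (rf := (f (s + h) - f s - l * h)%C) in *.
    set (rg := (g (s + h) - g s - m * h)%C) in *.
    (* The three summands contribute B B', 2 B B' and B B' times |h|^2, whence the constant 4. *)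
    replace (f (s + h) * g (s + h) - f s * g s - (l * g s + f s * m) * h)%C with
      (f (s + h) * rg + (rf * (g s + m * h) + (l * m) * (h * h)))%C
      by (unfold rf, rg; ring).
    eapply Rle_trans; [apply Cmod_triangle|].
    assert (T1 := mult_le _ _ _ _ H1 H4).
    assert (T2 : Cmod (g s + m * h) <= 2 * B').
    { eapply Rle_trans; [apply Cmod_triangle|].
      assert (T : Cmod (m * h) <= B' * 1) by (apply mult_le; [exact Hm|lra]). lra. }
    assert (T3 := mult_le _ _ _ _ H2 T2).
    assert (T4 : Cmod (l * m * (h * h)) <= B * B' * (Cmod h * Cmod h)).
    { apply mult_le; [now apply mult_le|rewrite Cmod_mult; lra]. }
    eapply Rle_trans; [apply Rplus_le_compat_l, Cmod_triangle|].
    replace (4 * (B * B') * (Cmod h * Cmod h)) with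
      (B * (B' * (Cmod h * Cmod h)) + (B * (Cmod h * Cmod h) * (2 * B') +
       B * B' * (Cmod h * Cmod h))) by ring.
    repeat apply Rplus_le_compat; assumption.
Qed.

Definition hol (f : C -> C) (s : C) : Prop :=
  exists (l : C) (e B : R), 0 < e <= 1 /\ quad f l s e B.

Lemma hol_const (c s : C) : hol (fun _ => c) s.
Proof. exists (RtoC 0), 1, (Cmod c). split; [lra|apply quad_const]. Qed.

Lemma hol_id (s : C) : hol (fun z => z) s.
Proof. exists (RtoC 1), 1, (Cmod s + 1). split; [lra|apply quad_id; lra]. Qed.

Lemma hol_common (f g : C -> C) (s : C) : hol f s -> hol g s ->
  exists l m e B B', 0 < e <= 1 /\ quad f l s e B /\ quad g m s e B'.
Proof.
  intros [l [e [B [He H]]]] [m [e' [B' [He' H']]]].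
  exists l, m, (Rmin e e'), B, B'.
  assert (H1 := Rmin_l e e'). assert (H2 := Rmin_r e e').
  split; [split; [now apply Rmin_glb_lt|lra]|].
  split; [exact (quad_weaken f l s e _ B B H1 (Rle_refl B) H)|
    exact (quad_weaken g m s e' _ B' B' H2 (Rle_refl B') H')].
Qed.

Lemma hol_plus (f g : C -> C) (s : C) : hol f s -> hol g s ->
  hol (fun z => f z + g z)%C s.
Proof.
  intros Hf Hg. destruct (hol_common f g s Hf Hg) as [l [m [e [B [B' [He [H H']]]]]]].
  exists (l + m)%C, e, (B + B'). split; [exact He|now apply quad_plus].
Qed.

Lemma hol_mult (f g : C -> C) (s : C) : hol f s -> hol g s ->
  hol (fun z => f z * g z)%C s.
Proof.
  intros Hf Hg. destruct (hol_common f g s Hf Hg) as [l [m [e [B [B' [He [H H']]]]]]].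
  exists (l * g s + f s * m)%C, e, (4 * (B * B')). split; [exact He|now apply quad_mult].
Qed.

Lemma hol_ext (f g : C -> C) (s : C) : (forall z, f z = g z) -> hol f s -> hol g s.
Proof.
  intros E [l [e [B [He H]]]]. exists l, e, B. split; [exact He|].
  now apply quad_ext with f.
Qed.

Lemma hol_sum (f : nat -> C -> C) (n : nat) (s : C) :
  (forall i, (i <= n)%nat -> hol (f i) s) ->
  hol (fun z => sum_n (G := C_AbelianMonoid) (fun i => f i z) n) s.
Proof.
  intros H. induction n as [|n IH].
  - apply hol_ext with (f 0%nat); [intros z; now rewrite sum_O|auto].
  - apply hol_ext with
      (fun z => sum_n (G := C_AbelianMonoid) (fun i => f i z) n + f (S n) z)%C.
    + intros z. now rewrite sum_Sn.
    + apply hol_plus; auto.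
Qed.

Lemma quad_translate (f : C -> C) (l s c : C) (e B : R) :
  quad f l (s + c)%C e B -> quad (fun z => f (z + c)%C) l s e B.
Proof.
  intros [Hl H]. split; [exact Hl|]. intros h Hh. destruct (H h Hh) as [H1 H2].
  replace (s + h + c)%C with (s + c + h)%C by ring. auto.
Qed.

Lemma hol_translate (f : C -> C) (s c : C) :
  hol f (s + c)%C -> hol (fun z => f (z + c)%C) s.
Proof.
  intros [l [e [B [He H]]]]. exists l, e, B. split; [exact He|now apply quad_translate].
Qed.

Lemma hol_is_derive (f : C -> C) (s : C) : hol f s ->
  @ex_derive C_AbsRing C_NormedModule f s.
Proof.
  intros [l [e [B [He Hf]]]]. assert (HB := quad_B_nonneg _ _ _ _ _ Hf).
  destruct Hf as [_ H]. exists l. split.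
  - apply (is_linear_scal_l (K := C_AbsRing) (V := C_NormedModule)).
  - intros x Hx. apply (is_filter_lim_locally_unique (V := AbsRing_NormedModule C_AbsRing)) in Hx.
    subst x. intros eps.
    set (dl := Rmin e (eps / (B + 1))).
    assert (Hdl : 0 < dl).
    { apply Rmin_glb_lt; [lra|]. apply Rdiv_lt_0_compat; [apply cond_pos|lra]. }
    apply (locally_le_locally_norm (V := AbsRing_NormedModule C_AbsRing)).
    exists (mkposreal dl Hdl).
    enough (T : forall y : C, Cmod (y - s)%C < dl ->
      Cmod ((f y - f s) - ((y - s) * l))%C <= eps * Cmod (y - s)%C) by exact T.
    intros y Hy.
    set (h := (y - s)%C) in *. assert (Hh0 := Cmod_ge_0 h).
    assert (H1 := Rmin_l e (eps / (B + 1))). assert (H2 := Rmin_r e (eps / (B + 1))).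
    destruct (H h) as [_ Hq]; [fold dl in H1; lra|].
    replace (s + h)%C with y in Hq by (unfold h; ring).
    replace (f y - f s - h * l)%C with (f y - f s - l * h)%C by ring.
    eapply Rle_trans; [exact Hq|]. rewrite <- Rmult_assoc.
    apply Rmult_le_compat_r; [exact Hh0|].
    assert (H3 : Cmod h < eps / (B + 1)) by (fold dl in H2; lra).
    apply Rlt_div_r in H3; [|lra]. nra.
Qed.

Lemma holomorphic_of_hol (f : C -> C) (s : C) (d : R) : 0 < d ->
  (forall z, Cmod (z - s)%C < d -> hol f z) -> holomorphic_at f s.
Proof.
  intros Hd H. unfold holomorphic_at.
  apply (locally_le_locally_norm (V := C_NormedModule)).
  exists (mkposreal d Hd). intros y Hy. apply hol_is_derive, H. exact Hy.
Qed.

Lemma locally_of_disc (P : C -> Prop) (s : C) (d : R) : 0 < d ->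
  (forall z, Cmod (z - s)%C < d -> P z) -> locally s P.
Proof.
  intros Hd H. apply (locally_le_locally_norm (V := C_NormedModule)).
  exists (mkposreal d Hd). intros y Hy. apply H. exact Hy.
Qed.

Lemma exp_ge_1 (x : R) : 0 <= x -> 1 <= exp x.
Proof. intros Hx. generalize (exp_ge_1_plus x). lra. Qed.

(** * Series of holomorphic functions *)

Definition is_cseries (a : nat -> C) (v : C) : Prop :=
  @is_series C_AbsRing C_NormedModule a v.

Definition CSeries (a : nat -> C) : C :=
  (Series (fun k => Re (a k)), Series (fun k => Im (a k))).

Lemma is_cseries_CSeries (a : nat -> C) (B : nat -> R) :
  (forall k, Cmod (a k) <= B k) -> ex_series B -> is_cseries a (CSeries a).
Proof.
  intros H HB. apply is_series_C_components. split; apply Series_correct.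
  - apply ex_series_le_R with (2 := HB). intros k.
    eapply Rle_trans; [apply Re_le_Cmod|apply H].
  - apply ex_series_le_R with (2 := HB). intros k.
    eapply Rle_trans; [apply Im_le_Cmod|apply H].
Qed.

Lemma is_cseries_unique (a : nat -> C) (v : C) : is_cseries a v -> CSeries a = v.
Proof.
  intros H. apply is_series_C_components in H. destruct H as [H1 H2].
  unfold CSeries. rewrite (is_series_unique _ _ H1), (is_series_unique _ _ H2).
  now destruct v.
Qed.

Lemma Rabs_Series_le (a B : nat -> R) : (forall k, Rabs (a k) <= B k) -> ex_series B ->
  Rabs (Series a) <= Series B.
Proof.
  intros H HB. eapply Rle_trans; [apply Series_Rabs|].
  - apply ex_series_le_R with (2 := HB). intros k. rewrite Rabs_Rabsolu. apply H.
  - apply Series_le with (2 := HB). intros k. split; [apply Rabs_pos|apply H].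
Qed.

Lemma CSeries_bound (a : nat -> C) (B : nat -> R) :
  (forall k, Cmod (a k) <= B k) -> ex_series B -> Cmod (CSeries a) <= 2 * Series B.
Proof.
  intros H HB. eapply Rle_trans; [apply Cmod_le_components|].
  replace (2 * Series B) with (Series B + Series B) by ring.
  apply Rplus_le_compat; apply Rabs_Series_le; try exact HB; intros k.
  - eapply Rle_trans; [apply Re_le_Cmod|apply H].
  - eapply Rle_trans; [apply Im_le_Cmod|apply H].
Qed.

Lemma is_cseries_ext (a b : nat -> C) (v : C) : (forall k, a k = b k) ->
  is_cseries a v -> is_cseries b v.
Proof. intros H. now apply is_series_ext. Qed.

Lemma is_cseries_plus (a b : nat -> C) (u v : C) : is_cseries a u -> is_cseries b v ->
  is_cseries (fun k => a k + b k)%C (u + v)%C.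
Proof. exact (is_series_plus (V := C_NormedModule) a b u v). Qed.

Lemma is_cseries_scal (c : C) (a : nat -> C) (v : C) : is_cseries a v ->
  is_cseries (fun k => c * a k)%C (c * v)%C.
Proof. exact (is_series_scal (V := C_NormedModule) c a v). Qed.

Lemma is_cseries_minus (a b : nat -> C) (u v : C) : is_cseries a u -> is_cseries b v ->
  is_cseries (fun k => a k - b k)%C (u - v)%C.
Proof. exact (is_series_minus (V := C_NormedModule) a b u v). Qed.

Lemma is_cseries_sum (a : nat -> nat -> C) (v : nat -> C) (n : nat) :
  (forall i, (i <= n)%nat -> is_cseries (a i) (v i)) ->
  is_cseries (fun k => sum_n (G := C_AbelianMonoid) (fun i => a i k) n)
    (sum_n (G := C_AbelianMonoid) v n).
Proof.
  intros H. induction n as [|n IH].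
  - rewrite sum_O. apply is_cseries_ext with (a 0%nat); [|auto].
    intros k. now rewrite sum_O.
  - rewrite sum_Sn. apply is_cseries_ext with
      (fun k => sum_n (G := C_AbelianMonoid) (fun i => a i k) n + a (S n) k)%C.
    + intros k. now rewrite sum_Sn.
    + apply is_cseries_plus; auto.
Qed.

(** Values, derivatives and remainders are dominated by the same summable sequence on a common disc,
    so the three series converge and the remainders add up. The factor 2 stems from summing real and
    imaginary parts separately. *)
Lemma hol_series (f : nat -> C -> C) (l : nat -> C) (B : nat -> R) (s : C) (e : R) :
  0 < e <= 1 -> (forall k, quad (f k) (l k) s e (B k)) -> ex_series B ->
  hol (fun z => CSeries (fun k => f k z)) s.
Proof.
  intros He H HB.
  exists (CSeries l), e, (2 * Series B). split; [exact He|].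
  assert (Hval : forall h, Cmod h < e -> is_cseries (fun k => f k (s + h)%C)
    (CSeries (fun k => f k (s + h)%C))).
  { intros h Hh. apply is_cseries_CSeries with (2 := HB). intros k. now apply H. }
  assert (Hl : is_cseries l (CSeries l))
    by (apply is_cseries_CSeries with (2 := HB); intros k; apply H).
  split; [apply CSeries_bound with (2 := HB); intros k; apply H|].
  intros h Hh. split; [apply CSeries_bound with (2 := HB); intros k; now apply H|].
  assert (H0 := Hval (RtoC 0)). rewrite Cmod_0 in H0. specialize (H0 (proj1 He)).
  rewrite Cplus_0_r in H0.
  set (rem := fun k => (f k (s + h) - f k s - l k * h)%C).
  assert (Hrem : is_cseries rem (CSeries (fun k => f k (s + h)) -
    CSeries (fun k => f k s) - CSeries l * h)%C).
  { apply is_cseries_minus; [apply is_cseries_minus; [now apply Hval|exact H0]|].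
    apply is_cseries_ext with (fun k => h * l k)%C; [intros k; ring|].
    replace (CSeries l * h)%C with (h * CSeries l)%C by ring.
    now apply is_cseries_scal. }
  rewrite <- (is_cseries_unique _ _ Hrem).
  replace (2 * Series B * (Cmod h * Cmod h)) with
    (2 * Series (fun k => Cmod h * Cmod h * B k)) by (rewrite Series_scal_l; ring).
  apply CSeries_bound.
  - intros k. rewrite (Rmult_comm _ (B k)). now apply H.
  - now apply (ex_series_scal (V := R_NormedModule)).
Qed.

Definition cpw (a : R) (s : C) : C := Cexp (- s * RtoC a)%C.

Lemma Cmod_cpw (a : R) (s : C) : Cmod (cpw a s) = exp (- (Re s * a)).
Proof.
  unfold cpw. rewrite Cmod_Cexp. f_equal. destruct s as [x y].
  unfold Re, Cmult, Copp, RtoC. simpl. ring.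
Qed.

Lemma cpw_plus (a : R) (s h : C) : cpw a (s + h) = (cpw a s * cpw a h)%C.
Proof. unfold cpw. rewrite <- Cexp_plus. f_equal. ring. Qed.

Lemma cpw_R (a x : R) : cpw a (RtoC x) = RtoC (exp (- (x * a))).
Proof.
  unfold cpw. rewrite <- RtoC_opp, <- RtoC_mult, Cexp_RtoC. do 2 f_equal. ring.
Qed.

Lemma square_le_exp (a e : R) : 0 <= a -> 0 < e <= 1 ->
  (1 + a) * (1 + a) <= / (e * e) * exp (2 * e * a).
Proof.
  intros Ha He. replace (2 * e * a) with (e * a + e * a) by ring. rewrite exp_plus.
  assert (H : 1 + a <= / e * exp (e * a)).
  { apply Rmult_le_reg_l with e; [lra|]. rewrite <- Rmult_assoc, Rinv_r, Rmult_1_l by lra.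
    generalize (exp_ge_1_plus (e * a)). nra. }
  replace (/ (e * e) * (exp (e * a) * exp (e * a))) with
    ((/ e * exp (e * a)) * (/ e * exp (e * a))) by (field; lra).
  apply Rmult_le_compat; lra.
Qed.

(** Moving within the disc lowers the real part by at most e; the factors a and a^2 brought down by
    differentiation are absorbed by exp (2 e a), at the cost of a further 2 e and of 1/e^2. *)
Lemma quad_cpw (a : R) (s : C) (e : R) : 0 <= a -> 0 < e <= 1 ->
  quad (cpw a) (- RtoC a * cpw a s)%C s e (2 / (e * e) * exp (- ((Re s - 3 * e) * a))).
Proof.
  intros Ha He.
  assert (Hsq := square_le_exp a e Ha He).
  set (E := exp (- ((Re s - e) * a))). assert (HE : 0 < E) by apply exp_pos.
  assert (Hbig : 2 * ((1 + a) * (1 + a)) * E <=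
    2 / (e * e) * exp (- ((Re s - 3 * e) * a))).
  { replace (exp (- ((Re s - 3 * e) * a))) with (exp (2 * e * a) * E)
      by (unfold E; rewrite <- exp_plus; f_equal; ring).
    replace (2 / (e * e) * (exp (2 * e * a) * E)) with
      (2 * (/ (e * e) * exp (2 * e * a)) * E) by (field; lra).
    apply Rmult_le_compat_r; [lra|]. lra. }
  assert (HsE : Cmod (cpw a s) <= E).
  { rewrite Cmod_cpw. apply exp_mono. nra. }
  split.
  - eapply Rle_trans; [|exact Hbig]. rewrite Cmod_mult, Cmod_opp, Cmod_R, Rabs_pos_eq
      by exact Ha.
    apply Rmult_le_compat; [exact Ha|apply Cmod_ge_0|nra|exact HsE].
  - intros h Hh.
    assert (HRe := Re_le_Cmod h). apply Rabs_le_between in HRe. split.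
    + eapply Rle_trans; [|exact Hbig]. rewrite cpw_plus, Cmod_mult, !Cmod_cpw, <- exp_plus.
      apply Rle_trans with E; [|nra]. apply exp_mono. nra.
    + eapply Rle_trans; [|apply Rmult_le_compat_r; [nra|exact Hbig]].
      rewrite cpw_plus.
      replace (cpw a s * cpw a h - cpw a s - - RtoC a * cpw a s * h)%C with
        (cpw a s * (Cexp (- h * RtoC a) - RtoC 1 - (- h * RtoC a)))%C
        by (change (Cexp (- h * RtoC a)%C) with (cpw a h); ring).
      rewrite Cmod_mult.
      assert (Hr := Cexp_remainder (- h * RtoC a)%C).
      rewrite Cmod_mult, Cmod_opp, Cmod_R, (Rabs_pos_eq a) in Hr by exact Ha.
      eapply Rle_trans.
      { apply Rmult_le_compat_l; [apply Cmod_ge_0|exact Hr]. }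
      assert (HsE' : Cmod (cpw a s) * exp (Cmod h * a) <= E).
      { rewrite Cmod_cpw, <- exp_plus. apply exp_mono. nra. }
      apply Rle_trans with (2 * ((Cmod h * a) * (Cmod h * a)) * E).
      * replace (Cmod (cpw a s) * (2 * (Cmod h * a * (Cmod h * a)) * exp (Cmod h * a)))
          with (2 * (Cmod h * a * (Cmod h * a)) * (Cmod (cpw a s) * exp (Cmod h * a)))
          by ring.
        apply Rmult_le_compat_l; [|exact HsE'].
        apply Rmult_le_pos; [lra|]. apply Rmult_le_pos; apply Rmult_le_pos; lra.
      * replace (2 * (Cmod h * a * (Cmod h * a)) * E) with
          (2 * (a * a) * E * (Cmod h * Cmod h)) by ring.
        apply Rmult_le_compat_r; [nra|]. apply Rmult_le_compat_r; [lra|]. nra.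
Qed.

Lemma hol_cpw (a : R) (s : C) : 0 <= a -> hol (cpw a) s.
Proof.
  intros Ha. eexists _, 1, _. split; [lra|]. apply quad_cpw; [exact Ha|lra].
Qed.

Lemma exp_ln_INR (x : R) (k : nat) : exp (- (x * ln (INR (S k)))) = Rpower (INR (S k)) (- x).
Proof. unfold Rpower. f_equal. ring. Qed.

Lemma ln_INR_nonneg (k : nat) : 0 <= ln (INR (S k)).
Proof. rewrite <- ln_1. apply ln_le; [lra|apply INR_S_ge_1]. Qed.

(** [npw k s] is [(k + 1)^(- s)]. *)
Definition npw (k : nat) (s : C) : C := cpw (ln (INR (S k))) s.

Lemma Cmod_npw (k : nat) (s : C) : Cmod (npw k s) = Rpower (INR (S k)) (- Re s).
Proof. unfold npw. rewrite Cmod_cpw. apply exp_ln_INR. Qed.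

Lemma npw_plus (k : nat) (s h : C) : npw k (s + h) = (npw k s * npw k h)%C.
Proof. apply cpw_plus. Qed.

Lemma npw_R (k : nat) (x : R) : npw k (RtoC x) = RtoC (Rpower (INR (S k)) (- x)).
Proof. unfold npw. now rewrite cpw_R, exp_ln_INR. Qed.

Lemma quad_npw (k : nat) (s : C) (e : R) : 0 < e <= 1 -> exists l,
  quad (npw k) l s e (2 / (e * e) * Rpower (INR (S k)) (- (Re s - 3 * e))).
Proof.
  intros He. eexists. rewrite <- exp_ln_INR.
  apply quad_cpw; [apply ln_INR_nonneg|exact He].
Qed.

Lemma hol_npw (k : nat) (s : C) : hol (npw k) s.
Proof. apply hol_cpw, ln_INR_nonneg. Qed.

Lemma hol_series_quad (f : nat -> C -> C) (B : nat -> R) (s : C) (e : R) :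
  0 < e <= 1 -> (forall k, exists l, quad (f k) l s e (B k)) -> ex_series B ->
  hol (fun z => CSeries (fun k => f k z)) s.
Proof.
  intros He H HB.
  set (l := fun k => proj1_sig (constructive_indefinite_description _ (H k))).
  apply hol_series with l B e; [exact He| |exact HB].
  intros k. exact (proj2_sig (constructive_indefinite_description _ (H k))).
Qed.

Lemma ex_series_Rpower_shift (a p : R) : 1 < p ->
  ex_series (fun k => a * Rpower (INR (S k)) (- p)).
Proof.
  intros Hp. apply (ex_series_scal (V := R_NormedModule)). now apply ex_series_Riemann.
Qed.

Lemma hol_dirichlet (a : nat -> R) (s0 : R) (s : C) :
  ex_series (fun k => Rabs (a k) * Rpower (INR (S k)) (- s0)) -> s0 < Re s ->
  hol (fun z => CSeries (fun k => RtoC (a k) * npw k z)%C) s.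
Proof.
  (* Small enough for Re s - 3 e >= s0, as [quad_npw] requires. *)
  intros Ha Hs. set (e := Rmin 1 ((Re s - s0) / 3)).
  assert (He1 := Rmin_l 1 ((Re s - s0) / 3)). assert (He2 := Rmin_r 1 ((Re s - s0) / 3)).
  fold e in He1, He2.
  assert (He : 0 < e <= 1) by (split; [apply Rmin_glb_lt; lra|exact He1]).
  apply hol_series_quad with
    (fun k => 4 * (Rabs (a k) * (2 / (e * e) * Rpower (INR (S k)) (- s0)))) e;
    [exact He| |].
  - intros k. destruct (quad_npw k s e He) as [l Hl]. eexists.
    eapply quad_weaken with (e := e); [apply Rle_refl| |apply quad_mult; [exact He| |exact Hl]].
    2: apply (quad_const (RtoC (a k)) s e).
    rewrite Cmod_R.
    apply Rmult_le_compat_l; [lra|]. apply Rmult_le_compat_l; [apply Rabs_pos|].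
    apply Rmult_le_compat_l.
    + apply Rlt_le, Rdiv_lt_0_compat; nra.
    + apply Rle_Rpower; [apply INR_S_ge_1|lra].
  - apply ex_series_ext with (fun k => 4 * (2 / (e * e)) *
      (Rabs (a k) * Rpower (INR (S k)) (- s0))).
    + intros k. eq_R. field. lra.
    + now apply (ex_series_scal (V := R_NormedModule)).
Qed.

Lemma is_cseries_dirichlet (a : nat -> R) (s0 : R) (s : C) :
  ex_series (fun k => Rabs (a k) * Rpower (INR (S k)) (- s0)) -> s0 <= Re s ->
  is_cseries (fun k => RtoC (a k) * npw k s)%C (CSeries (fun k => RtoC (a k) * npw k s)%C).
Proof.
  intros Ha Hs. apply is_cseries_CSeries with (2 := Ha). intros k.
  rewrite Cmod_mult, Cmod_R, Cmod_npw. apply Rmult_le_compat_l; [apply Rabs_pos|].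
  apply Rle_Rpower; [apply INR_S_ge_1|lra].
Qed.

Definition steps (k : nat) : R := ln (1 + / INR (S k)).

Lemma steps_bounds (k : nat) : 0 <= steps k <= / INR (S k) /\
  Rabs (steps k - / INR (S k)) <= / INR (S k) * / INR (S k).
Proof.
  assert (Hk : 0 < / INR (S k)) by (apply Rinv_0_lt_compat, INR_S_pos).
  assert (H := ln_1_plus_bounds _ (Rlt_le _ _ Hk)). unfold steps.
  split; [split; [|lra]|apply Rabs_le; nra].
  rewrite <- ln_1. apply ln_le; lra.
Qed.

Lemma steps_ln (k : nat) : ln (INR (S (S k))) = ln (INR (S k)) + steps k.
Proof.
  unfold steps. assert (H := INR_S_pos k).
  assert (Hi : 0 < / INR (S k)) by now apply Rinv_0_lt_compat.
  rewrite <- ln_mult by lra. f_equal. rewrite (S_INR (S k)). field. lra.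
Qed.

Lemma npw_succ (k : nat) (s : C) : npw (S k) s = (npw k s * cpw (steps k) s)%C.
Proof.
  unfold npw, cpw. rewrite steps_ln, <- Cexp_plus. f_equal.
  rewrite RtoC_plus. ring.
Qed.

Lemma inv_INR_le_1 (k : nat) : 0 < / INR (S k) <= 1.
Proof.
  split; [apply Rinv_0_lt_compat, INR_S_pos|]. rewrite <- Rinv_1.
  apply Rinv_le_contravar; [lra|apply INR_S_ge_1].
Qed.

(** The bound is linear in [L] with a constant depending on [s] only. For L of order 1/k this gains
    the power of k that makes the paired terms of [eta] summable. *)
Lemma quad_one_minus_cpw (s : C) : exists B, 0 <= B /\ forall L, 0 <= L <= 1 ->
  exists l, quad (fun z => RtoC 1 - cpw L z)%C l s 1 (B * L).
Proof.
  set (R0 := Cmod s + 1). assert (HR0 : 1 <= R0) by (unfold R0; generalize (Cmod_ge_0 s); lra).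
  assert (HE : 1 <= exp R0) by (apply exp_ge_1; lra).
  assert (HE1 : 1 <= exp 1) by (apply exp_ge_1; lra).
  assert (T1 : 0 <= R0 * (1 + 2 * R0 * exp R0)) by nra.
  assert (T2 : exp R0 <= 2 * exp R0 * exp 1) by nra.
  exists (R0 * (1 + 2 * R0 * exp R0) + 2 * exp R0 * exp 1). split; [lra|].
  intros L HL. exists (RtoC L * cpw L s)%C.
  assert (T3 : 0 <= 2 * exp R0 * exp 1 * L) by (apply Rmult_le_pos; lra).
  assert (T4 : 0 <= R0 * (1 + 2 * R0 * exp R0) * L) by (apply Rmult_le_pos; lra).
  assert (Hsmall : forall z, Cmod z <= R0 -> Cmod (- z * RtoC L) <= R0 * L).
  { intros z Hz. rewrite Cmod_mult, Cmod_opp, Cmod_R, Rabs_pos_eq by lra. nra. }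
  assert (Hs0 : Cmod s <= R0) by (unfold R0; lra).
  assert (Hcpw : Cmod (cpw L s) <= exp R0).
  { unfold cpw. eapply Rle_trans; [apply Cmod_Cexp_le|]. apply exp_mono.
    eapply Rle_trans; [now apply Hsmall|]. nra. }
  split.
  - rewrite Cmod_mult, Cmod_R, Rabs_pos_eq, Rmult_comm by lra.
    apply Rmult_le_compat_r; lra.
  - intros h Hh. assert (Hh0 := Cmod_ge_0 h). split.
    + assert (Hz : Cmod (s + h) <= R0) by (eapply Rle_trans; [apply Cmod_triangle|unfold R0; lra]).
      replace (RtoC 1 - cpw L (s + h))%C with (- (cpw L (s + h) - RtoC 1))%C by ring.
      rewrite Cmod_opp. unfold cpw.
      eapply Rle_trans; [apply Cexp_minus_1|].
      assert (Hw := Hsmall _ Hz). set (w := Cmod (- (s + h) * RtoC L)) in *.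
      assert (Hw0 : 0 <= w) by apply Cmod_ge_0.
      assert (Hwe : exp w <= exp R0) by (apply exp_mono; nra).
      assert (Hp := exp_pos w).
      assert (HwR : w <= R0) by nra.
      assert (1 + 2 * w * exp w <= 1 + 2 * R0 * exp R0).
      { apply Rplus_le_compat_l. apply Rmult_le_compat; lra. }
      apply Rle_trans with (R0 * L * (1 + 2 * R0 * exp R0)); [|lra].
      apply Rmult_le_compat; [exact Hw0| |exact Hw|assumption].
      assert (0 <= w * exp w) by (apply Rmult_le_pos; lra). lra.
    + rewrite cpw_plus.
      replace (RtoC 1 - cpw L s * cpw L h - (RtoC 1 - cpw L s) - RtoC L * cpw L s * h)%C
        with (- (cpw L s * (Cexp (- h * RtoC L) - RtoC 1 - (- h * RtoC L))))%C
        by (change (Cexp (- h * RtoC L)%C) with (cpw L h); ring).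
      rewrite Cmod_opp, Cmod_mult.
      assert (Hr := Cexp_remainder (- h * RtoC L)%C).
      rewrite Cmod_mult, Cmod_opp, Cmod_R, (Rabs_pos_eq L) in Hr by lra.
      assert (He : exp (Cmod h * L) <= exp 1) by (apply exp_mono; nra).
      assert (Hp := exp_pos (Cmod h * L)).
      assert (Hr2 : Cmod (Cexp (- h * RtoC L) - RtoC 1 - - h * RtoC L) <=
        2 * L * (Cmod h * Cmod h) * exp 1).
      { eapply Rle_trans; [exact Hr|]. apply Rmult_le_compat; [|lra| |exact He].
        - apply Rmult_le_pos; [lra|apply Rmult_le_pos; apply Rmult_le_pos; lra].
        - replace (2 * (Cmod h * L * (Cmod h * L))) with (2 * L * (Cmod h * Cmod h) * L)
            by ring.
          rewrite <- (Rmult_1_r (2 * L * (Cmod h * Cmod h))) at 2.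
          apply Rmult_le_compat_l; [|lra].
          apply Rmult_le_pos; [lra|apply Rmult_le_pos; lra]. }
      eapply Rle_trans; [apply Rmult_le_compat; [apply Cmod_ge_0|apply Cmod_ge_0|
        exact Hcpw|exact Hr2]|].
      replace (exp R0 * (2 * L * (Cmod h * Cmod h) * exp 1)) with
        (2 * exp R0 * exp 1 * L * (Cmod h * Cmod h)) by ring.
      apply Rmult_le_compat_r; [nra|]. lra.
Qed.

(** The second-order analogue: the gain L^2 compensates the factor k + 1 in [zterm] and leaves one
    power of k. *)
Lemma quad_exp_second (s : C) : exists B, 0 <= B /\ forall L, 0 <= L <= 1 ->
  exists l, quad (fun z => Cexp ((RtoC 1 - z) * RtoC L) - RtoC 1 - (RtoC 1 - z) * RtoC L)%C
    l s 1 (B * (L * L)).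
Proof.
  set (R0 := Cmod s + 2). assert (HR0 : 1 <= R0) by (unfold R0; generalize (Cmod_ge_0 s); lra).
  assert (HE : 1 <= exp R0) by (apply exp_ge_1; lra).
  assert (HE1 : 1 <= exp 1) by (apply exp_ge_1; lra).
  exists (R0 * (1 + 2 * R0 * exp R0) + 2 * (R0 * R0) * exp R0 + 2 * exp R0 * exp 1).
  split; [nra|].
  intros L HL. exists (- RtoC L * (Cexp ((RtoC 1 - s) * RtoC L) - RtoC 1))%C.
  assert (HB1 : 0 <= 2 * (R0 * R0) * exp R0) by nra.
  assert (HB2 : 0 <= 2 * exp R0 * exp 1) by nra.
  assert (HLL : 0 <= L * L) by nra.
  assert (Hsmall : forall z, Cmod z <= Cmod s + 1 ->
    Cmod ((RtoC 1 - z) * RtoC L) <= R0 * L).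
  { intros z Hz. rewrite Cmod_mult, Cmod_R, Rabs_pos_eq by lra.
    apply Rmult_le_compat_r; [lra|]. unfold Cminus.
    eapply Rle_trans; [apply Cmod_triangle|]. rewrite Cmod_1, Cmod_opp. unfold R0. lra. }
  assert (Hs0 : Cmod s <= Cmod s + 1) by lra.
  assert (Hw := Hsmall s Hs0).
  set (w := ((RtoC 1 - s) * RtoC L)%C) in *.
  assert (Hw0 := Cmod_ge_0 w).
  assert (HRL : R0 * L <= R0) by nra.
  assert (Hwe : exp (Cmod w) <= exp R0) by (apply exp_mono; lra).
  assert (Hpw := exp_pos (Cmod w)).
  split.
  - rewrite Cmod_mult, Cmod_opp, Cmod_R, Rabs_pos_eq by lra.
    assert (H1 := Cexp_minus_1 w).
    assert (H2 : Cmod w * (1 + 2 * Cmod w * exp (Cmod w)) <=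
      R0 * L * (1 + 2 * R0 * exp R0)).
    { apply Rmult_le_compat; [lra|nra|exact Hw|].
      assert (2 * Cmod w * exp (Cmod w) <= 2 * R0 * exp R0)
        by (apply Rmult_le_compat; lra). lra. }
    apply Rle_trans with (L * (R0 * L * (1 + 2 * R0 * exp R0))).
    + apply Rmult_le_compat_l; lra.
    + nra.
  - intros h Hh. assert (Hh0 := Cmod_ge_0 h). split.
    + assert (Hz : Cmod (s + h) <= Cmod s + 1)
        by (eapply Rle_trans; [apply Cmod_triangle|lra]).
      eapply Rle_trans; [apply Cexp_remainder|].
      assert (Hv := Hsmall _ Hz). set (v := Cmod ((RtoC 1 - (s + h)) * RtoC L)) in *.
      assert (Hv0 : 0 <= v) by apply Cmod_ge_0.
      assert (Hve : exp v <= exp R0) by (apply exp_mono; lra).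
      assert (Hp := exp_pos v).
      apply Rle_trans with (2 * ((R0 * L) * (R0 * L)) * exp R0).
      * apply Rmult_le_compat; [nra|lra| |exact Hve].
        apply Rmult_le_compat_l; [lra|]. apply Rmult_le_compat; lra.
      * nra.
    + replace (Cexp ((RtoC 1 - (s + h)) * RtoC L)) with (Cexp w * Cexp (- h * RtoC L))%C
        by (rewrite <- Cexp_plus; f_equal; unfold w; ring).
      match goal with |- Cmod ?x <= _ =>
        replace x with (Cexp w * (Cexp (- h * RtoC L) - RtoC 1 - (- h * RtoC L)))%C
          by (unfold w; ring) end.
      rewrite Cmod_mult.
      assert (Hr := Cexp_remainder (- h * RtoC L)%C).
      rewrite Cmod_mult, Cmod_opp, Cmod_R, (Rabs_pos_eq L) in Hr by lra.
      assert (He : exp (Cmod h * L) <= exp 1) by (apply exp_mono; nra).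
      assert (Hp := exp_pos (Cmod h * L)).
      assert (Hr2 : Cmod (Cexp (- h * RtoC L) - RtoC 1 - - h * RtoC L) <=
        2 * (L * L) * (Cmod h * Cmod h) * exp 1).
      { eapply Rle_trans; [exact Hr|]. apply Rmult_le_compat; [|lra| |exact He].
        - apply Rmult_le_pos; [lra|apply Rmult_le_pos; apply Rmult_le_pos; lra].
        - right; ring. }
      assert (Hew : Cmod (Cexp w) <= exp R0)
        by (eapply Rle_trans; [apply Cmod_Cexp_le|exact Hwe]).
      eapply Rle_trans; [apply Rmult_le_compat; [apply Cmod_ge_0|apply Cmod_ge_0|
        exact Hew|exact Hr2]|].
      replace (exp R0 * (2 * (L * L) * (Cmod h * Cmod h) * exp 1)) with
        (2 * exp R0 * exp 1 * (L * L) * (Cmod h * Cmod h)) by ring.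
      apply Rmult_le_compat_r; [nra|]. apply Rmult_le_compat_r; [exact HLL|]. lra.
Qed.

(** * Zeta and eta functions *)

Lemma quad_one_minus (s : C) : quad (fun z => RtoC 1 - z)%C (- RtoC 1)%C s 1 (Cmod s + 2).
Proof.
  assert (H := Cmod_ge_0 s).
  split; [rewrite Cmod_opp, Cmod_1; lra|]. intros h Hh. split.
  - unfold Cminus. eapply Rle_trans; [apply Cmod_triangle|]. rewrite Cmod_1, Cmod_opp.
    generalize (Cmod_triangle s h). lra.
  - replace (RtoC 1 - (s + h) - (RtoC 1 - s) - - RtoC 1 * h)%C with (RtoC 0) by ring.
    rewrite Cmod_0. apply Rmult_le_pos; [lra|nra].
Qed.

(** With [s] fixed, [(k+2)^(1-s) - (k+1)^(1-s) - (1-s) (k+1)^(-s)] is of order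
    [k^(- s - 1)]; see [zterm_eq]. *)
Definition zterm (k : nat) (s : C) : C :=
  (npw k s * RtoC (INR (S k)) *
   ((Cexp ((RtoC 1 - s) * RtoC (steps k)) - RtoC 1 - (RtoC 1 - s) * RtoC (steps k)) +
    (RtoC 1 - s) * RtoC (steps k - / INR (S k))))%C.

Lemma zterm_eq (k : nat) (s : C) :
  zterm k s = (RtoC (INR (S (S k))) * npw (S k) s - RtoC (INR (S k)) * npw k s +
    (s - RtoC 1) * npw k s)%C.
Proof.
  unfold zterm. rewrite npw_succ.
  assert (HI := INR_S_pos k).
  assert (HIC : RtoC (INR (S k)) <> RtoC 0) by (intros E; apply RtoC_inj in E; lra).
  assert (E : Cexp ((RtoC 1 - s) * RtoC (steps k)) =
    (RtoC (1 + / INR (S k)) * cpw (steps k) s)%C).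
  { replace ((RtoC 1 - s) * RtoC (steps k))%C with
      (RtoC (steps k) + - s * RtoC (steps k))%C by ring.
    rewrite Cexp_plus, Cexp_RtoC. unfold steps at 1. rewrite exp_ln; [reflexivity|].
    assert (0 < / INR (S k)) by now apply Rinv_0_lt_compat. lra. }
  rewrite E, RtoC_minus, RtoC_plus, RtoC_inv by lra.
  replace (RtoC (INR (S (S k)))) with (RtoC (INR (S k)) + RtoC 1)%C
    by (rewrite <- RtoC_plus, <- S_INR; reflexivity).
  field. exact HIC.
Qed.

(** This is (s - 1) zeta(s), continued to Re s > 0: the terms (k+1)^(1-s) telescope to -1, and what
    remains of the sum of [zterm] is (s - 1) times the zeta series. *)
Definition zG (s : C) : C := (RtoC 1 + CSeries (fun k => zterm k s))%C.

(** The residue of zeta at 1; at s = 1 every [zterm] vanishes. *)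
Lemma zG_1 : zG (RtoC 1) = RtoC 1.
Proof.
  unfold zG. replace (CSeries (fun k => zterm k (RtoC 1))) with (RtoC 0); [ring|].
  symmetry. apply is_cseries_unique.
  apply is_cseries_ext with (fun _ => RtoC 0).
  - intros k. unfold zterm.
    replace ((RtoC 1 - RtoC 1) * RtoC (steps k))%C with (RtoC 0) by ring.
    rewrite Cexp_0. ring.
  - apply is_series_C_components. split; simpl;
      (assert (H := Series_finite (fun _ => 0) 0 (fun _ _ => eq_refl));
       rewrite sum_O in H; exact H).
Qed.

Lemma quad_zterm (s : C) (e : R) : 0 < e <= 1 -> exists B, 0 <= B /\
  forall k, exists l, quad (zterm k) l s e (B * Rpower (INR (S k)) (- (Re s - 3 * e + 1))).
Proof.
  intros He. destruct (quad_exp_second s) as [B1 [HB1 H1]].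
  set (B2 := Cmod s + 2). assert (HB2 : 0 <= B2) by (unfold B2; generalize (Cmod_ge_0 s); lra).
  assert (He2 : 0 < 2 / (e * e)) by (apply Rdiv_lt_0_compat; nra).
  exists (4 * (4 * (2 / (e * e))) * (B1 + 4 * B2)).
  split; [apply Rmult_le_pos; lra|].
  intros k. destruct (steps_bounds k) as [[HL0 HL1] HL2].
  assert (Hi := inv_INR_le_1 k). assert (HI := INR_S_pos k).
  destruct (H1 (steps k) ltac:(lra)) as [l1 Q1].
  apply quad_weaken with (e' := e) (B' := B1 * (steps k * steps k)) in Q1; [|lra|lra].
  assert (Q2 := quad_one_minus s). fold B2 in Q2.
  apply quad_weaken with (e' := e) (B' := B2) in Q2; [|lra|lra].
  destruct (quad_npw k s e He) as [l3 Q3].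
  assert (Q4 := quad_mult _ _ _ _ _ _ _ _ He Q3 (quad_const (RtoC (INR (S k))) s e)).
  assert (Q5 := quad_mult _ _ _ _ _ _ _ _ He Q2
    (quad_const (RtoC (steps k - / INR (S k))) s e)).
  assert (Q6 := quad_mult _ _ _ _ _ _ _ _ He Q4 (quad_plus _ _ _ _ _ _ _ _ Q1 Q5)).
  eexists. eapply quad_weaken; [apply Rle_refl| |exact Q6].
  rewrite !Cmod_R, (Rabs_pos_eq (INR (S k))) by lra.
  replace (- (Re s - 3 * e + 1)) with (- (Re s - 3 * e) + Ropp 1) by ring.
  rewrite Rpower_plus, Rpower_m1 by exact HI.
  set (P := Rpower (INR (S k)) (- (Re s - 3 * e))).
  assert (HP : 0 < P) by apply Rpower_pos.
  set (x := / INR (S k)) in *.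
  assert (HB : B1 * (steps k * steps k) + 4 * (B2 * Rabs (steps k - x)) <=
    (B1 + 4 * B2) * (x * x)).
  { assert (steps k * steps k <= x * x) by (apply Rmult_le_compat; lra).
    assert (B1 * (steps k * steps k) <= B1 * (x * x)) by (apply Rmult_le_compat_l; lra).
    assert (B2 * Rabs (steps k - x) <= B2 * (x * x)) by (apply Rmult_le_compat_l; lra).
    lra. }
  replace (4 * (4 * (2 / (e * e))) * (B1 + 4 * B2) * (P * x)) with
    (4 * (4 * (2 / (e * e) * P * INR (S k)) * ((B1 + 4 * B2) * (x * x))))
    by (unfold x; field; lra).
  apply Rmult_le_compat_l; [lra|]. apply Rmult_le_compat_l; [|exact HB].
  apply Rmult_le_pos; [lra|]. apply Rmult_le_pos; [|lra]. apply Rmult_le_pos; lra.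
Qed.

Lemma small_radius (x : R) : 0 < x -> exists e, 0 < e <= 1 /\ 0 < x - 3 * e.
Proof.
  intros Hx. exists (Rmin 1 (x / 4)).
  assert (H1 := Rmin_l 1 (x / 4)). assert (H2 := Rmin_r 1 (x / 4)).
  split; [split; [apply Rmin_glb_lt; lra|exact H1]|lra].
Qed.

Lemma hol_zG (s : C) : 0 < Re s -> hol zG s.
Proof.
  intros Hs. destruct (small_radius (Re s) Hs) as [e [He Hr]].
  destruct (quad_zterm s e He) as [B [HB HQ]].
  apply hol_plus; [apply hol_const|].
  apply hol_series_quad with (2 := HQ); [exact He|].
  apply ex_series_Rpower_shift. lra.
Qed.

Lemma is_cseries_telescope (t : nat -> C) :
  is_lim_seq (fun n => Cmod (t n)) 0 ->
  is_cseries (fun k => t (S k) - t k)%C (- t 0%nat)%C.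
Proof.
  intros Ht.
  assert (E : forall n, sum_n (G := C_AbelianMonoid) (fun k => t (S k) - t k)%C n =
    (t (S n) - t 0%nat)%C).
  { induction n as [|n IH]; [now rewrite sum_O|]. rewrite sum_Sn, IH.
    change (t (S n) - t 0%nat + (t (S (S n)) - t (S n)) = t (S (S n)) - t 0%nat)%C.
    ring. }
  unfold is_cseries, is_series.
  apply filterlim_ext with (fun n => t (S n) - t 0%nat)%C; [intros n; now rewrite E|].
  apply filterlim_C_Cmod.
  apply is_lim_seq_ext with (fun n => Cmod (t (S n))).
  - intros n. f_equal. ring.
  - now apply (is_lim_seq_incr_1 (fun n => Cmod (t n))).
Qed.

Lemma ex_series_one_dirichlet (x : R) : 1 < x ->
  ex_series (fun k => Rabs 1 * Rpower (INR (S k)) (- x)).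
Proof.
  intros Hx. rewrite Rabs_R1. now apply ex_series_Rpower_shift.
Qed.

Lemma zeta_series (s : C) : 1 < Re s ->
  is_cseries (fun k => npw k s) (zG s * / (s - RtoC 1))%C.
Proof.
  intros Hs.
  assert (Hs1 : (s - RtoC 1)%C <> RtoC 0).
  { intros E. apply (f_equal Re) in E. destruct s as [x y]. simpl in *. lra. }
  set (Z := CSeries (fun k => npw k s)).
  assert (HZ : is_cseries (fun k => npw k s) Z).
  { unfold Z. apply is_cseries_CSeries with (fun k => 1 * Rpower (INR (S k)) (- Re s)).
    - intros k. rewrite Cmod_npw. lra.
    - now apply ex_series_Rpower_shift. }
  assert (Ht : is_lim_seq (fun n => Cmod (RtoC (INR (S n)) * npw n s)) 0).
  { apply is_lim_seq_ext with (fun n => Rpower (INR (S n)) (- (Re s - 1))).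
    - intros n. rewrite Cmod_mult, Cmod_R, Cmod_npw, Rabs_pos_eq by apply pos_INR.
      replace (- (Re s - 1)) with (1 + - Re s) by ring.
      rewrite Rpower_plus, Rpower_1 by apply INR_S_pos. reflexivity.
    - apply (is_lim_seq_incr_1 (fun n => Rpower (INR n) (- (Re s - 1)))).
      apply is_lim_seq_incr_1.
      apply is_lim_seq_ext with (fun n => Rpower (/ INR (S n)) (Re s - 1)).
      + intros n. unfold Rpower. rewrite ln_Rinv by apply INR_S_pos. f_equal. ring.
      + apply is_lim_seq_Rpower_0; [lra| |].
        * intros n. apply Rinv_0_lt_compat, INR_S_pos.
        * apply is_lim_seq_ext with (fun n => 1 / INR (S n)).
          -- intros n. unfold Rdiv. ring.
          -- apply (is_lim_seq_const_div_INR 1 S). lia. }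
  assert (H := is_cseries_plus _ _ _ _ (is_cseries_telescope _ Ht)
    (is_cseries_scal (s - RtoC 1) _ _ HZ)).
  apply is_cseries_ext with (b := fun k => zterm k s) in H;
    [|intros k; now rewrite zterm_eq].
  replace (zG s * / (s - RtoC 1))%C with Z; [exact HZ|].
  unfold zG. rewrite (is_cseries_unique _ _ H).
  replace (npw 0 s) with (RtoC 1).
  - change (INR 1) with 1. field. exact Hs1.
  - unfold npw, cpw. change (INR 1) with 1. rewrite ln_1.
    replace (- s * RtoC 0)%C with (RtoC 0) by ring. now rewrite Cexp_0.
Qed.

(** The alternating zeta function, summed in pairs (2i+1)^(-s) - (2i+2)^(-s), which converge
    absolutely for Re s > 0. *)
Definition eta (s : C) : C :=
  CSeries (fun i => npw (2 * i) s * (RtoC 1 - cpw (steps (2 * i)) s))%C.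

Lemma hol_eta (s : C) : 0 < Re s -> hol eta s.
Proof.
  intros Hs. destruct (small_radius (Re s) Hs) as [e [He Hr]].
  destruct (quad_one_minus_cpw s) as [B [HB HQ]].
  assert (He2 : 0 < 2 / (e * e)) by (apply Rdiv_lt_0_compat; nra).
  apply hol_series_quad with
    (fun i => 4 * (2 / (e * e) * B) * Rpower (INR (S i)) (- (Re s - 3 * e + 1))) e;
    [exact He| |apply ex_series_Rpower_shift; lra].
  intros i. set (k := (2 * i)%nat). destruct (steps_bounds k) as [[HL0 HL1] _].
  assert (Hi := inv_INR_le_1 k). assert (HI := INR_S_pos k).
  destruct (HQ (steps k) ltac:(lra)) as [l1 Q1].
  apply quad_weaken with (e' := e) (B' := B * / INR (S k)) in Q1;
    [|lra|apply Rmult_le_compat_l; lra].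
  destruct (quad_npw k s e He) as [l2 Q2].
  eexists. eapply quad_weaken; [apply Rle_refl| |exact (quad_mult _ _ _ _ _ _ _ _ He Q2 Q1)].
  assert (Hp : Rpower (INR (S k)) (- (Re s - 3 * e)) * / INR (S k) <=
    Rpower (INR (S i)) (- (Re s - 3 * e + 1))).
  { rewrite <- (Rpower_m1 (INR (S k))), <- Rpower_plus by exact HI.
    replace (- (Re s - 3 * e) + Ropp 1) with (- (Re s - 3 * e + 1)) by ring.
    apply Rpower_neg_antitone; [apply INR_S_pos|apply le_INR; unfold k; lia|lra]. }
  replace (4 * (2 / (e * e) * Rpower (INR (S k)) (- (Re s - 3 * e)) * (B * / INR (S k))))
    with (4 * (2 / (e * e) * B) * (Rpower (INR (S k)) (- (Re s - 3 * e)) * / INR (S k)))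
    by ring.
  apply Rmult_le_compat_l; [|exact Hp]. apply Rmult_le_pos; [lra|]. apply Rmult_le_pos; lra.
Qed.

Lemma is_cseries_pairs (a : nat -> C) (v : C) : is_cseries a v ->
  is_cseries (fun i => a (2 * i)%nat + a (S (2 * i)))%C v.
Proof.
  intros H.
  assert (E : forall n, sum_n (G := C_AbelianMonoid) a (S (2 * n)) =
    sum_n (G := C_AbelianMonoid) (fun i => a (2 * i)%nat + a (S (2 * i)))%C n).
  { induction n as [|n IH]; [rewrite sum_O, sum_Sn, sum_O; reflexivity|].
    replace (2 * S n)%nat with (S (S (2 * n))) by lia.
    rewrite !sum_Sn, <- IH, !sum_Sn.
    replace (2 * S n)%nat with (S (S (2 * n))) by lia.
    unfold plus; simpl. symmetry. apply Cplus_assoc. }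
  unfold is_cseries, is_series.
  apply filterlim_ext with (fun n => sum_n (G := C_AbelianMonoid) a (S (2 * n)));
    [exact E|].
  apply (filterlim_comp _ _ _ (fun n => S (2 * n)) (sum_n (G := C_AbelianMonoid) a)
    eventually eventually (locally v)); [|exact H].
  intros P [N HN]. exists N. intros n Hn. apply HN. lia.
Qed.

Lemma eta_series (s : C) : 1 < Re s ->
  is_cseries (fun k => RtoC (alt k) * npw k s)%C (eta s).
Proof.
  intros Hs.
  assert (Habs : ex_series (fun k => Rabs (alt k) * Rpower (INR (S k)) (- Re s))).
  { apply ex_series_ext with (fun k => Rabs 1 * Rpower (INR (S k)) (- Re s)).
    - intros k. now rewrite Rabs_alt, Rabs_R1.
    - now apply ex_series_one_dirichlet. }
  assert (H := is_cseries_dirichlet alt (Re s) s Habs (Rle_refl _)).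
  assert (H2 := is_cseries_pairs _ _ H).
  replace (eta s) with (CSeries (fun k => RtoC (alt k) * npw k s)%C); [exact H|].
  unfold eta. symmetry. apply is_cseries_unique.
  eapply is_cseries_ext; [|exact H2]. intros i. cbv beta.
  rewrite npw_succ. unfold alt. rewrite <- tech_pow_Rmult, pow_1_even.
  replace (-1 * 1) with (- (1)) by ring. rewrite RtoC_opp. ring.
Qed.

(** Position [m] stands for the integer m + 1: the terms of [b] are moved to the multiples of j + 1.
    A series in (k+1) for fixed j thereby becomes a series over the products (k+1)(j+1). *)
Definition sparse (j : nat) (b : nat -> C) (m : nat) : C :=
  if (S m mod S j =? 0)%nat then b (pred (S m / S j)) else RtoC 0.

(** Unlike [sum_n] this admits the empty sum, so that [csum_sparse] also holds before the first
    multiple is reached. *)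
Fixpoint csum (a : nat -> C) (n : nat) : C :=
  match n with O => RtoC 0 | S k => (csum a k + a k)%C end.

Lemma csum_sum_n (a : nat -> C) (n : nat) :
  csum a (S n) = sum_n (G := C_AbelianMonoid) a n.
Proof.
  induction n as [|n IH]; [rewrite sum_O; simpl; ring|].
  rewrite sum_Sn, <- IH. reflexivity.
Qed.

Lemma is_cseries_csum (a : nat -> C) (v : C) :
  is_cseries a v <-> filterlim (csum a) eventually (locally v).
Proof.
  split; intros H.
  - intros P HP. destruct (H P HP) as [N HN]. exists (S N). intros n Hn.
    destruct n as [|n]; [lia|]. rewrite csum_sum_n. apply HN. lia.
  - intros P HP. destruct (H P HP) as [N HN]. exists N. intros n Hn.
    rewrite <- csum_sum_n. apply HN. lia.
Qed.

Lemma csum_sparse (j : nat) (b : nat -> C) (M : nat) :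
  csum (sparse j b) M = csum b (M / S j).
Proof.
  induction M as [|M IH]; [now rewrite Nat.div_0_l by lia|].
  cbn [csum]. rewrite IH. unfold sparse.
  assert (H1 := Nat.div_mod M (S j) ltac:(lia)).
  assert (H2 := Nat.mod_upper_bound M (S j) ltac:(lia)).
  set (t := (M / S j)%nat) in *. set (u := (M mod S j)%nat) in *.
  destruct (Nat.eq_dec u j) as [Hu|Hu].
  - assert (E : S M = (S t * S j)%nat) by lia.
    rewrite E, Nat.Div0.mod_mul, Nat.div_mul by lia. simpl. reflexivity.
  - assert (Ed : (S M / S j)%nat = t) by (symmetry; apply (Nat.div_unique _ _ _ (S u)); lia).
    assert (Em : (S M mod S j)%nat = S u)
      by (symmetry; apply (Nat.mod_unique _ _ t); lia).
    rewrite Em, Ed. simpl. ring.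
Qed.

Lemma is_cseries_sparse (j : nat) (b : nat -> C) (v : C) :
  is_cseries b v -> is_cseries (sparse j b) v.
Proof.
  intros H. apply is_cseries_csum. apply is_cseries_csum in H.
  apply filterlim_ext with (fun M => csum b (M / S j)).
  - intros M. symmetry. apply csum_sparse.
  - apply (filterlim_comp _ _ _ (fun M => (M / S j)%nat) (csum b)
      eventually eventually (locally v)); [|exact H].
    intros P [N HN]. exists (S j * N)%nat. intros n Hn. apply HN.
    apply Nat.div_le_lower_bound; lia.
Qed.

(** * The complex logarithm *)

(** Subdividing [0, 1] into n + 1 steps bounds the total increment by M/(n+1). *)
Lemma constant_of_quadratic_increments (f : R -> C) (M : R) :
  (forall t h, 0 <= t -> 0 <= h -> t + h <= 1 -> Cmod (f (t + h)%R - f t)%C <= M * (h * h)) ->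
  f 1 = f 0.
Proof.
  intros H.
  assert (step : forall n i, (i <= S n)%nat ->
    Cmod (f (INR i * / INR (S n))%R - f 0)%C <= INR i * (M * (/ INR (S n) * / INR (S n)))).
  { intros n i. assert (Hn := inv_INR_le_1 n). assert (Hn' := INR_S_pos n).
    induction i as [|i IH]; intros Hi.
    - simpl INR. rewrite !Rmult_0_l. unfold Cminus. rewrite Cplus_opp_r, Cmod_0. lra.
    - rewrite S_INR, !Rmult_plus_distr_r, !Rmult_1_l.
      replace (f (INR i * / INR (S n) + / INR (S n))%R - f 0)%C with
        ((f (INR i * / INR (S n) + / INR (S n))%R - f (INR i * / INR (S n))%R) +
         (f (INR i * / INR (S n))%R - f 0))%C by ring.
      eapply Rle_trans; [apply Cmod_triangle|]. rewrite Rplus_comm.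
      apply Rplus_le_compat; [apply IH; lia|]. apply H.
      + apply Rmult_le_pos; [apply pos_INR|lra].
      + lra.
      + apply Rmult_le_reg_r with (INR (S n)); [exact Hn'|].
        replace ((INR i * / INR (S n) + / INR (S n)) * INR (S n)) with (INR (S i))
          by (rewrite (S_INR i); field; lra).
        rewrite Rmult_1_l. now apply le_INR. }
  assert (Hz : Cmod (f 1 - f 0)%C <= 0).
  { apply (is_lim_seq_le (fun _ => Cmod (f 1 - f 0)%C) (fun n => M / INR (S n))
      (Cmod (f 1 - f 0)%C) 0).
    - intros n. assert (Hs := step n (S n) (le_n _)). assert (Hn := INR_S_pos n).
      rewrite Rinv_r in Hs by lra. eapply Rle_trans; [exact Hs|].
      right. field. lra.
    - apply is_lim_seq_const.
    - apply (is_lim_seq_const_div_INR M S). lia. }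
  assert (Hz0 : Cmod (f 1 - f 0)%C = 0) by (generalize (Cmod_ge_0 (f 1 - f 0)%C); lra).
  apply Cmod_eq_0 in Hz0.
  replace (f 1) with ((f 1 - f 0) + f 0)%C by ring. rewrite Hz0. ring.
Qed.

Lemma ex_series_INR_geom (x : R) : 0 <= x < 1 ->
  ex_series (fun j => INR (S j) * x ^ S j).
Proof.
  intros Hx. set (y := (1 + x) / 2). assert (Hy : 0 < y < 1) by (unfold y; lra).
  assert (Hd : 0 < - ln y).
  { assert (ln y < ln 1) by (apply ln_increasing; lra). rewrite ln_1 in *. lra. }
  apply ex_series_le_R with (powexp 2 (- ln y)); [|now apply ex_series_powexp].
  intros j. rewrite Rabs_pos_eq by (apply Rmult_le_pos; [apply pos_INR|apply pow_le; lra]).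
  unfold powexp. rewrite exp_pow, Ropp_involutive, exp_ln by lra.
  replace (2 - 1) with 1 by ring. rewrite Rpower_1 by apply INR_S_pos.
  apply Rmult_le_compat_l; [apply pos_INR|]. apply pow_incr. unfold y. lra.
Qed.

Lemma ex_series_geom_S (x : R) : 0 <= x < 1 -> ex_series (fun j => x ^ S j).
Proof.
  intros Hx. apply (ex_series_incr_1 (fun j => x ^ j)). apply ex_series_geom.
  rewrite Rabs_pos_eq; lra.
Qed.

Lemma Cmod_Cpow (z : C) (n : nat) : Cmod (Cpow z n) = Cmod z ^ n.
Proof.
  induction n as [|n IH]; simpl; [apply Cmod_1|]. now rewrite Cmod_mult, IH.
Qed.

Lemma alt_div_bound (j : nat) : Rabs (alt j / INR (S j)) <= 1.
Proof.
  unfold Rdiv. rewrite Rabs_mult, Rabs_alt, Rmult_1_l.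
  assert (H := inv_INR_le_1 j). rewrite Rabs_pos_eq; lra.
Qed.

Definition log1p (w : C) : C :=
  CSeries (fun j => RtoC (alt j / INR (S j)) * Cpow w (S j))%C.

Lemma log1p_term_bound (w : C) (j : nat) :
  Cmod (RtoC (alt j / INR (S j)) * Cpow w (S j)) <= Cmod w ^ S j.
Proof.
  rewrite Cmod_mult, Cmod_R, Cmod_Cpow. rewrite <- (Rmult_1_l (Cmod w ^ S j)) at 2.
  apply Rmult_le_compat_r; [apply pow_le, Cmod_ge_0|apply alt_div_bound].
Qed.

Lemma log1p_series (w : C) : Cmod w < 1 ->
  is_cseries (fun j => RtoC (alt j / INR (S j)) * Cpow w (S j))%C (log1p w).
Proof.
  intros Hw. apply is_cseries_CSeries with (fun j => Cmod w ^ S j).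
  - apply log1p_term_bound.
  - apply ex_series_geom_S. split; [apply Cmod_ge_0|exact Hw].
Qed.

Lemma is_cseries_geom (v : C) : Cmod v < 1 ->
  is_cseries (fun j => Cpow v j) (/ (RtoC 1 - v))%C.
Proof.
  intros Hv. assert (Hv0 := Cmod_ge_0 v).
  assert (Hne : (RtoC 1 - v)%C <> RtoC 0).
  { intros E. assert (E1 : v = RtoC 1).
    { replace v with (RtoC 1 - (RtoC 1 - v))%C by ring. rewrite E. ring. }
    rewrite E1, Cmod_1 in Hv. lra. }
  assert (E : forall n, sum_n (G := C_AbelianMonoid) (fun j => Cpow v j) n =
    (/ (RtoC 1 - v) - Cpow v (S n) * / (RtoC 1 - v))%C).
  { induction n as [|n IH].
    - rewrite sum_O. simpl. field. exact Hne.
    - rewrite sum_Sn, IH.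
      change (/ (RtoC 1 - v) - Cpow v (S n) * / (RtoC 1 - v) + Cpow v (S n) =
        / (RtoC 1 - v) - v * Cpow v (S n) * / (RtoC 1 - v))%C. field. exact Hne. }
  unfold is_cseries, is_series.
  apply filterlim_ext with (fun n => / (RtoC 1 - v) - Cpow v (S n) * / (RtoC 1 - v))%C;
    [intros n; now rewrite E|].
  apply filterlim_C_Cmod.
  apply is_lim_seq_ext with (fun n => Cmod v ^ S n * Cmod (/ (RtoC 1 - v))%C).
  - intros n. rewrite <- Cmod_Cpow, <- Cmod_mult, <- Cmod_opp. f_equal. ring.
  - rewrite <- (Rmult_0_l (Cmod (/ (RtoC 1 - v))%C)).
    apply is_lim_seq_mult'; [|apply is_lim_seq_const].
    apply (is_lim_seq_incr_1 (fun n => Cmod v ^ n)), is_lim_seq_geom.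
    rewrite Rabs_pos_eq; lra.
Qed.

Lemma pow_increment_bound (t h : R) (j : nat) : 0 <= t -> 0 <= h -> t + h <= 1 ->
  Rabs ((t + h) ^ S j - t ^ S j - INR (S j) * t ^ j * h) <= INR (S j) * INR (S j) * (h * h).
Proof.
  intros Ht Hh Hth. assert (Hhh : 0 <= h * h) by nra.
  induction j as [|j IH].
  - simpl. replace ((t + h) * 1 - t * 1 - 1 * 1 * h) with 0 by ring.
    rewrite Rabs_R0. lra.
  - set (a := (t + h) ^ S j - t ^ S j - INR (S j) * t ^ j * h) in *.
    replace ((t + h) ^ S (S j) - t ^ S (S j) - INR (S (S j)) * t ^ S j * h) with
      ((t + h) * a + INR (S j) * t ^ j * (h * h))
      by (unfold a; rewrite (S_INR (S j)); simpl pow; ring).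
    assert (Hj := INR_S_pos j).
    assert (Htj : 0 <= t ^ j <= 1).
    { split; [now apply pow_le|]. rewrite <- (pow1 j). apply pow_incr. lra. }
    eapply Rle_trans; [apply Rabs_triang|]. rewrite !Rabs_mult.
    rewrite (Rabs_pos_eq (t + h)), (Rabs_pos_eq (INR (S j))), (Rabs_pos_eq (t ^ j)),
      (Rabs_pos_eq h) by lra.
    rewrite (S_INR (S j)). assert (Ha := Rabs_pos a).
    assert ((t + h) * Rabs a <= Rabs a) by nra.
    assert (INR (S j) * t ^ j * (h * h) <= INR (S j) * (h * h)).
    { apply Rmult_le_compat_r; [exact Hhh|]. nra. }
    assert (0 <= INR (S j) * (h * h)) by nra. lra.
Qed.

(** Along the ray t w the derivative w/(1 + t w) is the geometric series obtained by termwise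
    differentiation; the remainders of the powers are summable with weight k + 1. *)
Lemma log1p_increment (w : C) : Cmod w < 1 -> exists K, 0 <= K /\
  forall t h, 0 <= t -> 0 <= h -> t + h <= 1 ->
  Cmod (log1p (RtoC (t + h) * w) - log1p (RtoC t * w) -
    RtoC h * w * / (RtoC 1 + RtoC t * w))%C <= K * (h * h).
Proof.
  intros Hw. assert (Hw0 := Cmod_ge_0 w).
  set (B := fun j => INR (S j) * Cmod w ^ S j).
  assert (HB : ex_series B) by (apply ex_series_INR_geom; lra).
  assert (HBn : forall j, 0 <= B j)
    by (intros j; apply Rmult_le_pos; [apply pos_INR|apply pow_le; lra]).
  exists (2 * Series B). split.
  { generalize (sum_n_le_Series B 0 HBn HB). rewrite sum_O. generalize (HBn 0%nat). lra. }
  intros t h Ht Hh Hth.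
  assert (small : forall u, 0 <= u <= 1 -> Cmod (RtoC u * w) < 1).
  { intros u Hu. rewrite Cmod_mult, Cmod_R, Rabs_pos_eq by lra. nra. }
  assert (H1 := log1p_series _ (small (t + h) ltac:(lra))).
  assert (H2 := log1p_series _ (small t ltac:(lra))).
  assert (H3 : is_cseries (fun j => RtoC h * w * Cpow (- (RtoC t * w)) j)%C
    (RtoC h * w * / (RtoC 1 + RtoC t * w))%C).
  { apply is_cseries_scal.
    replace (RtoC 1 + RtoC t * w)%C with (RtoC 1 - - (RtoC t * w))%C by ring.
    apply is_cseries_geom. rewrite Cmod_opp. apply small. lra. }
  rewrite <- (is_cseries_unique _ _
    (is_cseries_minus _ _ _ _ (is_cseries_minus _ _ _ _ H1 H2) H3)).
  replace (2 * Series B * (h * h)) with (2 * Series (fun j => h * h * B j))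
    by (rewrite Series_scal_l; ring).
  apply CSeries_bound; [|now apply (ex_series_scal (V := R_NormedModule))].
  intros j.
  assert (Epow : forall u n, Cpow (RtoC u * w) n = (RtoC (u ^ n) * Cpow w n)%C)
    by (intros u n; now rewrite Cpow_mult_distr, Cpow_R).
  assert (Eneg : Cpow (- (RtoC t * w)) j = (RtoC (alt j * t ^ j) * Cpow w j)%C).
  { replace (- (RtoC t * w))%C with (RtoC (Ropp 1 * t) * w)%C
      by (rewrite RtoC_mult, RtoC_opp; ring).
    rewrite Epow, Rpow_mult_distr. reflexivity. }
  rewrite !Epow, Eneg.
  assert (Hj := INR_S_pos j).
  match goal with |- Cmod ?x <= _ => replace x with
    (RtoC (alt j / INR (S j) * ((t + h) ^ S j - t ^ S j - INR (S j) * t ^ j * h)) *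
      Cpow w (S j))%C end.
  - rewrite Cmod_mult, Cmod_R, Cmod_Cpow, Rabs_mult. unfold Rdiv.
    rewrite Rabs_mult, Rabs_alt, Rmult_1_l, (Rabs_pos_eq (/ _))
      by (left; now apply Rinv_0_lt_compat).
    unfold B. replace (h * h * (INR (S j) * Cmod w ^ S j)) with
      (/ INR (S j) * (INR (S j) * INR (S j) * (h * h)) * Cmod w ^ S j) by (field; lra).
    apply Rmult_le_compat_r; [apply pow_le; lra|].
    apply Rmult_le_compat_l; [left; now apply Rinv_0_lt_compat|].
    now apply pow_increment_bound.
  - replace (alt j / INR (S j) * ((t + h) ^ S j - t ^ S j - INR (S j) * t ^ j * h)) with
      (alt j / INR (S j) * (t + h) ^ S j - alt j / INR (S j) * t ^ S j -
       h * (alt j * t ^ j)) by (field; lra).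
    rewrite !RtoC_minus, !RtoC_mult. simpl (Cpow w (S j)). ring.
Qed.

(** The function exp (- log1p (t w)) (1 + t w) has derivative 0 in t, in the form of quadratic
    increments, and equals 1 at t = 0. *)
Lemma Cexp_log1p (w : C) : Cmod w < 1 -> Cexp (log1p w) = (RtoC 1 + w)%C.
Proof.
  intros Hw. assert (Hw0 := Cmod_ge_0 w).
  destruct (log1p_increment w Hw) as [K [HK Hinc]].
  set (psi := fun t => (Cexp (- log1p (RtoC t * w)) * (RtoC 1 + RtoC t * w))%C).
  set (G := 2 * Series (fun j => Cmod w ^ S j)).
  set (Q := / (1 - Cmod w) + K).
  assert (HQ : 0 < / (1 - Cmod w)) by (apply Rinv_0_lt_compat; lra).
  assert (HQ0 : 0 <= Q) by (unfold Q; lra).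
  assert (Hpsi : psi 1 = psi 0).
  { apply constant_of_quadratic_increments with
      (exp G * (2 * K + Q + 2 * (2 * (Q * Q) * exp Q))).
    intros t h Ht Hh Hth. specialize (Hinc t h Ht Hh Hth).
    set (u := (RtoC 1 + RtoC t * w)%C) in *.
    set (D := (log1p (RtoC (t + h) * w) - log1p (RtoC t * w))%C) in *.
    set (ep := (D - RtoC h * w * / u)%C) in *.
    assert (Htw : Cmod (RtoC t * w) <= Cmod w).
    { rewrite Cmod_mult, Cmod_R, Rabs_pos_eq by lra. nra. }
    assert (Hhw : Cmod (RtoC h * w) <= h).
    { rewrite Cmod_mult, Cmod_R, Rabs_pos_eq by lra. nra. }
    assert (Hu : 1 - Cmod w <= Cmod u).
    { assert (H := Cmod_triangle u (- (RtoC t * w))).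
      replace (u + - (RtoC t * w))%C with (RtoC 1) in H by (unfold u; ring).
      rewrite Cmod_1, Cmod_opp in H. lra. }
    assert (Hu2 : Cmod u <= 2).
    { eapply Rle_trans; [apply Cmod_triangle|]. rewrite Cmod_1. lra. }
    assert (Hu0 : u <> RtoC 0) by (intros E; rewrite E, Cmod_0 in Hu; lra).
    assert (HD : Cmod D <= Q * h).
    { replace D with (ep + RtoC h * w * / u)%C by (unfold ep; ring).
      eapply Rle_trans; [apply Cmod_triangle|].
      assert (H1 : Cmod (RtoC h * w * / u) <= h * / (1 - Cmod w)).
      { rewrite Cmod_mult. rewrite Cmod_inv by exact Hu0.
        apply Rmult_le_compat; [apply Cmod_ge_0| |exact Hhw|].
        - left. apply Rinv_0_lt_compat. lra.
        - apply Rinv_le_contravar; lra. }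
      assert (H2 : K * (h * h) <= K * h) by (apply Rmult_le_compat_l; nra).
      unfold Q. lra. }
    assert (HD1 : Cmod D <= Q) by nra.
    set (rm := (Cexp (- D) - RtoC 1 - - D)%C).
    assert (Hrm : Cmod rm <= 2 * (Q * Q) * exp Q * (h * h)).
    { eapply Rle_trans; [apply Cexp_remainder|]. rewrite Cmod_opp.
      assert (HD0 := Cmod_ge_0 D).
      replace (2 * (Q * Q) * exp Q * (h * h)) with (2 * ((Q * h) * (Q * h)) * exp Q) by ring.
      apply Rmult_le_compat; [nra|left; apply exp_pos| |now apply exp_mono].
      apply Rmult_le_compat_l; [lra|]. apply Rmult_le_compat; lra. }
    assert (E : (psi (t + h)%R - psi t)%C =
      (Cexp (- log1p (RtoC t * w)) *
       ((- (ep * u) + - (D * (RtoC h * w))) + rm * (u + RtoC h * w)))%C).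
    { unfold psi. fold u.
      replace (- log1p (RtoC (t + h) * w))%C with (- log1p (RtoC t * w) + - D)%C
        by (unfold D; ring).
      rewrite Cexp_plus.
      replace (RtoC 1 + RtoC (t + h) * w)%C with (u + RtoC h * w)%C
        by (unfold u; rewrite RtoC_plus; ring).
      replace (Cexp (- D)) with (rm + RtoC 1 - D)%C by (unfold rm; ring).
      unfold ep. field. exact Hu0. }
    rewrite E, Cmod_mult, Rmult_assoc. apply Rmult_le_compat; try apply Cmod_ge_0.
    - eapply Rle_trans; [apply Cmod_Cexp_le|]. rewrite Cmod_opp. apply exp_mono.
      apply CSeries_bound; [|apply ex_series_geom_S; lra].
      intros j. eapply Rle_trans; [apply log1p_term_bound|].
      apply pow_incr. split; [apply Cmod_ge_0|exact Htw].
    - eapply Rle_trans; [apply Cmod_triangle|].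
      assert (HA : Cmod (- (ep * u) + - (D * (RtoC h * w))) <=
        (2 * K + Q) * (h * h)).
      { eapply Rle_trans; [apply Cmod_triangle|]. rewrite !Cmod_opp, !(Cmod_mult _ u).
        rewrite (Cmod_mult D).
        assert (Cmod ep * Cmod u <= K * (h * h) * 2)
          by (apply Rmult_le_compat; try apply Cmod_ge_0; assumption).
        assert (Cmod D * Cmod (RtoC h * w) <= Q * h * h)
          by (apply Rmult_le_compat; try apply Cmod_ge_0; assumption). lra. }
      assert (HC : Cmod (rm * (u + RtoC h * w)) <=
        2 * (2 * (Q * Q) * exp Q) * (h * h)).
      { rewrite Cmod_mult.
        assert (Hs : Cmod (u + RtoC h * w) <= 2).
        { replace (u + RtoC h * w)%C with (RtoC 1 + RtoC (t + h) * w)%C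
            by (unfold u; rewrite RtoC_plus; ring).
          eapply Rle_trans; [apply Cmod_triangle|].
          rewrite Cmod_1, Cmod_mult, Cmod_R, Rabs_pos_eq by lra. nra. }
        eapply Rle_trans; [apply Rmult_le_compat; [apply Cmod_ge_0|apply Cmod_ge_0|
          exact Hrm|exact Hs]|]. right. ring. }
      lra. }
  unfold psi in Hpsi. rewrite !Cmult_1_l, !Cmult_0_l in Hpsi.
  assert (H0 : log1p (RtoC 0) = RtoC 0).
  { unfold log1p. apply is_cseries_unique. apply is_cseries_ext with (fun _ => RtoC 0).
    - intros j. simpl. ring.
    - apply is_series_C_components. split; simpl;
      (assert (H := Series_finite (fun _ => 0) 0 (fun _ _ => eq_refl));
       rewrite sum_O in H; exact H). }
  rewrite H0 in Hpsi. replace (- RtoC 0)%C with (RtoC 0) in Hpsi by ring.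
  rewrite Cexp_0 in Hpsi.
  assert (Hinv : (Cexp (log1p w) * Cexp (- log1p w))%C = RtoC 1).
  { rewrite <- Cexp_plus, Cplus_opp_r. apply Cexp_0. }
  transitivity (Cexp (log1p w) * (Cexp (- log1p w) * (RtoC 1 + w)))%C.
  - rewrite Hpsi. ring.
  - rewrite Cmult_assoc, Hinv. ring.
Qed.

(** * The Taylor coefficients of the logarithm *)

Ltac eq_C := match goal with |- @eq _ ?x ?y => change (@eq C x y) end.

Notation csum_n := (sum_n (G := C_AbelianMonoid)).

Lemma csum_n_Sn (a : nat -> C) (n : nat) : csum_n a (S n) = (csum_n a n + a (S n))%C.
Proof. exact (sum_Sn (G := C_AbelianMonoid) a n). Qed.

Lemma csum_n_ext (a b : nat -> C) (n : nat) :
  (forall k, (k <= n)%nat -> a k = b k) -> csum_n a n = csum_n b n.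
Proof. intros H. now apply sum_n_ext_loc. Qed.

Lemma csum_n_0 (a : nat -> C) (n : nat) :
  (forall k, (k <= n)%nat -> a k = RtoC 0) -> csum_n a n = RtoC 0.
Proof.
  intros H. induction n as [|n IH]; [rewrite sum_O; auto|].
  rewrite csum_n_Sn, IH, H by auto. apply Cplus_0_l.
Qed.

Lemma csum_n_single (a : nat -> C) (n i : nat) : (i <= n)%nat ->
  (forall k, (k <= n)%nat -> k <> i -> a k = RtoC 0) -> csum_n a n = a i.
Proof.
  intros Hi H. induction n as [|n IH].
  - rewrite sum_O. f_equal. lia.
  - rewrite csum_n_Sn. destruct (Nat.eq_dec i (S n)) as [->|Hne].
    + rewrite csum_n_0; [apply Cplus_0_l|]. intros k Hk. apply H; lia.
    + rewrite IH; [|lia|intros k Hk; apply H; lia].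
      rewrite (H (S n)) by lia. apply Cplus_0_r.
Qed.

Lemma csum_n_scal (c : C) (a : nat -> C) (n : nat) :
  csum_n (fun k => c * a k)%C n = (c * csum_n a n)%C.
Proof. exact (sum_n_mult_l (K := C_Ring) c a n). Qed.

Lemma Cmod_csum_n (a : nat -> C) (n : nat) :
  Cmod (csum_n a n) <= sum_n (fun k => Cmod (a k)) n.
Proof.
  induction n as [|n IH]; [rewrite !sum_O; lra|].
  rewrite csum_n_Sn, sum_Sn_R. eapply Rle_trans; [apply Cmod_triangle|]. lra.
Qed.

Lemma RtoC_sum_n (a : nat -> R) (n : nat) :
  RtoC (sum_n a n) = csum_n (fun k => RtoC (a k)) n.
Proof.
  induction n as [|n IH]; [now rewrite !sum_O|].
  now rewrite csum_n_Sn, sum_Sn_R, RtoC_plus, IH.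
Qed.

(** Indices are shifted by one: [ind k j m] tests [(k + 1)(j + 1) = m + 1]. *)
Definition ind (k j m : nat) : R := if (S k * S j =? S m)%nat then 1 else 0.

Lemma sparse_ind (k m N : nat) (b : nat -> C) : (m <= N)%nat ->
  csum_n (fun j => RtoC (ind k j m) * b j)%C N = sparse k b m.
Proof.
  intros HN. unfold sparse.
  assert (H1 := Nat.div_mod (S m) (S k) ltac:(lia)).
  set (t := (S m / S k)%nat) in *. set (u := (S m mod S k)%nat) in *.
  destruct (Nat.eqb_spec u 0) as [Hu|Hu].
  - assert (E1 : (S k * S (pred t))%nat = S m) by (replace (S (pred t)) with t by lia; lia).
    rewrite (csum_n_single _ _ (pred t)).
    + unfold ind. rewrite (proj2 (Nat.eqb_eq _ _) E1). eq_C; ring.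
    + nia.
    + intros j _ Hj. unfold ind.
      destruct (Nat.eqb_spec (S k * S j) (S m)) as [E|_]; [|eq_C; ring].
      exfalso. apply Hj. rewrite <- E1 in E. apply Nat.mul_cancel_l in E; lia.
  - apply csum_n_0. intros j _. unfold ind.
    destruct (Nat.eqb_spec (S k * S j) (S m)) as [E|_]; [|eq_C; ring].
    exfalso. apply Hu. unfold u. rewrite <- E, Nat.mul_comm. apply Nat.Div0.mod_mul.
Qed.

Lemma sparse_large (k m : nat) (b : nat -> C) : (m < k)%nat -> sparse k b m = RtoC 0.
Proof.
  intros H. unfold sparse. rewrite Nat.mod_small by lia. reflexivity.
Qed.

Lemma ind_sym (k j m : nat) : ind k j m = ind j k m.
Proof. unfold ind. now rewrite Nat.mul_comm. Qed.

(** The sum over all factorizations [m + 1 = (k + 1)(j + 1)]. *)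
Definition divsum (T : nat -> nat -> C) (m : nat) : C :=
  csum_n (fun k => csum_n (fun j => RtoC (ind k j m) * T k j)%C m) m.

(** Larger first factors do not divide m + 1, so the outer sum may run to any common [N]; this lets
    all coefficients be compared with one partial product. *)
Lemma divsum_sparse (T : nat -> nat -> C) (m N : nat) : (m <= N)%nat ->
  divsum T m = csum_n (fun k => sparse k (T k) m) N.
Proof.
  intros HN. unfold divsum.
  rewrite (csum_n_ext _ (fun k => sparse k (T k) m)) by (intros; now apply sparse_ind).
  induction HN as [|N HN IH]; [reflexivity|].
  rewrite csum_n_Sn, <- IH, sparse_large by lia. symmetry. apply Cplus_0_r.
Qed.

Lemma divsum_swap (T : nat -> nat -> C) (m : nat) :
  divsum T m = divsum (fun j k => T k j) m.
Proof.
  unfold divsum. rewrite (sum_n_switch (G := C_AbelianMonoid)).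
  apply csum_n_ext. intros j _. apply csum_n_ext. intros k _. now rewrite ind_sym.
Qed.

Lemma divsum_ext (T T' : nat -> nat -> C) (m : nat) :
  (forall k j, (S k * S j)%nat = S m -> T k j = T' k j) -> divsum T m = divsum T' m.
Proof.
  intros H. unfold divsum. apply csum_n_ext. intros k _. apply csum_n_ext. intros j _.
  unfold ind. destruct (Nat.eqb_spec (S k * S j) (S m)) as [E|_]; [now rewrite H|eq_C; ring].
Qed.

Lemma divsum_scal (c : C) (T : nat -> nat -> C) (m : nat) :
  divsum (fun k j => c * T k j)%C m = (c * divsum T m)%C.
Proof.
  unfold divsum. rewrite <- csum_n_scal. apply csum_n_ext. intros k _.
  rewrite <- csum_n_scal. apply csum_n_ext. intros j _. eq_C; ring.
Qed.

Lemma divsum_plus (T T' : nat -> nat -> C) (m : nat) :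
  divsum (fun k j => T k j + T' k j)%C m = (divsum T m + divsum T' m)%C.
Proof.
  unfold divsum.
  assert (H := sum_n_plus (G := C_AbelianMonoid)
    (fun k => csum_n (fun j => RtoC (ind k j m) * T k j)%C m)
    (fun k => csum_n (fun j => RtoC (ind k j m) * T' k j)%C m) m).
  refine (eq_trans _ H). apply csum_n_ext. intros k _.
  assert (H' := sum_n_plus (G := C_AbelianMonoid)
    (fun j => RtoC (ind k j m) * T k j)%C (fun j => RtoC (ind k j m) * T' k j)%C m).
  refine (eq_trans _ H'). apply csum_n_ext. intros j _.
  change (RtoC (ind k j m) * (T k j + T' k j) =
    RtoC (ind k j m) * T k j + RtoC (ind k j m) * T' k j)%C. ring.
Qed.

Definition rdivsum (T : nat -> nat -> R) (m : nat) : R :=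
  sum_n (fun k => sum_n (fun j => ind k j m * T k j) m) m.

Lemma RtoC_rdivsum (T : nat -> nat -> R) (m : nat) :
  RtoC (rdivsum T m) = divsum (fun k j => RtoC (T k j)) m.
Proof.
  unfold rdivsum, divsum. rewrite RtoC_sum_n. apply csum_n_ext. intros k _.
  rewrite RtoC_sum_n. apply csum_n_ext. intros j _. now rewrite RtoC_mult.
Qed.

(** The coefficient of z^((k+1)(j+1)) in log (1 + (k+1)^(-q) z^(k+1)). *)
Definition lam (q : R) (k j : nat) : R := alt j / INR (S j) * wt q (S k) ^ S j.

Definition Lam (q : R) (m : nat) : R :=
  match m with O => 0 | S m' => rdivsum (lam q) m' end.

Lemma sum_n_indicator_le (c : R) (m N : nat) : 0 <= c ->
  sum_n (fun k => if (k <=? m)%nat then c else 0) N <= INR (S m) * c.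
Proof.
  intros Hc.
  enough (H : sum_n (fun k => if (k <=? m)%nat then c else 0) N <=
    INR (min (S N) (S m)) * c).
  { eapply Rle_trans; [exact H|]. apply Rmult_le_compat_r; [exact Hc|].
    apply le_INR. lia. }
  induction N as [|N IH].
  - rewrite sum_O. replace (min 1 (S m)) with 1%nat by lia. simpl. lra.
  - rewrite sum_Sn_R. destruct (Nat.leb_spec (S N) m) as [H|H].
    + replace (min (S (S N)) (S m)) with (S (min (S N) (S m))) by lia.
      rewrite S_INR. lra.
    + replace (min (S (S N)) (S m)) with (min (S N) (S m)) by lia. lra.
Qed.

Lemma Cmod_sparse_le (k m : nat) (b : nat -> C) (c : R) : 0 <= c ->
  (forall j, (S k * S j)%nat = S m -> Cmod (b j) <= c) ->
  Cmod (sparse k b m) <= if (k <=? m)%nat then c else 0.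
Proof.
  intros Hc H. destruct (Nat.leb_spec k m) as [Hk|Hk].
  - unfold sparse. destruct (Nat.eqb_spec (S m mod S k) 0) as [E|_].
    + apply H. assert (H1 := Nat.div_mod (S m) (S k) ltac:(lia)).
      rewrite E in H1.
      replace (S (pred (S m / S k))) with (S m / S k)%nat by lia. lia.
    + rewrite Cmod_0. exact Hc.
  - rewrite sparse_large by lia. rewrite Cmod_0. lra.
Qed.

Lemma tannery_C (a : nat -> nat -> C) (l : nat -> C) (M : nat -> R) :
  ex_series M -> (forall n k, Cmod (a n k) <= M k) ->
  (forall k, exists N, forall n, (N <= n)%nat -> a n k = l k) ->
  filterlim (fun n => CSeries (a n)) eventually (locally (CSeries l)).
Proof.
  intros HM Hle Hlim. apply filterlim_C_components.
  assert (aux : forall p : C -> R, (forall z, Rabs (p z) <= Cmod z) ->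
    is_lim_seq (fun n => Series (fun k => p (a n k))) (Series (fun k => p (l k)))).
  { intros p Hp. apply tannery with M; [exact HM| |].
    - exists O. intros n k _. eapply Rle_trans; [apply Hp|apply Hle].
    - intros k. destruct (Hlim k) as [N HN].
      apply is_lim_seq_ext_loc with (fun _ => p (l k)); [|apply is_lim_seq_const].
      exists N. intros n Hn. now rewrite HN. }
  split; [exact (aux Re Re_le_Cmod)|exact (aux Im Im_le_Cmod)].
Qed.

Lemma filterlim_Cexp (u : nat -> C) (l : C) :
  filterlim u eventually (locally l) ->
  filterlim (fun n => Cexp (u n)) eventually (locally (Cexp l)).
Proof.
  intros H. apply filterlim_C_Cmod in H. apply filterlim_C_Cmod.
  apply is_lim_seq_ext with (fun n => Cmod (Cexp l) * Cmod (Cexp (u n - l) - RtoC 1)%C).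
  - intros n. rewrite <- Cmod_mult. f_equal.
    replace (u n) with (l + (u n - l))%C at 2 by ring. rewrite Cexp_plus. ring.
  - rewrite <- (Rmult_0_r (Cmod (Cexp l))). apply (is_lim_seq_scal_l _ _ (Finite 0)).
    apply is_lim_seq_le_le with (fun _ => 0)
      (fun n => Cmod (u n - l)%C * (1 + 2 * Cmod (u n - l)%C * exp (Cmod (u n - l)%C))).
    + intros n. split; [apply Cmod_ge_0|apply Cexp_minus_1].
    + apply is_lim_seq_const.
    + replace (Finite 0) with (Finite (0 * (1 + 2 * 0 * exp 0))) by (f_equal; ring).
      apply is_lim_seq_mult'; [exact H|].
      apply is_lim_seq_plus'; [apply is_lim_seq_const|].
      apply is_lim_seq_mult'; [|now apply is_lim_seq_exp].
      apply (is_lim_seq_scal_l _ 2 0 H).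
Qed.

Lemma Cmod_factor_lt_1 (q : R) (z : C) (k : nat) : 0 <= q -> Cmod z < 1 ->
  Cmod (RtoC (wt q (S k)) * Cpow z (S k)) < 1.
Proof.
  intros Hq Hz. assert (Hz0 := Cmod_ge_0 z).
  rewrite Cmod_mult, Cmod_R, Cmod_Cpow, Rabs_pos_eq by (left; apply wt_pos).
  assert (H1 := wt_le_1 q k Hq). assert (H2 := wt_pos q (S k)).
  assert (Hk1 : Cmod z ^ k <= 1) by (rewrite <- (pow1 k); apply pow_incr; lra).
  simpl pow. assert (Cmod z * Cmod z ^ k <= Cmod z) by nra.
  nra.
Qed.

Lemma cprod_Cexp (q : R) (z : C) (N : nat) : 0 <= q -> Cmod z < 1 ->
  cprod q (S N) z = Cexp (csum_n (fun k => log1p (RtoC (wt q (S k)) * Cpow z (S k))%C) N).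
Proof.
  intros Hq Hz.
  assert (Hw := fun k => Cmod_factor_lt_1 q z k Hq Hz).
  induction N as [|N IH].
  - rewrite sum_O, Cexp_log1p by apply Hw. cbn [cprod]. ring.
  - rewrite csum_n_Sn, Cexp_plus, <- IH, Cexp_log1p by apply Hw. reflexivity.
Qed.

(** The logarithm of a partial product is a power series whose coefficient of each index is final as
    soon as [N] reaches it. Since m + 1 has at most m + 1 factorizations, (m+1) |z|^(m+1) dominates,
    and the limit passes through the exponential. *)
Lemma log_coefficients_Lam (q : R) : 0 <= q -> log_coefficients q (Lam q).
Proof.
  intros Hq. split; [reflexivity|]. intros z Hz. assert (Hz0 := Cmod_ge_0 z).
  set (T := fun k j => (RtoC (lam q k j) * Cpow z (S k * S j))%C).
  assert (HT : forall k j, T k j = (RtoC (alt j / INR (S j)) *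
    Cpow (RtoC (wt q (S k)) * Cpow z (S k)) (S j))%C).
  { intros k j. unfold T, lam. rewrite Cpow_mult_distr, Cpow_R, RtoC_mult.
    rewrite <- Cmult_assoc. f_equal. f_equal. apply Cpow_mult_r. }
  assert (HTb : forall k j m, (S k * S j)%nat = S m -> Cmod (T k j) <= Cmod z ^ S m).
  { intros k j m E. unfold T. rewrite E, Cmod_mult, Cmod_R, Cmod_Cpow.
    rewrite <- (Rmult_1_l (Cmod z ^ S m)) at 2.
    apply Rmult_le_compat_r; [now apply pow_le|]. unfold lam. rewrite Rabs_mult.
    rewrite <- (Rmult_1_l 1).
    apply Rmult_le_compat; try apply Rabs_pos; [apply alt_div_bound|].
    rewrite Rabs_pos_eq by (apply pow_le; left; apply wt_pos).
    rewrite <- (pow1 (S j)). apply pow_incr.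
    split; [left; apply wt_pos|now apply wt_le_1]. }
  assert (HM : ex_series (fun m => INR (S m) * Cmod z ^ S m))
    by (apply ex_series_INR_geom; lra).
  assert (Hpart : forall N m, Cmod (csum_n (fun k => sparse k (T k) m) N) <=
    INR (S m) * Cmod z ^ S m).
  { intros N m. eapply Rle_trans; [apply Cmod_csum_n|].
    eapply Rle_trans; [|apply (sum_n_indicator_le (Cmod z ^ S m) m N); now apply pow_le].
    apply sum_n_le_loc. intros k _. apply Cmod_sparse_le; [now apply pow_le|].
    intros j E. now apply HTb. }
  exists (CSeries (divsum T)). split.
  - assert (HL : is_cseries (divsum T) (CSeries (divsum T))).
    { apply is_cseries_CSeries with (2 := HM). intros m.
      rewrite (divsum_sparse T m m) by lia. apply Hpart. }
    apply is_pseries_C_series. apply is_cseries_csum.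
    apply is_cseries_csum in HL.
    assert (E : forall n, csum (fun n => RtoC (Lam q n) * Cpow z n)%C (S n) =
      csum (divsum T) n).
    { induction n as [|n IH].
      - simpl. ring.
      - change (csum (fun n => RtoC (Lam q n) * Cpow z n)%C (S (S n))) with
          (csum (fun n => RtoC (Lam q n) * Cpow z n)%C (S n) +
            RtoC (Lam q (S n)) * Cpow z (S n))%C.
        rewrite IH. cbn [csum]. f_equal.
        cbn [Lam]. rewrite RtoC_rdivsum, Cmult_comm, <- divsum_scal.
        apply divsum_ext. intros k j Ekj. unfold T. rewrite Ekj. ring. }
    intros P HP. destruct (HL P HP) as [N HN]. exists (S N). intros n Hn.
    destruct n as [|n]; [lia|]. rewrite E. apply HN. lia.
  - apply is_product_cprod.
    assert (H : filterlim (fun N => CSeries (fun m => csum_n (fun k => sparse k (T k) m) N))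
      eventually (locally (CSeries (divsum T)))).
    { apply tannery_C with (1 := HM); [exact Hpart|].
      intros m. exists m. intros N HN. symmetry. now apply divsum_sparse. }
    apply filterlim_Cexp in H.
    intros P HP. destruct (H P HP) as [N HN]. exists (S N). intros n Hn.
    destruct n as [|n]; [lia|]. rewrite cprod_Cexp by assumption.
    replace (csum_n _ n) with (CSeries (fun m => csum_n (fun k => sparse k (T k) m) n)).
    + apply HN. lia.
    + apply is_cseries_unique, is_cseries_sum. intros k _.
      apply is_cseries_sparse. eapply is_cseries_ext; [|apply log1p_series].
      * intros j. symmetry. apply HT.
      * now apply Cmod_factor_lt_1.
Qed.

(** * The continuation of D *)

Lemma hol_inv_shift (c s : C) : s <> c -> hol (fun z => / (z - c))%C s.
Proof.
  intros Hne. set (u := (s - c)%C).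
  assert (Hu : u <> RtoC 0).
  { intros E. apply Hne. replace s with (u + c)%C by (unfold u; ring). rewrite E. ring. }
  set (m := Cmod u). assert (Hm : 0 < m) by now apply Cmod_gt_0.
  set (e := Rmin 1 (m / 2)).
  assert (He1 := Rmin_l 1 (m / 2)). assert (He2 := Rmin_r 1 (m / 2)). fold e in He1, He2.
  assert (Hi : 0 < / m) by now apply Rinv_0_lt_compat.
  exists (- (/ u * / u))%C, e, (2 * / m + (/ m * / m + 2 * (/ m * / m * / m))).
  split; [split; [apply Rmin_glb_lt; lra|exact He1]|].
  assert (P2 : 0 < / m * / m) by now apply Rmult_lt_0_compat.
  assert (P3 : 0 < / m * / m * / m) by now apply Rmult_lt_0_compat.
  split.
  - rewrite Cmod_opp, Cmod_mult, Cmod_inv by exact Hu. fold m. lra.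
  - intros h Hh.
    replace (s + h - c)%C with (u + h)%C by (unfold u; ring). fold u.
    assert (Hlow : m / 2 <= Cmod (u + h)).
    { assert (H := Cmod_triangle (u + h) (- h)).
      replace (u + h + - h)%C with u in H by ring. rewrite Cmod_opp in H. fold m in H. lra. }
    assert (Huh : (u + h)%C <> RtoC 0) by (intros E; rewrite E, Cmod_0 in Hlow; lra).
    assert (Hinv : Cmod (/ (u + h)) <= 2 * / m).
    { rewrite Cmod_inv by exact Huh.
      replace (2 * / m) with (/ (m / 2)) by (field; lra).
      apply Rinv_le_contravar; lra. }
    split; [lra|].
    replace (/ (u + h) - / u - - (/ u * / u) * h)%C with
      (/ u * / u * / (u + h) * (h * h))%C by (field; auto).
    rewrite !Cmod_mult, !(Cmod_inv u) by exact Hu. fold m.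
    apply Rmult_le_compat_r; [nra|].
    apply Rle_trans with (/ m * / m * (2 * / m)); [|lra].
    apply Rmult_le_compat_l; lra.
Qed.

(** [f] is [g z / (z - s0)] near [s0], with [g] holomorphic and [g s0 = v]. *)
Definition simple_form (f : C -> C) (s0 v : C) : Prop :=
  exists (g : C -> C) (d : R), 0 < d /\ g s0 = v /\
    (forall z, Cmod (z - s0)%C < d -> hol g z) /\
    (forall z, Cmod (z - s0)%C < d -> z <> s0 -> f z = (g z * / (z - s0))%C).

Lemma simple_form_laurent (f : C -> C) (s0 v : C) : simple_form f s0 v ->
  exists g, has_laurent_form f s0 1 g /\ g s0 = v.
Proof.
  intros [g [d [Hd [Hv [Hg Hf]]]]]. exists g. split; [|exact Hv]. split.
  - now apply holomorphic_of_hol with d.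
  - apply locally_of_disc with d; [exact Hd|]. intros z Hz Hne.
    rewrite (Hf z Hz Hne). simpl Cpow. rewrite Cmult_1_r. reflexivity.
Qed.

Lemma simple_form_plus (f f' : C -> C) (s0 v v' : C) :
  simple_form f s0 v -> simple_form f' s0 v' ->
  simple_form (fun z => f z + f' z)%C s0 (v + v')%C.
Proof.
  intros [g [d [Hd [Hv [Hg Hf]]]]] [g' [d' [Hd' [Hv' [Hg' Hf']]]]].
  exists (fun z => g z + g' z)%C, (Rmin d d').
  assert (H1 := Rmin_l d d'). assert (H2 := Rmin_r d d').
  split; [now apply Rmin_glb_lt|]. split; [now rewrite Hv, Hv'|]. split.
  - intros z Hz. apply hol_plus; [apply Hg|apply Hg']; lra.
  - intros z Hz Hne. rewrite Hf, Hf' by (assumption || lra). ring.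
Qed.

Lemma simple_form_sum (f : nat -> C -> C) (v : nat -> C) (s0 : C) (n : nat) :
  (forall i, (i <= n)%nat -> simple_form (f i) s0 (v i)) ->
  simple_form (fun z => csum_n (fun i => f i z) n) s0 (csum_n v n).
Proof.
  intros H. induction n as [|n IH].
  - rewrite sum_O. destruct (H 0%nat (le_n _)) as [g [d [Hd [Hv [Hg Hf]]]]].
    exists g, d. repeat split; auto. intros z Hz Hne. rewrite sum_O. auto.
  - rewrite csum_n_Sn.
    destruct (simple_form_plus _ _ _ _ _ (IH ltac:(auto)) (H (S n) (le_n _)))
      as [g [d [Hd [Hv [Hg Hf]]]]].
    exists g, d. repeat split; auto. intros z Hz Hne. rewrite csum_n_Sn. auto.
Qed.

Lemma Re_near (z s0 : C) (d : R) : Cmod (z - s0)%C < d -> Re s0 - d < Re z.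
Proof.
  intros H. assert (H1 := Re_le_Cmod (z - s0)%C).
  assert (E : Re (z - s0)%C = Re z - Re s0) by reflexivity.
  rewrite E in H1. apply Rabs_le_between in H1. lra.
Qed.

(** A regular point counts as a simple form of value 0, so that poles and regular points of the
    summands need not be distinguished when adding. *)
Lemma simple_form_hol (f : C -> C) (s0 : C) (a : R) :
  (forall z, a < Re z -> hol f z) -> a < Re s0 -> simple_form f s0 (RtoC 0).
Proof.
  intros Hf Hs. exists (fun z => f z * (z + - s0))%C, (Re s0 - a).
  split; [lra|]. split; [rewrite Cplus_opp_r; ring|]. split.
  - intros z Hz. apply hol_mult.
    + apply Hf. generalize (Re_near _ _ _ Hz). lra.
    + apply hol_plus; [apply hol_id|apply hol_const].
  - intros z Hz Hne. assert (z - s0 <> RtoC 0)%C.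
    { intros E. apply Hne. replace z with ((z - s0) + s0)%C by ring. rewrite E. ring. }
    field. assumption.
Qed.

(** The contribution of the factors with second index [j]:
    [(-1)^j/(j+1) (j+1)^(-s) zeta (s + q (j+1))]. *)
Definition zpart (q : R) (j : nat) (s : C) : C :=
  (RtoC (alt j / INR (S j)) * npw j s * zG (s + RtoC (q * INR (S j))) *
   / (s - RtoC (1 - q * INR (S j))))%C.

Lemma hol_zpart_numerator (q : R) (j : nat) (s : C) : - (q * INR (S j)) < Re s ->
  hol (fun s => RtoC (alt j / INR (S j)) * npw j s * zG (s + RtoC (q * INR (S j))))%C s.
Proof.
  intros Hs. apply hol_mult; [apply hol_mult; [apply hol_const|apply hol_npw]|].
  apply hol_translate, hol_zG.
  change (0 < Re s + q * INR (S j)). lra.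
Qed.

Lemma hol_zpart (q : R) (j : nat) (s : C) : - (q * INR (S j)) < Re s ->
  s <> RtoC (1 - q * INR (S j)) -> hol (zpart q j) s.
Proof.
  intros Hs Hne. apply hol_mult; [now apply hol_zpart_numerator|now apply hol_inv_shift].
Qed.

(** The only pole comes from the pole of zeta at s + q (j + 1) = 1, and [zG_1] gives its residue. *)
Lemma simple_form_zpart (q : R) (j : nat) (s0 : C) : - (q * INR (S j)) < Re s0 ->
  exists v, simple_form (zpart q j) s0 v /\
    (s0 = RtoC (1 - q * INR (S j)) ->
      v = (RtoC (alt j / INR (S j)) * npw j s0)%C) /\
    (s0 <> RtoC (1 - q * INR (S j)) -> v = RtoC 0).
Proof.
  intros Hs. set (p := RtoC (1 - q * INR (S j))).
  assert (Hd0 : 0 < Re s0 + q * INR (S j)) by lra.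
  set (d0 := Re s0 + q * INR (S j)) in *.
  destruct (classic (s0 = p)) as [E|Hne].
  - exists (RtoC (alt j / INR (S j)) * npw j s0)%C. split; [|split; tauto].
    exists (fun s => RtoC (alt j / INR (S j)) * npw j s * zG (s + RtoC (q * INR (S j))))%C, d0.
    split; [exact Hd0|]. split.
    { replace (s0 + RtoC (q * INR (S j)))%C with (RtoC 1).
      - rewrite zG_1. ring.
      - rewrite E. unfold p. rewrite <- RtoC_plus. f_equal. ring. }
    split.
    + intros z Hz. apply hol_zpart_numerator.
      generalize (Re_near _ _ _ Hz). unfold d0. lra.
    + intros z _ _. unfold zpart. fold p. now rewrite E.
  - exists (RtoC 0). split; [|split; tauto].
    assert (Hm : 0 < Cmod (s0 - p)%C).
    { apply Cmod_gt_0. intros E. apply Hne.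
      replace s0 with ((s0 - p) + p)%C by ring. rewrite E. ring. }
    exists (fun z => zpart q j z * (z + - s0))%C, (Rmin d0 (Cmod (s0 - p)%C)).
    assert (H1 := Rmin_l d0 (Cmod (s0 - p)%C)). assert (H2 := Rmin_r d0 (Cmod (s0 - p)%C)).
    split; [now apply Rmin_glb_lt|]. split; [rewrite Cplus_opp_r; ring|]. split.
    + intros z Hz. apply hol_mult.
      * apply hol_zpart.
        -- generalize (Re_near _ _ _ Hz). unfold d0 in *. lra.
        -- intros E. fold p in E. rewrite E in Hz.
           replace (p - s0)%C with (- (s0 - p))%C in Hz by ring.
           rewrite Cmod_opp in Hz. lra.
      * apply hol_plus; [apply hol_id|apply hol_const].
    + intros z Hz Hz0. assert (z - s0 <> RtoC 0)%C.
      { intros E. apply Hz0. replace z with ((z - s0) + s0)%C by ring. rewrite E. ring. }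
      field. assumption.
Qed.

Lemma zpart_series (q : R) (j : nat) (s : C) : 1 < Re s + q * INR (S j) ->
  is_cseries (fun k => RtoC (lam q k j) * (npw k s * npw j s))%C (zpart q j s).
Proof.
  intros Hs.
  assert (H := zeta_series (s + RtoC (q * INR (S j)))%C ltac:(exact Hs)).
  apply (is_cseries_scal (RtoC (alt j / INR (S j)) * npw j s)%C) in H.
  unfold zpart.
  replace (s - RtoC (1 - q * INR (S j)))%C with
    (s + RtoC (q * INR (S j)) - RtoC 1)%C by (rewrite RtoC_minus; ring).
  rewrite <- Cmult_assoc. eapply is_cseries_ext; [|exact H].
  intros k. cbv beta. rewrite npw_plus, npw_R. unfold lam, wt. rewrite RtoC_mult.
  replace (Rpower (INR (S k)) (- q) ^ S j) with (Rpower (INR (S k)) (- (q * INR (S j)))).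
  - ring.
  - rewrite <- Rpower_pow by apply Rpower_pos. rewrite Rpower_mult. f_equal. ring.
Qed.

Lemma npw_mult (k j m : nat) (s : C) : (S k * S j)%nat = S m ->
  npw m s = (npw k s * npw j s)%C.
Proof.
  intros E. unfold npw, cpw. rewrite <- E, mult_INR, ln_mult by apply INR_S_pos.
  rewrite <- Cexp_plus. f_equal. rewrite RtoC_plus. ring.
Qed.

(** For k >= 1 the factor (k+1)^(- q (j+1)) decays geometrically in j. For k = 0 it is 1, so those
    terms converge to the left of 0 only through their signs and are left to [eta]. *)
Definition lamC (q : R) (r k j : nat) : R :=
  if andb (r <? j)%nat (0 <? k)%nat then lam q k j else 0.

Lemma sum_ind_le_1 (k j M : nat) : sum_n (fun m => ind k j m) M <= 1.
Proof.
  enough (H : sum_n (fun m => ind k j m) M <= if (S k * S j <=? S M)%nat then 1 else 0)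
    by (destruct (S k * S j <=? S M)%nat; lra).
  induction M as [|M IH].
  - rewrite sum_O. unfold ind. destruct (Nat.eqb_spec (S k * S j) 1);
      destruct (Nat.leb_spec (S k * S j) 1); lra || lia.
  - rewrite sum_Sn_R. unfold ind at 2.
    destruct (Nat.eqb_spec (S k * S j) (S (S M)));
      destruct (Nat.leb_spec (S k * S j) (S M));
      destruct (Nat.leb_spec (S k * S j) (S (S M))); lra || lia.
Qed.

Lemma ind_nonneg (k j m : nat) : 0 <= ind k j m.
Proof. unfold ind. destruct (S k * S j =? S m)%nat; lra. Qed.

Lemma Rabs_sum_n (a : nat -> R) (n : nat) :
  Rabs (sum_n a n) <= sum_n (fun k => Rabs (a k)) n.
Proof.
  induction n as [|n IH]; [rewrite !sum_O; lra|].
  rewrite !sum_Sn_R. eapply Rle_trans; [apply Rabs_triang|]. lra.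
Qed.

Lemma sum_n_scal_R (c : R) (a : nat -> R) (n : nat) :
  sum_n (fun k => c * a k) n = c * sum_n a n.
Proof. exact (sum_n_mult_l (K := R_Ring) c a n). Qed.

(** The estimate at Re s = - q/2 separates the variables: q (r + 2) of the exponent is kept for the
    sum over k, where q (r + 2) - q/2 > 1 as soon as q (r + 1) >= 1, and the rest is bounded by its
    value at k + 1 = 2, a geometric sequence in j. The factor 1/(j+1) absorbs (j+1)^(q/2). *)
Lemma lamC_bound (q : R) (r k j : nat) : 0 < q < 1 ->
  Rabs (lamC q r k j) * Rpower (INR (S k)) (q / 2) * Rpower (INR (S j)) (q / 2) <=
  Rpower (INR (S k)) (- (q * INR (S (S r)) - q / 2)) *
  (Rpower 2 (q * INR (S r)) * Rpower 2 (- q) ^ j).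
Proof.
  intros Hq.
  assert (Hrhs : 0 <= Rpower (INR (S k)) (- (q * INR (S (S r)) - q / 2)) *
    (Rpower 2 (q * INR (S r)) * Rpower 2 (- q) ^ j)).
  { apply Rmult_le_pos; [left; apply Rpower_pos|].
    apply Rmult_le_pos; [left; apply Rpower_pos|]. apply pow_le. left; apply Rpower_pos. }
  unfold lamC. destruct (Nat.ltb_spec r j) as [Hj|Hj]; cbn [andb].
  2:{ rewrite Rabs_R0, !Rmult_0_l. exact Hrhs. }
  destruct (Nat.ltb_spec 0 k) as [Hk|Hk]; cbn [andb].
  2:{ rewrite Rabs_R0, !Rmult_0_l. exact Hrhs. }
  clear Hrhs. unfold lam, wt.
  assert (HJ := INR_S_pos j).
  assert (HK2 : 2 <= INR (S k)) by (change 2 with (INR 2); apply le_INR; lia).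
  unfold Rdiv at 1. rewrite !Rabs_mult, Rabs_alt, Rmult_1_l.
  rewrite (Rabs_pos_eq (/ _)) by (left; now apply Rinv_0_lt_compat).
  rewrite <- !Rpower_pow by apply Rpower_pos.
  rewrite (Rabs_pos_eq (Rpower _ _)) by (left; apply Rpower_pos).
  rewrite !Rpower_mult.
  assert (HJ1 : / INR (S j) * Rpower (INR (S j)) (q / 2) <= 1).
  { rewrite <- (Rpower_m1 (INR (S j))), <- Rpower_plus by exact HJ.
    replace (Ropp 1 + q / 2) with (- (1 - q / 2)) by ring.
    apply Rpower_neg_le_1; [apply INR_S_ge_1|lra]. }
  assert (Hexp : Rpower (INR (S k)) (- q * INR (S j)) =
    Rpower (INR (S k)) (- (q * INR (S (S r)))) *
    Rpower (INR (S k)) (- (q * (INR j - INR (S r))))).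
  { rewrite <- Rpower_plus. f_equal. rewrite (S_INR j), (S_INR (S r)). ring. }
  assert (Hjr : 0 <= INR j - INR (S r)) by (assert (INR (S r) <= INR j) by (apply le_INR; lia); lra).
  assert (H2 : Rpower (INR (S k)) (- (q * (INR j - INR (S r)))) <=
    Rpower 2 (q * INR (S r)) * Rpower 2 (- q * INR j)).
  { rewrite <- Rpower_plus.
    replace (q * INR (S r) + - q * INR j) with (- (q * (INR j - INR (S r)))) by ring.
    apply Rpower_neg_antitone; [lra|exact HK2|]. apply Rmult_le_pos; lra. }
  rewrite Hexp.
  replace (- (q * INR (S (S r)) - q / 2)) with (- (q * INR (S (S r))) + q / 2) by ring.
  rewrite Rpower_plus.
  set (x := Rpower (INR (S k)) (- (q * INR (S (S r))))) in *.
  set (y := Rpower (INR (S k)) (- (q * (INR j - INR (S r))))) in *.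
  set (z := Rpower (INR (S k)) (q / 2)) in *.
  set (w := Rpower 2 (q * INR (S r)) * Rpower 2 (- q * INR j)) in *.
  assert (Hx : 0 < x) by apply Rpower_pos. assert (Hy : 0 < y) by apply Rpower_pos.
  assert (Hz : 0 < z) by apply Rpower_pos.
  replace (/ INR (S j) * (x * y) * z * Rpower (INR (S j)) (q / 2)) with
    ((/ INR (S j) * Rpower (INR (S j)) (q / 2)) * (x * z * y)) by ring.
  assert (Hxz : 0 < x * z) by nra.
  apply Rle_trans with (1 * (x * z * y)).
  - apply Rmult_le_compat_r; [nra|exact HJ1].
  - rewrite Rmult_1_l. apply Rmult_le_compat_l; lra.
Qed.

(** Each pair (k, j) contributes to a single m, so the sum over m is at most the double sum, which
    factorizes by [lamC_bound]. *)
Lemma rdivsum_lamC_summable (q : R) (r : nat) : 0 < q < 1 -> 1 <= q * INR (S r) ->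
  ex_series (fun m => Rabs (rdivsum (lamC q r) m) * Rpower (INR (S m)) (- - (q / 2))).
Proof.
  intros Hq Hr. rewrite Ropp_involutive.
  set (X := fun k j => Rabs (lamC q r k j) * Rpower (INR (S k)) (q / 2) *
    Rpower (INR (S j)) (q / 2)).
  set (P := fun k => Rpower (INR (S k)) (- (q * INR (S (S r)) - q / 2))).
  set (Q := fun j => Rpower 2 (q * INR (S r)) * Rpower 2 (- q) ^ j).
  assert (HP : ex_series P).
  { apply ex_series_Riemann. rewrite S_INR. lra. }
  assert (HQ : ex_series Q).
  { apply (ex_series_scal (V := R_NormedModule)). apply ex_series_geom.
    rewrite Rabs_pos_eq by (left; apply Rpower_pos).
    rewrite Rpower_Ropp, <- Rinv_1. apply Rinv_lt_contravar.
    - rewrite Rmult_1_l. apply Rpower_pos.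
    - rewrite <- (Rpower_O 2) by lra. apply Rpower_lt; lra. }
  assert (HPn : forall k, 0 <= P k) by (intros k; left; apply Rpower_pos).
  assert (HQn : forall k, 0 <= Q k).
  { intros k. apply Rmult_le_pos; [left; apply Rpower_pos|].
    apply pow_le; left; apply Rpower_pos. }
  assert (HX : forall k j, 0 <= X k j <= P k * Q j).
  { intros k j. split; [|now apply lamC_bound].
    repeat apply Rmult_le_pos; try (left; apply Rpower_pos). apply Rabs_pos. }
  apply ex_series_bounded with (Series P * Series Q).
  { intros m. apply Rmult_le_pos; [apply Rabs_pos|left; apply Rpower_pos]. }
  intros M.
  apply Rle_trans with
    (sum_n (fun m => sum_n (fun k => sum_n (fun j => ind k j m * X k j) M) M) M).
  - apply sum_n_le_loc. intros m Hm.
    apply Rle_trans with (sum_n (fun k => sum_n (fun j => ind k j m * X k j) m) m).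
    + unfold rdivsum. rewrite Rmult_comm.
      eapply Rle_trans.
      { apply Rmult_le_compat_l; [left; apply Rpower_pos|].
        eapply Rle_trans; [apply Rabs_sum_n|]. apply sum_n_le_loc.
        intros k _. apply Rabs_sum_n. }
      rewrite <- sum_n_scal_R. apply sum_n_le_loc. intros k _.
      rewrite <- sum_n_scal_R. apply sum_n_le_loc. intros j _.
      rewrite Rabs_mult, (Rabs_pos_eq (ind k j m)) by apply ind_nonneg.
      unfold ind. destruct (Nat.eqb_spec (S k * S j) (S m)) as [E|_]; [|lra].
      rewrite <- E, mult_INR, Rpower_mult_base by apply INR_S_pos.
      unfold X. lra.
    + apply Rle_trans with (sum_n (fun k => sum_n (fun j => ind k j m * X k j) M) m).
      * apply sum_n_le_loc. intros k _. apply sum_n_mono; [|exact Hm].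
        intros j. apply Rmult_le_pos; [apply ind_nonneg|apply HX].
      * apply sum_n_mono; [|exact Hm]. intros k. apply sum_n_nonneg.
        intros j _. apply Rmult_le_pos; [apply ind_nonneg|apply HX].
  - rewrite (sum_n_switch (G := R_AbelianMonoid)).
    apply Rle_trans with (sum_n (fun k => P k * sum_n Q M) M).
    + apply sum_n_le_loc. intros k _.
      rewrite (sum_n_switch (G := R_AbelianMonoid)).
      rewrite <- sum_n_scal_R. apply sum_n_le_loc. intros j _.
      rewrite (sum_n_ext _ (fun m => X k j * ind k j m)) by (intros m; apply Rmult_comm).
      rewrite sum_n_scal_R.
      apply Rle_trans with (X k j * 1); [|rewrite Rmult_1_r; apply HX].
      apply Rmult_le_compat_l; [apply HX|apply sum_ind_le_1].
    + rewrite (sum_n_ext _ (fun k => sum_n Q M * P k)) by (intros k; apply Rmult_comm).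
      rewrite sum_n_scal_R, Rmult_comm.
      apply Rmult_le_compat; try (apply sum_n_nonneg; auto);
        now apply sum_n_le_Series.
Qed.

Lemma csum_n_truncate (a : nat -> C) (r N : nat) : (r <= N)%nat ->
  (forall k, (r < k <= N)%nat -> a k = RtoC 0) -> csum_n a N = csum_n a r.
Proof.
  intros HN H. induction HN as [|N HN IH]; [reflexivity|].
  rewrite csum_n_Sn, IH by (intros k Hk; apply H; lia).
  rewrite (H (S N)) by lia. apply Cplus_0_r.
Qed.

Lemma sparse_ext (k m : nat) (a b : nat -> C) : (forall i, a i = b i) ->
  sparse k a m = sparse k b m.
Proof. intros H. unfold sparse. now rewrite H. Qed.

Lemma sparse_zero (k m : nat) : sparse k (fun _ => RtoC 0) m = RtoC 0.
Proof. unfold sparse. now destruct (S m mod S k =? 0)%nat. Qed.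

Lemma is_cseries_finite (a : nat -> C) (r : nat) :
  (forall k, (r < k)%nat -> a k = RtoC 0) -> is_cseries a (csum_n a r).
Proof.
  intros H. unfold is_cseries, is_series.
  apply filterlim_ext_loc with (fun _ => csum_n a r); [|apply filterlim_const].
  exists r. intros n Hn. symmetry. apply csum_n_truncate; [exact Hn|].
  intros k Hk. apply H. lia.
Qed.

(** Factorizations with second factor at most r + 1; remaining ones with first
    factor 1; all others. *)
Definition dirichlet_sum (q : R) (r : nat) (s : C) : C :=
  (csum_n (fun j => zpart q j s) r +
   (eta (s + RtoC 1) - csum_n (fun m => RtoC (alt m / INR (S m)) * npw m s)%C r) +
   CSeries (fun m => RtoC (rdivsum (lamC q r) m) * npw m s))%C.

Lemma Lam_split (q : R) (r m : nat) (s : C) :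
  (RtoC (Lam q (S m)) * npw m s)%C =
  (csum_n (fun j => sparse j (fun k => RtoC (lam q k j) * (npw k s * npw j s))%C m) r +
   (if (r <? m)%nat then RtoC (alt m / INR (S m)) * npw m s else RtoC 0) +
   RtoC (rdivsum (lamC q r) m) * npw m s)%C.
Proof.
  set (T := fun k j => (RtoC (lam q k j) * (npw k s * npw j s))%C).
  set (TA := fun k j => if (j <=? r)%nat then T k j else RtoC 0).
  set (TB := fun k j => if andb (r <? j)%nat (k =? 0)%nat then T k j else RtoC 0).
  set (TC := fun k j => (RtoC (lamC q r k j) * (npw k s * npw j s))%C).
  assert (conv : forall L : nat -> nat -> R, (RtoC (rdivsum L m) * npw m s)%C =
    divsum (fun k j => RtoC (L k j) * (npw k s * npw j s))%C m).
  { intros L. rewrite RtoC_rdivsum, Cmult_comm, <- divsum_scal. apply divsum_ext.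
    intros k j E. rewrite (npw_mult k j m s E). ring. }
  assert (EA : divsum TA m = csum_n (fun j => sparse j (fun k => T k j) m) r).
  (* The roles of k and j are exchanged because [TA] restricts the second factor, whereas
     [divsum_sparse] sums over the first. *)
  { rewrite divsum_swap, (divsum_sparse _ m (max m r)) by lia.
    rewrite (csum_n_truncate _ r (max m r)).
    - apply csum_n_ext. intros j Hj. apply sparse_ext. intros k. unfold TA.
      now rewrite (proj2 (Nat.leb_le j r) Hj).
    - lia.
    - intros j Hj. rewrite <- (sparse_zero j m). apply sparse_ext. intros k. unfold TA.
      now rewrite (proj2 (Nat.leb_gt j r) (proj1 Hj)). }
  assert (EB : divsum TB m =
    if (r <? m)%nat then (RtoC (alt m / INR (S m)) * npw m s)%C else RtoC 0).
  { rewrite (divsum_sparse _ m m) by lia. rewrite (csum_n_single _ _ 0) by (try lia;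
      intros k _ Hk; rewrite <- (sparse_zero k m); apply sparse_ext; intros j; unfold TB;
      rewrite (proj2 (Nat.eqb_neq k 0) Hk); now destruct (r <? j)%nat).
    unfold sparse. rewrite Nat.mod_1_r, Nat.div_1_r. cbn [Nat.eqb pred].
    unfold TB. destruct (r <? m)%nat; cbn [andb Nat.eqb]; [|reflexivity].
    unfold T, lam, wt. change (INR 1) with 1. rewrite Rpower_base_1, pow1, Rmult_1_r.
    unfold npw at 1. unfold cpw. change (INR 1) with 1. rewrite ln_1.
    replace (- s * RtoC 0)%C with (RtoC 0) by ring. rewrite Cexp_0. ring. }
  cbn [Lam]. rewrite (conv (lam q)), (conv (lamC q r)). fold T. fold TC.
  change (csum_n (fun j => sparse j (fun k => RtoC (lam q k j) * (npw k s * npw j s))%C m) r)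
    with (csum_n (fun j => sparse j (fun k => T k j) m) r).
  rewrite <- EA, <- EB, <- divsum_plus, <- divsum_plus. apply divsum_ext.
  intros k j _. unfold TA, TB, TC, T, lamC.
  destruct (Nat.leb_spec j r) as [Hj|Hj]; destruct (Nat.ltb_spec r j) as [Hj'|Hj'];
    try lia; destruct k as [|k]; cbn [andb Nat.eqb Nat.ltb Nat.leb]; ring.
Qed.

Lemma eta_shift_series (s : C) : 0 < Re s ->
  is_cseries (fun m => RtoC (alt m / INR (S m)) * npw m s)%C (eta (s + RtoC 1)%C).
Proof.
  intros Hs. assert (H := eta_series (s + RtoC 1)%C).
  eapply is_cseries_ext; [|apply H; change (1 < Re s + 1); lra].
  intros m. cbv beta. rewrite npw_plus, npw_R, Rpower_Ropp, Rpower_1 by apply INR_S_pos.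
  unfold Rdiv. rewrite RtoC_mult. ring.
Qed.

Lemma dirichlet_sum_series (q : R) (r : nat) (s : C) : 0 < q < 1 ->
  1 <= q * INR (S r) -> 1 < Re s -> is_dirichlet (Lam q) s (dirichlet_sum q r s).
Proof.
  intros Hq Hr Hs.
  enough (H : is_cseries (fun m => RtoC (Lam q (S m)) * npw m s)%C (dirichlet_sum q r s))
    by exact H.
  eapply is_cseries_ext; [intros m; symmetry; apply (Lam_split q r)|].
  apply is_cseries_plus; [apply is_cseries_plus|].
  - apply is_cseries_sum. intros j _. apply is_cseries_sparse, zpart_series.
    assert (0 < q * INR (S j)) by (apply Rmult_lt_0_compat; [lra|apply INR_S_pos]). lra.
  - set (x := fun m => (RtoC (alt m / INR (S m)) * npw m s)%C).
    set (y := fun m => if (m <=? r)%nat then x m else RtoC 0).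
    assert (Hy : is_cseries y (csum_n x r)).
    { replace (csum_n x r) with (csum_n y r).
      - apply is_cseries_finite. intros k Hk. unfold y.
        now rewrite (proj2 (Nat.leb_gt k r) Hk).
      - apply csum_n_ext. intros k Hk. unfold y. now rewrite (proj2 (Nat.leb_le k r) Hk). }
    eapply is_cseries_ext; [|apply is_cseries_minus;
      [apply (eta_shift_series s); lra|exact Hy]].
    intros m. cbv beta. unfold y. fold (x m).
    destruct (Nat.leb_spec m r) as [H|H]; destruct (Nat.ltb_spec r m) as [H'|H'];
      try lia; ring.
  - apply is_cseries_dirichlet with (- (q / 2)).
    + now apply rdivsum_lamC_summable.
    + lra.
Qed.

Lemma hol_dirichlet_rest (q : R) (r : nat) (s : C) : 0 < q < 1 ->
  1 <= q * INR (S r) -> - (q / 2) < Re s ->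
  hol (fun s => (eta (s + RtoC 1) -
    csum_n (fun m => RtoC (alt m / INR (S m)) * npw m s)%C r) +
    CSeries (fun m => RtoC (rdivsum (lamC q r) m) * npw m s))%C s.
Proof.
  intros Hq Hr Hs. apply hol_plus.
  - apply hol_ext with (fun z => eta (z + RtoC 1) + RtoC (Ropp 1) *
      csum_n (fun m => RtoC (alt m / INR (S m)) * npw m z)%C r)%C.
    { intros z. rewrite RtoC_opp. ring. }
    apply hol_plus.
    + apply hol_translate, hol_eta. change (0 < Re s + 1). lra.
    + apply hol_mult; [apply hol_const|].
      apply (hol_sum (fun m z => RtoC (alt m / INR (S m)) * npw m z)%C). intros m _.
      apply hol_mult; [apply hol_const|apply hol_npw].
  - apply (hol_dirichlet (rdivsum (lamC q r)) (- (q / 2)) s); [|exact Hs].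
    now apply rdivsum_lamC_summable.
Qed.

(** The poles of the parts lie at 1 - q (j + 1), positive for j < r; hence only the part j = r can
    be singular at 0, namely if q (r + 1) = 1, and then its residue is [alt r] / (r + 1). *)
Lemma is_A0_val (q : R) (r : nat) : 0 < q < 1 -> q * INR r < 1 ->
  1 <= q * INR (S r) -> is_A0 q (A0val q r).
Proof.
  intros Hq Hr Hr'.
  assert (Hqj : forall j, q <= q * INR (S j)) by (intros j; generalize (INR_S_ge_1 j); nra).
  set (rest := fun s => ((eta (s + RtoC 1) -
    csum_n (fun m => RtoC (alt m / INR (S m)) * npw m s)%C r) +
    CSeries (fun m => RtoC (rdivsum (lamC q r) m) * npw m s))%C).
  assert (Hrest : forall z, - (q / 2) < Re z -> hol rest z)
    by (intros z Hz; now apply hol_dirichlet_rest).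
  assert (Hsum : forall s, dirichlet_sum q r s =
    (csum_n (fun j => zpart q j s) r + rest s)%C)
    by (intros s; unfold dirichlet_sum, rest; ring).
  assert (Hform : forall s0 v, - (q / 2) < Re s0 ->
    (forall j, (j <= r)%nat -> simple_form (zpart q j) s0 (v j)) ->
    simple_form (dirichlet_sum q r) s0 (csum_n v r)).
  { intros s0 v Hs Hv.
    destruct (simple_form_plus _ _ _ _ _ (simple_form_sum _ _ _ _ Hv)
      (simple_form_hol rest s0 _ Hrest Hs)) as [g [d [Hd [Hgv [Hg Hf]]]]].
    exists g, d. split; [exact Hd|]. split; [rewrite Hgv; apply Cplus_0_r|].
    split; [exact Hg|]. intros z Hz Hne. rewrite Hsum. now apply Hf. }
  exists (dirichlet_sum q r). split.
  - exists (Lam q). split; [apply log_coefficients_Lam; lra|]. split.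
    + exists 1. intros s Hs. now apply dirichlet_sum_series.
    + exists (q / 2). split; [lra|]. intros s Hs.
      assert (Hj : forall j, exists v, simple_form (zpart q j) s v).
      { intros j. destruct (simple_form_zpart q j s) as [v [Hv _]];
          [specialize (Hqj j); lra|]. now exists v. }
      set (v := fun j => proj1_sig (constructive_indefinite_description _ (Hj j))).
      destruct (simple_form_laurent _ _ _ (Hform s v Hs
        (fun j _ => proj2_sig (constructive_indefinite_description _ (Hj j)))))
        as [g [Hg _]].
      now exists 1%nat, g.
  - assert (Hsmall : forall j, (j < r)%nat -> q * INR (S j) <> 1).
    { intros j Hj. assert (q * INR (S j) <= q * INR r)
        by (apply Rmult_le_compat_l; [lra|apply le_INR; lia]). lra. }
    assert (H0 : - (q / 2) < Re (RtoC 0)) by (simpl; lra).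
    unfold A0val. destruct (Req_EM_T (q * INR (S r)) 1) as [E|NE].
    + left. split.
      { intros E0. apply RtoC_inj in E0. assert (H1 := Rabs_alt r).
        assert (H2 := INR_S_pos r).
        replace (alt r) with (alt r / INR (S r) * INR (S r)) in H1 by (field; lra).
        rewrite E0, Rmult_0_l, Rabs_R0 in H1. lra. }
      apply simple_form_laurent.
      assert (Ev : RtoC (alt r / INR (S r)) =
        csum_n (fun j => if (j =? r)%nat then RtoC (alt r / INR (S r)) else RtoC 0) r).
      { rewrite (csum_n_single _ _ r); [now rewrite Nat.eqb_refl|lia|].
        intros k _ Hk. now rewrite (proj2 (Nat.eqb_neq k r) Hk). }
      rewrite Ev. apply Hform; [exact H0|]. intros j Hj.
      destruct (simple_form_zpart q j (RtoC 0)) as [v [Hv [H1 H2]]];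
        [specialize (Hqj j); change (Re (RtoC 0)) with 0; lra|].
      destruct (Nat.eqb_spec j r) as [->|Hne].
      * rewrite H1 in Hv by (rewrite E; f_equal; ring).
        rewrite npw_R in Hv. replace (- 0) with 0 in Hv by ring.
        rewrite Rpower_O in Hv by apply INR_S_pos. now rewrite Cmult_1_r in Hv.
      * rewrite H2 in Hv; [exact Hv|]. intros E0. apply RtoC_inj in E0.
        apply (Hsmall j); [lia|lra].
    + right. split; [|reflexivity].
      set (gap := q * INR (S r) - 1). assert (Hgap : 0 < gap) by (unfold gap; lra).
      (* The disc lies in the half-plane of continuation and avoids the poles on both sides of 0: -
         gap on the left, and on the right those from 1 - q r onwards. *)
      set (d := Rmin (q / 2) (Rmin gap (1 - q * INR r))).
      assert (D1 := Rmin_l (q / 2) (Rmin gap (1 - q * INR r))).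
      assert (D2 := Rmin_r (q / 2) (Rmin gap (1 - q * INR r))).
      assert (D3 := Rmin_l gap (1 - q * INR r)). assert (D4 := Rmin_r gap (1 - q * INR r)).
      fold d in D1, D2.
      assert (Hd : 0 < d) by (repeat apply Rmin_glb_lt; lra).
      exists (dirichlet_sum q r). split.
      * apply holomorphic_of_hol with d; [exact Hd|]. intros z Hz.
        assert (HRe := Re_near _ _ _ Hz). change (Re (RtoC 0)) with 0 in HRe.
        apply hol_ext with (fun s => csum_n (fun j => zpart q j s) r + rest s)%C;
          [intros s; now rewrite Hsum|].
        apply hol_plus; [|apply Hrest; lra].
        apply (hol_sum (fun j s => zpart q j s)). intros j Hj.
        apply hol_zpart; [specialize (Hqj j); lra|]. intros Ez.
        assert (Hz' := Re_le_Cmod (z - RtoC 0)%C). rewrite Ez in Hz' at 1.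
        assert (Er : Re (RtoC (1 - q * INR (S j)) - RtoC 0)%C = 1 - q * INR (S j))
          by (simpl; ring).
        rewrite Er in Hz'. apply Rabs_le_between in Hz'.
        destruct (Nat.eq_dec j r) as [->|Hjr].
        -- unfold gap in *. lra.
        -- assert (q * INR (S j) <= q * INR r)
        by (apply Rmult_le_compat_l; [lra|apply le_INR; lia]). lra.
      * apply locally_of_disc with 1; [lra|]. intros z _ _. simpl Cpow. field.
Qed.

(** * The theorem *)

(** For l >= 1 the numbers rho_l are 1 - q (i + 1) in reverse order, i = r + 1 - l. The exponent
    rho_0 = 0 receives the coefficient 0, because constants have gone into H. *)
Lemma exponent_sum (q : R) (r : nat) (v : nat -> R) (x : R) :
  sum_n_m (fun l => (match l with O => 0 | S _ => v (S r - l)%nat end) *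
    Rpower x (rho q (S r) l / (rho q (S r) (S r) + 1))) 0 (S r) =
  sum_n (fun i => v i * Rpower x ((1 - q * INR (S i)) / (2 - q))) r.
Proof.
  rewrite sum_Sn_m, <- sum_n_m_S by lia. fold (sum_n (G := R_AbelianMonoid)
    (fun l => v (S r - S l)%nat *
      Rpower x (rho q (S r) (S l) / (rho q (S r) (S r) + 1))) r).
  rewrite (sum_n_rev (fun i => v i * _)), Rmult_0_l.
  refine (eq_trans (Rplus_0_l _) _). apply sum_n_ext_loc. intros l Hl.
  replace (S r - S l)%nat with (r - l)%nat by lia.
  rewrite rho_top by lia. f_equal. f_equal. f_equal; [|ring].
  change (rho q (S r) (S l)) with (1 - q * (INR (S r) - INR (S l) + 1)).
  rewrite !S_INR, minus_INR by exact Hl. ring.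
Qed.

Theorem theorem3 (q : R) (hq : 0 < q) :
  (q < 1 ->
   forall r : nat, is_r q r ->
   exists (A0 : R) (lam : list R),
     is_A0 q A0 /\ is_lambdas q r lam /\
     exists (H : R) (P h : nat -> R) (K : nat -> nat -> R),
     forall c : nat -> R, product_coefficients q c ->
       asymp c (fun n : nat =>
         H * Rpower (INR n)
               (- ((2 + rho q r r - 2 * A0) / (2 * (rho q r r + 1)))) *
         exp (sum_n_m (fun l => P l *
                Rpower (INR n) (rho q r l / (rho q r r + 1))) 0 r +
              sum_n_m (fun l => h l * lambda_sum q r lam K l n) 0 r)))
  /\
  (1 < q ->
   exists W : R, 0 < W /\
     forall c : nat -> R, product_coefficients q c ->
       asymp c (fun n : nat => W * Rpower (INR n) (- q))).
Proof.
  split; [|apply theorem3_gt_1].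
  intros Hq1 r [[Hr1 Hr] Hmax].
  assert (Hq : 0 < q < 1) by lra.
  assert (Hr' : 1 <= q * INR (S r)).
  { destruct (Rle_dec 1 (q * INR (S r))) as [H|H]; [exact H|].
    assert (S r <= r)%nat by (apply Hmax; [lia|lra]). lia. }
  destruct (exists_lambdas q r Hq Hr1 ltac:(lra)) as [lam Hlam].
  exists (A0val q r), lam. split; [now apply is_A0_val; lra|]. split; [exact Hlam|].
  (* From here on [S r] is the r of the statement, matching the shift in [coefs_asymp_lt_1]. *)
  destruct r as [|r]; [lia|].
  destruct (coefs_asymp_lt_1 q r hq ltac:(lra) Hr') as [H [v [HH Hlim]]].
  exists H, (fun l => match l with O => 0 | S _ => v (S r - l)%nat end),
    (fun _ => 0), (fun _ _ => 0).
  intros c Hc. unfold asymp.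
  replace (Finite 1) with (Finite (H * / H)) by (f_equal; field; lra).
  apply is_lim_seq_ext with (2 := is_lim_seq_mult' _ _ _ _ Hlim (is_lim_seq_const (/ H))).
  intros n. rewrite (product_coefficients_unique q c n) by (lra || exact Hc).
  rewrite exponent_sum, rho_top by lia.
  replace (sum_n_m (fun l => 0 * lambda_sum q (S r) lam (fun _ _ => 0) l n) 0 (S r)) with 0.
  - replace (- ((2 + (1 - q) - 2 * A0val q (S r)) / (2 * (1 - q + 1)))) with
      (- (((3 - q) / 2 - A0val q (S r)) / (2 - q))) by (field; lra).
    rewrite Rplus_0_r. field.
    repeat split; try lra; apply Rgt_not_eq; apply exp_pos || apply Rpower_pos.
  - symmetry. rewrite (sum_n_m_ext _ (fun _ => zero)).
    + exact (sum_n_m_const_zero (G := R_AbelianMonoid) 0 (S r)).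
    + intros l. rewrite Rmult_0_l. reflexivity.
Qed.
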